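(* Let $a,b>0$, $\Omega=(0,a)\times(0,b)$, and let $d\in L^\infty(\Omega)\cap C^2(\Omega)$, $d\ge0$, be such that $\omega=\{(x,y)\in\Omega:d(x,y)>0\}$ contains a nonempty open set and does not satisfy the Geometric Control Condition. Consider, for $b_2,c\in L^2(\Omega)$, the equation $$w_{tt}(t,x,y)-\Delta w(t,x,y)+d(x,y)w_t(t,x,y)-b_2(x,y)\int_\Omega\sqrt{d(\xi,\eta)}\,w_t(t,\xi,\eta)c(\xi,\eta)\,d\xi\,d\eta=0\qquad(\ast)$$ on $\Omega$ with $w=0$ on $\partial\Omega$. Assume that $(\ast)$ is polynomially stable with some $\alpha$, $0<\alpha\le2$, in the case $b_2=0$. Then there exists $\kappa>0$ such that if $b_2\in\operatorname{dom}\Delta$ and $c\in L^2(\Omega)$ satisfy $$\|\sqrt d\,c\|_{L^2}<\kappa,\qquad \|d\,b_2\|_{H_{1/2}}^2+\|b_2\|_{H_1}^2<\frac{\kappa^2}{M^2},$$ where $M=1+\frac{ab\|d\|_{L^\infty}}{\pi\sqrt{a^2+b^2}}$, then $(\ast)$ is polynomially stable with the same $\alpha$. Moreover, for such perturbations there exists $M_T>0$ such that the solutions of $(\ast)$ with initial conditions $w(0)=w_0\in H^2(\Omega)\cap H^1_0(\Omega)$ and $w_t(0)=w_1\in H^1_0(\Omega)$ satisfy $$\|w(t,\cdot,\cdot)\|_{H^1}^2+\|w_t(t,\cdot,\cdot)\|_{L^2}^2\le\frac{M_T}{t^{2/\alpha}}\bigl(\|w_0\|_{H^2}^2+\|w_1\|_{H^1}^2\bigr),\qquad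 t>0.$$
   Context: $\Delta$ is the Dirichlet Laplacian on $L^2(\Omega)$ (complex-valued), $\operatorname{dom}\Delta=H^2(\Omega)\cap H^1_0(\Omega)$. For $\theta\ge0$, $H_\theta=H_\theta(\Delta)=\operatorname{dom}(-\Delta)^\theta$ with norm $\|u\|_{H_\theta}=\|(-\Delta)^\theta u\|_{L^2}$; in particular $\|b_2\|_{H_1}=\|\Delta b_2\|_{L^2}$. The condition involving $\|d\,b_2\|_{H_{1/2}}$ includes that $d\,b_2\in H_{1/2}(\Delta)$. $H^1$ and $H^2$ (superscripts) are the usual Sobolev spaces. State space: $\mathcal H=\operatorname{dom}(-\Delta)^{1/2}\times L^2(\Omega)$ with $\langle u,v\rangle=\langle(-\Delta)^{1/2}u_1,(-\Delta)^{1/2}v_1\rangle+\langle u_2,v_2\rangle$. With $u=(w,w_t)^\top$, equation $(\ast)$ is $u'=\widetilde Au$ with $\widetilde A(u_1,u_2)^\top=(u_2,\ \Delta u_1-du_2+b_2\int_\Omega\sqrt d\,u_2\,c)^\top$ and $\operatorname{dom}\widetilde A=\operatorname{dom}\Delta\times\operatorname{dom}(-\Delta)^{1/2}$. The equation is called polynomially stable with $\alpha$ if the semigroup $T(t)$ generated by $\widetilde A$ satisfies $\sup_{t\ge0}\|T(t)\|<\infty$, $i\mathbb R\subset\rho(\widetilde A)$, and $\|T(t)\widetilde A^{-1}\|\le M't^{-1/\alpha}$ for some $M'>0$ and all $t>0$. Geometric Control Condition: there is $T>0$ such that every unit-speed billiard trajectory in $\overline\Omega$ of length $T$ (reflected at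 $\partial\Omega$ by the laws of geometric optics; equivalently $t\mapsto F(p+t\theta)$ with $p\in\mathbb R^2$, $|\theta|=1$, and $F(x,y)=(\operatorname{dist}(x,2a\mathbb Z),\operatorname{dist}(y,2b\mathbb Z))$) meets $\omega$. *)

(* Defs.v *)
From HB Require Import structures.
From mathcomp Require Import all_boot all_order all_algebra.
From mathcomp Require Import complex.
From mathcomp Require Import all_classical all_reals all_analysis.
Set Implicit Arguments.
Unset Strict Implicit.
Unset Printing Implicit Defensive.
Import Order.TTheory GRing.Theory Num.Theory.
Import numFieldNormedType.Exports.
Local Open Scope classical_set_scope.
Local Open Scope ring_scope.
Local Open Scope complex_scope.

(** * Operators on Hilbert spaces of representatives

   A Hilbert space whose points are equivalence classes (of functions modulo
   a.e. equality) is handled through representatives: a complex vector space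
   [hvec], the subset [hcar] of representatives of points, and the inner
   product [hip], which is only meaningful on [hcar].  Two representatives stand
   for the same point when [hsame] holds. *)

Record hspace (R : realType) := HSpace {
  hvec :> lmodType R[i] ;
  hcar : set hvec ;
  hip : hvec -> hvec -> R[i] }.

Section Operators.
Context {R : realType} {H : hspace R}.
Implicit Types (u v f : H) (A B : H -> set H) (T : R -> H -> H).

Definition hnorm u : R := Num.sqrt (complex.Re (hip u u)).

Definition hsame u v : Prop := hnorm (u - v) = 0.

(** An unbounded operator is its graph: [A u v] means that u lies in the domain
    of A and that v represents A u. *)
Definition opdom A : set H := [set u | exists v, A u v].

Definition opinv A : H -> set H := fun v => [set u | A u v].

Definition opcomp (S : H -> H) B : H -> set H := fun u => S @` B u.

Definition opnorm B : \bar R :=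
  ereal_sup [set (hnorm v)%:E | v in
    [set v | exists u, [/\ hcar u, hnorm u <= 1 & B u v]]].

(** [l - A] is a bijection from the domain of A onto the space, with bounded
    inverse; injectivity is contained in the bound. *)
Definition resolvent_set A : set R[i] := [set l | exists K : R,
  (forall f, hcar f -> exists u v, A u v /\ hsame (l *: u - v) f) /\
  (forall u v, A u v -> hnorm u <= K * hnorm (l *: u - v))].

Definition bounded_linear (S : H -> H) : Prop :=
  [/\ forall u, hcar u -> hcar (S u),
      forall (k : R[i]) u v, hcar u -> hcar v ->
        hsame (S (k *: u + v)) (k *: S u + S v) &
      exists K : R, forall u, hcar u -> hnorm (S u) <= K * hnorm u].

Definition C0_semigroup T : Prop :=
  [/\ forall t, 0 <= t -> bounded_linear (T t),
      forall u, hcar u -> hsame (T 0 u) u,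
      forall s t u, 0 <= s -> 0 <= t -> hcar u ->
        hsame (T (t + s) u) (T t (T s u)) &
      forall u, hcar u -> hnorm (T t u - u) @[t --> 0^'+] --> (0 : R)].

Definition generator T : H -> set H := fun u => [set v |
  [/\ hcar u, hcar v &
      hnorm ((t^-1)%:C *: (T t u - u) - v) @[t --> 0^'+] --> (0 : R)]].

Definition polynomially_stable A (alpha : R) : Prop :=
  exists T,
  [/\ C0_semigroup T /\ A = generator T,
      (ereal_sup [set opnorm (fun u => [set T t u]) | t in [set t : R | (0 <= t)%R]]
        < +oo)%E,
      forall s : R, resolvent_set A (0 +i* s) &
      exists2 M' : R, 0 < M' & forall t, 0 < t ->
        (opnorm (opcomp (T t) (opinv A)) <= (M' * t `^ (- alpha^-1))%:E)%E].

(** Continuously differentiable solutions on [0, +oo[ of u' = A u. *)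
Definition classical_solution A (u : R -> H) : Prop :=
  exists u' : R -> H, forall t, 0 <= t ->
  [/\ A (u t) (u' t),
      hnorm (((s - t)^-1)%:C *: (u s - u t) - u' t)
        @[s --> within [set s : R | 0 <= s] t^'] --> (0 : R) &
      hnorm (u' s - u' t) @[s --> within [set s : R | 0 <= s] (nbhs t)] --> (0 : R)].

(** Orthonormal basis of eigenvectors. *)
Definition eigenbasis A (e : nat -> H) (lam : nat -> R) : Prop :=
  [/\ forall n, A (e n) ((lam n)%:C *: e n),
      forall m n, hip (e m) (e n) = (m == n)%:R &
      forall u, hcar u -> (forall n, hip u (e n) = 0) -> hnorm u = 0].

(** Functional calculus of a nonnegative self-adjoint operator with an
    orthonormal basis of eigenvectors (such as the negative Dirichlet Laplacian
    of a bounded domain): A^theta multiplies the n-th coefficient by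
    lam_n^theta, and its domain consists of the u for which the products are
    again the coefficients of a point of the space. *)
Definition frac_pow A (theta : R) : H -> set H := fun u => [set v |
  [/\ hcar u, hcar v & exists e lam, eigenbasis A e lam /\
      forall n, hip v (e n) = (lam n `^ theta)%:C * hip u (e n)]].

Definition frac_pow_val A (theta : R) u : H := xget 0 (frac_pow A theta u).

End Operators.

(** * The Lebesgue space of complex functions and weak derivatives *)

Section Sobolev.
Context {R : realType}.
Local Notation point := (R * R)%type.
Local Notation fn := (R * R -> R[i])%type.

Definition leb2 :
    {measure set (measurableTypeR R * measurableTypeR R) -> \bar R} :=
  (lebesgue_measure \x lebesgue_measure)%E.

(** First partial derivatives, in x for [false] and in y for [true]. *)
Definition partial (k : bool) (f : point -> R) : point -> R :=
  fun p => 'D_((if k then (0, 1) else (1, 0)) : point) f p.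

Definition partials (s : seq bool) (f : point -> R) : point -> R :=
  foldr partial f s.

(** All partial derivatives of f up to order k exist and are continuous on the
    open set Om. *)
Definition C_on (k : nat) (Om : set point) (f : point -> R) : Prop :=
  forall (s : seq bool) (p : point), (size s <= k)%N -> Om p ->
    {for p, continuous (partials s f)} /\
    ((size s < k)%N ->
      derivable (partials s f) p (1, 0) /\ derivable (partials s f) p (0, 1)).

Section Domain.
Variable Om : set point.
Implicit Types (u v : fn).

Definition test_function (phi : point -> R) : Prop :=
  (forall k, C_on k setT phi) /\
  exists K : set point,
    [/\ compact K, K `<=` Om & forall p, ~ K p -> phi p = 0].

Definition ctest_function (phi : fn) : Prop :=
  test_function (@complex.Re R \o phi) /\ test_function (@complex.Im R \o phi).

Definition cintegral u : R[i] :=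
  (\int[leb2]_(p in Om) complex.Re (u p)) +i*
  (\int[leb2]_(p in Om) complex.Im (u p)).

(** The values of u outside Om are irrelevant. *)
Definition L2_car : set fn := [set u : fn |
  (@complex.Re R \o u) \_ Om \in Lfun leb2 2%:E /\
  (@complex.Im R \o u) \_ Om \in Lfun leb2 2%:E].

Definition L2 : hspace R :=
  @HSpace R fn L2_car (fun u v => cintegral (fun p => u p * (v p)^*)).

(** v is the weak derivative d^(i+j) u / dx^i dy^j. *)
Definition weak_derivative (i j : nat) u v : Prop :=
  [/\ L2_car u, L2_car v & forall phi, test_function phi ->
      cintegral (fun p =>
        u p * (partials (nseq i false ++ nseq j true) phi p)%:C) =
      (-1) ^+ (i + j) * cintegral (fun p => v p * (phi p)%:C)].

Definition wderiv (i j : nat) u : fn := xget 0 [set v | weak_derivative i j u v].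

(** The Sobolev space H^k and its norm; the latter is only meaningful on H^k. *)
Definition sobolev (k : nat) : set fn := [set u : fn |
  forall i j : nat, (i + j <= k)%N -> exists v, weak_derivative i j u v].

Definition sobolev_norm (k : nat) u : R :=
  Num.sqrt (\sum_(i < k.+1) \sum_(j < k.+1 | (i + j <= k)%N)
              hnorm (wderiv i j u : L2) ^+ 2).

(** H^1_0: the closure of the test functions in H^1. *)
Definition H10 : set fn := [set u : fn | sobolev 1 u /\
  forall eps : R, 0 < eps ->
    exists2 phi, ctest_function phi & sobolev_norm 1 (u - phi) < eps].

Definition laplacian : L2 -> set L2 := fun u => [set v : L2 |
  [/\ sobolev 2 u, H10 u, L2_car v & exists uxx uyy : L2,
      [/\ weak_derivative 2 0 u uxx, weak_derivative 0 2 u uyy &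
          hsame v (uxx + uyy)]]].

Definition neg_laplacian : L2 -> set L2 := fun u => [set v | laplacian u (- v)].

(** H_theta = dom (-Delta)^theta with its norm. *)
Definition Hdom (theta : R) : set fn := opdom (frac_pow neg_laplacian theta).

Definition Hnorm (theta : R) u : R :=
  hnorm (frac_pow_val neg_laplacian theta u).

(** * The damped wave equation *)

Definition state : hspace R :=
  @HSpace R (fn * fn)%type
    [set u : fn * fn | Hdom 2^-1 u.1 /\ L2_car u.2]
    (fun u v : fn * fn =>
       hip (frac_pow_val neg_laplacian 2^-1 u.1 : L2)
           (frac_pow_val neg_laplacian 2^-1 v.1) +
       hip (u.2 : L2) v.2).

Definition rmul (g : point -> R) u : fn := fun p => (g p)%:C * u p.

Definition sqrtf (d : point -> R) : point -> R := fun p => Num.sqrt (d p).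

(** [v] represents (u_2, Delta u_1 - d u_2 + b2 \int sqrt(d) u_2 c). *)
Definition wave_op (d : point -> R) (b2 c : fn) : state -> set state :=
  fun u : state => [set v : state |
    [/\ opdom laplacian u.1, Hdom 2^-1 u.2, hcar v, hsame (v.1 : L2) u.2 &
        exists2 l, laplacian u.1 l &
          hsame (v.2 : L2)
            (l - rmul d u.2
             + cintegral (fun p => rmul (sqrtf d) u.2 p * c p) *: b2)]].

End Domain.

Definition rect (a b : R) : set point := `]0, a[ `*` `]0, b[.

Definition Linfty_norm (Om : set point) (f : point -> R) : \bar R :=
  Lnorm leb2 +oo%E (EFin \o (f \_ Om)).

(** The distance of x to 2 a Z. *)
Definition fold_dist (a x : R) : R :=
  inf [set `|x - 2 * a * m%:~R| | m in [set: int]].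

(** Unit-speed billiard trajectories of [0,a] x [0,b] are the images of straight
    lines under the folding map. *)
Definition geometric_control (a b : R) (w : set point) : Prop :=
  exists2 T : R, 0 < T & forall p th : point, th.1 ^+ 2 + th.2 ^+ 2 = 1 ->
    exists2 t : R, 0 <= t <= T &
      w (fold_dist a (p.1 + t * th.1), fold_dist b (p.2 + t * th.2)).

End Sobolev.

Arguments L2 {R} Om.
Arguments laplacian {R} Om _ _.
Arguments neg_laplacian {R} Om _ _.
Arguments state {R} Om.
Arguments wave_op {R} Om d b2 c _ _.

(* Main.v *)
From HB Require Import structures.
Require Import Defs.
From mathcomp Require Import all_boot all_order all_algebra.
From mathcomp Require Import complex.
From mathcomp Require Import all_classical all_reals all_analysis measurable_realfun ess_sup_inf.
From mathcomp Require Import ring lra zify.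
From mathcomp Require separable cyclotomic cyclic.
Import Order.TTheory GRing.Theory Num.Theory.
Import numFieldNormedType.Exports.
Local Open Scope classical_set_scope.
Local Open Scope ring_scope.
Local Open Scope complex_scope.
Set Implicit Arguments.
Unset Strict Implicit.
Unset Printing Implicit Defensive.

(** On the energy space the equation reads [u' = A u + <u,ct> bt], where [A] is the damped wave
    operator, [bt = (0, b2)] and [ct = (0, sqrt(d) conj(c))]. Three facts about this rank-one
    perturbation carry the proof.

    The energy identity [Re <A u, u> = - |sqrt(d) u_2|^2] and Cauchy-Schwarz give
    [del |<u,ct>|^2 <= - Re <A u, u>]: the damping controls the observation, so the unperturbed
    signal [<T(t) x, ct>] is square integrable in time. The assumptions on [b2] place [bt] in the
    domain of [A^2], with [A bt = (b2, - d b2)] and [A^2 bt = (- d b2, Delta b2 + d^2 b2)] small.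
    Finally, decay at rate [t^(-1/alpha)] with [alpha <= 2] forces the resolvent to grow at most
    like [(1 + |mu|)^2], and the expansion [(mu - A)^-1 bt = bt/mu + A bt/mu^2 + (mu - A)^-1 A^2
    bt/mu^2] then makes the transfer function [<(mu - A)^-1 bt, ct>] uniformly small ([apriori],
    [apriori_smooth]).

    By Parseval the feedback loop has gain below one ([multiplier]), so the perturbed signal is
    square integrable too ([feed_sum]). Since [|T(t) bt|] is [O(1/t)], Duhamel's formula and
    Cauchy-Schwarz bound the perturbed orbits ([perturbed_bounded]). For the rate, Duhamel's formula
    over a time [L] is averaged over starting times between [L] and [2 L]; the forced part is at
    most of order [log(L)^2 / L] times the squared norm at time [L], and an induction from [L] to
    [3 L] transports the decay ([perturbed_decay]). A rank-one inversion keeps the imaginary axis in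
    the resolvent set.

    These arguments run on the backward Euler iterates of [(1 - h A)^-1], with constants uniform in
    [h]: time integrals become finite sums and the Fourier transform a discrete one.
    [resolvent_comparison] carries the decay of the semigroup to the iterates; [generation] builds
    the perturbed semigroup as the limit of its iterates along [h = 2^-j], which inherits all
    bounds. The result is [perturbation_theorem].

    The rest applies it to the wave equation. Functions up to null sets are replaced by points of a
    quotient Hilbert space. The square root of the Laplacian is handled through an eigenbasis, whose
    existence is part of membership in [Hdom]. Uniqueness of weak derivatives follows from the
    generator being single-valued ([unique_weak_derivatives]). Green's formula and Poincare's
    inequality compare energy and Sobolev norms, and uniqueness of classical solutions turns decay
    of the semigroup into the last estimate. *)

Local Notation normc := Normc.normc.
Local Notation Re := complex.Re.
Local Notation Im := complex.Im.

(** * Deciding linear identities in a module by reflection *)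

(** Linear combinations in a module are compared coefficientwise. *)
Section LinearExpressions.
Variables (K : comNzRingType) (V : lmodType K).

Inductive lexp := LVar of nat | LZero | LAdd of lexp & lexp | LOpp of lexp
  | LScale of K & lexp.

Fixpoint leval (env : seq V) (e : lexp) : V :=
  match e with
  | LVar n => nth 0 env n
  | LZero => 0
  | LAdd e1 e2 => leval env e1 + leval env e2
  | LOpp e1 => - leval env e1
  | LScale k e1 => k *: leval env e1
  end.

(** The index test is [Nat.eqb], which [lazy] evaluates on closed numerals, so every coefficient
    becomes a plain ring expression. *)
Fixpoint lcoef (e : lexp) (i : nat) : K :=
  match e with
  | LVar n => if Nat.eqb n i then 1 else 0
  | LZero => 0
  | LAdd e1 e2 => lcoef e1 i + lcoef e2 i
  | LOpp e1 => - lcoef e1 i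
  | LScale k e1 => k * lcoef e1 i
  end.

Fixpoint lcoef_eq (e1 e2 : lexp) (n : nat) : Prop :=
  match n with
  | 0%N => True
  | m.+1 => lcoef e1 m = lcoef e2 m /\ lcoef_eq e1 e2 m
  end.

Lemma leval_coef env e :
  leval env e = \sum_(i < size env) lcoef e i *: nth 0 env i.
Proof.
elim: e => [n||e1 h1 e2 h2|e1 h1|k e1 h1] /=.
- have [nlt|nge] := ltnP n (size env).
    rewrite (bigD1 (Ordinal nlt))//= PeanoNat.Nat.eqb_refl scale1r big1 ?addr0// => i.
    move=> /negP ni; case: PeanoNat.Nat.eqb_spec => [e|]; last by rewrite scale0r.
    by case: ni; apply/eqP/val_inj.
  rewrite nth_default// big1// => i _.
  case: PeanoNat.Nat.eqb_spec => [e|]; last by rewrite scale0r.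
  by move: nge; rewrite e leqNgt ltn_ord.
- by rewrite big1// => i _; rewrite scale0r.
- by rewrite h1 h2 -big_split/=; apply: eq_bigr => i _; rewrite scalerDl.
- by rewrite h1 -sumrN; apply: eq_bigr => i _; rewrite scaleNr.
- by rewrite h1 scaler_sumr; apply: eq_bigr => i _; rewrite scalerA.
Qed.

Lemma leval_eq env e1 e2 : lcoef_eq e1 e2 (size env) ->
  leval env e1 = leval env e2.
Proof.
move=> h; rewrite !leval_coef; apply: eq_bigr => i _; congr (_ *: _).
elim: (size env) i h => [[]//|n IH i /= [h0 h]].
have [ilt|] := ltnP i n; first exact: (IH (Ordinal ilt)).
by move=> ni; have -> : (i : nat) = n by apply/eqP; rewrite eqn_leq ni -ltnS ltn_ord.
Qed.

End LinearExpressions.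

Ltac lexp_index x env :=
  lazymatch env with
  | x :: _ => constr:(0%N)
  | _ :: ?env' => let n := lexp_index x env' in constr:(n.+1)
  end.

Ltac lexp_insert x env :=
  match env with
  | context [x :: _] => env
  | _ => constr:(x :: env)
  end.

Ltac lexp_atoms t env :=
  lazymatch t with
  | (?a + ?b)%R => let env := lexp_atoms a env in lexp_atoms b env
  | (- ?a)%R => lexp_atoms a env
  | (?k *: ?a)%R => lexp_atoms a env
  | 0%R => env
  | _ => lexp_insert t env
  end.

Ltac lexp_reify K t env :=
  lazymatch t with
  | (?a + ?b)%R => let x := lexp_reify K a env in let y := lexp_reify K b env in
      constr:(LAdd x y)
  | (- ?a)%R => let x := lexp_reify K a env in constr:(LOpp x)
  | (?k *: ?a)%R => let x := lexp_reify K a env in constr:(LScale k x)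
  | 0%R => constr:(LZero K)
  | _ => let n := lexp_index t env in constr:(LVar K n)
  end.

(** Atoms are collected syntactically and treated as independent; one scalar equation per atom is
    left to [ring] or [field]. *)
Ltac lmod_coefs :=
  lazymatch goal with
  | |- ?a = ?b :> ?V =>
    let env := lexp_atoms a (@nil V) in
    let env := lexp_atoms b env in
    lazymatch type of (fun k => k *: a)%R with
    | forall _ : ?K, _ =>
      let e1 := lexp_reify K a env in
      let e2 := lexp_reify K b env in
      apply: (@leval_eq _ _ env e1 e2)
    end
  end;
  lazy beta iota delta [lcoef_eq lcoef Nat.eqb size];
  repeat split.

Ltac lmod := lmod_coefs; ring.
Ltac lmod_field := lmod_coefs; field; rewrite ?fmorph_eq0.

(** * Modulus, conjugation and real part *)

Section ComplexScalars.
Variable R : realType.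
Implicit Types (x y : R[i]) (r : R).

Lemma normc_ge0 x : 0 <= normc x.
Proof. by case: x => a b; apply: sqrtr_ge0. Qed.

Lemma normcR r : normc r%:C = `|r|.
Proof. by rewrite /= expr0n/= addr0 sqrtr_sqr. Qed.

Lemma normcJ x : normc (conjc x) = normc x.
Proof. by case: x => a b /=; rewrite sqrrN. Qed.

Lemma Re_le_normc x : Re x <= normc x.
Proof.
case: x => a b /=; apply: le_trans (ler_norm _) _.
by rewrite -sqrtr_sqr ler_wsqrtr// lerDl sqr_ge0.
Qed.

Lemma normc_abs x : `|x| = (normc x)%:C.
Proof. by case: x. Qed.

Lemma normc_sqr x : (normc x) ^+ 2 = Re (x * conjc x).
Proof.
case: x => a b /=; rewrite sqr_sqrtr ?addr_ge0 ?sqr_ge0//.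
by rewrite mulrN opprK !expr2.
Qed.

Lemma normc_sqrC x : x * conjc x = ((normc x) ^+ 2)%:C.
Proof.
rewrite normc_sqr; case: x => a b.
by apply/eqP; rewrite eq_complex/= eqxx/=; apply/eqP; ring.
Qed.

Lemma conjcM x y : conjc (x * y) = conjc x * conjc y.
Proof. by case: x => a b; case: y => c e; simpc; congr (_ +i* _); ring. Qed.

Lemma conjcX x n : conjc (x ^+ n) = conjc x ^+ n.
Proof. by elim: n => [|n IH]; [exact: conjc1|rewrite !exprS conjcM IH]. Qed.

Lemma conjcD x y : conjc (x + y) = conjc x + conjc y.
Proof. by case: x => a b; case: y => c e; simpc; congr (_ +i* _); ring. Qed.

Lemma ReD x y : Re (x + y) = Re x + Re y.
Proof. by case: x; case: y. Qed.

Lemma ReB x y : Re (x - y) = Re x - Re y.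
Proof. by case: x; case: y. Qed.

Lemma ReN x : Re (- x) = - Re x.
Proof. by case: x. Qed.

Lemma ReZ r x : Re (r%:C * x) = r * Re x.
Proof. by case: x => a b; simpc. Qed.

Lemma ReJ x : Re (conjc x) = Re x.
Proof. by case: x. Qed.

Lemma ImD x y : Im (x + y) = Im x + Im y.
Proof. by case: x; case: y. Qed.

Lemma normc_sum (I : Type) (s : seq I) (P : pred I) (F : I -> R[i]) :
  normc (\sum_(i <- s | P i) F i) <= \sum_(i <- s | P i) normc (F i).
Proof.
elim/big_ind2 : _ => [|x a y b xa yb|//]; first by rewrite Normc.normc0.
by apply: le_trans (le_normcD _ _) _; apply: lerD.
Qed.

Lemma Re_sum (I : Type) (s : seq I) (P : pred I) (F : I -> R[i]) :
  Re (\sum_(i <- s | P i) F i) = \sum_(i <- s | P i) Re (F i).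
Proof. by elim/big_ind2 : _ => // x a y b <- <-; rewrite ReD. Qed.

End ComplexScalars.

(** [hcar] is a subspace on which [hip] is a positive Hermitian form. *)
Record prehilbert (R : realType) (H : hspace R) : Prop := Prehilbert {
  ph_car0 : hcar (0 : H) ;
  ph_carP : forall (k : R[i]) (u v : H), hcar u -> hcar v -> hcar (k *: u + v) ;
  ph_lin : forall (k : R[i]) (u v w : H), hcar u -> hcar v -> hcar w ->
    hip (k *: u + v) w = k * hip u w + hip v w ;
  ph_herm : forall u v : H, hcar u -> hcar v -> hip v u = conjc (hip u v) ;
  ph_ge0 : forall u : H, hcar u -> 0 <= Re (hip u u) }.

(** * Inner product calculus on representatives *)

Section Prehilbert.
Context {R : realType} {H : hspace R}.
Hypothesis pH : prehilbert H.
Implicit Types (u v w : H) (k : R[i]).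

Lemma ph_carZ k u : hcar u -> hcar (k *: u).
Proof. by move=> hu; rewrite -[_ *: _]addr0; apply: ph_carP => //; exact: ph_car0. Qed.

Lemma ph_carD u v : hcar u -> hcar v -> hcar (u + v).
Proof. by move=> hu hv; rewrite -[u]scale1r; exact: ph_carP. Qed.

Lemma ph_carN u : hcar u -> hcar (- u).
Proof. by move=> hu; rewrite -scaleN1r; exact: ph_carZ. Qed.

Lemma ph_carB u v : hcar u -> hcar v -> hcar (u - v).
Proof. by move=> hu hv; apply: ph_carD => //; exact: ph_carN. Qed.

Lemma ph_sum (I : Type) (s : seq I) (P : pred I) (F : I -> H) :
  (forall i, hcar (F i)) -> hcar (\sum_(i <- s | P i) F i).
Proof.
by move=> hF; elim/big_rec : _ => [|i x _ hx]; [exact: ph_car0|exact: ph_carD].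
Qed.

Lemma ph_ipDl u v w : hcar u -> hcar v -> hcar w ->
  hip (u + v) w = hip u w + hip v w.
Proof. by move=> hu hv hw; rewrite -[u]scale1r ph_lin// !scale1r mul1r. Qed.

Lemma ph_ip0l w : hcar w -> hip 0 w = 0.
Proof.
move=> hw; have h0 := ph_car0 pH; apply: (addIr (hip 0 w)).
by rewrite -ph_ipDl// !add0r.
Qed.

Lemma ph_ipZl k u w : hcar u -> hcar w -> hip (k *: u) w = k * hip u w.
Proof.
by move=> hu hw; rewrite -[k *: u]addr0 ph_lin ?ph_ip0l ?addr0//; exact: ph_car0.
Qed.

Lemma ph_ipNl u w : hcar u -> hcar w -> hip (- u) w = - hip u w.
Proof. by move=> hu hw; rewrite -scaleN1r ph_ipZl// mulN1r. Qed.

Lemma ph_ipBl u v w : hcar u -> hcar v -> hcar w ->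
  hip (u - v) w = hip u w - hip v w.
Proof. by move=> hu hv hw; rewrite ph_ipDl ?ph_ipNl//; exact: ph_carN. Qed.

Lemma ph_ipDr u v w : hcar u -> hcar v -> hcar w ->
  hip w (u + v) = hip w u + hip w v.
Proof.
move=> hu hv hw; rewrite (ph_herm pH (ph_carD hu hv) hw) ph_ipDl// rmorphD/=.
by rewrite -!(ph_herm pH).
Qed.

Lemma ph_ipZr k u w : hcar u -> hcar w -> hip w (k *: u) = conjc k * hip w u.
Proof.
move=> hu hw; rewrite (ph_herm pH (ph_carZ k hu) hw) ph_ipZl// rmorphM/=.
by rewrite -(ph_herm pH).
Qed.

Lemma ph_ipNr u w : hcar u -> hcar w -> hip w (- u) = - hip w u.
Proof.
by move=> hu hw; rewrite -scaleN1r ph_ipZr// rmorphN1 mulN1r.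
Qed.

Lemma ph_ipBr u v w : hcar u -> hcar v -> hcar w ->
  hip w (u - v) = hip w u - hip w v.
Proof. by move=> hu hv hw; rewrite ph_ipDr ?ph_ipNr//; exact: ph_carN. Qed.

Lemma ph_ip0r w : hcar w -> hip w 0 = 0.
Proof.
move=> hw; rewrite (ph_herm pH (ph_car0 pH) hw).
by rewrite ph_ip0l// conjc0.
Qed.

Lemma hnorm_ge0 u : 0 <= hnorm u.
Proof. exact: sqrtr_ge0. Qed.

Lemma ph_norm2 u : hcar u -> hnorm u ^+ 2 = Re (hip u u).
Proof. by move=> hu; rewrite sqr_sqrtr//; exact: ph_ge0. Qed.

Lemma ph_ipxx u : hcar u -> hip u u = (hnorm u ^+ 2)%:C.
Proof.
move=> hu; rewrite ph_norm2//; have := ph_herm pH hu hu.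
by case: (hip u u) => a b [] /eqP; rewrite -addr_eq0 -mulr2n mulrn_eq0/= => /eqP ->.
Qed.

(** Positivity of the form at [u - t z v], with [z = hip u v] and [t] real, gives an inequality
    quadratic in [t]. The minimizer [1 / q] is replaced by [1 / (q + d)] with [d] tending to 0,
    which also covers the null vectors [v], for which [q = 0]. *)
Lemma ph_CS u v : hcar u -> hcar v -> normc (hip u v) <= hnorm u * hnorm v.
Proof.
move=> hu hv; rewrite -(@ler_pXn2r _ 2)// ?nnegrE ?normc_ge0 ?mulr_ge0 ?hnorm_ge0//.
rewrite exprMn.
set z := hip u v; set p := hnorm u ^+ 2; set q := hnorm v ^+ 2.
have key (t : R) : 0 <= p - 2 * t * normc z ^+ 2 + t ^+ 2 * normc z ^+ 2 * q.
  have hw : hcar (u - (t%:C * z) *: v) by apply: ph_carB => //; exact: ph_carZ.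
  have := ph_ge0 pH hw.
  rewrite ph_ipBl ?ph_ipBr ?ph_ipZl ?ph_ipZr//; try exact: ph_carZ.
  rewrite !(ph_ipxx hu) !(ph_ipxx hv) (ph_herm pH hu hv) -/z -/p -/q.
  rewrite normc_sqr; case: z {hw} => zx zy; simpc => /=; lra.
have p0 : 0 <= p by exact: sqr_ge0.
have q0 : 0 <= q by exact: sqr_ge0.
apply/ler_addgt0Pr => e e0.
pose n2 := normc z ^+ 2; rewrite -/n2.
have n20 : 0 <= n2 by exact: sqr_ge0.
have step d : 0 < d -> n2 <= p * (q + d).
  move=> d0; have qd : 0 < q + d by exact: ltr_wpDl.
  have := key ((q + d)^-1); rewrite -/n2 => h.
  have : 0 <= (q + d) ^+ 2 * (p - 2 * (q + d)^-1 * n2 + (q + d)^-1 ^+ 2 * n2 * q).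
    by rewrite mulr_ge0// sqr_ge0.
  have -> : (q + d) ^+ 2 * (p - 2 * (q + d)^-1 * n2 + (q + d)^-1 ^+ 2 * n2 * q)
     = p * (q + d) ^+ 2 - 2 * (q + d) * n2 + n2 * q.
    by field; rewrite gt_eqF.
  move=> h2; have : 0 <= (q + d) * (p * (q + d) - n2).
    have : 0 <= n2 * d by rewrite mulr_ge0// ltW.
    nra.
  by rewrite pmulr_rge0// subr_ge0.
have pe : 0 < p + 1 by lra.
apply: le_trans (step (e / (p + 1)) (divr_gt0 e0 pe)) _.
rewrite mulrDr lerD2l mulrCA ger_pMr// ler_pdivrMr// mul1r lerDl//.
Qed.

Lemma ph_norm0 : hnorm (0 : H) = 0.
Proof. by rewrite /hnorm ph_ip0l ?sqrtr0//; exact: ph_car0. Qed.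

Lemma ph_normD u v : hcar u -> hcar v -> hnorm (u + v) <= hnorm u + hnorm v.
Proof.
move=> hu hv; rewrite -(@ler_pXn2r _ 2)// ?nnegrE ?addr_ge0 ?hnorm_ge0//.
rewrite ph_norm2; last exact: ph_carD.
rewrite ph_ipDl ?ph_ipDr//; try exact: ph_carD.
rewrite !ReD -!ph_norm2// (ph_herm pH hu hv) ReJ.
have := Re_le_normc (hip u v); have := ph_CS hu hv; nra.
Qed.

Lemma ph_normZ k u : hcar u -> hnorm (k *: u) = normc k * hnorm u.
Proof.
move=> hu; rewrite /hnorm ph_ipZl ?ph_ipZr//; last exact: ph_carZ.
rewrite mulrA normc_sqrC ph_ipxx// -rmorphM/= sqrtrM ?sqr_ge0//.
by rewrite sqrtr_sqr ger0_norm ?normc_ge0// sqrtr_sqr ger0_norm ?hnorm_ge0// sqrtr_sqr ger0_norm ?hnorm_ge0.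
Qed.

Lemma ph_normN u : hcar u -> hnorm (- u) = hnorm u.
Proof. by move=> hu; rewrite -scaleN1r ph_normZ// normcN Normc.normc1 mul1r. Qed.

Lemma ph_normBC u v : hcar u -> hcar v -> hnorm (u - v) = hnorm (v - u).
Proof. by move=> hu hv; rewrite -ph_normN ?opprB//; exact: ph_carB. Qed.

Lemma hsame_refl u : hsame u u.
Proof. by rewrite /hsame subrr ph_norm0. Qed.

Lemma hsame_sym u v : hcar u -> hcar v -> hsame u v -> hsame v u.
Proof. by move=> hu hv; rewrite /hsame ph_normBC. Qed.

Lemma hsame_trans u v w : hcar u -> hcar v -> hcar w ->
  hsame u v -> hsame v w -> hsame u w.
Proof.
move=> hu hv hw huv hvw; apply/eqP; rewrite eq_le hnorm_ge0 andbT.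
rewrite -(subrKA v); apply: le_trans (ph_normD _ _) _; rewrite ?huv ?hvw ?addr0//.
all: exact: ph_carB.
Qed.

Lemma hsame_comb k u u' v v' : hcar u -> hcar u' -> hcar v -> hcar v' ->
  hsame u u' -> hsame v v' -> hsame (k *: u + v) (k *: u' + v').
Proof.
move=> hu hu' hv hv' e1 e2; apply/eqP; rewrite eq_le hnorm_ge0 andbT.
rewrite opprD addrACA -scalerBr; apply: le_trans (ph_normD _ _) _.
- by apply: ph_carZ; exact: ph_carB.
- exact: ph_carB.
- by rewrite ph_normZ ?e1 ?e2 ?mulr0 ?addr0//; exact: ph_carB.
Qed.

Lemma hsame_norm u v : hcar u -> hcar v -> hsame u v -> hnorm u = hnorm v.
Proof.
move=> hu hv e; apply/eqP; rewrite eq_le; apply/andP; split.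
- by rewrite -(subrK v u); apply: le_trans (ph_normD _ _) _ => //;
    [exact: ph_carB|rewrite e add0r].
- rewrite -(subrK u v); apply: le_trans (ph_normD _ _) _ => //;
    first exact: ph_carB.
  by rewrite ph_normBC// e add0r.
Qed.

Lemma hsame_ipl u v w : hcar u -> hcar v -> hcar w -> hsame u v ->
  hip u w = hip v w.
Proof.
move=> hu hv hw e; apply/eqP; rewrite -subr_eq0 -ph_ipBl//; apply/eqP.
apply: Normc.eq0_normc; apply/eqP; rewrite eq_le normc_ge0 andbT.
by apply: le_trans (ph_CS _ _) _ => //; [exact: ph_carB|rewrite e mul0r].
Qed.

Lemma hsame_ipr u v w : hcar u -> hcar v -> hcar w -> hsame u v ->
  hip w u = hip w v.
Proof.
move=> hu hv hw e; rewrite (ph_herm pH hu hw) (ph_herm pH hv hw).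
by rewrite (hsame_ipl hu hv hw e).
Qed.

End Prehilbert.

(** * Mean value inequalities from one-sided increments *)

Section RightDerivative.
Variable R : realType.
Implicit Types (phi : R -> R) (a b : R).

(* Continuous induction: the set of [s] such that [phi r <= phi a + e (r - a)]
   on [[a, s]] has maximum [b]. *)
Lemma right_mvt phi a b : a <= b ->
  (forall s : R, a <= s < b -> forall e : R, 0 < e ->
    exists2 d : R, 0 < d & forall r : R, 0 < r < d -> phi (s + r) <= phi s + e * r) ->
  (forall s : R, a < s <= b -> forall e : R, 0 < e ->
    exists2 d : R, 0 < d & forall r : R, 0 < r < d -> phi s <= phi (s - r) + e) ->
  phi b <= phi a.
Proof.
move=> ab hr hl; suff key e : 0 < e -> phi b <= phi a + e * (b - a).
  apply/ler_addgt0Pr => e e0; have h : 0 < b - a + 1 by lra.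
  apply: le_trans (key (e / (b - a + 1)) (divr_gt0 e0 h)) _.
  rewrite lerD2l mulrAC ler_pdivrMr// ler_pM2l//; lra.
move=> e0; pose P r := phi r <= phi a + e * (r - a).
pose S := [set s | a <= s <= b /\ forall r, a <= r <= s -> P r].
have Pa : P a by rewrite /P subrr mulr0 addr0.
have Sa : S a.
  split; first by rewrite lexx.
  by move=> r; rewrite -eq_le => /eqP <-.
have Sub : ubound S b by move=> s [/andP[]].
have hS : has_sup S by split; [exists a|exists b].
set s0 := sup S.
have as0 : a <= s0 by apply: (ub_le_sup (ex_intro _ b Sub)).

have s0b : s0 <= b by apply: ge_sup => //; exists a; exact: Sa.
have Plt r : a <= r < s0 -> P r.
  move=> /andP[ar rs]; have sr : 0 < s0 - r by rewrite subr_gt0.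
  have [s [_ hs] ] := sup_adherent sr hS; rewrite opprB addrC subrK => rs'.
  by apply: hs; rewrite ar ltW.
have Ps0 : P s0.
  have [<-//|as0'] := eqVneq a s0.
  have lts : a < s0 by rewrite lt_neqAle as0'.
  apply/ler_addgt0Pr => e' e'0.
  have hs0 : a < s0 <= b by rewrite lts.
  have [d d0 hd] := hl s0 hs0 e' e'0.
  pose r := Num.min (d / 2) ((s0 - a) / 2).
  have r0 : 0 < r by rewrite lt_min !divr_gt0// subr_gt0.
  have rd : r < d.
    by apply: (@le_lt_trans _ _ (d / 2)); [rewrite ge_min lexx|lra].
  have ra : r <= (s0 - a) / 2 by rewrite ge_min lexx orbT.
  have h := hd r (introT andP (conj r0 rd)); apply: le_trans h _.
  rewrite lerD2r; have := Plt (s0 - r); rewrite /P => h.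
  apply: le_trans (h _) _; first by lra.
  by rewrite lerD2l ler_pM2l//; lra.
suff <- : s0 = b by [].
apply/eqP; rewrite eq_le s0b/= leNgt; apply/negP => ltb.
have hs0 : a <= s0 < b by rewrite as0.
have [d d0 hd] := hr s0 hs0 e e0.
pose r := Num.min (d / 2) (b - s0).
have r0 : 0 < r by rewrite lt_min divr_gt0//= subr_gt0.
have rd : r < d by apply: (@le_lt_trans _ _ (d / 2)); [rewrite ge_min lexx|lra].
have rb : r <= b - s0 by rewrite ge_min lexx orbT.
have : S (s0 + r).
  split; first by lra.
  move=> t /andP[at_ ts]; have [tlt|tge] := ltP t s0; first by apply: Plt; rewrite at_.
  have [<-//|ne] := eqVneq s0 t.
  have lt0t : s0 < t by rewrite lt_neqAle ne.
  have := hd (t - s0); rewrite addrCA subrr addr0 => h.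
  apply: le_trans (h _) _; first by lra.
  by move: Ps0; rewrite /P; lra.
move/(ub_le_sup (ex_intro _ b Sub)); rewrite -/s0; lra.
Qed.

End RightDerivative.

Section VectorMvt.
Context {R : realType} {H : hspace R}.
Hypotheses (pH : prehilbert H) (cH : forall u : H, hcar u).

(** Apply [right_mvt] to the real function [|g s - g a| - G s]; the triangle inequality converts the
    increments of [g]. On the left of a point only a form of continuity is asked for. *)
Lemma vector_mvt (g : R -> H) (G : R -> R) a b : a <= b ->
  (forall s : R, a <= s < b -> forall e : R, 0 < e -> exists2 d : R, 0 < d &
    forall r : R, 0 < r < d -> hnorm (g (s + r) - g s) <= G (s + r) - G s + e * r) ->
  (forall s : R, a < s <= b -> forall e : R, 0 < e -> exists2 d : R, 0 < d &
    forall r : R, 0 < r < d -> hnorm (g s - g (s - r)) + (G (s - r) - G s) <= e) ->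
  hnorm (g b - g a) <= G b - G a.
Proof.
move=> ab hr hl; suff: hnorm (g b - g a) - G b <= hnorm (g a - g a) - G a.
  by rewrite subrr (ph_norm0 pH); lra.
apply: (@right_mvt _ (fun s => hnorm (g s - g a) - G s)) => // s hs e e0.
- have [d d0 hd] := hr s hs e e0; exists d => // r hr'.
  have := hd r hr'; have := ph_normD pH (cH (g (s + r) - g s)) (cH (g s - g a)).
  rewrite addrA subrK; lra.
- have [d d0 hd] := hl s hs e e0; exists d => // r hr'.
  have := hd r hr'.
  have := ph_normD pH (cH (g s - g (s - r))) (cH (g (s - r) - g a)).
  rewrite addrA subrK; lra.
Qed.

End VectorMvt.

Lemma derive_eps (R : realType) (f : R -> R) (x df : R) : is_derive x 1 f df ->
  forall e : R, 0 < e -> exists2 d : R, 0 < d &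
    forall r : R, `|r| < d -> `|f (x + r) - f x - df * r| <= e * `|r|.
Proof.
move=> [df' <-] e e0; have /cvgrPdist_le/(_ e e0) := df'.
rewrite near_withinE => /nbhs_ballP[d /= d0 hd]; exists d => // r rd.
have [->|r0] := eqVneq r 0; first by rewrite addr0 subrr mulr0 normr0 subr0 normr0 mulr0.
have := hd r; rewrite /ball/= sub0r normrN => /(_ rd r0).
rewrite /derive/= [r *: 1]mulr1 (addrC r).
set q := f (x + r) - f x; set L := lim _ => h.
have -> : q - L * r = - (r * (L - r^-1 * q)) by field.
by rewrite normrN normrM mulrC ler_wpM2r.
Qed.

(** * Complete spaces whose vectors are points, and linear graphs on them *)

Record hilbert (R : realType) (X : hspace R) : Prop := Hilbert {
  hil_ph : prehilbert X ;
  hil_car : forall u : X, hcar u ;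
  hil_def : forall u : X, hnorm u = 0 -> u = 0 ;
  hil_complete : forall s : nat -> X,
    (forall e : R, 0 < e -> exists n, forall m p, (n <= m)%N -> (n <= p)%N ->
      hnorm (s m - s p) <= e) ->
    exists l, hnorm (s m - l) @[m --> \oo] --> (0 : R) }.

Section HilbertRules.
Context {R : realType} {X : hspace R}.
Hypothesis hX : hilbert X.
Implicit Types (u v w : X) (k : R[i]).
Let pX := hil_ph hX.
Let cX := hil_car hX.

Lemma ipDl u v w : hip (u + v) w = hip u w + hip v w.
Proof. exact: ph_ipDl. Qed.
Lemma ipBl u v w : hip (u - v) w = hip u w - hip v w.
Proof. exact: ph_ipBl. Qed.
Lemma ipNl u w : hip (- u) w = - hip u w.
Proof. exact: ph_ipNl. Qed.
Lemma ipZl k u w : hip (k *: u) w = k * hip u w.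
Proof. exact: ph_ipZl. Qed.
Lemma ip0l w : hip 0 w = 0.
Proof. exact: ph_ip0l. Qed.
Lemma ipDr u v w : hip w (u + v) = hip w u + hip w v.
Proof. exact: ph_ipDr. Qed.
Lemma ipBr u v w : hip w (u - v) = hip w u - hip w v.
Proof. exact: ph_ipBr. Qed.
Lemma ipZr k u w : hip w (k *: u) = conjc k * hip w u.
Proof. exact: ph_ipZr. Qed.
Lemma ip0r w : hip w 0 = 0.
Proof. exact: ph_ip0r. Qed.
Lemma ip_herm u v : hip v u = conjc (hip u v).
Proof. exact: ph_herm. Qed.
Lemma ipxx u : hip u u = (hnorm u ^+ 2)%:C.
Proof. exact: ph_ipxx. Qed.
Lemma ip_suml (I : Type) (s : seq I) (P : pred I) (F : I -> X) w :
  hip (\sum_(i <- s | P i) F i) w = \sum_(i <- s | P i) hip (F i) w.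
Proof. by elim/big_rec2 : _ => [|i x y _ <-]; [exact: ip0l|exact: ipDl]. Qed.
Lemma ip_sumr (I : Type) (s : seq I) (P : pred I) (F : I -> X) w :
  hip w (\sum_(i <- s | P i) F i) = \sum_(i <- s | P i) hip w (F i).
Proof. by elim/big_rec2 : _ => [|i x y _ <-]; [exact: ip0r|exact: ipDr]. Qed.

Lemma CS u v : normc (hip u v) <= hnorm u * hnorm v.
Proof. exact: ph_CS. Qed.
Lemma hnormD u v : hnorm (u + v) <= hnorm u + hnorm v.
Proof. exact: ph_normD. Qed.
Lemma hnormN u : hnorm (- u) = hnorm u.
Proof. exact: ph_normN. Qed.
Lemma hnormB u v : hnorm (u - v) <= hnorm u + hnorm v.
Proof. by rewrite -(hnormN v) hnormD. Qed.
Lemma hnormBC u v : hnorm (u - v) = hnorm (v - u).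
Proof. exact: ph_normBC. Qed.
Lemma hnormZ k u : hnorm (k *: u) = normc k * hnorm u.
Proof. exact: ph_normZ. Qed.
Lemma hnormZR (r : R) u : hnorm (r%:C *: u) = `|r| * hnorm u.
Proof. by rewrite hnormZ normcR. Qed.
Lemma hnormZp (r : R) u : 0 <= r -> hnorm (r%:C *: u) = r * hnorm u.
Proof. by move=> r0; rewrite hnormZR ger0_norm. Qed.
Lemma hnorm0 : hnorm (0 : X) = 0.
Proof. exact: ph_norm0. Qed.
Lemma hnorm_le0 u : hnorm u <= 0 -> u = 0.
Proof. by move=> h; apply: (hil_def hX); apply/eqP; rewrite eq_le h hnorm_ge0. Qed.
Lemma hnorm_subr_le0 u v : hnorm (u - v) <= 0 -> u = v.
Proof. by move=> /hnorm_le0/eqP; rewrite subr_eq0 => /eqP. Qed.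
Lemma hnorm_sum (I : Type) (s : seq I) (P : pred I) (F : I -> X) :
  hnorm (\sum_(i <- s | P i) F i) <= \sum_(i <- s | P i) hnorm (F i).
Proof.
elim/big_ind2 : _ => [|x a y b xa yb|//]; first by rewrite hnorm0.
by apply: le_trans (hnormD _ _) _; apply: lerD.
Qed.
Lemma hnorm_tri v u w : hnorm (u - w) <= hnorm (u - v) + hnorm (v - w).
Proof. by rewrite -(subrKA v); exact: hnormD. Qed.
Lemma hsame_eq u v : hsame u v -> u = v.
Proof. by move=> h; apply: hnorm_subr_le0; rewrite h. Qed.

Lemma hcvg_unique (s : nat -> X) u v :
  hnorm (s m - u) @[m --> \oo] --> (0 : R) ->
  hnorm (s m - v) @[m --> \oo] --> (0 : R) -> u = v.
Proof.
move=> hu hv; apply: hnorm_subr_le0.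
have h : (hnorm (s m - u) + hnorm (s m - v)) @[m --> \oo] --> (0 + 0 : R).
  exact: cvgD.
rewrite -[X in _ <= X]addr0; apply: (ler_cvg_to (cvg_cst _) h).
by near=> m; rewrite (hnormBC (s m) u); exact: hnorm_tri.
Unshelve. all: by end_near. Qed.

Lemma hcvg_eps (s : nat -> X) u :
  (hnorm (s m - u) @[m --> \oo] --> (0 : R)) <->
  (forall e : R, 0 < e -> exists n, forall m, (n <= m)%N -> hnorm (s m - u) <= e).
Proof.
split.
- move=> /cvgr0Pnorm_le h e e0; have [n _ hn] := h e e0; exists n => m nm.
  by have := hn m nm; rewrite /= ger0_norm ?hnorm_ge0.
- move=> h; apply/cvgr0Pnorm_le => e e0; have [n hn] := h e e0; exists n => // m nm.
  by rewrite /= ger0_norm ?hnorm_ge0//; exact: hn.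
Qed.

Lemma hcvg_norm_le (s : nat -> X) u (c : R) :
  hnorm (s m - u) @[m --> \oo] --> (0 : R) ->
  (\forall m \near \oo, hnorm (s m) <= c) -> hnorm u <= c.
Proof.
move=> hu hc.
have h : (hnorm (s m - u) + c) @[m --> \oo] --> (0 + c : R).
  by apply: cvgD => //; exact: cvg_cst.
rewrite -[c]add0r; apply: (ler_cvg_to (cvg_cst _) h).
have key m : hnorm (s m) <= c -> hnorm u <= hnorm (s m - u) + c.
  by move=> hm; have := hnormB (s m) (s m - u); rewrite subKr; lra.
by near=> m; apply: key; near: m.
Unshelve. all: by end_near. Qed.

End HilbertRules.

Definition linear_graph (R : realType) (X : hspace R) (A : X -> set X) : Prop :=
  A 0 0 /\ forall (k : R[i]) u v u' v', A u v -> A u' v' ->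
    A (k *: u + u') (k *: v + v').

Section LinearGraph.
Context {R : realType} {X : hspace R} {A : X -> set X}.
Hypothesis lA : linear_graph A.
Implicit Types (u v w : X) (k : R[i]).

Lemma lgD u v u' v' : A u v -> A u' v' -> A (u + u') (v + v').
Proof. by move=> h h'; have := lA.2 1 _ _ _ _ h h'; rewrite !scale1r. Qed.

Lemma lgZ k u v : A u v -> A (k *: u) (k *: v).
Proof. by move=> h; have := lA.2 k _ _ _ _ h lA.1; rewrite !addr0. Qed.

Lemma lgN u v : A u v -> A (- u) (- v).
Proof. by rewrite -(scaleN1r u) -(scaleN1r v); exact: lgZ. Qed.

Lemma lgB u v u' v' : A u v -> A u' v' -> A (u - u') (v - v').
Proof. by move=> h h'; apply: lgD => //; exact: lgN. Qed.

Lemma lg_sum (I : Type) (s : seq I) (P : pred I) (F G : I -> X) :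
  (forall i, A (F i) (G i)) ->
  A (\sum_(i <- s | P i) F i) (\sum_(i <- s | P i) G i).
Proof. by move=> h; elim/big_rec2 : _ => [|i x y _]; [exact: lA.1|exact: lgD]. Qed.

End LinearGraph.

(** * Strongly continuous semigroups and their generators *)

Lemma right0_eps (R : realType) (F : R -> R) : (forall r, 0 <= F r) ->
  (F r @[r --> 0^'+] --> (0 : R)) <->
  (forall e : R, 0 < e -> exists2 d : R, 0 < d & forall r : R, 0 < r < d -> F r <= e).
Proof.
move=> F0; split.
- move=> /cvgr0Pnorm_le h e e0; have := h e e0.
  rewrite near_withinE => /nbhs_ballP[d /= d0 hd]; exists d => // r /andP[r0 rd].
  have := hd r; rewrite /ball/= sub0r normrN gtr0_norm// => /(_ rd r0).
  by rewrite ger0_norm.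
- move=> h; apply/cvgr0Pnorm_le => e e0; have [d d0 hd] := h e e0.
  rewrite near_withinE; apply/nbhs_ballP; exists d => // r.
  rewrite /ball/= sub0r normrN => rd r0; rewrite ger0_norm//; apply: hd.
  by rewrite r0/= -(gtr0_norm r0).
Qed.

Lemma realC_mulV (R : realType) (t : R) : t != 0 -> (t%:C) * (t^-1)%:C = 1.
Proof. by move=> t0; rewrite -rmorphM/= mulfV. Qed.

Section Semigroup.
Context {R : realType} {X : hspace R}.
Hypothesis hX : hilbert X.
Variables (T : R -> X -> X) (N : R).
Hypothesis hT : C0_semigroup T.
Hypothesis hN : forall (t : R) u, 0 <= t -> hnorm (T t u) <= N * hnorm u.
Implicit Types (u v w : X) (k : R[i]).
Let cX := hil_car hX.

Lemma sgP t k u v : 0 <= t -> T t (k *: u + v) = k *: T t u + T t v.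
Proof. by move=> t0; have [/(_ t t0)[_ h _] _ _ _] := hT; apply: (hsame_eq hX); exact: h. Qed.

Lemma sg0 t : 0 <= t -> T t 0 = 0.
Proof.
by move=> t0; apply: (hnorm_le0 hX); have := hN 0 t0; rewrite (hnorm0 hX) mulr0.
Qed.

Lemma sgD t u v : 0 <= t -> T t (u + v) = T t u + T t v.
Proof. by move=> t0; have := sgP 1 u v t0; rewrite !scale1r. Qed.

Lemma sgZ t k u : 0 <= t -> T t (k *: u) = k *: T t u.
Proof. by move=> t0; have := sgP k u 0 t0; rewrite sg0// !addr0. Qed.

Lemma sgB t u v : 0 <= t -> T t (u - v) = T t u - T t v.
Proof. by move=> t0; rewrite sgD// -scaleN1r sgZ// scaleN1r. Qed.

Lemma sgt0 u : T 0 u = u.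
Proof. by have [_ h _ _] := hT; apply: (hsame_eq hX); exact: h. Qed.

Lemma sgA s t u : 0 <= s -> 0 <= t -> T (t + s) u = T t (T s u).
Proof. by move=> s0 t0; have [_ _ h _] := hT; apply: (hsame_eq hX); exact: h. Qed.

Lemma sg_cont u e : 0 < e -> exists2 d : R, 0 < d &
  forall r : R, 0 < r < d -> hnorm (T r u - u) <= e.
Proof.
move=> e0; have [_ _ _ /(_ u (cX u)) h] := hT.
by move/(right0_eps (fun r => hnorm_ge0 _)) : h => /(_ e e0).
Qed.

(** Multiplying the difference quotient by [r] removes the inverses; in this form linearity and
    invariance under the semigroup are triangle inequalities. *)
Lemma gen_eps u v : generator T u v <->
  forall e : R, 0 < e -> exists2 d : R, 0 < d &
    forall r : R, 0 < r < d -> hnorm (T r u - u - r%:C *: v) <= e * r.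
Proof.
have E r : 0 < r -> hnorm ((r^-1)%:C *: (T r u - u) - v) =
    r^-1 * hnorm (T r u - u - r%:C *: v).
  move=> r0; rewrite -(hnormZp hX) ?invr_ge0 ?ltW//; congr hnorm.
  by lmod_field; rewrite gt_eqF.
split.
- move=> [_ _ /(right0_eps (fun r => hnorm_ge0 _)) h] e e0.
  have [d d0 hd] := h e e0; exists d => // r rd.
  have r0 : 0 < r by case/andP: rd.
  by have := hd r rd; rewrite E// mulrC ler_pdivrMr.
- move=> h; split; [exact: cX|exact: cX|].
  apply/(right0_eps (fun r => hnorm_ge0 _)) => e e0.
  have [d d0 hd] := h e e0; exists d => // r rd.
  have r0 : 0 < r by case/andP: rd.
  by rewrite E// mulrC ler_pdivrMr//; exact: hd.
Qed.

Lemma gen_linear : linear_graph (generator T).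
Proof.
split.
  apply/gen_eps => e e0; exists 1 => // r /andP[r0 _].
  rewrite (sg0 (ltW r0)) scaler0 !subr0 (hnorm0 hX).
  by apply: mulr_ge0; exact: ltW.
move=> k u v u' v' /gen_eps h /gen_eps h'; apply/gen_eps => e e0.
have k1 : 0 < 2 * (normc k + 1) by have := normc_ge0 k; lra.
have [d d0 hd] := h (e / (2 * (normc k + 1))) (divr_gt0 e0 k1).
have [d' d'0 hd'] := h' (e / 2) (divr_gt0 e0 (ltr0Sn R 1)).
exists (Num.min d d'); first by rewrite lt_min d0.
move=> r /andP[r0]; rewrite lt_min => /andP[rd rd'].
have -> : T r (k *: u + u') - (k *: u + u') - r%:C *: (k *: v + v') =
    k *: (T r u - u - r%:C *: v) + (T r u' - u' - r%:C *: v').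
  by rewrite (sgP _ _ _ (ltW r0)); lmod.
apply: le_trans (hnormD hX _ _) _; rewrite (hnormZ hX).
have h1 : normc k * hnorm (T r u - u - r%:C *: v) <= e / 2 * r.
  have := hd r; rewrite r0 rd => /(_ isT) q.
  apply: le_trans (ler_wpM2l (normc_ge0 k) q) _.
  rewrite mulrA ler_pM2r// mulrCA ler_pM2l// ler_pdivrMr//.
  by have := normc_ge0 k; lra.
have h2 := hd' r; rewrite r0 rd' in h2; have := h2 isT; lra.
Qed.

Lemma gen_sg t u v : 0 <= t -> generator T u v -> generator T (T t u) (T t v).
Proof.
move=> t0 /gen_eps h; apply/gen_eps => e e0.
have N1 : 0 < `|N| + 1 by have := normr_ge0 N; lra.
have [d d0 hd] := h (e / (`|N| + 1)) (divr_gt0 e0 N1); exists d => // r rd.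
have r0 : 0 < r by case/andP: rd.
rewrite -(sgA _ t0 (ltW r0)) (addrC r t) (sgA _ (ltW r0) t0) -sgZ// -!sgB//.
apply: le_trans (hN _ t0) _; have := hd r rd.
set q := hnorm _ => hq; apply: (@le_trans _ _ ((`|N| + 1) * q)).
  by rewrite ler_wpM2r ?hnorm_ge0//; have := ler_norm N; lra.
apply: le_trans (ler_wpM2l (ltW N1) hq) _.
by rewrite mulrA ler_pM2r// mulrCA ger_pMr// divff ?gt_eqF.
Qed.

(* Differentiates [exp (- s / h) (T s w - p)] and integrates the bound. *)
Lemma resolvent_comparison (h : R) w v p (psi psit dpsi : R -> R) : 0 < h ->
  generator T w v ->
  (forall s : R, 0 <= s -> hnorm (T s (w - h%:C *: v) - p) <= psi s) ->
  (forall s : R, 0 <= s -> is_derive s 1 psit (dpsi s)) ->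
  (forall s : R, 0 <= s -> 0 <= psit s) ->
  (forall s : R, 0 <= s -> psi s <= psit s - h * dpsi s) ->
  hnorm (w - p) <= psit 0.
Proof.
move=> h0 Awv hpsi dpsit psit0 cmp.
(* Formally, [w] is the average of [T s (w - h v)] against the exponential law of mean [h]. As
   [psi <= psit - h psit'], the derivative of [G] dominates [exp(- s / h) psi s / h], a bound for
   the speed of [g], and no vector integral is formed. *)
pose Ex s := expR (- s / h); pose g s := (Ex s)%:C *: (T s w - p).
pose G s := - (Ex s * psit s).
pose K : R := `|N| * hnorm w + hnorm p.
have K0 : 0 <= K by rewrite addr_ge0 ?mulr_ge0 ?hnorm_ge0.
have TK (s : R) : 0 <= s -> hnorm (T s w - p) <= K.
  move=> s0; apply: le_trans (hnormB hX _ _) _; rewrite lerD2r.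
  apply: le_trans (hN _ s0) _; rewrite ler_wpM2r ?hnorm_ge0//; exact: ler_norm.
have Ex0 (s : R) : 0 < Ex s by exact: expR_gt0.
have Ex1 (s : R) : 0 <= s -> Ex s <= 1.
  by move=> s0; rewrite -expR0 ler_expR// mulNr oppr_le0 divr_ge0// ltW.
have ExD s r : Ex (s + r) = Ex s * Ex r.
  by rewrite /Ex -expRD -mulrDl opprD.
have Ex00 : Ex 0 = 1 by rewrite /Ex oppr0 mul0r expR0.
have dEx (s : R) : is_derive s (1 : R) Ex (- h^-1 * Ex s).
  have dl : is_derive s (1 : R) (fun s : R => - s / h) (- h^-1).
    rewrite (_ : (fun s : R => - s / h) = (- h^-1) \*: id); last first.
      by apply/funext => x /=; rewrite /GRing.scale/= mulNr mulNr mulrC.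
    by apply: is_derive_eq; rewrite /GRing.scale/= mulr1.
  have := @is_derive1_comp _ expR (fun s : R => - s / h) s _ _ (is_derive_expR (- s / h)) dl.
  by move=> hh; apply: is_derive_eq hh _; rewrite mulrC.
have dG (s : R) : 0 <= s -> is_derive s (1 : R) G (Ex s * (psit s / h - dpsi s)).
  move=> s0; have d1 := dEx s; have d2 := dpsit s s0.
  have d3 := is_deriveN (is_deriveM d1 d2).
  apply: is_derive_eq (d3) _; rewrite /GRing.scale/=; field; exact: lt0r_neq0.
have gest (s : R) : 0 <= s -> forall e : R, 0 < e -> exists2 d : R, 0 < d &
    forall r : R, 0 < r < d -> hnorm (g (s + r) - g s) <= r * (Ex s * psi s / h) + e * r.
  move=> s0 e e0; have N1 : 0 < 2 * (`|N| + 1) by have := normr_ge0 N; lra.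
  have K1 : 0 < 2 * (K + 1) by lra.
  move/gen_eps : (Awv) => /(_ (e / (2 * (`|N| + 1))) (divr_gt0 e0 N1))[d d0 hd].
  have d'0 : 0 < e * h ^+ 2 / (2 * (K + 1)) by rewrite divr_gt0// mulr_gt0// exprn_gt0.
  exists (Num.min d (e * h ^+ 2 / (2 * (K + 1)))); first by rewrite lt_min d0.
  move=> r /andP[r0]; rewrite lt_min => /andP[rd rd'].
  set q := Ex r; set err := T r w - w - r%:C *: v.
  have herr : hnorm err <= e / (2 * (`|N| + 1)) * r by apply: hd; rewrite r0.
  have Ew : T s (T r w) = T s err + T s w + r%:C *: T s v.
    by rewrite -sgZ// -!sgD// /err addrAC subrK subrK.
  have Ev : (r / h)%:C *: T s (w - h%:C *: v) = (r / h)%:C *: T s w - r%:C *: T s v.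
    rewrite sgB// scalerBr sgZ// scalerA -rmorphM/= divfK ?gt_eqF//.
  (* The increment splits into the error of the generator, the second order error of the
     exponential, and the main term of size [(r / h) psi s]. *)
  have -> : g (s + r) - g s = (Ex s)%:C *: (q%:C *: T s err +
      (q - 1 + q * (r / h))%:C *: (T s w - p) -
      q%:C *: ((r / h)%:C *: (T s (w - h%:C *: v) - p))).
    rewrite /g (sgA _ (ltW r0) s0) Ew ExD -/q (sgB w (h%:C *: v) s0) (sgZ h%:C v s0).
    by lmod_field; rewrite gt_eqF.
  have q0 : 0 < q by exact: Ex0.
  have q1 : q <= 1 by apply: Ex1; exact: ltW.
  have rh0 : 0 < r / h by exact: divr_gt0.
  have qq : `|q - 1 + q * (r / h)| <= (r / h) ^+ 2.
    have l1 : 1 - r / h <= q by rewrite /q /Ex mulNr; have := expR_ge1Dx (- (r / h)).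
    have l2 : q * (1 + r / h) <= 1.
      have := expR_ge1Dx (r / h) => l3; apply: le_trans (ler_wpM2l (ltW q0) l3) _.
      by rewrite /q /Ex -expRD mulNr addNr expR0.
    rewrite ler_norml; apply/andP; move: l1 l2 q0 rh0; clear; split; nra.
  have Exs := Ex1 s s0; have Exs0 := Ex0 s.
  rewrite (hnormZp hX) ?(ltW (Ex0 s))//.
  set T1 := q%:C *: T s err; set T2 := _ *: (T s w - p); set T3 := q%:C *: _.
  have b1 : hnorm T1 <= e / 2 * r.
    rewrite (hnormZp hX) ?(ltW q0)//.
    apply: (@le_trans _ _ (1 * (`|N| * hnorm err))).
      apply: ler_pM => //; [exact: ltW|exact: hnorm_ge0|].
      apply: le_trans (hN _ s0) _; rewrite ler_wpM2r ?hnorm_ge0//; exact: ler_norm.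
    rewrite mul1r; apply: le_trans (ler_wpM2l (normr_ge0 _) herr) _.
    rewrite mulrA ler_pM2r// mulrCA ler_pM2l// ler_pdivrMr//.
    by have := normr_ge0 N; lra.
  have b2 : hnorm T2 <= e / 2 * r.
    rewrite (hnormZR hX).
    apply: le_trans (ler_pM (normr_ge0 _) (hnorm_ge0 _) qq (TK s s0)) _.
    have rr : r * (2 * (K + 1)) <= e * h ^+ 2.
      by rewrite -ler_pdivlMr// ltW.
    have -> : (r / h) ^+ 2 * K = r * (r * K / h ^+ 2) by field; rewrite gt_eqF.
    rewrite [_ * r]mulrC ler_pM2l// ler_pdivrMr ?exprn_gt0//.
    by move: rr r0; clear; lra.
  have b3 : hnorm T3 <= r / h * psi s.
    rewrite (hnormZp hX) ?(ltW q0)// (hnormZp hX) ?(ltW rh0)//.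
    have := hpsi s s0; set z := hnorm _ => hz; have z0 : 0 <= z by exact: hnorm_ge0.
    rewrite mulrCA ler_pM2l//; move: hz z0 q0 q1; clear; nra.
  have := hnormB hX (T1 + T2) T3; have := hnormD hX T1 T2 => c1 c2.
  apply: (@le_trans _ _ (Ex s * (e * r + r / h * psi s))).
    by rewrite ler_pM2l//; move: c1 c2 b1 b2 b3; clear; lra.
  have er0 : 0 < e * r by exact: mulr_gt0.
  have : Ex s * (e * r) <= e * r by rewrite ger_pMl.
  by rewrite mulrDr; clear; lra.
have Gd (s : R) : 0 <= s -> forall e : R, 0 < e -> exists2 d : R, 0 < d & forall r : R, `|r| < d ->
    `|G (s + r) - G s - (Ex s * (psit s / h - dpsi s)) * r| <= e * `|r|.
  by move=> s0; exact: derive_eps (dG s s0).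
have main (b : R) : 0 <= b -> hnorm (g b - g 0) <= G b - G 0.
  move=> b0; apply: (vector_mvt (hil_ph hX) cX) => // s /andP[s0 sb] e e0.
  - have e2 : 0 < e / 2 by lra.
    have [d d0 hd] := gest s s0 _ e2; have [d' d'0 hd'] := Gd s s0 _ e2.
    exists (Num.min d d'); first by rewrite lt_min d0.
    move=> r /andP[r0]; rewrite lt_min => /andP[rd rd'].
    have h1 := hd r (introT andP (conj r0 rd)).
    have := hd' r; rewrite gtr0_norm// => /(_ rd'); rewrite ler_norml => /andP[h2 _].
    have h3 : Ex s * psi s / h <= Ex s * (psit s / h - dpsi s).
      rewrite -mulrA ler_pM2l// ler_pdivrMr// mulrBl divfK ?gt_eqF//.
      by rewrite [dpsi s * h]mulrC; exact: cmp.
    have : r * (Ex s * psi s / h) <= r * (Ex s * (psit s / h - dpsi s)).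
      by rewrite ler_pM2l.
    lra.
  (* To the left of [s], continuity of [g] and [G] suffices: each of three terms is brought below
     [e / 3]. *)
  - have s0' := ltW s0.
    have e3 : 0 < e / 3 by lra.
    have N1 : 0 < `|N| + 1 by have := normr_ge0 N; lra.
    have K1 : 0 < K + 1 by lra.
    have [d1 d10 hd1] := sg_cont w (divr_gt0 e3 N1).
    have [d2 d20 hd2] := derive_eps (dEx s) ltr01.
    have [d3 d30 hd3] := Gd s s0' _ ltr01.
    set D1 := - h^-1 * Ex s in hd2; set D2 := Ex s * _ in hd3.
    pose d4 := e / 3 / ((1 + `|D1|) * (K + 1)).
    pose d5 := e / 3 / (1 + `|D2|).
    have D11 : 0 < 1 + `|D1| by have := normr_ge0 D1; lra.
    have D21 : 0 < 1 + `|D2| by have := normr_ge0 D2; lra.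
    have d40 : 0 < d4 by rewrite divr_gt0// mulr_gt0.
    have d50 : 0 < d5 by rewrite divr_gt0.
    exists (Num.min s (Num.min d1 (Num.min d2 (Num.min d3 (Num.min d4 d5))))).
      by rewrite !lt_min s0 d10 d20 d30 d40 d50.
    move=> r /andP[r0]; rewrite !lt_min => /and5P[rs r1 r2 r3 /andP[r4 r5]].
    have := hd2 (- r); rewrite normrN gtr0_norm// => /(_ r2).
    rewrite ler_norml mul1r => /andP[u1 u2].
    have := hd3 (- r); rewrite normrN gtr0_norm// => /(_ r3).
    rewrite ler_norml mul1r => /andP[_ v2].
    have lip (D x y : R) : 0 < 1 + `|D| -> 0 < y -> r < x / ((1 + `|D|) * y) ->
        (r + `|D| * r) * y <= x.
      move=> D1' y0; rewrite ltr_pdivlMr ?mulr_gt0// => /ltW; apply: le_trans.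
      by rewrite le_eqVlt; apply/orP; left; apply/eqP; ring.
    have q1 := lip _ _ _ D11 K1 r4.
    have q2 := lip D2 (e / 3) 1 D21 ltr01; rewrite !mulr1 in q2; have {}q2 := q2 r5.
    have nD1 : D1 * r <= `|D1| * r by rewrite ler_pM2r// ler_norm.
    have nD2 : D2 * - r <= `|D2| * r by rewrite mulrN -mulNr ler_pM2r// -normrN ler_norm.
    have nD1' : - (D1 * r) <= `|D1| * r by rewrite -mulNr ler_pM2r// -normrN ler_norm.
    have sr0 : 0 <= s - r by rewrite subr_ge0 ltW.
    have -> : g s - g (s - r) = (Ex s - Ex (s - r))%:C *: (T s w - p) +
        (Ex (s - r))%:C *: T (s - r) (T r w - w).
      have E : T s w = T (s - r) (T r w) by rewrite -(sgA _ (ltW r0) sr0) subrK.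
      by rewrite /g sgB// E; lmod.
    have := hnormD hX ((Ex s - Ex (s - r))%:C *: (T s w - p))
        ((Ex (s - r))%:C *: T (s - r) (T r w - w)).
    have w1 : hnorm ((Ex s - Ex (s - r))%:C *: (T s w - p)) <= e / 3.
      rewrite (hnormZR hX); apply: le_trans q1; apply: ler_pM => //.
      - exact: hnorm_ge0.
      - by rewrite ler_norml; apply/andP; move: u1 u2 nD1 nD1'; clear; split; lra.
      - by apply: le_trans (TK s s0') _; rewrite lerDl.
    have w2 : hnorm ((Ex (s - r))%:C *: T (s - r) (T r w - w)) <= e / 3.
      rewrite (hnormZp hX) ?(ltW (Ex0 _))//.
      have z1 := hd1 r (introT andP (conj r0 r1)).
      apply: (@le_trans _ _ (1 * ((`|N| + 1) * hnorm (T r w - w)))).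
        apply: ler_pM; [exact: ltW|exact: hnorm_ge0|exact: Ex1|].
        apply: le_trans (hN _ sr0) _; rewrite ler_wpM2r ?hnorm_ge0//.
        by apply: le_trans (ler_norm _) _; rewrite lerDl.
      rewrite mul1r; apply: le_trans (ler_wpM2l (ltW N1) z1) _.
      by rewrite mulrC divfK ?gt_eqF.
    move: w1 w2 v2 q2 nD2; rewrite !mulrN; clear; lra.
have G0 : G 0 = - psit 0 by rewrite /G Ex00 mul1r.
have g0 : g 0 = w - p by rewrite /g Ex00 scale1r sgt0.
apply/ler_addgt0Pr => e e0.
(* [T s w - p] is bounded by [K], so [g b] vanishes at infinity; [b = h K / e] works because
   [exp(K / e) >= K / e]. *)
have [b b0 hb] : exists2 b, 0 <= b & Ex b * K <= e.
  have [->|Kn] := eqVneq K 0; first by exists 0 => //; rewrite mulr0 ltW.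
  have Kp : 0 < K by rewrite lt_neqAle eq_sym Kn.
  exists (h * (K / e)); first by rewrite ltW// mulr_gt0// divr_gt0.
  rewrite /Ex mulNr mulrAC divff ?gt_eqF// mul1r expRN.
  rewrite ler_pdivrMl ?expR_gt0// mulrC -ler_pdivrMl//.
  by apply: le_trans (expR_ge1Dx _); rewrite mulrC; lra.
have := main b b0; rewrite G0 g0 => hm.
have Gb : G b <= 0 by rewrite oppr_le0 mulr_ge0 ?psit0// ltW.
have gb : hnorm (g b) <= e.
  rewrite (hnormZp hX) ?(ltW (Ex0 _))//; apply: le_trans hb.
  by rewrite ler_pM2l//; exact: TK.
have := hnormB hX (g b) (g b - (w - p)); rewrite opprB addrCA subrr addr0; lra.
Qed.

End Semigroup.

(** * The resolvent [(1 - h A)^-1] as one backward Euler step of length [h] *)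

Definition resolvent (R : realType) (X : hspace R) (A : X -> set X) (h : R)
    (J : X -> X) : Prop :=
  (forall x, exists2 v, A (J x) v & J x - h%:C *: v = x) /\
  (forall u v, A u v -> J (u - h%:C *: v) = u).

Section Resolvents.
Context {R : realType} {X : hspace R}.
Variable A : X -> set X.
Hypotheses (hX : hilbert X) (lA : linear_graph A).
Implicit Types (u v w x y : X) (h : R) (J K : X -> X).
Let cX := hil_car hX.

Lemma resolventP h J (k : R[i]) x y : resolvent A h J ->
  J (k *: x + y) = k *: J x + J y.
Proof.
move=> [h1 h2]; have [v Av ev] := h1 x; have [w Aw ew] := h1 y.
by rewrite -(h2 _ _ (lA.2 k _ _ _ _ Av Aw)); congr J; rewrite -{1}ev -{1}ew; lmod.
Qed.

Lemma resolvent0 h J : resolvent A h J -> J 0 = 0.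
Proof.
by move=> hJ; have := hJ.2 _ _ lA.1; rewrite scaler0 subr0.
Qed.

Lemma resolventD h J x y : resolvent A h J -> J (x + y) = J x + J y.
Proof. by move=> hJ; have := resolventP 1 x y hJ; rewrite !scale1r. Qed.

Lemma resolventZ h J (k : R[i]) x : resolvent A h J -> J (k *: x) = k *: J x.
Proof.
by move=> hJ; have := resolventP k x 0 hJ; rewrite (resolvent0 hJ) !addr0.
Qed.

Lemma resolventB h J x y : resolvent A h J -> J (x - y) = J x - J y.
Proof.
by move=> hJ; rewrite (resolventD _ _ hJ) -scaleN1r (resolventZ _ _ hJ) scaleN1r.
Qed.

Lemma resolvent_eq h J u v : h != 0 -> resolvent A h J -> A u v ->
  J u - h%:C *: J v = u.
Proof.
move=> h0 hJ Auv; have [w Aw ew] := hJ.1 u.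
suff -> : J v = w by [].
have := hJ.2 _ _ (lgZ lA (h^-1)%:C (lgB lA Aw Auv)).
have E : (h^-1)%:C *: (J u - u) = w by rewrite -{2}ew; lmod_field.
by rewrite E => <-; congr J; lmod_field.
Qed.

Lemma resolvent_gen h J u v : h != 0 -> resolvent A h J -> A u v ->
  A (J u) (J v).
Proof.
move=> h0 hJ Auv; have [w Aw ew] := hJ.1 u; suff -> : J v = w by [].
have := resolvent_eq h0 hJ Auv; rewrite -[in RHS]ew => /addrI/oppr_inj.
by apply: scalerI; rewrite fmorph_eq0.
Qed.

Lemma resolvent_comm h k J K x : k != 0 ->
  resolvent A h J -> resolvent A k K -> J (K x) = K (J x).
Proof.
move=> k0 hJ hK; have [v Av ev] := hJ.1 x.
have := hJ.2 _ _ (resolvent_gen k0 hK Av) => <-.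
by rewrite -(resolventZ _ _ hK) -(resolventB _ _ hK) ev.
Qed.

Lemma resolvent_iterP h J n (k : R[i]) x y : resolvent A h J ->
  iter n J (k *: x + y) = k *: iter n J x + iter n J y.
Proof. by move=> hJ; elim: n => //= n ->; exact: (resolventP _ _ _ hJ). Qed.

Lemma resolvent_iter_gen h J n u v : h != 0 -> resolvent A h J -> A u v ->
  A (iter n J u) (iter n J v).
Proof. by move=> h0 hJ Auv; elim: n => //= n IH; exact: resolvent_gen hJ IH. Qed.

Lemma hcvg_geom (s : nat -> X) (C q : R) : 0 <= q < 1 ->
  (forall n, hnorm (s n.+1 - s n) <= C * q ^+ n) ->
  exists l, hnorm (s m - l) @[m --> \oo] --> (0 : R).
Proof.
move=> /andP[q0 q1] hs; apply: (hil_complete hX) => e e0.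
have C0 : 0 <= C by have := le_trans (hnorm_ge0 _) (hs 0%N); rewrite expr0 mulr1.
have q1' : 0 < 1 - q by lra.
have est n k : hnorm (s (n + k)%N - s n) <= C * q ^+ n / (1 - q) * (1 - q ^+ k).
  elim: k => [|k IH]; first by rewrite addn0 subrr (hnorm0 hX) expr0 subrr mulr0.
  rewrite addnS; apply: le_trans (hnorm_tri hX (s (n + k)%N) _ _) _.
  apply: le_trans (lerD (hs _) IH) _; rewrite le_eqVlt; apply/orP; left; apply/eqP.
  by rewrite exprS exprD; field; rewrite gt_eqF.
have [n hn] : exists n, C * q ^+ n / (1 - q) <= e / 2.
  have := @cvg_expr R q; rewrite ger0_norm// => /(_ q1)/cvgr0Pnorm_le.
  have dd : 0 < e / 2 * (1 - q) / (C + 1) by rewrite divr_gt0 ?mulr_gt0//; lra.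
  move=> /(_ _ dd)[n _ hn]; exists n; have := hn n (leqnn n).
  rewrite /= ger0_norm ?exprn_ge0// ler_pdivlMr ?ltr_wpDl// ler_pdivrMr//.
  by apply: le_trans; rewrite mulrC ler_wpM2l ?exprn_ge0// lerDl.
have est2 m : (n <= m)%N -> hnorm (s m - s n) <= e / 2.
  move=> /subnKC <-; apply: le_trans (est _ _) _; apply: le_trans hn.
  apply: ler_piMr; last by rewrite lerBlDr lerDl exprn_ge0.
  by apply: divr_ge0; [rewrite mulr_ge0 ?exprn_ge0|exact: ltW].
exists n => m p nm np; apply: le_trans (hnorm_tri hX (s n) _ _) _.
by rewrite (hnormBC hX (s n)); have := est2 m nm; have := est2 p np; lra.
Qed.

Hypothesis dissA : forall u v, A u v -> Re (hip v u) <= 0.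

Lemma dissipative_contr h u v : 0 <= h -> A u v ->
  hnorm u <= hnorm (u - h%:C *: v).
Proof.
move=> h0 Auv; have dv := dissA Auv.
have : hnorm u ^+ 2 <= hnorm (u - h%:C *: v) * hnorm u.
  have -> : hnorm u ^+ 2 = Re (hip (u - h%:C *: v) u) + h * Re (hip v u).
    by rewrite ipBl// ipZl// ipxx// ReB ReZ/=; ring.
  have := Re_le_normc (hip (u - h%:C *: v) u).
  have := CS hX (u - h%:C *: v) u; have : h * Re (hip v u) <= 0 by rewrite mulr_ge0_le0.
  lra.
have [->|u0] := eqVneq (hnorm u) 0; first by rewrite hnorm_ge0.
by rewrite expr2 ler_pM2r// lt_neqAle eq_sym u0 hnorm_ge0.
Qed.

(** The equation [l u - A u = f] is the fixed point equation of
    [u |-> (l0 - A)^-1 (f + (l0 - l) u)], a contraction of ratio [|l - l0| K]. *)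
Lemma surj_extend (l0 l K : R) :
  (forall f, exists u v, A u v /\ l0%:C *: u - v = f) ->
  (forall u v, A u v -> hnorm u <= K * hnorm (l0%:C *: u - v)) ->
  0 <= K -> `|l - l0| * K < 1 ->
  forall f, exists u v, A u v /\ l%:C *: u - v = f.
Proof.
move=> sur bnd K0 lK f.
have /choice[S hS] : forall g, exists u, exists v, A u v /\ l0%:C *: u - v = g by [].
have SB g1 g2 : hnorm (S g1 - S g2) <= K * hnorm (g1 - g2).
  have [v1 [A1 e1]] := hS g1; have [v2 [A2 e2]] := hS g2.
  apply: le_trans (bnd _ _ (lgB lA A1 A2)) _.
  by rewrite -[in leRHS]e1 -[in leRHS]e2 le_eqVlt; apply/orP; left; apply/eqP;
    congr (_ * hnorm _); lmod.
pose F u := S (f + (l0 - l)%:C *: u).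
pose s n := iter n F 0.
have FB u w : hnorm (F u - F w) <= `|l - l0| * K * hnorm (u - w).
  apply: le_trans (SB _ _) _.
  rewrite (_ : _ - _ = (l0 - l)%:C *: (u - w)); last by lmod.
  by rewrite (hnormZR hX) distrC mulrCA mulrA.
have q01 : 0 <= `|l - l0| * K < 1 by rewrite mulr_ge0.
have [u hu] : exists u, hnorm (s m - u) @[m --> \oo] --> (0 : R).
  apply: (hcvg_geom (C := hnorm (s 1%N - s 0%N)) q01); elim=> [|n IH].
    by rewrite expr0 mulr1.
  apply: le_trans (FB _ _) _; apply: le_trans (ler_wpM2l (andP q01).1 IH) _.
  by rewrite exprS mulrCA.
have Fu : F u = u.
  apply: (hcvg_unique hX (s := fun m => s m.+1)).
    apply/(hcvg_eps (fun m => s m.+1) (F u)) => e e0.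
    have /hcvg_eps/(_ e e0)[n hn] := hu.
    exists n => m nm; apply: le_trans (FB _ _) _; apply: le_trans (hn m nm).
    by rewrite ler_piMl ?hnorm_ge0// ltW// (andP q01).2.
  apply/(hcvg_eps (fun m => s m.+1) u) => e e0.
  have /hcvg_eps/(_ e e0)[n hn] := hu.
  by exists n => m nm; apply: hn; exact: leqW.
have [v [Av ev]] := hS (f + (l0 - l)%:C *: u).
exists u, v; split; first by rewrite -{1}Fu.
have : l0%:C *: u - v = f + (l0 - l)%:C *: u by rewrite -ev -/(F u) Fu.
by move=> e; rewrite -[f](addrK ((l0 - l)%:C *: u)) -e; lmod.
Qed.

(** Surjectivity of [l - A] spreads from [l = 0] to all [l > 0]. The bound [K] gives a first small
    positive [l]; from there dissipativity bounds [(l - A)^-1] by [1 / l], so each step by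
    [surj_extend] reaches every value below [2 l]. *)
Lemma resolvent_exists (K : R) :
  (forall f, exists u, A u f) ->
  (forall u v, A u v -> hnorm u <= K * hnorm v) ->
  forall h, 0 < h -> exists J, resolvent A h J.
Proof.
move=> sur bnd.
have bnd' (l : R) u v : 0 < l -> A u v -> hnorm u <= l^-1 * hnorm (l%:C *: u - v).
  move=> l0 Auv; have li0 : 0 <= l^-1 by rewrite invr_ge0 ltW.
  have := dissipative_contr li0 Auv; rewrite -(hnormZp hX _ li0).
  move=> q; apply: le_trans q _.
  by rewrite le_eqVlt; apply/orP; left; apply/eqP; congr hnorm;
    lmod_field; rewrite gt_eqF.
pose sl (l : R) := forall f, exists u v, A u v /\ l%:C *: u - v = f.
have s0 : sl 0.
  move=> f; have [u Au] := sur (- f); exists u, (- f); split=> //.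
  by rewrite scale0r sub0r opprK.
(* Small enough that [2 l1 |K| < 1]; the induction then climbs along the multiples of [l1]. *)
pose l1 : R := (4 * (`|K| + 1))^-1.
have K0 := normr_ge0 K.
have l10 : 0 < l1 by rewrite invr_gt0; lra.
have s1 : sl (l1 * 2).
  apply: (surj_extend (K := `|K|) s0) => // [u v Auv|].
    apply: le_trans (bnd _ _ Auv) _; rewrite scale0r sub0r (hnormN hX).
    by rewrite ler_wpM2r ?hnorm_ge0// ler_norm.
  rewrite subr0 gtr0_norm ?mulr_gt0// (_ : _ * _ = 2 * `|K| / (4 * (`|K| + 1))).
    by rewrite ltr_pdivrMr; lra.
  by rewrite /l1; set z := _^-1; ring.
have sd (l0 l : R) : sl l0 -> 0 < l0 -> 0 < l < 2 * l0 -> sl l.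
  move=> hl l00 hl'; have li0 : 0 <= l0^-1 by rewrite invr_ge0 ltW.
  apply: (surj_extend hl _ li0) => [u v|]; first exact: bnd'.
  by rewrite ltr_pdivrMr// mul1r ltr_norml; lra.
have sn n : sl (l1 * n.+2%:R).
  elim: n => [//|n IH]; apply: sd IH _ _; first by rewrite mulr_gt0.
  rewrite mulr_gt0//= mulrCA ltr_pM2l// -natrM ltr_nat; lia.
have sall l : 0 < l -> sl l.
  move=> l0; have [n ln] : exists n, l < l1 * n.+2%:R.
    exists (Num.truncn (l / l1)); rewrite mulrC -ltr_pdivrMr//.
    by apply: lt_trans (truncnS_gt _) _; rewrite ltr_nat.
  by apply: sd (sn n) _ _; rewrite ?mulr_gt0//; lra.
move=> h h0; have hi0 : 0 < h^-1 by rewrite invr_gt0.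
have /choice[J hJ] : forall x, exists u, exists2 v, A u v & u - h%:C *: v = x.
  move=> x; have [u [v [Auv e]]] := sall _ hi0 ((h^-1)%:C *: x).
  exists u, v => //; rewrite -[RHS]scale1r -[1](realC_mulV (lt0r_neq0 h0)).
  by rewrite -scalerA -e; lmod_field; rewrite gt_eqF.
exists J; split=> // u v Auv; have [w Aw ew] := hJ (u - h%:C *: v).
apply: (hnorm_subr_le0 hX).
apply: le_trans (dissipative_contr (ltW h0) (lgB lA Aw Auv)) _.
rewrite (_ : _ - _ = (J (u - h%:C *: v) - h%:C *: w) - (u - h%:C *: v)); last by lmod.
by rewrite ew subrr (hnorm0 hX).
Qed.

Lemma resolvent_contr h J x : 0 <= h -> resolvent A h J -> hnorm (J x) <= hnorm x.
Proof.
move=> h0 hJ; have [v Av e] := hJ.1 x; rewrite -[in leRHS]e.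
exact: dissipative_contr.
Qed.

Lemma resolvent_iter_contr h J n x : 0 <= h -> resolvent A h J ->
  hnorm (iter n J x) <= hnorm x.
Proof.
move=> h0 hJ; elim: n => //= n IH; apply: le_trans IH; exact: resolvent_contr hJ.
Qed.

(* Summing the discrete energy identity along the orbit of the resolvent. *)
Lemma dissipation_sum (del h : R) (c x : X) J n : 0 <= del -> 0 <= h ->
  (forall u v, A u v -> del * normc (hip u c) ^+ 2 <= - Re (hip v u)) ->
  resolvent A h J ->
  2 * del * (h * \sum_(i < n) normc (hip (iter i.+1 J x) c) ^+ 2)
    + hnorm (iter n J x) ^+ 2 <= hnorm x ^+ 2.
Proof.
move=> del0 h0 hc hJ; elim: n => [|n IH].
  by rewrite big_ord0 mulr0 mulr0 add0r.
apply: le_trans IH; rewrite big_ord_recr/= !mulrDr -addrA lerD2l.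
set y := iter n J x; have [v Av e] := hJ.1 y; rewrite -[in leRHS]e.
have -> : hnorm (J y - h%:C *: v) ^+ 2 =
    hnorm (J y) ^+ 2 - 2 * h * Re (hip v (J y)) + h ^+ 2 * hnorm v ^+ 2.
  rewrite (ph_norm2 (hil_ph hX) (cX (J y - _))) ipBl// !ipBr// !ipZl// !ipZr// !ipxx//.
  rewrite (ip_herm hX v); case: (hip v (J y)) => a b; simpc; rewrite /=; ring.
have : 0 <= h ^+ 2 * hnorm v ^+ 2 by rewrite mulr_ge0// sqr_ge0.
have := ler_wpM2l h0 (hc _ _ Av).
set P := normc _ ^+ 2; set Q := Re _; set Z := _ * hnorm v ^+ 2; set W := hnorm _ ^+ 2.
clear; lra.
Qed.

End Resolvents.

(** * Polynomial decay of the backward Euler iterates *)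

(** From [- ln (1 - y) <= 2 y] for [y <= 1/2] the left side is at most [exp z] with
    [z = g x / (1 + g)], hence at most [1 / (1 - z)]; and [(1 - z)(1 + g x) = 1 + g^2 x (1 - x) / (1
    + g) >= 1]. It shows that a power with exponent [- g] is a supersolution in
    [resolvent_sg_decay]. *)
Lemma powR_step (R : realType) (g x : R) : 0 < g -> 0 <= x <= 1 ->
  (1 - x / (2 * (1 + g))) `^ (- g) <= 1 + g * x.
Proof.
move=> g0 /andP[x0 x1]; have g1 : 0 < 1 + g by lra.
set y := x / (2 * (1 + g)).
have y0 : 0 <= y by rewrite divr_ge0// mulr_ge0// ltW.
have y12 : y <= 1 / 2 by rewrite ler_pdivrMr ?mulr_gt0//; lra.
have y1 : 0 < 1 - y by lra.
rewrite /powR gt_eqF//.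
have lny : - ln (1 - y) <= 2 * y.
  rewrite -lnV ?posrE// -(expRK (2 * y)) ler_ln ?posrE ?invr_gt0 ?expR_gt0//.
  apply: le_trans (expR_ge1Dx _); rewrite -[leLHS]mul1r ler_pdivrMr//.
  by move: y0 y12; clear; nra.
have z1 : g * x / (1 + g) < 1 by rewrite ltr_pdivrMr//; move: x0 x1 g0; clear; nra.
apply: (@le_trans _ _ (expR (g * x / (1 + g)))).
  rewrite ler_expR mulNr -mulrN; apply: le_trans (ler_wpM2l (ltW g0) lny) _.
  by rewrite le_eqVlt; apply/orP; left; apply/eqP; rewrite /y; field; rewrite gt_eqF.
rewrite -[leLHS]invrK -expRN.
have l1 := expR_ge1Dx (- (g * x / (1 + g))).
have p1 : 0 < 1 - g * x / (1 + g) by lra.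
have p2 : 0 < 1 + g * x by rewrite ltr_wpDr// mulr_ge0// ltW.
rewrite -[leRHS]invrK lef_pV2 ?posrE ?expR_gt0 ?invr_gt0//.
apply: le_trans l1; rewrite -[leLHS]mul1r ler_pdivrMr//.
have -> : (1 - g * x / (1 + g)) * (1 + g * x) =
  1 + g ^+ 2 * (x * (1 - x)) / (1 + g) by field; rewrite gt_eqF.
by rewrite lerDl divr_ge0 ?mulr_ge0 ?sqr_ge0 ?subr_ge0// ltW.
Qed.

Section ResolventDecay.
Context {R : realType} {X : hspace R}.
Hypothesis hX : hilbert X.
Variables (T : R -> X -> X) (N : R).
Hypothesis hT : C0_semigroup T.
Hypothesis hN : forall (t : R) u, 0 <= t -> hnorm (T t u) <= N * hnorm u.
Variables (g D : R).
Hypotheses (g0 : 0 < g) (D0 : 0 <= D).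
Hypothesis dec : forall (s : R) u v, 0 <= s -> generator T u v ->
  hnorm (T s u) <= D * hnorm v * (1 + s) `^ (- g).
Implicit Types (u v : X) (h : R).
Let eta : R := (2 * (1 + g))^-1.
Let lA := gen_linear hX hT hN.

Let eta0 : 0 < eta.
Proof. by rewrite invr_gt0 mulr_gt0//; move: g0; lra. Qed.

(** One step [J] averages the semigroup over times of mean [h]; for polynomial decay this gains at
    least the fixed delay [eta h] with [eta = 1 / (2 (1 + g))]. Each induction step applies
    [resolvent_comparison] with [psit] the decay function and [psi] the same function shifted back
    by [eta h], their relation being [powR_step]. *)
Lemma resolvent_sg_decay h J n u v (s : R) : 0 < h <= 1 ->
  resolvent (generator T) h J -> generator T u v -> 0 <= s ->
  hnorm (T s (iter n J u)) <= D * hnorm v * (1 + s + n%:R * (eta * h)) `^ (- g).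
Proof.
move=> /andP[h0 h1] hJ Auv.
have D'0 : 0 <= D * hnorm v by rewrite mulr_ge0 ?hnorm_ge0.
elim: n s => [|n IH] s s0; first by rewrite mul0r addr0; exact: dec.
have An := resolvent_iter_gen lA n (lt0r_neq0 h0) hJ Auv.
have [w Aw ew] := hJ.1 (iter n J u).
have Asw := gen_sg hX hT hN s0 Aw.
have ehn : 0 < eta * h by rewrite mulr_gt0.
pose B (r : R) := 1 + s + n.+1%:R * (eta * h) + r.
have B1 r : 0 <= r -> 1 <= B r.
  by move=> r0; rewrite /B -!addrA lerDl !addr_ge0// mulr_ge0// ltW.
rewrite -[T s _]subr0 -[1 + s + _]addr0.
apply: (resolvent_comparison hX hT hN (psi := fun r => D * hnorm v * (B r - eta * h) `^ (- g))
  (psit := fun r => D * hnorm v * (B r) `^ (- g))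
  (dpsi := fun r => D * hnorm v * (- g * (B r) `^ (- g - 1))) h0 Asw).
- move=> r r0; rewrite subr0 -(sgZ hX hT hN _ _ s0) -(sgB hX hT hN _ _ s0) ew.
  rewrite -(sgA hX hT _ s0 r0); apply: le_trans (IH _ _) _; first exact: addr_ge0.
  rewrite le_eqVlt; apply/orP; left; apply/eqP; congr (_ * _ `^ _).
  by rewrite /B -(natr1 n) mulrDl mul1r; ring.
- move=> r r0; have Br : 0 < B r by apply: lt_le_trans (B1 r r0).
  have dB : is_derive r (1 : R) B 1.
    have q := is_deriveD (is_derive_cst (1 + s + n.+1%:R * (eta * h)) r (1 : R))
      (is_derive_id r (1 : R)).
    by apply: is_derive_eq q _; rewrite add0r.
  have := @is_derive1_comp _ (fun x : R => x `^ (- g)) B r _ _ (is_derive1_powR (- g) Br) dB.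
  move=> dc; have := is_deriveZ (D * hnorm v) dc => dz.
  by apply: is_derive_eq dz _; rewrite /GRing.scale/= mulr1.
- by move=> r r0; rewrite mulr_ge0// powR_ge0.
- move=> r r0; have Br := B1 r r0; have Bp : 0 < B r by apply: lt_le_trans Br.
  rewrite mulrCA -mulrBr ler_wpM2l//.
  have x01 : 0 <= h / B r <= 1.
    by rewrite divr_ge0 ?(ltW h0) ?(ltW Bp)//= ler_pdivrMr// mul1r; exact: le_trans h1 Br.
  have := powR_step g0 x01; have -> : h / B r / (2 * (1 + g)) = eta * h / B r.
    by rewrite mulrC /eta mulrA.
  move=> st; have -> : B r - eta * h = B r * (1 - eta * h / B r).
    by field; rewrite gt_eqF.
  have p1 : 0 <= 1 - eta * h / B r.
    rewrite subr_ge0 ler_pdivrMr// mul1r; apply: le_trans Br.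
    rewrite /eta mulrC ler_pdivrMr ?mulr_gt0//; move: g0 h1; lra.
  rewrite powRM ?(ltW Bp)//; apply: le_trans (ler_wpM2l (powR_ge0 _ _) st) _.
  rewrite (@powRD _ (B r) (- g) (- 1)) ?(gt_eqF Bp) ?implybT//.
  rewrite powR_inv1 ?(ltW Bp)//.
  by rewrite le_eqVlt; apply/orP; left; apply/eqP; ring.
Qed.

Lemma resolvent_decay h J n u v : 0 < h <= 1 ->
  resolvent (generator T) h J -> generator T u v ->
  hnorm (iter n J u) <= D * hnorm v * (1 + n%:R * (eta * h)) `^ (- g).
Proof.
move=> h01 hJ Auv; have := resolvent_sg_decay n h01 hJ Auv (lexx 0).
by rewrite (sgt0 hX hT) addr0.
Qed.

(** For [b] in the domain of the square, each half of the iterates contributes a factor of exponent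
    [- g]; the product has exponent [- 2 g <= - 1]. An odd leftover step is dropped by
    contractivity. *)
Lemma resolvent_decay2 h J n b b' b'' : 1 <= 2 * g -> 0 < h <= 1 ->
  resolvent (generator T) h J -> generator T b b' -> generator T b' b'' ->
  (forall x, hnorm (J x) <= hnorm x) ->
  hnorm (iter n J b) <= 2 * D ^+ 2 * hnorm b'' / (1 + n%:R * (eta / 2 * h)).
Proof.
move=> g12 h01 hJ Ab Ab' contr; have /andP[h0 h1] := h01.
have eta1 : eta <= 1 by rewrite invf_le1 ?mulr_gt0//; move: g0; lra.
have -> : n = (odd n + (n./2 + n./2))%N by rewrite addnn odd_double_half.
set m := n./2; rewrite iterD.
apply: (@le_trans _ _ (hnorm (iter (m + m) J b))).
  by case: (odd n) => /=.
have mh0 : 0 <= m%:R * (eta * h) by rewrite !mulr_ge0// ltW.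
have E0 : 0 < 1 + m%:R * (eta * h) by lra.
rewrite iterD; apply: le_trans
  (resolvent_decay m h01 hJ (resolvent_iter_gen lA m (lt0r_neq0 h0) hJ Ab)) _.
apply: (@le_trans _ _ (D ^+ 2 * hnorm b'' * ((1 + m%:R * (eta * h)) `^ (- g)) ^+ 2)).
  have := resolvent_decay m h01 hJ Ab'.
  have pw := powR_ge0 (1 + m%:R * (eta * h)) (- g).
  rewrite expr2 => q; rewrite mulrAC; apply: le_trans (ler_wpM2l (mulr_ge0 D0 pw) q) _.
  by rewrite le_eqVlt; apply/orP; left; apply/eqP; ring.
apply: (@le_trans _ _ (D ^+ 2 * hnorm b'' / (1 + m%:R * (eta * h)))).
  rewrite ler_wpM2l ?mulr_ge0 ?sqr_ge0 ?hnorm_ge0//.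
  rewrite -powR_mulrn ?powR_ge0// -powRrM -[leRHS]powR_inv1 ?(ltW E0)//.
  by apply: ler_powR; [rewrite lerDl|move: g12; lra].
set n' := (odd n + _)%N; set P := D ^+ 2 * hnorm b''.
have P0 : 0 <= P by rewrite mulr_ge0 ?sqr_ge0 ?hnorm_ge0.
have E1 : 0 < 1 + n'%:R * (eta / 2 * h).
  by rewrite ltr_wpDr// mulr_ge0// mulr_ge0 ?(ltW h0)// divr_ge0 ?(ltW eta0).
apply: (@le_trans _ _ (P * (2 / (1 + n'%:R * (eta / 2 * h))))); last first.
  by rewrite le_eqVlt; apply/orP; left; apply/eqP; rewrite /P; ring.
apply: ler_wpM2l => //; rewrite ler_pdivlMr// mulrC ler_pdivrMr//.
rewrite /n' natrD natrD {n' E1}.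
have o1 : (odd n)%:R <= 1 :> R by case: (odd n).
have eh1 : eta * h <= 1 by rewrite -[1]mulr1 ler_pM// ltW.
have eh0 : 0 < eta * h by rewrite mulr_gt0.
have : (odd n)%:R * (eta * h) <= 1 * (eta * h) by rewrite ler_pM2r.
have -> : eta / 2 * h = eta * h / 2 by ring.
move: mh0 eh1; lra.
Qed.

Lemma resolvent_cvg x (e : R) : 0 < e -> exists2 h0 : R, 0 < h0 &
  forall h J, 0 < h < h0 -> resolvent (generator T) h J -> hnorm (J x - x) <= e.
Proof.
move=> e0; have e2 : 0 < e / 2 by lra.
have [d d0 hd] := sg_cont hX hT x e2.
(* The slope for which the line [K s] exceeds the trivial bound of [T s x - x] once [s >= d]; below
   [d] strong continuity gives [e / 2]. *)
pose K : R := (`|N| + 1) * hnorm x / d.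
have K0 : 0 <= K by rewrite divr_ge0 ?mulr_ge0 ?hnorm_ge0 ?addr_ge0 ?(ltW d0).
exists (e / 2 / (K + 1)); first by rewrite divr_gt0//; lra.
move=> h J /andP[h0 hh] hJ; have [w Aw ew] := hJ.1 x.
have psit00 : e / 2 + K * h + 0 <= e.
  have : K * h <= e / 2; last by lra.
  move: hh; rewrite ltr_pdivlMr; last by lra.
  by move=> /ltW; apply: le_trans; rewrite mulrC ler_wpM2l ?(ltW h0)//; lra.
apply: le_trans psit00; rewrite -[0](mulr0 K).
apply: (resolvent_comparison hX hT hN (psi := fun r => e / 2 + K * r)
  (psit := fun r => e / 2 + K * h + K * r) (dpsi := fun=> K) h0 Aw).
- move=> s s0; rewrite ew; have [sd|ds] := ltP s d.
    have [->|sn] := eqVneq s 0; first by rewrite (sgt0 hX hT) subrr (hnorm0 hX) mulr0 addr0 ltW.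
    apply: le_trans (hd s _) _; first by rewrite sd lt_neqAle eq_sym sn s0.
    by rewrite lerDl mulr_ge0.
  apply: le_trans (hnormB hX _ _) _.
  apply: (@le_trans _ _ (K * d)).
    rewrite /K divfK ?gt_eqF// mulrDl mul1r lerD2r; apply: le_trans (hN _ s0) _.
    by rewrite ler_wpM2r ?hnorm_ge0// ler_norm.
  by apply: le_trans (ler_wpM2l K0 ds) _; rewrite lerDr ltW.
- move=> s s0; have := is_deriveD (is_derive_cst (e / 2 + K * h) s (1 : R))
    (is_deriveZ K (is_derive_id s (1 : R))).
  by move=> q; apply: is_derive_eq q _; rewrite add0r /GRing.scale/= mulr1.
- move=> s s0; apply: addr_ge0; last exact: mulr_ge0.
  by apply: addr_ge0; [exact: ltW|exact: mulr_ge0 K0 (ltW h0)].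
- by move=> s s0; rewrite le_eqVlt; apply/orP; left; apply/eqP; ring.
Qed.

End ResolventDecay.

(** * Roots of unity and the discrete Fourier transform *)

Section DiscreteFourier.
Variable R : realType.
Implicit Types (p q : nat -> R[i]).

Lemma primitive_root_exists n : (0 < n)%N ->
  exists w : R[i], n.-primitive_root w.
Proof.
move=> n0; have Xn0 : ('X^n - 1 : {poly R[i]}) != 0 by rewrite -size_poly_eq0 size_XnsubC.
have [r rE] := closed_field_poly_normal ('X^n - 1 : {poly R[i]}).
have lc : lead_coef ('X^n - 1 : {poly R[i]}) = 1 by exact: lead_coefXnsubC.
rewrite lc scale1r in rE.
have sr : size r = n.
  have := size_XnsubC (1 : R[i]) n0; rewrite rE size_prod_XsubC => -[]//.
have rn : all n.-unity_root r.
  by apply/allP => x xr; rewrite /root_of_unity rE root_prod_XsubC.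
have ru : uniq r.
  rewrite -separable.separable_prod_XsubC -rE cyclotomic.separable_Xn_sub_1//.
  by rewrite pnatr_eq0 -lt0n.
by have /hasP[w _ hw] := cyclic.has_prim_root n0 rn ru (eq_leq (esym sr)); exists w.
Qed.

Lemma unity_root_norm n (w : R[i]) : (0 < n)%N -> w ^+ n = 1 -> normc w = 1.
Proof.
move=> n0 wn; have : `|w| ^+ n = 1 by rewrite -normrX wn normr1.
move=> /eqP; rewrite pexpr_eq1 ?normr_ge0// => /eqP.
by rewrite normc_abs => -[].
Qed.

(* Parseval's identity for the discrete Fourier transform. *)
Lemma dft_parseval n (w : R[i]) p : (0 < n)%N -> n.-primitive_root w ->
  \sum_(l < n) normc (\sum_(j < n) (w ^+ l) ^+ j * p j) ^+ 2 =
  n%:R * \sum_(j < n) normc (p j) ^+ 2.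
Proof.
move=> n0 wp; apply: (@complexI R).
have wn : w ^+ n = 1 by exact: prim_expr_order.
have nw := unity_root_norm n0 wn.
have wJ : w * conjc w = 1 by rewrite normc_sqrC nw expr1n.
have wU : w \is a GRing.unit by rewrite unitfE; apply/eqP => w0; move: wJ; rewrite w0 mul0r => /eqP; rewrite eq_sym oner_eq0.
have wJE : conjc w = w^-1 by rewrite -[LHS]mul1r -(mulVr wU) -mulrA wJ mulr1.
rewrite rmorph_sum rmorphM rmorph_sum/= rmorph_nat.
under eq_bigr do rewrite -normc_sqrC rmorph_sum/= big_distrl/=.
under eq_bigr => l _.
  under eq_bigr => j _ do rewrite big_distrr/=.
  over.
under [in RHS]eq_bigr do rewrite -normc_sqrC.
rewrite exchange_big/= mulr_sumr; apply: eq_bigr => j _.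
rewrite exchange_big/= (bigD1 j)//= [X in _ + X]big1 ?addr0; last first.
  move=> i ij.
  have E (l : 'I_n) : (w ^+ l) ^+ j * p j * conjc ((w ^+ l) ^+ i * p i) =
      p j * conjc (p i) * (w ^+ j / w ^+ i) ^+ l.
    rewrite conjcM !conjcX wJE expr_div_n.
    by rewrite !exprVn (exprAC w l j) (exprAC w l i); ring.
  under eq_bigr => l _ do rewrite E.
  rewrite -mulr_sumr; set x := w ^+ j / w ^+ i.
  have x1 : x != 1.
    apply/negP => /eqP xe; have : w ^+ j = w ^+ i.
      by rewrite -[RHS]mul1r -xe /x divrK// unitrX.
    move/eqP; rewrite (eq_prim_root_expr wp) !modn_small// => /eqP e.
    by case/negP: ij; apply/eqP/val_inj; rewrite /= e.
  have xn : x ^+ n = 1 by rewrite /x expr_div_n ![(w ^+ _) ^+ n]exprAC wn !expr1n divr1.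
  have : (x - 1) * (\sum_(l < n) x ^+ l) = 0 by rewrite -subrX1 xn subrr.
  by move/eqP; rewrite mulf_eq0 subr_eq0 (negPf x1)/= => /eqP ->; rewrite mulr0.
rewrite -[n in n%:R](card_ord n) -sum1_card natr_sum mulr_suml.
apply: eq_bigr => l _; rewrite conjcM !conjcX wJE mul1r.
have U : (w ^+ l) ^+ j * (w^-1 ^+ l) ^+ j = 1.
  by rewrite -exprMn -exprMn mulrV// !expr1n.
by rewrite mulrACA U mul1r.
Qed.

End DiscreteFourier.

(** * Uniform smallness of the discrete transfer function *)

Section Multiplier.
Context {R : realType} {X : hspace R}.
Hypothesis hX : hilbert X.
Variable A : X -> set X.
Hypothesis lA : linear_graph A.
Variables (h eta D : R) (J : X -> X).
Hypotheses (h01 : 0 < h <= 1) (eta0 : 0 < eta) (D0 : 0 < D).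
Hypothesis hJ : resolvent A h J.
Hypothesis contr : forall x, hnorm (J x) <= hnorm x.
(** The rate [n^(-1/2)], the slowest one that occurs, corresponding to [alpha = 2]. *)
Hypothesis dec : forall n u v, A u v ->
  hnorm (iter n J u) ^+ 2 * (1 + n%:R * (eta * h)) <= (D * hnorm v) ^+ 2.
Implicit Types (u v w b : X) (mu : R[i]).

Let h0 : 0 < h. Proof. by case/andP: h01. Qed.
Let h1 : h <= 1. Proof. by case/andP: h01. Qed.

(* With [z = 1 - h mu] one has [w = z J w + h J (mu w - v)]. *)
Lemma apriori_iter mu w v n : normc (1 - h%:C * mu) <= 1 -> A w v ->
  hnorm w <= hnorm (iter n J w) + n%:R * h * hnorm (mu *: w - v).
Proof.
move=> z1 Awv; set y := mu *: w - v.
have E : w = (1 - h%:C * mu) *: J w + h%:C *: J y.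
  rewrite -{1}(hJ.2 _ _ Awv) (_ : w - _ = (1 - h%:C * mu) *: w + h%:C *: y).
    by rewrite (resolventP lA _ _ _ hJ) (resolventZ lA _ _ hJ).
  by rewrite /y; lmod.
have Cn k x : hnorm (iter k J x) <= hnorm x.
  by elim: k => //= k; apply: le_trans; exact: contr.
elim: n => [|n IH]; first by rewrite !mul0r addr0.
apply: le_trans IH _; rewrite -natr1 !mulrDl mul1r addrA [leRHS]addrAC lerD2r.
rewrite {1}E.
have -> : iter n J ((1 - h%:C * mu) *: J w + h%:C *: J y) =
    (1 - h%:C * mu) *: iter n.+1 J w + h%:C *: iter n.+1 J y.
  rewrite (resolvent_iterP lA _ _ _ _ hJ) -iterSr.
  have := resolvent_iterP lA n h%:C (J y) 0 hJ; rewrite addr0 => ->.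
  have J00 : iter n J 0 = 0 by elim: n => //= n' ->; rewrite (resolvent0 lA hJ).
  by rewrite J00 addr0 -iterSr.
apply: le_trans (hnormD hX _ _) _; apply: lerD.
  by rewrite (hnormZ hX) ler_piMl ?hnorm_ge0.
by rewrite (hnormZp hX) ?(ltW h0)// ler_pM2l.
Qed.

Let K1 : R := 3 + 8 * D ^+ 2 / eta.

(** Run [n] Euler steps, with [n h] of order [(1 + |mu|)^2]. The decay hypothesis makes [J^n w] at
    most [|v| / (2 (1 + |mu|))], and since [v] is [mu w] up to the residual, this is at most half of
    [|w|] plus half of the residual, which is absorbed. The [n] steps cost [n h] times the residual
    by [apriori_iter]. *)
Lemma apriori mu w v : normc (1 - h%:C * mu) <= 1 -> A w v ->
  hnorm w <= K1 * (1 + normc mu) ^+ 2 * hnorm (mu *: w - v).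
Proof.
move=> z1 Awv; set y := hnorm (mu *: w - v); set m := normc mu.
have m0 : 0 <= m by exact: normc_ge0.
(* With [n eta h >= Q] the decay bound becomes [|J^n w| <= |v| / (2 (1 + m))]. *)
pose Q := 4 * D ^+ 2 * (1 + m) ^+ 2.
have D20 : 0 < D ^+ 2 by rewrite exprn_gt0.
have m12 : 0 < (1 + m) ^+ 2 by apply: exprn_gt0; lra.
have Q0 : 0 < Q by rewrite /Q mulr_gt0// mulr_gt0.
have eh0 : 0 < eta * h by rewrite mulr_gt0.
pose n := (Num.truncn (Q / (eta * h))).+1.
have nQ : Q <= n%:R * (eta * h) by rewrite -ler_pdivrMr// ltW// truncnS_gt.
have nh : n%:R * h <= Q / eta + 1.
  have : n%:R <= Q / (eta * h) + 1.
    by rewrite /n -natr1 lerD2r truncn_le// divr_ge0// ltW.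
  move=> q; apply: le_trans (ler_wpM2r (ltW h0) q) _.
  rewrite mulrDl mul1r; apply: lerD => //.
  by rewrite le_eqVlt; apply/orP; left; apply/eqP; field; rewrite !gt_eqF.
have hw := apriori_iter n z1 Awv; rewrite -/y in hw.
set x := hnorm (iter n J w) in hw.
have x0 : 0 <= x by exact: hnorm_ge0.
have y0 : 0 <= y by exact: hnorm_ge0.
have w0 := hnorm_ge0 w.
have vle : hnorm v <= m * hnorm w + y.
  have := hnormB hX (mu *: w) (mu *: w - v); rewrite (hnormZ hX).
  by rewrite opprB addrCA subrr addr0.
have xv : x * (2 * (1 + m)) <= hnorm v.
  rewrite -(@ler_pXn2r _ 2)// ?nnegrE ?mulr_ge0 ?hnorm_ge0//; last by lra.
  have := dec n Awv; rewrite -/x exprMn => dn.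
  rewrite -(ler_pM2l D20); apply: le_trans dn.
  have : x ^+ 2 * Q <= x ^+ 2 * (1 + n%:R * (eta * h)).
    by rewrite ler_wpM2l ?sqr_ge0//; lra.
  by apply: le_trans; rewrite /Q le_eqVlt; apply/orP; left; apply/eqP; ring.
have xle : x <= (hnorm w + y) / 2.
  have p : 0 < 2 * (1 + m) by lra.
  rewrite -(ler_pM2r p); apply: le_trans xv _; apply: le_trans vle _.
  by move: m0 w0 y0; nra.
have hwy : hnorm w <= (1 + 2 * (Q / eta + 1)) * y.
  have : n%:R * h * y <= (Q / eta + 1) * y by rewrite ler_wpM2r.
  by move: xle hw; lra.
apply: le_trans hwy _; rewrite ler_wpM2r//.
have -> : Q / eta = 4 * D ^+ 2 / eta * (1 + m) ^+ 2 by rewrite /Q; ring.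
rewrite /K1; have : 1 <= (1 + m) ^+ 2 by move: m0; nra.
set z := (1 + m) ^+ 2; have -> : 8 * D ^+ 2 / eta = 2 * (4 * D ^+ 2 / eta) by ring.
by lra.
Qed.

Variables (b b' b'' : X).
Hypotheses (Ab : A b b') (Ab' : A b' b'').
Let eps : R := hnorm b + hnorm b' + hnorm b''.
(** The 4 bounds [(1 + |mu|)^2] when [|mu| <= 1] and [(1 + |mu|)^2 / |mu|^2] when [|mu| > 1]; the 1
    pays for the two subtracted terms. *)
Let K2 : R := 4 * K1 + 1.

Let K10 : 0 < K1.
Proof.
have : 0 < 8 * D ^+ 2 / eta by rewrite divr_gt0// mulr_gt0// exprn_gt0.
by rewrite /K1; lra.
Qed.

(* Subtracting [b / mu + b' / mu^2] trades [b] for [b'' / mu^2]. *)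
Lemma apriori_smooth mu (beta : R[i]) w v r : normc (1 - h%:C * mu) <= 1 ->
  A w v -> mu *: w - v = beta *: b + r ->
  hnorm w <= K2 * eps * normc beta + K1 * (1 + normc mu) ^+ 2 * hnorm r.
Proof.
move=> z1 Awv E; have m0 := normc_ge0 mu; have B0 := normc_ge0 beta.
have [nb nb' nb''] : [/\ 0 <= hnorm b, 0 <= hnorm b' & 0 <= hnorm b''].
  by split; exact: hnorm_ge0.
have r0 := hnorm_ge0 r.
have [m1|m1] := leP (normc mu) 1.
  apply: le_trans (apriori z1 Awv) _; rewrite E.
  apply: (@le_trans _ _ (K1 * (1 + normc mu) ^+ 2 * (normc beta * hnorm b + hnorm r))).
    apply: ler_wpM2l; first by rewrite mulr_ge0 ?sqr_ge0 ?(ltW K10).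
    by apply: le_trans (hnormD hX _ _) _; rewrite (hnormZ hX).
  rewrite mulrDr lerD2r.
  apply: (@le_trans _ _ (K1 * 4 * (normc beta * hnorm b))).
    rewrite ler_wpM2r ?mulr_ge0// ler_pM2l//; move: m0 m1; nra.
  rewrite mulrA mulrAC; apply: ler_wpM2r => //; apply: ler_pM => //.
  - by rewrite mulr_ge0// ltW.
  - by rewrite /K2; lra.
  - by rewrite /eps; lra.
have mu0 : mu != 0.
  by apply/eqP => mu0; move: m1; rewrite mu0 Normc.normc0 ltr10.
pose w' := w - (beta / mu) *: b - (beta / mu ^+ 2) *: b'.
pose v' := v - (beta / mu) *: b' - (beta / mu ^+ 2) *: b''.
have Aw' : A w' v' by do 2?[apply: lgB => //]; exact: lgZ.
have E' : mu *: w' - v' = r + (beta / mu ^+ 2) *: b''.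
  have -> : r = mu *: w - v - beta *: b by rewrite E addrC addKr.
  by rewrite /w' /v'; lmod_coefs; field; rewrite ?mu0.
have mp : 0 < normc mu by apply: lt_trans m1.
have nb2 : normc (beta / mu ^+ 2) = normc beta / normc mu ^+ 2.
  by rewrite Normc.normcM Normc.normcV expr2 Normc.normcM -expr2.
have nb1 : normc (beta / mu) <= normc beta.
  by rewrite Normc.normcM Normc.normcV ler_piMr// invf_le1// ltW.
have hw' : hnorm w' <= K1 * (1 + normc mu) ^+ 2 * hnorm r + 4 * K1 * normc beta * hnorm b''.
  apply: le_trans (apriori z1 Aw') _; rewrite E'.
  apply: (@le_trans _ _ (K1 * (1 + normc mu) ^+ 2 *
      (hnorm r + normc beta / normc mu ^+ 2 * hnorm b''))).
    apply: ler_wpM2l; first by rewrite mulr_ge0 ?sqr_ge0 ?(ltW K10).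
    by apply: le_trans (hnormD hX _ _) _; rewrite (hnormZ hX) nb2.
  rewrite mulrDr lerD2l mulrA; apply: ler_wpM2r => //.
  rewrite -mulrA [4 * _]mulrC -[K1 * 4 * _]mulrA ler_pM2l// mulrCA [4 * _]mulrC.
  apply: ler_wpM2l => //; rewrite ler_pdivrMr ?exprn_gt0//.
  by move: m1; nra.
have ww' : hnorm w <= hnorm w' + normc beta * (hnorm b + hnorm b').
  have -> : w = w' + ((beta / mu) *: b + (beta / mu ^+ 2) *: b').
    by rewrite /w'; lmod.
  apply: le_trans (hnormD hX _ _) _; rewrite lerD2l.
  apply: le_trans (hnormD hX _ _) _; rewrite !(hnormZ hX) mulrDr.
  apply: lerD; rewrite ler_wpM2r// nb2 ler_piMr// invf_le1 ?exprn_gt0//.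
  by rewrite exprn_ege1// ltW.
apply: le_trans ww' _; apply: le_trans (lerD hw' (lexx _)) _.
rewrite -addrA addrC lerD2r /K2 /eps.
set B := normc beta in B0 *; have K10' := ltW K10.
have q1 : 0 <= K1 * B * (hnorm b + hnorm b').
  by apply: mulr_ge0; [exact: mulr_ge0|exact: addr_ge0].
have q2 : 0 <= B * hnorm b'' by exact: mulr_ge0.
by move: q1 q2; lra.
Qed.

(* The point [h s^2 + i s] satisfies the hypothesis of [apriori_smooth]. *)
Lemma apriori_imaginary (s : R) w v : h * `|s| <= 1 ->
  K1 * (1 + 2 * `|s|) ^+ 2 * (h * s ^+ 2) <= 2^-1 ->
  A w v -> (0 +i* s) *: w - v = b -> hnorm w <= 2 * K2 * eps.
Proof.
move=> hs hs2 Awv E; set x := h * s ^+ 2 in hs2.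
have x0 : 0 <= x by rewrite mulr_ge0 ?sqr_ge0// ltW.
have sn := normr_ge0 s.
have s2 : s ^+ 2 = `|s| ^+ 2 by rewrite real_normK ?num_real.
have xs : x <= `|s|.
  by rewrite /x s2 expr2 mulrA -[leRHS]mul1r ler_wpM2r.
have z1 : normc (1 - h%:C * (x +i* s)) <= 1.
  have -> : 1 - h%:C * (x +i* s) = (1 - h * x) +i* (- (h * s)).
    by apply/eqP; rewrite eq_complex/=; apply/andP; split; apply/eqP; ring.
  rewrite -[leRHS]sqrtr1 ler_wsqrtr// sqrrN -subr_ge0.
  have -> : 1 - ((1 - h * x) ^+ 2 + (h * s) ^+ 2) = h * x * (1 - (h * `|s|) ^+ 2).
    by rewrite /x !exprMn -s2; ring.
  apply: mulr_ge0; first by rewrite mulr_ge0 ?(ltW h0).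
  by rewrite subr_ge0 expr_le1// mulr_ge0// ltW.
have nmu : normc (x +i* s) <= 2 * `|s|.
  rewrite /= -(ger0_norm (_ : 0 <= 2 * `|s|)) ?mulr_ge0// -sqrtr_sqr ler_wsqrtr//.
  by rewrite s2; move: x0 xs sn; nra.
have E' : (x +i* s) *: w - v = 1 *: b + x%:C *: w.
  rewrite -E; have -> : (x +i* s) = x%:C + (0 +i* s) by simpc.
  by lmod.
have := apriori_smooth z1 Awv E'; rewrite Normc.normc1 mulr1 (hnormZp hX)//.
have K10' := ltW K10.
have le2 : K1 * (1 + normc (x +i* s)) ^+ 2 * x <= 2^-1.
  apply: le_trans hs2; apply: ler_wpM2r => //; apply: ler_wpM2l => //.
  by rewrite ler_pXn2r ?nnegrE ?lerD2l ?addr_ge0 ?normc_ge0 ?mulr_ge0.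
have := ler_wpM2r (hnorm_ge0 w) le2; rewrite -!mulrA; lra.
Qed.

Variable c : X.

(** The backward Euler solution of [y' = A y + f b] with [y = 0] at time 0. *)
Fixpoint response (f : nat -> R[i]) (n : nat) : X :=
  if n is m.+1 then J (response f m + (h%:C * f m) *: b) else 0.

Lemma response_graph f n : exists2 v, A (response f n.+1) v &
  response f n.+1 - h%:C *: v = response f n + (h%:C * f n) *: b.
Proof. exact: (hJ.1 _). Qed.

Lemma response_dom f n : exists v, A (response f n) v.
Proof.
case: n => [|n]; first by exists 0; exact: lA.1.
by have [v Av _] := response_graph f n; exists v.
Qed.

Lemma response_tail f L k : (forall n, (L <= n)%N -> f n = 0) ->
  response f (L + k)%N = iter k J (response f L).
Proof.
move=> f0; elim: k => [|k IH]; first by rewrite addn0.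
by rewrite addnS /= IH f0 ?leq_addr// mulr0 scale0r addr0.
Qed.

(** Once the input has stopped, the response follows the free iterates, which decay. This provides a
    period after which wrap-around in the Fourier transform is negligible. *)
Lemma response_small f L d : 0 < d -> (forall n, (L <= n)%N -> f n = 0) ->
  exists2 n, (L < n)%N & hnorm (response f n) <= d.
Proof.
move=> d0 f0; have [v Av] := response_dom f L.
have eh0 : 0 < eta * h by rewrite mulr_gt0.
set Q := (D * hnorm v) ^+ 2 / d ^+ 2.
have Q0 : 0 <= Q by rewrite divr_ge0 ?sqr_ge0.
pose k := (Num.truncn (Q / (eta * h))).+1.
have kQ : Q <= k%:R * (eta * h) by rewrite -ler_pdivrMr// ltW// truncnS_gt.
exists (L + k)%N; first by rewrite -{1}[L]addn0 ltn_add2l.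
rewrite response_tail// -(@ler_pXn2r _ 2)// ?nnegrE ?hnorm_ge0 ?(ltW d0)//.
have := dec k Av; set x := hnorm _ ^+ 2.
have x0 : 0 <= x by exact: sqr_ge0.
have d20 : 0 < d ^+ 2 by rewrite exprn_gt0.
have -> : (D * hnorm v) ^+ 2 = Q * d ^+ 2 by rewrite /Q divfK// gt_eqF.
have Q10 : 0 < 1 + k%:R * (eta * h) by lra.
move=> q; rewrite -(ler_pM2r Q10); apply: le_trans q _.
by rewrite mulrC ler_pM2l//; lra.
Qed.

(** Cut the input at [L], let the response die out until a time [N], and take the discrete Fourier
    transform of period [N]. At a root of unity [x], the transform [Z] satisfies
    [(mu - A) Z = G b - z_N / h] with [mu = (1 - x) / h], where [G] is the transform of the input
    and [|1 - h mu| = |x| = 1]. So [apriori_smooth] bounds [Z] by [K2 eps |G|] up to a small error,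
    and Parseval's identity returns to sums over time. The factor 2 comes from splitting off the
    error in the square. *)
Lemma multiplier f L :
  \sum_(n < L) normc (hip (response f n.+1) c) ^+ 2 <=
  2 * (K2 * eps * hnorm c) ^+ 2 * \sum_(n < L) normc (f n) ^+ 2.
Proof.
pose g n := if (n < L)%N then f n else 0.
have fg n : (n <= L)%N -> response f n = response g n.
  by elim: n => //= n IH nL; rewrite IH ?(ltnW nL)// /g nL.
have g0 n : (L <= n)%N -> g n = 0 by rewrite /g ltnNge => ->.
have -> : \sum_(n < L) normc (f n) ^+ 2 = \sum_(n < L) normc (g n) ^+ 2.
  by apply: eq_bigr => i _; rewrite /g ltn_ord.
have -> : \sum_(n < L) normc (hip (response f n.+1) c) ^+ 2 =
    \sum_(n < L) normc (hip (response g n.+1) c) ^+ 2.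
  by apply: eq_bigr => i _; rewrite fg.
(* Cost of the wrap-around term [z_N / h], using [|mu| <= 2 / h]. It depends on [h], which is
   harmless: [z_N] is made small afterwards. *)
pose Kh : R := K1 * (1 + 2 / h) ^+ 2 / h.
have Kh0 : 0 <= Kh.
  by rewrite divr_ge0 ?(ltW h0)// mulr_ge0 ?sqr_ge0// ltW.
have K20 : 0 <= K2 by rewrite /K2; have := K10; lra.
have eps0 : 0 <= eps by rewrite !addr_ge0 ?hnorm_ge0.
have c0 := hnorm_ge0 c.
apply/ler_addgt0Pr => e e0.
(* A size of [z_N] for which its contribution to each frequency is at most [e]. *)
have d0 : 0 < e / (1 + 2 * (hnorm c * Kh) ^+ 2).
  by rewrite divr_gt0//; have := sqr_ge0 (hnorm c * Kh); lra.
have d1 : 0 < Num.min 1 (e / (1 + 2 * (hnorm c * Kh) ^+ 2)) by rewrite lt_min ltr01.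
set d := Num.min 1 _ in d1.
have [N LN zN] := response_small d1 g0; set z := response g in zN *.
have N0 : (0 < N)%N by apply: leq_ltn_trans LN.
have [w wp] := primitive_root_exists R N0.
have /choice[V hV] : forall n, exists v, A (z n.+1) v /\
    z n.+1 - h%:C *: v = z n + (h%:C * g n) *: b.
  by move=> n; have [v] := response_graph g n; exists v.
pose Z (l : nat) := \sum_(n < N) (w ^+ l) ^+ n *: z n.+1.
pose G (l : nat) := \sum_(n < N) (w ^+ l) ^+ n * g n.
have nw l : normc (w ^+ l) = 1.
  by apply: (unity_root_norm N0); rewrite exprAC (prim_expr_order wp) expr1n.
have Zb (l : nat) : hnorm (Z l) <= K2 * eps * normc (G l) + Kh * d.
  set x := w ^+ l; pose W := \sum_(n < N) x ^+ n *: V n.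
  have AZ : A (Z l) W.
    by apply: lg_sum => // i; apply: lgZ => //; have [] := hV i.
  have xN : x ^+ N = 1 by rewrite /x exprAC (prim_expr_order wp) expr1n.
  (* Summation by parts: shifting the index multiplies by [x], and the boundary terms are [z 0 = 0]
     and [x^N z N = z N]. *)
  have S1 : Z l - h%:C *: W = x *: Z l - z N + (h%:C * G l) *: b.
    have -> : (h%:C * G l) *: b = \sum_(n < N) x ^+ n *: ((h%:C * g n) *: b).
      rewrite mulr_sumr scaler_suml; apply: eq_bigr => i _.
      by rewrite scalerA; congr (_ *: _); rewrite -/x; ring.
    have -> : x *: Z l - z N = \sum_(n < N) x ^+ n *: z n.
      have -> : x *: Z l = \sum_(n < N) x ^+ n.+1 *: z n.+1.
        by rewrite scaler_sumr; apply: eq_bigr => i _; rewrite scalerA -exprS.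
      have : \sum_(n < N.+1) x ^+ n *: z n = \sum_(n < N) x ^+ n.+1 *: z n.+1.
        by rewrite big_ord_recl/= /bump/= scaler0 add0r.
      by rewrite big_ord_recr/= xN scale1r => <-; rewrite addrK.
    rewrite -big_split/= scaler_sumr -sumrB; apply: eq_bigr => i _.
    have [_ e1] := hV i; rewrite -scalerDr -e1 scalerBr !scalerA.
    by congr (_ - _ *: _); rewrite mulrC.
  pose mu := (h^-1)%:C * (1 - x).
  have hC : h%:C != 0 by rewrite fmorph_eq0 gt_eqF.
  have z1 : normc (1 - h%:C * mu) <= 1.
    by rewrite /mu mulrA realC_mulV ?gt_eqF// mul1r opprB addrCA subrr addr0 nw.
  have E : mu *: Z l - W = G l *: b + (- h^-1)%:C *: z N.
    have : W = (h^-1)%:C *: (Z l - (x *: Z l - z N + (h%:C * G l) *: b)).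
      by rewrite -S1; lmod_field; rewrite gt_eqF.
    by move=> ->; rewrite /mu; lmod_field; rewrite gt_eqF.
  apply: le_trans (apriori_smooth z1 AZ E) _; rewrite lerD2l (hnormZR hX).
  rewrite normrN gtr0_norm ?invr_gt0// -[K1 * _ * _]mulrA.
  have -> : Kh * d = K1 * ((1 + 2 / h) ^+ 2 * (h^-1 * d)) by rewrite /Kh; ring.
  apply: ler_wpM2l; first exact: ltW K10.
  have nmu : normc mu <= 2 / h.
    rewrite /mu Normc.normcM normcR gtr0_norm ?invr_gt0// mulrC ler_pM2r ?invr_gt0//.
    by apply: le_trans (le_normcD _ _) _; rewrite normcN nw Normc.normc1.
  apply: ler_pM; [exact: sqr_ge0| |..].
  - by rewrite mulr_ge0 ?hnorm_ge0// invr_ge0 ltW.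
  - rewrite ler_pXn2r ?nnegrE ?lerD2l// addr_ge0 ?normc_ge0//.
    by rewrite divr_ge0// ltW.
  - by rewrite ler_pM2l ?invr_gt0.
have NR : 0 < N%:R :> R by rewrite ltr0n.
have PZ := dft_parseval (fun n => hip (z n.+1) c) N0 wp.
have PG := dft_parseval g N0 wp.
have lhs : \sum_(n < L) normc (hip (z n.+1) c) ^+ 2 <=
    \sum_(n < N) normc (hip (z n.+1) c) ^+ 2.
  rewrite (big_ord_widen N (fun n => normc (hip (z n.+1) c) ^+ 2) (ltnW LN)).
  by rewrite [leRHS](bigID (fun i : 'I_N => (i < L)%N))/= lerDl sumr_ge0// => i _; exact: sqr_ge0.
have rhs : \sum_(n < L) normc (g n) ^+ 2 = \sum_(n < N) normc (g n) ^+ 2.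
  rewrite (big_ord_widen N (fun n => normc (g n) ^+ 2) (ltnW LN)).
  rewrite [RHS](bigID (fun i : 'I_N => (i < L)%N))/= [X in _ = _ + X]big1 ?addr0//.
  by move=> i; rewrite -leqNgt => Li; rewrite g0// Normc.normc0 expr0n.
apply: le_trans lhs _; rewrite rhs -(ler_pM2l NR) -PZ.
apply: (@le_trans _ _ (\sum_(l < N) (2 * (K2 * eps * hnorm c) ^+ 2 * normc (G l) ^+ 2 + e))).
  apply: ler_sum => l _.
  have -> : \sum_(j < N) (w ^+ l) ^+ j * hip (z j.+1) c = hip (Z l) c.
    by rewrite ip_suml//; apply: eq_bigr => i _; rewrite ipZl.
  have cs := CS hX (Z l) c; have n0 := normc_ge0 (hip (Z l) c).
  have zb := Zb l; have G0 := normc_ge0 (G l).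
  apply: (@le_trans _ _ (((K2 * eps * normc (G l) + Kh * d) * hnorm c) ^+ 2)).
    have B0 : 0 <= K2 * eps * normc (G l) + Kh * d.
      by apply: addr_ge0; apply: mulr_ge0 => //; [exact: mulr_ge0|exact: ltW].
    rewrite ler_pXn2r ?nnegrE//; last exact: mulr_ge0.
    by apply: le_trans cs _; apply: ler_wpM2r.
  have dd : 2 * (hnorm c * Kh) ^+ 2 * d ^+ 2 <= e.
    have q0 := sqr_ge0 (hnorm c * Kh).
    have dle1 : d <= 1 by rewrite /d ge_min lexx.
    have dle2 : d <= e / (1 + 2 * (hnorm c * Kh) ^+ 2) by rewrite /d ge_min lexx orbT.
    apply: (@le_trans _ _ ((1 + 2 * (hnorm c * Kh) ^+ 2) * d)).
      have dd : d ^+ 2 <= d by rewrite expr2 ger_pMl.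
      have := ler_wpM2l q0 dd; have := ltW d1; lra.
    by rewrite mulrC -ler_pdivlMr//; lra.
  apply: le_trans _ (lerD (lexx _) dd).
  rewrite -subr_ge0.
  set P := K2 * eps; set Q := normc (G l); set C := hnorm c; set E := Kh.
  have -> : 2 * (P * C) ^+ 2 * Q ^+ 2 + 2 * (C * E) ^+ 2 * d ^+ 2 -
    ((P * Q + E * d) * C) ^+ 2 = (P * Q * C - E * d * C) ^+ 2 by ring.
  exact: sqr_ge0.
rewrite big_split/= -mulr_sumr PG sumr_const card_ord -[e *+ N]mulr_natl.
by rewrite le_eqVlt; apply/orP; left; apply/eqP; ring.
Qed.

End Multiplier.

(** * Elementary sums and logarithms *)

Section RealSums.
Variable R : realType.

Lemma sqrD_le (p q : R) : (p + q) ^+ 2 <= 2 * p ^+ 2 + 2 * q ^+ 2.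
Proof.
rewrite -subr_ge0 (_ : _ - _ = (p - q) ^+ 2) ?sqr_ge0//; ring.
Qed.

Lemma sum_CS n (x y : 'I_n -> R) :
  (\sum_i x i * y i) ^+ 2 <= (\sum_i x i ^+ 2) * (\sum_i y i ^+ 2).
Proof.
have : 0 <= \sum_i \sum_j (x i * y j - x j * y i) ^+ 2.
  by apply: sumr_ge0 => i _; apply: sumr_ge0 => j _; exact: sqr_ge0.
have -> : \sum_i \sum_j (x i * y j - x j * y i) ^+ 2 =
    2 * ((\sum_i x i ^+ 2) * (\sum_i y i ^+ 2) - (\sum_i x i * y i) ^+ 2).
  under eq_bigr => i _.
    under eq_bigr => j _.
      rewrite (_ : (_ - _) ^+ 2 = x i ^+ 2 * y j ^+ 2 + (- (2 * (x i * y i)) * (x j * y j)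
        + y i ^+ 2 * x j ^+ 2)); last by ring.
      over.
    rewrite big_split/= big_split/= -!mulr_sumr.
    over.
  rewrite !big_split/= -!mulr_suml sumrN -mulr_sumr; ring.
by rewrite pmulr_rge0// subr_ge0.
Qed.

(* Telescoping: [1/(1+y-z) - 1/(1+y) >= z / (1+y)^2]. *)
Lemma sum_inv_sqr (z : R) n : 0 < z ->
  \sum_(j < n) z * ((1 + j.+1%:R * z)^-1) ^+ 2 <= 1 - (1 + n%:R * z)^-1.
Proof.
move=> z0; elim: n => [|n IH]; first by rewrite big_ord0 mul0r addr0 invr1 subrr.
rewrite big_ord_recr/=; apply: le_trans (lerD IH (lexx _)) _.
have p : 0 < 1 + n%:R * z by rewrite ltr_wpDr// mulr_ge0// ltW.
rewrite -natr1 mulrDl mul1r addrA; set y := 1 + _ in p *.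
have q : 0 < y + z by rewrite addr_gt0.
rewrite -subr_ge0.
have -> : 1 - (y + z)^-1 - (1 - y^-1 + z * (y + z)^-1 ^+ 2) = z ^+ 2 / (y * (y + z) ^+ 2).
  by field; rewrite !gt_eqF.
by rewrite divr_ge0 ?sqr_ge0// mulr_ge0 ?sqr_ge0// ltW.
Qed.

(** Each term is at most the corresponding increment of the logarithm, by [ln (1 - x) <= - x]. *)
Lemma sum_inv (z : R) n : 0 < z ->
  \sum_(j < n) z / (1 + j.+1%:R * z) <= ln (1 + n%:R * z).
Proof.
move=> z0; elim: n => [|n IH]; first by rewrite big_ord0 mul0r addr0 ln1.
rewrite big_ord_recr/=; apply: le_trans (lerD IH (lexx _)) _.
have p : 0 < 1 + n%:R * z by rewrite ltr_wpDr// mulr_ge0// ltW.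
rewrite -natr1 mulrDl mul1r addrA; set y := 1 + _ in p *.
have q : 0 < y + z by rewrite addr_gt0.
have hx : -1 < - (z / (y + z)) by rewrite ltrN2 ltr_pdivrMr// mul1r ltrDr.
have := le_ln1Dx hx.
rewrite (_ : 1 + - (z / (y + z)) = y / (y + z)); last by field; rewrite gt_eqF.
rewrite ln_div ?posrE//; lra.
Qed.

(** With [s = y^(1/4)] one has [ln y = 4 ln s <= 4 s]. An exponent below 1 on the right is what
    [small_coef] relies on. *)
Lemma ln_sqr_le (y : R) : 1 <= y -> ln y ^+ 2 <= 16 * Num.sqrt y.
Proof.
move=> y1; set t := Num.sqrt y; set s := Num.sqrt t.
have y0 : 0 < y by lra.
have t0 : 0 < t by rewrite sqrtr_gt0.
have s0 : 0 < s by rewrite sqrtr_gt0.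
have ts : s ^+ 2 = t by rewrite sqr_sqrtr// ltW.
have yE : y = s ^+ 4 by rewrite (exprM _ 2 2) ts sqr_sqrtr// ltW.
have ly : ln y <= 4 * s.
  rewrite yE lnXn// -[ln s *+ 4]mulr_natl ler_pM2l//.
  by have := @expR_ge1Dx _ (ln s); rewrite lnK ?posrE//; lra.
have l0 : 0 <= ln y by exact: ln_ge0.
apply: (@le_trans _ _ ((4 * s) ^+ 2)).
  by rewrite ler_pXn2r ?nnegrE// mulr_ge0// ltW.
by rewrite exprMn ts le_eqVlt; apply/orP; left; apply/eqP; ring.
Qed.

End RealSums.

(** * Rank-one perturbation: resolvent, feedback signal and boundedness *)

Definition perturbed (R : realType) (X : hspace R) (A : X -> set X) (b c : X) :
  X -> set X := fun u => [set v | A u (v - hip u c *: b)].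

Lemma perturbed_linear (R : realType) (X : hspace R) (A : X -> set X) (b c : X) :
  hilbert X -> linear_graph A -> linear_graph (perturbed A b c).
Proof.
move=> hX lA; split; rewrite /perturbed/=.
  by rewrite ip0l// scale0r subr0; exact: lA.1.
move=> k u v u' v' h1 h2; have := lA.2 k _ _ _ _ h1 h2.
by congr (A _ _); rewrite ipDl// ipZl//; lmod.
Qed.

Section Perturbed.
Context {R : realType} {X : hspace R}.
Hypothesis hX : hilbert X.
Variable A : X -> set X.
Hypothesis lA : linear_graph A.
Variables (b c : X) (h : R) (J : X -> X).
Hypotheses (h0 : 0 < h) (hJ : resolvent A h J).
Hypothesis contr : forall x, hnorm (J x) <= hnorm x.
Implicit Types (u v w x y : X).
Let P := perturbed A b c.
Let kap : R[i] := hip (h%:C *: J b) c.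
Hypothesis small : normc kap <= 4^-1.

(** The Sherman-Morrison formula for [(1 - h A - h <.,c> b)^-1]. *)
Definition perturbed_resolvent x : X :=
  J x + (hip (J x) c / (1 - kap)) *: (h%:C *: J b).
Let E := perturbed_resolvent.

Let kap1 : 1 - kap != 0.
Proof.
rewrite subr_eq0; apply/eqP => k1; move: small; rewrite -k1 Normc.normc1; lra.
Qed.

Lemma perturbed_resolvent_ip x : hip (E x) c = hip (J x) c / (1 - kap).
Proof. by rewrite ipDl// ipZl// -/kap; field. Qed.

Lemma perturbed_resolventE x : E x = J (x + (h%:C * hip (E x) c) *: b).
Proof.
rewrite perturbed_resolvent_ip (resolventD lA _ _ hJ) (resolventZ lA _ _ hJ).
by rewrite /E /perturbed_resolvent; lmod.
Qed.

Lemma perturbed_resolventP : resolvent P h E.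
Proof.
split=> [x|u v Puv].
  have [v Av e] := hJ.1 (x + (h%:C * hip (E x) c) *: b).
  rewrite -perturbed_resolventE in Av e.
  exists (v + hip (E x) c *: b); first by rewrite /P /perturbed/= addrK.
  by rewrite -[RHS](addrK ((h%:C * hip (E x) c) *: b)) -e; lmod.
have := hJ.2 _ _ Puv; set f := hip u c.
have -> : u - h%:C *: (v - f *: b) = (u - h%:C *: v) + (h%:C * f) *: b by lmod.
rewrite (resolventD lA _ _ hJ) (resolventZ lA _ _ hJ) => e.
have e' : J (u - h%:C *: v) = u - f *: (h%:C *: J b) by rewrite -[in RHS]e; lmod.
rewrite /E /perturbed_resolvent e' ipBl// ipZl// -/kap -/f.
have -> : (f - f * kap) / (1 - kap) = f by field.
by rewrite subrK.
Qed.

Local Notation resp := (response h J b).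
Let feed x (n : nat) := hip (iter n.+1 E x) c.

(** Discrete Duhamel formula. The input at step [n] is the observation of the new point [E^(n+1) x],
    because the feedback is implicit ([perturbed_resolventE]). *)
Lemma perturbed_iterE x n : iter n E x = iter n J x + resp (feed x) n.
Proof.
elim: n => [|n IH]; first by rewrite addr0.
rewrite iterS [LHS]perturbed_resolventE -iterS -/(feed x n) {1}IH /=.
by rewrite -(resolventD lA _ _ hJ) addrA.
Qed.

Lemma response_bound f n : hnorm (resp f n) <=
  h * \sum_(m < n) normc (f m) * hnorm (iter (n - m) J b).
Proof.
have -> : resp f n = \sum_(m < n) (h%:C * f m) *: iter (n - m) J b.
  elim: n => [|n IH]; first by rewrite big_ord0.
  rewrite big_ord_recr/= subSnn/= (resolventD lA _ _ hJ) (resolventZ lA _ _ hJ).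
  congr (_ + _); rewrite IH.
  have -> : J (\sum_(m < n) (h%:C * f m) *: iter (n - m) J b) =
      \sum_(m < n) J ((h%:C * f m) *: iter (n - m) J b).
    elim/big_rec2 : _ => [|i u v _ <-]; first exact: resolvent0 lA _ _ hJ.
    exact: resolventD lA _ _ _ _ hJ.
  by apply: eq_bigr => m _; rewrite (resolventZ lA _ _ hJ) subSn ?(ltnW (ltn_ord m)).
apply: le_trans (hnorm_sum hX _ _ _) _; rewrite mulr_sumr; apply: ler_sum => m _.
by rewrite (hnormZ hX) Normc.normcM normcR gtr0_norm// mulrA.
Qed.

Variable del : R.
Hypothesis del0 : 0 < del.
Hypothesis diss : forall u v, A u v -> del * normc (hip u c) ^+ 2 <= - Re (hip v u).
Hypothesis mult : forall f L,
  \sum_(n < L) normc (hip (resp f n.+1) c) ^+ 2 <= 8^-1 * \sum_(n < L) normc (f n) ^+ 2.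

(** By Duhamel the feedback signal is the free signal plus the response to the feedback itself. The
    gain [1/8] gives [S <= 2 S0 + S / 4], so [S <= 4 S0], and [dissipation_sum] bounds the free part
    [S0] by the initial energy. *)
Lemma feed_sum x L :
  h * \sum_(n < L) normc (hip (iter n.+1 E x) c) ^+ 2 <= 2 / del * hnorm x ^+ 2.
Proof.
set S := \sum_(_ < L) _.
pose S0 := \sum_(n < L) normc (hip (iter n.+1 J x) c) ^+ 2.
have S1 : S <= 2 * S0 + 4^-1 * S.
  have := mult (feed x) L; rewrite -/S => hm.
  apply: (@le_trans _ _ (2 * S0 +
      2 * \sum_(n < L) normc (hip (resp (feed x) n.+1) c) ^+ 2)); last by lra.
  rewrite /S0 !mulr_sumr -big_split/=; apply: ler_sum => n _.
  have -> : hip (E (iter n E x)) c =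
      hip (iter n.+1 J x) c + hip (resp (feed x) n.+1) c.
    by rewrite -ipDl// -perturbed_iterE.
  set p := hip (iter _ _ _) c; set q := hip (resp _ _) c.
  apply: le_trans (sqrD_le _ _).
  by rewrite ler_pXn2r ?nnegrE ?normc_ge0 ?addr_ge0 ?normc_ge0//; exact: le_normcD.
have := dissipation_sum hX x L (ltW del0) (ltW h0) diss hJ; rewrite -/S0 => hd.
have hS : h * S <= 4 * (h * S0).
  rewrite mulrCA ler_pM2l//; have : 0 <= S0 by apply: sumr_ge0 => i _; exact: sqr_ge0.
  lra.
apply: le_trans hS _; rewrite mulrAC ler_pdivlMr//.
have := sqr_ge0 (hnorm (iter L J x)); lra.
Qed.

Variables (a Cb : R).
Hypotheses (a0 : 0 < a) (Cb0 : 0 <= Cb).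
Hypothesis decb : forall n, hnorm (iter n J b) <= Cb / (1 + n%:R * (a * h)).

(** Cauchy-Schwarz in Duhamel's formula: the iterates of [b] are square summable, being bounded by
    [Cb / (1 + n a h)], and so is the feedback signal by [feed_sum]. *)
Lemma perturbed_bounded x n :
  hnorm (iter n E x) <= (1 + Num.sqrt (Cb ^+ 2 / a * (2 / del))) * hnorm x.
Proof.
have Jn : hnorm (iter n J x) <= hnorm x.
  by elim: n => //= n; apply: le_trans; exact: contr.
rewrite perturbed_iterE mulrDl mul1r.
apply: le_trans (hnormD hX _ _) _; apply: lerD => //.
have K0 : 0 <= Cb ^+ 2 / a * (2 / del) by rewrite mulr_ge0 ?divr_ge0 ?sqr_ge0// ltW.
rewrite -(@ler_pXn2r _ 2)// ?nnegrE ?mulr_ge0 ?hnorm_ge0 ?sqrtr_ge0//.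
rewrite exprMn (sqr_sqrtr K0).
have rb := response_bound (feed x) n; have s0 := hnorm_ge0 (resp (feed x) n).
apply: (@le_trans _ _ ((h * \sum_(m < n) normc (feed x m) * hnorm (iter (n - m) J b)) ^+ 2)).
  by rewrite ler_pXn2r ?nnegrE//; exact: le_trans rb.
rewrite exprMn; apply: le_trans (ler_wpM2l (sqr_ge0 h) (sum_CS _ _)) _.
have ah0 : 0 < a * h by rewrite mulr_gt0.
have q1 : h * \sum_(m < n) hnorm (iter (n - m) J b) ^+ 2 <= Cb ^+ 2 / a.
  rewrite ler_pdivlMr// mulrC mulrA.
  have -> : \sum_(m < n) hnorm (iter (n - m) J b) ^+ 2 =
      \sum_(m < n) hnorm (iter m.+1 J b) ^+ 2.
    rewrite (reindex_inj rev_ord_inj)/=; apply: eq_bigr => m _.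
    by rewrite subKn.
  apply: (@le_trans _ _ (Cb ^+ 2 * \sum_(j < n) (a * h) * ((1 + j.+1%:R * (a * h))^-1) ^+ 2)).
    rewrite !mulr_sumr; apply: ler_sum => j _.
    rewrite [leRHS]mulrCA ler_pM2l// -exprMn ler_pXn2r ?nnegrE ?hnorm_ge0//.
    by rewrite mulr_ge0// invr_ge0 addr_ge0// mulr_ge0// ltW.
  apply: ler_piMr; first exact: sqr_ge0.
  apply: le_trans (sum_inv_sqr n ah0) _.
  by rewrite lerBlDr lerDl invr_ge0 addr_ge0// mulr_ge0// ltW.
have q2 := feed_sum x n.
have -> : h ^+ 2 * ((\sum_(i < n) normc (feed x i) ^+ 2) *
    (\sum_(i < n) hnorm (iter (n - i) J b) ^+ 2)) =
    (h * \sum_(m < n) hnorm (iter (n - m) J b) ^+ 2) *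
    (h * \sum_(i < n) normc (feed x i) ^+ 2) by ring.
rewrite -[leRHS]mulrA; apply: ler_pM => //.
- by rewrite mulr_ge0 ?(ltW h0)// sumr_ge0// => i _; exact: sqr_ge0.
- by rewrite mulr_ge0 ?(ltW h0)// sumr_ge0// => i _; exact: sqr_ge0.
Qed.

End Perturbed.

(** * Decay of the perturbed iterates by an induction from time [L] to time [3 L] *)

Lemma third_nat n : exists L r : nat,
  [/\ n = (r + 3 * L)%N, (r <= 2)%N, (n <= 3 * L + 2)%N & (0 < L -> L < n)%N].
Proof.
exists (n %/ 3)%N, (n %% 3)%N; have := divn_eq n 3.
by have := ltn_pmod n (isT : (0 < 3)%N) => *; split; lia.
Qed.

Section PerturbedDecay.
Context {R : realType} {X : hspace R}.
Variables (b c x : X) (E J : X -> X) (h N1 F Cb a c3 w0 Y : R) (W : nat -> R).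
Hypotheses (h01 : 0 < h <= 1) (N11 : 1 <= N1) (F0 : 0 <= F) (Cb0 : 0 <= Cb)
  (a0 : 0 < a) (c30 : 0 < c3) (w00 : 0 < w0).
Hypothesis bnd : forall y n, hnorm (iter n E y) <= N1 * hnorm y.
Hypothesis feed : forall y L,
  h * \sum_(n < L) normc (hip (iter n.+1 E y) c) ^+ 2 <= F * hnorm y ^+ 2.
Hypothesis duhamel : forall y n, hnorm (iter n E y) <= hnorm (iter n J y) +
  h * \sum_(m < n) normc (hip (iter m.+1 E y) c) * hnorm (iter (n - m) J b).
Hypothesis decb : forall n, hnorm (iter n J b) <= Cb / (1 + n%:R * (a * h)).
(** Free decay restarted from any point of the perturbed orbit; [Y] bounds the graph norm of the
    whole orbit and [W] is the squared rate. *)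
Hypothesis decx : forall k n, hnorm (iter n J (iter k E x)) ^+ 2 <= Y ^+ 2 * W n.
Hypothesis xY : hnorm x <= Y.
Hypothesis W0 : forall n, 0 < W n.
Hypothesis W3 : forall L n, (n <= 3 * L + 2)%N -> W L <= c3 * W n.
(** [G] and [t0] are fixed so that [G sqrt(1 + a t) <= t] for [t >= t0], the inequality behind
    [small_coef]. *)
Let G : R := 64 * N1 ^+ 6 * F * (Cb / a) ^+ 2 * c3.
Let t0 : R := 1 + G ^+ 2 * (1 + a).
(** The window of short times: for [n = r + 3 L] with [r <= 2] and [h <= 1], [L h < t0] gives
    [n h <= 3 t0 + 2]. *)
Hypothesis Ww0 : forall n, n%:R * h <= 3 * t0 + 2 -> w0 <= W n.

Let Q : R := 4 * N1 ^+ 4 * c3 + N1 ^+ 2 / w0.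
Let m n := hnorm (iter n E x).
Let h0 : 0 < h. Proof. by case/andP: h01. Qed.
Let beta n := hnorm (iter n J b).
Let Bs L := h * \sum_(j < L) beta (L - j).

(** The decay [1 / n] of the iterates of [b] is barely not summable: their sum grows like a
    logarithm, whose square [ln_sqr_le] weakens to a square root. *)
Let Bs_le L : Bs L ^+ 2 <= (Cb / a) ^+ 2 * (16 * Num.sqrt (1 + L%:R * (a * h))).
Proof.
have ah0 : 0 < a * h by rewrite mulr_gt0.
have Bs0 : 0 <= Bs L by rewrite mulr_ge0 ?(ltW h0)// sumr_ge0// => i _; exact: hnorm_ge0.
have y1 : 1 <= 1 + L%:R * (a * h) by rewrite lerDl mulr_ge0// ltW.
have BL : Bs L <= Cb / a * ln (1 + L%:R * (a * h)).
  apply: (@le_trans _ _ (Cb / a * \sum_(j < L) (a * h) / (1 + j.+1%:R * (a * h)))).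
    rewrite /Bs (reindex_inj rev_ord_inj)/= !mulr_sumr; apply: ler_sum => j _.
    rewrite subKn//; apply: le_trans (ler_wpM2l (ltW h0) (decb _)) _.
    have p : 0 < 1 + j.+1%:R * (a * h) by rewrite ltr_wpDr// mulr_ge0// ltW.
    rewrite le_eqVlt; apply/orP; left; apply/eqP.
    move: (j.+1%:R : R) p => z p; field.
    by apply/andP; split; rewrite gt_eqF.
  apply: ler_wpM2l; first by rewrite divr_ge0// ltW.
  exact: sum_inv.
apply: le_trans (_ : (Cb / a * ln (1 + L%:R * (a * h))) ^+ 2 <= _).
  by rewrite ler_pXn2r ?nnegrE// mulr_ge0 ?divr_ge0 ?ln_ge0// ltW.
by rewrite exprMn; apply: ler_wpM2l; [exact: sqr_ge0|exact: ln_sqr_le].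
Qed.

(* Young's inequality for the convolution with [beta], summed over the
   [L] starting points [L + i], [i < L]. *)
Let young L : h * \sum_(i < L)
    (h * \sum_(j < L) normc (hip (iter j.+1 E (iter (L + i) E x)) c) * beta (L - j)) ^+ 2
  <= Bs L ^+ 2 * (F * N1 ^+ 2) * m L ^+ 2.
Proof.
pose f k := normc (hip (iter k.+1 E (iter L E x)) c) ^+ 2.
have b0 k : 0 <= beta k by exact: hnorm_ge0.
have S0 : 0 <= \sum_(j < L) beta (L - j) by apply: sumr_ge0.
have step (i : 'I_L) :
    (h * \sum_(j < L) normc (hip (iter j.+1 E (iter (L + i) E x)) c) * beta (L - j)) ^+ 2
    <= Bs L * (h * \sum_(j < L) beta (L - j) * f (j + i)%N).
  have -> : \sum_(j < L) normc (hip (iter j.+1 E (iter (L + i) E x)) c) * beta (L - j) =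
      \sum_(j < L) Num.sqrt (beta (L - j)) *
        (Num.sqrt (beta (L - j)) * normc (hip (iter j.+1 E (iter (L + i) E x)) c)).
    by apply: eq_bigr => j _; rewrite mulrA -expr2 sqr_sqrtr// mulrC.
  rewrite exprMn; apply: le_trans (ler_wpM2l (sqr_ge0 h) (sum_CS _ _)) _.
  have -> : \sum_(j < L) Num.sqrt (beta (L - j)) ^+ 2 = \sum_(j < L) beta (L - j).
    by apply: eq_bigr => j _; rewrite sqr_sqrtr.
  have -> : \sum_(j < L) (Num.sqrt (beta (L - j)) *
      normc (hip (iter j.+1 E (iter (L + i) E x)) c)) ^+ 2 =
      \sum_(j < L) beta (L - j) * f (j + i)%N.
    apply: eq_bigr => j _; rewrite exprMn sqr_sqrtr// /f.
    congr (_ * normc (hip _ _) ^+ 2).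
    by rewrite -!iterD; congr (iter _ E x); rewrite !addSn [(L + i)%N]addnC addnA.
  by rewrite le_eqVlt; apply/orP; left; apply/eqP; rewrite /Bs; ring.
apply: (@le_trans _ _ (h * \sum_(i < L) Bs L * (h * \sum_(j < L) beta (L - j) * f (j + i)%N))).
  by rewrite ler_pM2l//; apply: ler_sum => i _; exact: step.
have Bs0 : 0 <= Bs L by rewrite mulr_ge0// ltW.
suff T : \sum_(i < L) (h * \sum_(j < L) beta (L - j) * f (j + i)%N) <=
    \sum_(j < L) beta (L - j) * (F * N1 ^+ 2 * m L ^+ 2).
  rewrite -mulr_sumr mulrCA; apply: le_trans (ler_wpM2l Bs0 (ler_wpM2l (ltW h0) T)) _.
  by rewrite -mulr_suml /Bs le_eqVlt; apply/orP; left; apply/eqP; ring.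
rewrite -mulr_sumr exchange_big/= mulr_sumr; apply: ler_sum => j _.
rewrite -mulr_sumr mulrCA; apply: ler_wpM2l => //.
have fE : \sum_(i < L) f (j + i)%N =
    \sum_(n < L) normc (hip (iter n.+1 E (iter (j + L) E x)) c) ^+ 2.
  apply: eq_bigr => i _; rewrite /f; congr (normc (hip _ _) ^+ 2).
  by rewrite -!iterD; congr (iter _ E x); rewrite !addSn (addnCA i) addnA.
rewrite fE; apply: le_trans (feed _ _) _; rewrite -mulrA; apply: ler_wpM2l => //.
have N1p : 0 <= N1 by exact: le_trans N11.
have nN : 0 <= N1 * m L by rewrite mulr_ge0 ?hnorm_ge0.
by rewrite -exprMn ler_pXn2r ?nnegrE ?hnorm_ge0// iterD; exact: bnd.
Qed.

(** The norm at time [3 L] is compared, up to the factor [N1], with the norm at time [2 L + i] for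
    every [i < L], reached by Duhamel's formula of length [L] from time [L + i]. Averaging over [i]
    allows [young]: the forced part gains the factor [1 / (L h)], while the free part has decayed
    for a time [L]. *)
Let recursion L : (0 < L)%N -> m (3 * L) ^+ 2 <=
  2 * N1 ^+ 2 * Y ^+ 2 * W L +
  2 * N1 ^+ 4 * F * (Bs L ^+ 2 / (L%:R * h)) * m L ^+ 2.
Proof.
move=> L0; have LR : 0 < L%:R :> R by rewrite ltr0n.
have Lh : 0 < L%:R * h by rewrite mulr_gt0.
have N10 : 0 < N1 by exact: lt_le_trans N11.
rewrite -(ler_pM2l Lh).
pose r (i : nat) := h * \sum_(j < L)
   normc (hip (iter j.+1 E (iter (L + i) E x)) c) * beta (L - j).
have one (i : 'I_L) : m (3 * L) ^+ 2 <= N1 ^+ 2 * (2 * (Y ^+ 2 * W L) + 2 * r i ^+ 2).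
  have E3 : (3 * L)%N = ((L - i) + (L + (L + i)))%N 
    by rewrite addnCA (addnCA (L - i)%N) subnK ?(ltnW (ltn_ord i))// !mulSn mul0n addn0.
  have l1 : m (3 * L) <= N1 * hnorm (iter L E (iter (L + i) E x)).
    by rewrite /m E3 iterD (iterD L); exact: bnd.
  have l2 := duhamel (iter (L + i) E x) L; rewrite -/(r i) in l2.
  have l3 := decx (L + i) L.
  set p := hnorm (iter L E _) in l1 l2; set q := hnorm (iter L J _) in l2 l3.
  have [p0 q0] : 0 <= p /\ 0 <= q by split; exact: hnorm_ge0.
  have r0 : 0 <= r i.
    by rewrite mulr_ge0 ?(ltW h0)// sumr_ge0// => j _; rewrite mulr_ge0 ?normc_ge0 ?hnorm_ge0.
  apply: (@le_trans _ _ ((N1 * p) ^+ 2)).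
    by rewrite ler_pXn2r ?nnegrE ?hnorm_ge0// mulr_ge0// ltW.
  rewrite exprMn; apply: ler_wpM2l; first exact: sqr_ge0.
  apply: (@le_trans _ _ ((q + r i) ^+ 2)); first by rewrite ler_pXn2r ?nnegrE// addr_ge0.
  by apply: le_trans (sqrD_le _ _) _; rewrite lerD2r ler_pM2l.
apply: (@le_trans _ _ (h * \sum_(i < L) N1 ^+ 2 * (2 * (Y ^+ 2 * W L) + 2 * r i ^+ 2))).
  rewrite (_ : L%:R * h * _ = h * (L%:R * m (3 * L) ^+ 2)); last by ring.
  rewrite ler_pM2l//.
  have -> : L%:R * m (3 * L) ^+ 2 = \sum_(i < L) m (3 * L) ^+ 2.
    by rewrite sumr_const card_ord mulr_natl.
  by apply: ler_sum => i _; exact: one.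
rewrite -mulr_sumr big_split/= sumr_const card_ord -[_ *+ L]mulr_natl -mulr_sumr.
have := young L; rewrite -/(r _); set S := \sum_(i < L) r i ^+ 2 => hS.
have -> : L%:R * h * (2 * N1 ^+ 2 * Y ^+ 2 * W L +
     2 * N1 ^+ 4 * F * (Bs L ^+ 2 / (L%:R * h)) * m L ^+ 2) =
   N1 ^+ 2 * (h * L%:R * 2 * (Y ^+ 2 * W L)) +
     2 * N1 ^+ 2 * (Bs L ^+ 2 * (F * N1 ^+ 2) * m L ^+ 2).
  by field; rewrite !gt_eqF.
have -> : h * (N1 ^+ 2 * (L%:R * (2 * (Y ^+ 2 * W L)) + 2 * S)) =
   N1 ^+ 2 * (h * L%:R * 2 * (Y ^+ 2 * W L)) + 2 * N1 ^+ 2 * (h * S) by ring.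
by rewrite lerD2l; apply: ler_wpM2l => //; rewrite mulr_ge0 ?sqr_ge0.
Qed.

(** [Bs L ^+ 2] grows at most like the square root of [L h], hence is negligible after division by
    [L h]; the numerical factors are collected in [G]. *)
Let small_coef L : t0 <= L%:R * h ->
  2 * N1 ^+ 6 * F * (Bs L ^+ 2 / (L%:R * h)) * c3 <= 2^-1.
Proof.
move=> tL; set t := L%:R * h in tL *.
have N10 : 0 <= N1 by exact: le_trans N11.
have G0 : 0 <= G.
  by rewrite mulr_ge0 ?(ltW c30)// mulr_ge0 ?sqr_ge0// mulr_ge0// mulr_ge0// exprn_ge0.
have G2 := sqr_ge0 G.
have t1 : 1 <= t.
  by apply: le_trans tL; rewrite /t0 lerDl mulr_ge0// addr_ge0// ltW.
have tp : 0 < t by lra.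
have Gs : G * Num.sqrt (1 + a * t) <= t.
  have GS0 : 0 <= G * Num.sqrt (1 + a * t) by apply: mulr_ge0 => //; exact: sqrtr_ge0.
  rewrite -(@ler_pXn2r _ 2)// ?nnegrE ?(ltW tp)//.
  have p1 : 0 <= 1 + a * t by rewrite addr_ge0// mulr_ge0// ltW.
  rewrite exprMn (sqr_sqrtr p1).
  apply: (@le_trans _ _ (G ^+ 2 * (1 + a) * t)).
    rewrite -mulrA; apply: ler_wpM2l => //; rewrite mulrDl mul1r lerD2r//.
  rewrite [leRHS]expr2 ler_pM2r//; apply: le_trans tL; rewrite /t0 lerDr//.
have Bl := Bs_le L; rewrite (_ : L%:R * (a * h) = a * t) in Bl; last by rewrite /t; ring.
rewrite (_ : _ * c3 = 2 * N1 ^+ 6 * F * c3 * Bs L ^+ 2 / t); last by rewrite /t; ring.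
rewrite ler_pdivrMr//.
have K0 : 0 <= 2 * N1 ^+ 6 * F * c3.
  by rewrite !mulr_ge0 ?exprn_ge0 ?(ltW c30).
apply: le_trans (ler_wpM2l K0 Bl) _.
have -> : 2 * N1 ^+ 6 * F * c3 * ((Cb / a) ^+ 2 * (16 * Num.sqrt (1 + a * t))) =
  2^-1 * (G * Num.sqrt (1 + a * t)) by rewrite /G; field; rewrite gt_eqF.
by rewrite ler_pM2l.
Qed.

(** Strong induction. At short times boundedness suffices, through the summand [N1^2 / w0] of [Q].
    Otherwise [recursion] applies with [L] about [n / 3]: the free part uses half of [Q] through the
    summand [4 N1^4 c3], and by [small_coef] the induction hypothesis at [L] uses the other half,
    [c3] being the price of comparing [W L] with [W n]. *)
Lemma perturbed_decay n : hnorm (iter n E x) ^+ 2 <= Q * Y ^+ 2 * W n.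
Proof.
have N10 : 0 < N1 by exact: lt_le_trans N11.
have Q0 : 0 <= Q.
  apply: addr_ge0; last by apply: divr_ge0; [exact: sqr_ge0|exact: ltW].
  by apply: mulr_ge0; [apply: mulr_ge0 => //; apply: exprn_ge0; exact: ltW|exact: ltW].
have Y20 := sqr_ge0 Y; have h1 : h <= 1 by case/andP: h01.
have Y0 : 0 <= Y by apply: le_trans xY; exact: hnorm_ge0.
elim/ltn_ind: n => n IH.
have [L [r [nD r2 nL L0n]]] := third_nat n.
have [tL|Lt] := leP t0 (L%:R * h); last first.
  have nw : w0 <= W n.
    apply: Ww0; apply: (@le_trans _ _ (3 * (L%:R * h) + 2)); last first.
      by rewrite lerD2r ler_pM2l// ltW.
    rewrite nD natrD mulrDl natrM -mulrA addrC lerD2l.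
    by rewrite -[leRHS]mulr1; apply: ler_pM => //; [exact: ltW|rewrite ler_nat].
  apply: (@le_trans _ _ ((N1 * Y) ^+ 2)).
    rewrite ler_pXn2r ?nnegrE ?hnorm_ge0 ?mulr_ge0 ?(ltW N10)//.
    by apply: le_trans (bnd _ _) _; rewrite ler_pM2l.
  rewrite exprMn [leRHS]mulrAC; apply: ler_wpM2r => //.
  apply: (@le_trans _ _ (N1 ^+ 2 / w0 * W n)).
    by rewrite [leRHS]mulrAC ler_pdivlMr//; apply: ler_wpM2l => //; exact: sqr_ge0.
  rewrite ler_pM2r// /Q lerDr; apply: mulr_ge0; last exact: ltW.
  by apply: mulr_ge0 => //; apply: exprn_ge0; exact: ltW.
have L0 : (0 < L)%N.
  rewrite lt0n; apply/negP => /eqP L00; move: tL; rewrite L00 mul0r /t0.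
  have := mulr_ge0 (sqr_ge0 G) (addr_ge0 ler01 (ltW a0)); lra.
have Ln : (L < n)%N by exact: L0n.
have mn : m n <= N1 * m (3 * L).
  by rewrite /m nD iterD; exact: bnd.
have r1 := recursion L0; have {}r2 := IH L Ln; rewrite -/(m L) in r2.
have sc := small_coef tL.
have WL : W L <= c3 * W n by exact: W3.
apply: (@le_trans _ _ (N1 ^+ 2 * m (3 * L) ^+ 2)).
  rewrite -exprMn ler_pXn2r ?nnegrE ?hnorm_ge0// mulr_ge0 ?hnorm_ge0// ltW//.
apply: le_trans (ler_wpM2l (sqr_ge0 N1) r1) _.
set B := Bs L ^+ 2 / _ in sc *.
have B0 : 0 <= B by rewrite divr_ge0 ?sqr_ge0// mulr_ge0// ltW.
have -> : N1 ^+ 2 * (2 * N1 ^+ 2 * Y ^+ 2 * W L + 2 * N1 ^+ 4 * F * B * m L ^+ 2) =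
  2 * N1 ^+ 4 * Y ^+ 2 * W L + 2 * N1 ^+ 6 * F * B * m L ^+ 2 by ring.
have K1 : 0 <= 2 * N1 ^+ 4 * Y ^+ 2.
  by apply: mulr_ge0 => //; apply: mulr_ge0 => //; apply: exprn_ge0; exact: ltW.
have K2 : 0 <= 2 * N1 ^+ 6 * F * B.
  apply: mulr_ge0 => //; apply: mulr_ge0 => //; apply: mulr_ge0 => //.
  by apply: exprn_ge0; exact: ltW.
have s1 := ler_wpM2l K1 WL.
have QY : 0 <= Q * Y ^+ 2 by rewrite mulr_ge0.
have s2 := ler_wpM2l K2 (le_trans r2 (ler_wpM2l QY WL)).
have s3 : 2 * N1 ^+ 6 * F * B * (Q * Y ^+ 2 * (c3 * W n)) <= 2^-1 * (Q * Y ^+ 2 * W n).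
  have -> : 2 * N1 ^+ 6 * F * B * (Q * Y ^+ 2 * (c3 * W n)) =
    2 * N1 ^+ 6 * F * B * c3 * (Q * Y ^+ 2 * W n) by ring.
  by apply: ler_wpM2r => //; rewrite mulr_ge0// ltW.
have s4 : 2 * N1 ^+ 4 * Y ^+ 2 * (c3 * W n) <= 2^-1 * (Q * Y ^+ 2 * W n).
  have -> : 2 * N1 ^+ 4 * Y ^+ 2 * (c3 * W n) =
     2^-1 * ((4 * N1 ^+ 4 * c3) * (Y ^+ 2 * W n)) by field.
  rewrite ler_pM2l// -[leRHS]mulrA; apply: ler_wpM2r; first by rewrite mulr_ge0// ltW.
  by rewrite /Q lerDl divr_ge0 ?sqr_ge0// ltW.
by move: s1 s2 s3 s4; set u1 := 2 * N1 ^+ 4 * _ * W L; lra.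
Qed.

End PerturbedDecay.

(** * A generation theorem by dyadic backward Euler schemes *)

Section Generation.
Context {R : realType} {X : hspace R}.
Hypothesis hX : hilbert X.
Variables (P : X -> set X) (E : R -> X -> X) (N1 : R).
Hypothesis lP : linear_graph P.
Hypothesis hE : forall h : R, 0 < h <= 1 -> resolvent P h (E h).
Hypothesis N11 : 1 <= N1.
(** Stability is assumed for all powers at once, uniformly in [h]; a single step may expand by
    [N1]. *)
Hypothesis bnd : forall (h : R) x n, 0 < h <= 1 -> hnorm (iter n (E h) x) <= N1 * hnorm x.
Hypothesis dense : forall x (e : R), 0 < e -> exists u v, P u v /\ hnorm (x - u) <= e.
Implicit Types (u v w x y z : X) (e h t s : R).
Local Notation "s ~~> l" := (hnorm (s m - l) @[m --> \oo] --> (0 : R)) (at level 70).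

Let N10 : 0 < N1. Proof. exact: lt_le_trans N11. Qed.

Let bnd1 h x : 0 < h <= 1 -> hnorm (E h x) <= N1 * hnorm x.
Proof. by move=> h01; exact: (bnd x 1 h01). Qed.

Let resB h x y n : 0 < h <= 1 ->
  iter n (E h) (x - y) = iter n (E h) x - iter n (E h) y.
Proof.
move=> h01; rewrite -[x - y]addrC -scaleN1r.
by rewrite (resolvent_iterP lP n _ _ _ (hE h01)) scaleN1r addrC.
Qed.

Let resB1 h x y : 0 < h <= 1 -> E h (x - y) = E h x - E h y.
Proof. exact: (@resB h x y 1). Qed.

Let step_le h u v : 0 < h <= 1 -> P u v -> hnorm (E h u - u) <= h * (N1 * hnorm v).
Proof.
move=> h01 Puv; have /andP[h0 _] := h01.
have e := resolvent_eq lP (lt0r_neq0 h0) (hE h01) Puv.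
have -> : E h u - u = h%:C *: E h v by rewrite -{2}e; lmod.
by rewrite (hnormZp hX) ?(ltW h0)// ler_pM2l//; exact: bnd1.
Qed.

Let res_cvg x e : 0 < e -> exists2 d : R, 0 < d &
  forall h, 0 < h <= 1 -> h < d -> hnorm (E h x - x) <= e.
Proof.
move=> e0; have N1p := N10; have d0 : 0 < e / (2 * (N1 + 1)) by rewrite divr_gt0//; lra.
have [u [v [Puv xu]]] := dense x d0.
have nv : 0 < 2 * (N1 * hnorm v + 1).
  by rewrite mulr_gt0// ltr_wpDl// mulr_ge0 ?hnorm_ge0// ltW.
exists (e / (2 * (N1 * hnorm v + 1))); first by rewrite divr_gt0.
move=> h h01 hd; have /andP[h0 _] := h01.
have -> : E h x - x = (E h (x - u) - (x - u)) + (E h u - u).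
  by rewrite (resB1 _ _ h01); lmod.
apply: le_trans (hnormD hX _ _) _.
have s1 := step_le h01 Puv; have s2 := bnd1 (x - u) h01.
have s3 := hnormB hX (E h (x - u)) (x - u).
have s4 : (N1 + 1) * hnorm (x - u) <= e / 2.
  rewrite -ler_pdivlMl ?addr_gt0//; apply: le_trans xu _.
  by rewrite le_eqVlt; apply/orP; left; apply/eqP; field; rewrite gt_eqF// addr_gt0.
have s5 : h * (N1 * hnorm v) <= e / 2.
  move: hd; rewrite ltr_pdivlMr// => /ltW; nra.
lra.
Qed.

Let dense2 x e : 0 < e -> exists u v w, [/\ P u v, P v w & hnorm (x - u) <= e].
Proof.
move=> e0; have N1p := N10; have d0 : 0 < e / (N1 + 1) by rewrite divr_gt0//; lra.
have [d dp hd] := res_cvg x d0.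
pose h := Num.min 1 (d / 2).
have h01 : 0 < h <= 1 by rewrite lt_min ltr01 divr_gt0//= ge_min lexx.
have hlt : h < d by apply: (@le_lt_trans _ _ (d / 2)); [rewrite ge_min lexx orbT|lra].
have [v Pv ev] := (hE h01).1 x; have [w Pw ew] := (hE h01).1 v.
have /andP[h0 _] := h01.
have Pv2 := resolvent_gen lP (lt0r_neq0 h0) (hE h01) Pv.
exists (E h (E h x)), (E h v), w; split; [exact: Pv2|exact: Pw|].
have s1 := hd h h01 hlt.
rewrite (hnormBC hX); have := hnorm_tri hX (E h x) (E h (E h x)) x.
have := bnd1 (E h x - x) h01; rewrite (resB1 _ _ h01).
have : (N1 + 1) * hnorm (E h x - x) <= e by rewrite -ler_pdivlMl ?addr_gt0 // mulrC.
lra.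
Qed.

(** One step of length [h] and two of length [h / 2] differ by [h^2 / 4] times a bounded image of
    [z = P^2 x]. The prefix [iter k (E h)] carries each local error to the end by a single use of
    [bnd]; bounding step by step would lose a factor [N1] each time. *)
Let halving h x y z n k : 0 < h <= 1 -> P x y -> P y z ->
  hnorm (iter k (E h) (iter n (E h) x - iter (n + n) (E (h / 2)) x)) <=
  n%:R * (h ^+ 2 / 4) * (N1 ^+ 2 * hnorm z).
Proof.
move=> h01 Pxy Pyz; have /andP[h0 h1] := h01.
have h01' : 0 < h / 2 <= 1 by rewrite divr_gt0//=; lra.
have h'0 := lt0r_neq0 (andP h01').1.
set F := E (h / 2).
elim: n k => [|n IH] k.
  by rewrite subrr (_ : iter k (E h) 0 = 0) ?(hnorm0 hX) ?mul0r//;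
    elim: k => //= k ->; rewrite (resolvent0 lP (hE h01)).
set q := iter (n + n) F x; set q' := iter (n + n) F y; set q'' := iter (n + n) F z.
have Pq : P q q' := resolvent_iter_gen lP (n + n) h'0 (hE h01') Pxy.
have Pq' : P q' q'' := resolvent_iter_gen lP (n + n) h'0 (hE h01') Pyz.
have e1 := resolvent_eq lP h'0 (hE h01') Pq.
have e2 := resolvent_eq lP h'0 (hE h01') Pq'.
have PFq := resolvent_gen lP h'0 (hE h01') Pq.
have e3 := resolvent_eq lP h'0 (hE h01') PFq.
have PFq' := resolvent_gen lP h'0 (hE h01') Pq'.
have e4 := resolvent_eq lP h'0 (hE h01') PFq'.
rewrite -/F in e1 e2 e3 e4 PFq PFq'.
have PFFq := resolvent_gen lP h'0 (hE h01') PFq; rewrite -/F in PFFq.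
(* The expansion of [(1 - (h / 2) P)^2] applied to [F (F q)]. *)
have qE : q = (F (F q) - h%:C *: F (F q')) + (h ^+ 2 / 4)%:C *: F (F q'').
  by rewrite -[LHS]e1 -[in LHS]e4 -[in LHS]e3; lmod_coefs; field.
have Eq : E h q = F (F q) + (h ^+ 2 / 4)%:C *: E h (F (F q'')).
  rewrite [in LHS]qE (resolventD lP _ _ (hE h01)) (resolventZ lP _ _ (hE h01)).
  by rewrite ((hE h01).2 _ _ PFFq).
rewrite addSn addnS /= -/F -/q.
have -> : E h (iter n (E h) x) - F (F q) =
    E h (iter n (E h) x - q) + (h ^+ 2 / 4)%:C *: E h (F (F q'')).
  rewrite (resB1 _ _ h01) Eq; lmod.
rewrite -[E h (_ - q)]scale1r (resolvent_iterP lP k _ _ _ (hE h01)) scale1r -iterSr.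
apply: le_trans (hnormD hX _ _) _.
rewrite -(natr1 n) (mulrDl n%:R) mul1r [leRHS]mulrDl; apply: lerD; first exact: IH.
have := resolvent_iterP lP k (h ^+ 2 / 4)%:C (E h (F (F q''))) 0 (hE h01).
rewrite addr0 (_ : iter k (E h) 0 = 0); last first.
  by elim: k {IH} => //= k ->; rewrite (resolvent0 lP (hE h01)).
rewrite addr0 => ->; rewrite (hnormZp hX); last by rewrite divr_ge0 ?sqr_ge0.
apply: ler_wpM2l; first by rewrite divr_ge0 ?sqr_ge0.
rewrite -iterSr; apply: le_trans (bnd _ _ h01) _; rewrite expr2 -mulrA ler_pM2l//.
by rewrite -/(iter 2 F q'') -iterD; exact: bnd.
Qed.

Let hj (j : nat) : R := 2^-1 ^+ j.
Let nj (t : R) (j : nat) := Num.truncn (t * 2 ^+ j).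
Let Tj j (t : R) x := iter (nj t j) (E (hj j)) x.

Let hj01 j : 0 < hj j <= 1.
Proof. by rewrite exprn_gt0 ?invr_gt0//= exprn_ile1// invf_le1// ler1n. Qed.

Let hjM j : hj j * 2 ^+ j = 1.
Proof. by rewrite /hj exprVn mulVf// gt_eqF// exprn_gt0. Qed.

Let nj_le t j : 0 <= t -> (nj t j)%:R * hj j <= t < (nj t j)%:R * hj j + hj j.
Proof.
move=> t0; have /andP[hp _] := hj01 j.
have p : 0 <= t * 2 ^+ j by rewrite mulr_ge0// exprn_ge0.
have /andP[l1 l2] := truncn_itv p.
have tE : t = t * 2 ^+ j * hj j by rewrite -mulrA [2 ^+ j * _]mulrC hjM mulr1.
apply/andP; split; first by rewrite [leRHS]tE ler_pM2r.
have -> : (nj t j)%:R * hj j + hj j = ((nj t j)%:R + 1) * hj j by ring.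
by rewrite [ltLHS]tE ltr_pM2r// natr1.
Qed.

Let njS t j : 0 <= t -> exists r, (r <= 1)%N /\ nj t j.+1 = (r + (nj t j + nj t j))%N.
Proof.
move=> t0; have p k : 0 <= t * 2 ^+ k by rewrite mulr_ge0// exprn_ge0.
have /andP[a1 a2] := truncn_itv (p j); have /andP[b1 b2] := truncn_itv (p j.+1).
rewrite -/(nj t j) -/(nj t j.+1) in a1 a2 b1 b2.
rewrite exprS mulrCA in b1 b2; set s := t * _ in a1 a2 b1 b2.
have l1 : (nj t j + nj t j <= nj t j.+1)%N.
  rewrite -ltnS -(ltr_nat R) natrD; lra.
have l2 : (nj t j.+1 <= (nj t j + nj t j).+1)%N.
  rewrite -ltnS -(ltr_nat R) -addn2 natrD natrD; move: a2; rewrite -natr1; lra.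
exists (nj t j.+1 - (nj t j + nj t j))%N; split; last by rewrite subnK.
by rewrite leq_subLR addn1.
Qed.

(** Passing from step [2^-j] to [2^-(j+1)] doubles the number of steps, plus at most one extra step
    ([njS]). The doubling costs [halving] and the extra step costs [step_le]; both are of order
    [2^-j]. *)
Let Tj_step t j x y z : 0 <= t -> P x y -> P y z ->
  hnorm (Tj j.+1 t x - Tj j t x) <= N1 ^+ 2 * (t * hnorm z + hnorm y) * 2^-1 ^+ j.
Proof.
move=> t0 Pxy Pyz; have [r [r1 nE]] := njS j t0.
have hS : hj j.+1 = hj j / 2 by rewrite /hj exprS mulrC.
have /andP[hp hp1] := hj01 j.
have h01' : 0 < hj j / 2 <= 1 by rewrite -hS.
rewrite /Tj hS nE iterD; set n := nj t j; set F := E (hj j / 2).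
have a1 : hnorm (iter r F (iter (n + n) F x) - iter (n + n) F x) <=
    N1 ^+ 2 * (hj j * hnorm y).
  case: r r1 {nE} => [|[|//]] _ /=.
    rewrite subrr (hnorm0 hX); apply: mulr_ge0; first exact: sqr_ge0.
    by apply: mulr_ge0; [exact: ltW|exact: hnorm_ge0].
  rewrite -iterS iterSr -resB//; apply: le_trans (bnd _ _ h01') _.
  rewrite [N1 ^+ 2]expr2 -!mulrA ler_pM2l//.
  apply: le_trans (step_le h01' Pxy) _; rewrite mulrCA ler_pM2l//.
  by apply: ler_wpM2r; [exact: hnorm_ge0|lra].
have a2 := halving n 0 (hj01 j) Pxy Pyz; rewrite /= -/F in a2.
apply: le_trans (hnorm_tri hX (iter (n + n) F x) _ _) _.
rewrite (hnormBC hX (iter (n + n) F x)).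
apply: le_trans (lerD a1 a2) _; rewrite -/(hj j).
have /andP[nt _] := nj_le j t0; rewrite -/n in nt.
have z0 := hnorm_ge0 z.
have -> : N1 ^+ 2 * (t * hnorm z + hnorm y) * hj j =
  N1 ^+ 2 * (hj j * hnorm y) + N1 ^+ 2 * hnorm z * (t * hj j) by ring.
rewrite lerD2l.
have -> : n%:R * (hj j ^+ 2 / 4) * (N1 ^+ 2 * hnorm z) =
  N1 ^+ 2 * hnorm z * (n%:R * hj j * hj j / 4) by ring.
apply: ler_wpM2l; first by rewrite mulr_ge0 ?sqr_ge0.
have : n%:R * hj j * hj j <= t * hj j by rewrite ler_pM2r.
have : 0 <= t * hj j by rewrite mulr_ge0// ltW.
lra.
Qed.

(** On the domain of [P^2] the increments are geometric; this domain is dense ([dense2]), and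
    uniform stability extends convergence to every [x]. *)
Let Tj_cvg t x : 0 <= t -> exists l, (Tj ^~ t ^~ x) ~~> l.
Proof.
move=> t0; apply: (hil_complete hX) => e e0.
have d0 : 0 < e / (4 * N1) by rewrite divr_gt0// mulr_gt0.
have [u [v [w [Puv Pvw xu]]]] := dense2 x d0.
have q01 : 0 <= (2^-1 : R) < 1 by lra.
have [l hl] := hcvg_geom hX q01 (fun n => Tj_step n t0 Puv Pvw).
have e4 : 0 < e / 4 by lra.
have /hcvg_eps/(_ _ e4)[n hn] := hl.
exists n => m p nm np.
have close j : hnorm (Tj j t x - Tj j t u) <= e / 4.
  rewrite /Tj -resB; last exact: hj01.
  apply: le_trans (bnd _ _ (hj01 j)) _; rewrite -ler_pdivlMl//.
  by apply: le_trans xu _; rewrite le_eqVlt; apply/orP; left; apply/eqP; field;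
    rewrite gt_eqF.
have := hnorm_tri hX (Tj m t u) (Tj m t x) (Tj p t x).
have := hnorm_tri hX (Tj p t u) (Tj m t u) (Tj p t x).
have := hnorm_tri hX l (Tj m t u) (Tj p t u).
have := close m; have := close p; have := hn m nm; have := hn p np.
rewrite (hnormBC hX l) (hnormBC hX (Tj p t u) (Tj p t x)); lra.
Qed.

Definition limit_semigroup (t : R) x : X := xget 0 [set l | (Tj ^~ t ^~ x) ~~> l].
Let T := limit_semigroup.

Let TP t x : 0 <= t -> (Tj ^~ t ^~ x) ~~> T t x.
Proof. by move=> t0; have [l hl] := Tj_cvg x t0; by have := @xgetPex _ (0 : X) [set l | (Tj ^~ t ^~ x) ~~> l] (ex_intro _ l hl). Qed.

Lemma limit_semigroup_cvg t x : 0 <= t ->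
  (fun j => iter (Num.truncn (t * 2 ^+ j)) (E (2^-1 ^+ j)) x) ~~> limit_semigroup t x.
Proof. exact: TP. Qed.

Lemma limit_semigroup_bounded t x : 0 <= t -> hnorm (T t x) <= N1 * hnorm x.
Proof.
move=> t0; apply: (hcvg_norm_le hX (TP x t0)).
by apply: nearW => j; exact: bnd.
Qed.

Let squeeze (s : nat -> X) l (r : nat -> R) :
  (forall j, hnorm (s j - l) <= r j) -> r @ \oo --> (0 : R) -> s ~~> l.
Proof.
move=> sr r0; apply: (squeeze_cvgr _ (cvg_cst 0) r0).
by apply: nearW => j; rewrite hnorm_ge0 sr.
Qed.

Let T_lin t k x y : 0 <= t -> T t (k *: x + y) = k *: T t x + T t y.
Proof.
move=> t0; apply: (hcvg_unique hX (TP _ t0)).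
apply: (squeeze (r := fun j => normc k * hnorm (Tj j t x - T t x) +
   hnorm (Tj j t y - T t y))).
  move=> j; rewrite /Tj (resolvent_iterP lP _ _ _ _ (hE (hj01 j))) -/(Tj j t x) -/(Tj j t y).
  rewrite -(hnormZ hX); apply: le_trans (hnormD hX _ _).
  by rewrite le_eqVlt; apply/orP; left; apply/eqP; congr hnorm; lmod.
rewrite -[0]addr0; apply: cvgD; last exact: TP.
by rewrite -[0](mulr0 (normc k)); apply: cvgM; [exact: cvg_cst|exact: TP].
Qed.

Let hj_cvg : hj @ \oo --> (0 : R).
Proof. by apply: cvg_expr; rewrite gtr0_norm; lra. Qed.

Let res_cvgj x : (fun j => E (hj j) x) ~~> x.
Proof.
apply/hcvg_eps => e e0; have [d d0 hd] := res_cvg x e0.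
have /cvgr0Pnorm_lt/(_ d d0)[n _ hn] := hj_cvg; exists n => m nm.
have /andP[hp hp1] := hj01 m; apply: hd; rewrite ?hp ?hp1//.
by have := hn m nm; rewrite /= gtr0_norm.
Qed.

(** The integer part of a sum exceeds the sum of the integer parts by 0 or 1, and one extra step
    tends to the identity by [res_cvgj]. *)
Let T_add t s x : 0 <= s -> 0 <= t -> T (t + s) x = T t (T s x).
Proof.
move=> s0 t0; have ts0 : 0 <= t + s by exact: addr_ge0.
apply: (hcvg_unique hX (TP _ ts0)).
apply: (squeeze (r := fun j => N1 * hnorm (E (hj j) x - x) +
   (N1 * hnorm (Tj j s x - T s x) + hnorm (Tj j t (T s x) - T t (T s x))))); last first.
  rewrite -[0]addr0; apply: cvgD; last first.
    rewrite -[0]addr0; apply: cvgD; last exact: TP.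
    by rewrite -[0](mulr0 N1); apply: cvgM; [exact: cvg_cst|exact: TP].
  by rewrite -[0](mulr0 N1); apply: cvgM; [exact: cvg_cst|exact: res_cvgj].
move=> j; have [r [r1 nE]] : exists r, (r <= 1)%N /\ nj (t + s) j = (r + (nj t j + nj s j))%N.
  have p (k : R) : 0 <= k -> 0 <= k * 2 ^+ j by move=> k0; rewrite mulr_ge0// exprn_ge0.
  have /andP[a1 a2] := truncn_itv (p _ t0); have /andP[b1 b2] := truncn_itv (p _ s0).
  have /andP[c1 c2] := truncn_itv (p _ ts0).
  rewrite -/(nj t j) -/(nj s j) -/(nj (t + s) j) in a1 a2 b1 b2 c1 c2.
  rewrite mulrDl in c1 c2.
  have l1 : (nj t j + nj s j <= nj (t + s) j)%N.
    by rewrite -ltnS -(ltr_nat R) natrD; lra.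
  have l2 : (nj (t + s) j <= (nj t j + nj s j).+1)%N.
    rewrite -ltnS -(ltr_nat R) -addn2 natrD natrD; move: a2 b2; rewrite -(natr1 (nj t j)) -(natr1 (nj s j)); lra.
  exists (nj (t + s) j - (nj t j + nj s j))%N; split; last by rewrite subnK.
  by rewrite leq_subLR addn1.
rewrite /Tj nE; set F := E (hj j); set n := (nj t j + nj s j)%N.
have a1 : hnorm (iter (r + n) F x - iter n F x) <= N1 * hnorm (F x - x).
  case: r r1 {nE} => [|[|//]] _.
    by rewrite subrr (hnorm0 hX) mulr_ge0 ?hnorm_ge0// ltW.
  by rewrite add1n iterSr -resB//; exact: bnd.
have a2 : hnorm (iter n F x - iter (nj t j) F (T s x)) <= N1 * hnorm (Tj j s x - T s x).
  by rewrite iterD -resB//; exact: bnd.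
apply: le_trans (hnorm_tri hX (iter n F x) _ _) _; apply: lerD => //.
by apply: le_trans (hnorm_tri hX (iter (nj t j) F (T s x)) _ _) _; apply: lerD.
Qed.

(** Continuity at time 0 uniform in the step: exact Lipschitz growth for domain vectors, and density
    for the rest. It survives the limit and yields both strong continuity and the generator. *)
Let orbit_close x e : 0 < e -> exists2 K : R, 0 <= K & forall h n, 0 < h <= 1 ->
  hnorm (iter n (E h) x - x) <= e + K * (n%:R * h).
Proof.
move=> e0; have N1p := N10; have d0 : 0 < e / (N1 + 1) by rewrite divr_gt0//; lra.
have [u [v [Puv xu]]] := dense x d0.
exists (N1 * hnorm v); first by rewrite mulr_ge0 ?hnorm_ge0// ltW.
move=> h n h01; have /andP[h0 h1] := h01.
have orb : hnorm (iter n (E h) u - u) <= N1 * hnorm v * (n%:R * h).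
  elim: n => [|n IH]; first by rewrite subrr (hnorm0 hX) mul0r mulr0.
  apply: le_trans (hnorm_tri hX (iter n (E h) u) _ _) _.
  rewrite -(natr1 n) mulrDl mul1r [leRHS]mulrDr addrC; apply: lerD => //.
  have Pn := resolvent_iter_gen lP n (lt0r_neq0 h0) (hE h01) Puv.
  have e1 := resolvent_eq lP (lt0r_neq0 h0) (hE h01) Pn.
  have -> : iter n.+1 (E h) u - iter n (E h) u = h%:C *: iter n.+1 (E h) v.
    by rewrite -[X in _ - X]e1 /=; lmod.
  by rewrite (hnormZp hX) ?(ltW h0)// mulrC ler_pM2r//; exact: bnd.
have -> : iter n (E h) x - x = (iter n (E h) (x - u) - (x - u)) + (iter n (E h) u - u).
  by rewrite resB//; lmod.
apply: le_trans (hnormD hX _ _) _; apply: lerD => //.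
apply: le_trans (hnormB hX _ _) _; have s2 := bnd (x - u) n h01.
have : (N1 + 1) * hnorm (x - u) <= e by rewrite -ler_pdivlMl ?addr_gt0 // mulrC.
lra.
Qed.

Let T_cont x e : 0 < e -> exists2 d : R, 0 < d &
  forall r, 0 < r < d -> hnorm (T r x - x) <= e.
Proof.
move=> e0; have e2 : 0 < e / 2 by lra.
have [K K0 hK] := orbit_close x e2.
exists (e / 2 / (K + 1)); first by rewrite divr_gt0//; lra.
move=> r /andP[r0 rd].
apply: (hcvg_norm_le hX (s := fun j => Tj j r x - x)).
  apply: squeeze (TP x (ltW r0)) => j.
  by rewrite le_eqVlt; apply/orP; left; apply/eqP; congr hnorm; lmod.
apply: nearW => j; apply: le_trans (hK _ _ (hj01 j)) _.
have /andP[nr _] := nj_le j (ltW r0).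
have : K * ((nj r j)%:R * hj j) <= K * r by exact: ler_wpM2l.
move: rd; rewrite ltr_pdivlMr; last by lra.
nra.
Qed.

Let T_C0 : C0_semigroup T.
Proof.
split.
- move=> t t0; split.
  + by move=> u _; exact: hil_car.
  + by move=> k u v _ _; rewrite T_lin//; exact: hsame_refl (hil_ph hX) _.
  + by exists N1 => u _; exact: limit_semigroup_bounded.
- move=> u _; suff -> : T 0 u = u by exact: hsame_refl (hil_ph hX) _.
  apply: (hcvg_unique hX (TP u (lexx 0))).
  apply: (squeeze (r := fun=> 0)) => [j|]; last exact: cvg_cst.
  by rewrite /Tj /nj mul0r truncn0 subrr (hnorm0 hX).
- by move=> s t u s0 t0 _; rewrite T_add//; exact: hsame_refl (hil_ph hX) _.
- move=> u _; apply/(right0_eps (fun r => hnorm_ge0 _)) => e e0; exact: T_cont.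
Qed.

Let T_gen u v : P u v -> generator T u v.
Proof.
move=> Puv; apply/(gen_eps hX) => e e0; have e2 : 0 < e / 2 by lra.
have [K K0 hK] := orbit_close v e2.
exists (e / 2 / (K + 1)); first by rewrite divr_gt0//; lra.
move=> r /andP[r0 rd].
pose s j := Tj j r u - u - ((nj r j)%:R * hj j)%:C *: v.
apply: (hcvg_norm_le hX (s := s)).
  apply: (squeeze (r := fun j => hnorm (Tj j r u - T r u) + hj j * hnorm v)); last first.
    rewrite -[0]addr0; apply: cvgD; first exact: TP (ltW r0).
    by rewrite -[0](mul0r (hnorm v)); apply: cvgM; [exact: hj_cvg|exact: cvg_cst].
  move=> j; have /andP[n1 n2] := nj_le j (ltW r0).
  have -> : s j - (T r u - u - r%:C *: v) =
      (Tj j r u - T r u) + (r - (nj r j)%:R * hj j)%:C *: v by rewrite /s; lmod.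
  apply: le_trans (hnormD hX _ _) _; rewrite lerD2l (hnormZp hX) ?subr_ge0//.
  by apply: ler_wpM2r; [exact: hnorm_ge0|lra].
apply: nearW => j; have /andP[n1 n2] := nj_le j (ltW r0).
have h01 := hj01 j; have /andP[h0 _] := h01; rewrite /s /Tj.
have key n : hnorm (iter n (E (hj j)) u - u - (n%:R * hj j)%:C *: v) <=
    n%:R * hj j * (e / 2 + K * (n%:R * hj j)).
  elim: n => [|n IH]; first by rewrite !mul0r scale0r subr0 subrr (hnorm0 hX).
  have Pn := resolvent_iter_gen lP n (lt0r_neq0 h0) (hE h01) Puv.
  have e1 := resolvent_eq lP (lt0r_neq0 h0) (hE h01) Pn.
  have -> : iter n.+1 (E (hj j)) u - u - (n.+1%:R * hj j)%:C *: v =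
    (iter n (E (hj j)) u - u - (n%:R * hj j)%:C *: v) +
      (hj j)%:C *: (iter n.+1 (E (hj j)) v - v).
    by rewrite -(natr1 n) -[iter n (E (hj j)) u in RHS]e1 /=; lmod.
  apply: le_trans (hnormD hX _ _) _; apply: le_trans (lerD IH (lexx _)) _.
  rewrite (hnormZp hX) ?(ltW h0)//.
  have := ler_wpM2l (ltW h0) (hK _ n.+1 h01); rewrite -(natr1 n).
  set a := hj j * hnorm _ => ha.
  apply: le_trans (lerD (lexx _) ha) _.
  rewrite -subr_ge0 (_ : _ - _ = n%:R * hj j * (K * hj j)); last by ring.
  by rewrite !mulr_ge0// ltW.
apply: le_trans (key _) _; rewrite [leRHS]mulrC.
apply: ler_pM => //.
- by rewrite mulr_ge0// ltW.
- by rewrite addr_ge0 ?(ltW e2)// mulr_ge0// mulr_ge0// ltW.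
have : K * ((nj r j)%:R * hj j) <= K * r by exact: ler_wpM2l.
move: rd; rewrite ltr_pdivlMr; last by lra.
nra.
Qed.

(** [T_gen] gives one inclusion. Conversely, for [(u, v)] in the generator, [w = E 1 (u - v)] solves
    the same resolvent equation as [u]; the difference lies in the kernel of [1 - generator], which
    is zero by [resolvent_comparison] with zero bounds. *)
Theorem generation : C0_semigroup limit_semigroup /\ P = generator limit_semigroup.
Proof.
split; first exact: T_C0.
have TN (t : R) u : 0 <= t -> hnorm (T t u) <= N1 * hnorm u.
  by exact: limit_semigroup_bounded.
have lT := gen_linear hX T_C0 TN.
apply/funext => u; apply/seteqP; split => v; first exact: T_gen.
move=> Guv; have h01 : 0 < (1 : R) <= 1 by rewrite ltr01 lexx.
have [w' Pw ew] := (hE h01).1 (u - v); set w := E 1 (u - v) in Pw ew.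
have Gy := lgB lT (T_gen Pw) Guv.
have ey : (w - u) - (1 : R)%:C *: (w' - v) = 0.
  rewrite (_ : _ - _ = (w - (1 : R)%:C *: w') - (u - v)); last by lmod.
  by rewrite ew subrr.
have wu : w - u = 0.
  apply: (hnorm_le0 hX); rewrite -[X in hnorm X]subr0.
  apply: (resolvent_comparison hX T_C0 TN (psi := fun=> 0) (psit := fun=> 0)
    (dpsi := fun=> 0) ltr01 Gy) => // s s0.
  by rewrite ey subr0 (sg0 hX TN)// (hnorm0 hX).
move/eqP : wu; rewrite subr_eq0 => /eqP wu; move: ey.
rewrite wu subrr sub0r scale1r => /eqP; rewrite oppr_eq0 subr_eq0 => /eqP <-.
by rewrite -wu.
Qed.

End Generation.

(** * The abstract perturbation theorem *)

Section PerturbationTheorem.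
Context {R : realType} {X : hspace R}.
Hypothesis hX : hilbert X.
Variables (T0 : R -> X -> X) (N : R).
Hypothesis hT : C0_semigroup T0.
Hypothesis hN : forall (t : R) u, 0 <= t -> hnorm (T0 t u) <= N * hnorm u.
Variables (g M0 : R).
Hypothesis g12 : 1 <= 2 * g.
Hypothesis dec0 : forall (t : R) u v, 0 < t -> generator T0 u v ->
  hnorm (T0 t u) <= M0 * t `^ (- g) * hnorm v.
Hypothesis rho : forall s : R, resolvent_set (generator T0) (0 +i* s).
Implicit Types (u v w x y f : X).
Local Notation A := (generator T0).
Let lA : linear_graph A := gen_linear hX hT hN.
Let eta : R := (2 * (1 + g))^-1.

Let g0 : 0 < g. Proof. by have := g12; lra. Qed.
Let eta0 : 0 < eta.
Proof. by have gp := g0; rewrite invr_gt0 mulr_gt0//; lra. Qed.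

Lemma resolvent_setP (B : X -> set X) (l : R[i]) : resolvent_set B l <->
  exists K : R, (forall f, exists u, B u (l *: u - f)) /\
    (forall u v, B u v -> hnorm u <= K * hnorm (l *: u - v)).
Proof.
split=> [[K [sur bnd]]|[K [sur bnd]]]; exists K; split=> // f.
  have [u [v [Buv e]]] := sur f (hil_car hX f); exists u.
  by rewrite -(hsame_eq hX e) opprB addrCA subrr addr0.
move=> _; have [u Bu] := sur f; exists u, (l *: u - f); split=> //.
by rewrite opprB addrCA subrr addr0; exact: hsame_refl (hil_ph hX) _.
Qed.

Let at0 : exists2 K : R, 0 <= K & (forall f, exists u, A u f) /\
  (forall u v, A u v -> hnorm u <= K * hnorm v).
Proof.
have /resolvent_setP[K [sur bnd]] := rho 0.
have z0 u : (0 +i* 0 : R[i]) *: u = 0 by rewrite (_ : 0 +i* 0 = 0)// scale0r.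
exists `|K| => //; split=> [f|u v Auv].
  by have [u] := sur (- f); rewrite z0 sub0r opprK; exists u.
have := bnd _ _ Auv; rewrite z0 sub0r (hnormN hX) => h; apply: le_trans h _.
by rewrite ler_wpM2r ?hnorm_ge0// ler_norm.
Qed.

(** The rate [t^(-g)] is singular at 0. For [s <= 1], boundedness of the semigroup and of the
    inverse of the generator take over; [2^g] compares [s] or 1 with [1 + s]. *)
Let decD : exists2 D : R, 0 < D & forall (s : R) u v, 0 <= s -> A u v ->
  hnorm (T0 s u) <= D * hnorm v * (1 + s) `^ (- g).
Proof.
have [K K0 [_ bnd]] := at0; have gp := g0.
pose D : R := 2 `^ g * (`|M0| + `|N| * K + 1).
have NK : 0 <= `|N| * K by rewrite mulr_ge0.
have M00 := normr_ge0 M0.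
have p2 : 0 < 2 `^ g :> R by rewrite powR_gt0.
exists D; first by rewrite mulr_gt0//; lra.
move=> s u v s0 Auv; have v0 := hnorm_ge0 v.
suff : exists2 q : R, hnorm (T0 s u) <= (`|M0| + `|N| * K) * hnorm v * q &
    0 <= q <= 2 `^ g * (1 + s) `^ (- g).
  move=> [q h /andP[q0 q1]]; apply: le_trans h _.
  have M00' : 0 <= (`|M0| + `|N| * K) * hnorm v by rewrite mulr_ge0// addr_ge0.
  apply: le_trans (ler_wpM2l M00' q1) _.
  rewrite /D -subr_ge0 (_ : _ - _ = 2 `^ g * hnorm v * (1 + s) `^ (- g)); last by ring.
  by rewrite !mulr_ge0// ?powR_ge0// ltW.
have s1 : 0 < 1 + s by lra.
have [sle|sgt] := leP s 1.
  exists 1.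
    rewrite mulr1; apply: le_trans (hN _ s0) _.
    apply: (@le_trans _ _ (`|N| * (K * hnorm v))).
      apply: (@le_trans _ _ (`|N| * hnorm u)).
        by apply: ler_wpM2r; [exact: hnorm_ge0|exact: ler_norm].
      by apply: ler_wpM2l => //; exact: bnd.
    by rewrite mulrA; apply: ler_wpM2r => //; rewrite lerDr.
  rewrite ler01/= powRN -(ler_pM2r (powR_gt0 g s1)) mul1r divfK.
    by apply: ge0_ler_powR; rewrite ?nnegrE; lra.
  by rewrite gt_eqF// powR_gt0.
have sp : 0 < s by lra.
exists (s `^ (- g)).
  apply: le_trans (dec0 sp Auv) _; rewrite mulrAC; apply: ler_wpM2r; first exact: powR_ge0.
  apply: ler_wpM2r => //; apply: le_trans (ler_norm _) _; rewrite lerDl//.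
rewrite powR_ge0/= !powRN ler_pdivlMr ?powR_gt0// mulrC ler_pdivrMr ?powR_gt0//.
rewrite -powRM//.
by apply: ge0_ler_powR; rewrite ?nnegrE; lra.
Qed.

(** The threshold [k0] depends on the unperturbed semigroup alone through [D] and [g]; the
    dissipation constant [del] enters only the size of the resulting bounds. All estimates are made
    for the Euler iterates with constants uniform in the step, and pass to the limit through
    [generation]. *)
Lemma perturbation_theorem : exists2 k0 : R, 0 < k0 &
  forall b b' b'' c, A b b' -> A b' b'' ->
  (exists2 del : R, 0 < del &
    forall u v, A u v -> del * normc (hip u c) ^+ 2 <= - Re (hip v u)) ->
  (hnorm b + hnorm b' + hnorm b'') * hnorm c <= k0 ->
  exists T : R -> X -> X, [/\ C0_semigroup T, perturbed A b c = generator T,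
    exists N' : R, forall (t : R) u, 0 <= t -> hnorm (T t u) <= N' * hnorm u,
    forall s : R, resolvent_set (perturbed A b c) (0 +i* s) &
    exists2 M' : R, 0 < M' & forall (t : R) u v, 0 < t -> perturbed A b c u v ->
      hnorm (T t u) <= M' * t `^ (- g) * hnorm v].
Proof.
have [D D0 dec] := decD; have gp := g0; have etap := eta0.
pose K1 : R := 3 + 8 * D ^+ 2 / eta; pose K2 : R := 4 * K1 + 1.
have K10 : 0 < K1.
  have : 0 < 8 * D ^+ 2 / eta by rewrite divr_gt0// mulr_gt0// exprn_gt0.
  by rewrite /K1; lra.
have K20 : 0 < K2 by rewrite /K2; lra.
(* This makes [K2 eps |c| <= 1/8], so the squared loop gain [2 (K2 eps |c|)^2] of [multiplier] is at
   most [1/32]. *)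
exists (8^-1 / K2); first by rewrite divr_gt0.
move=> b b' b'' c Ab Ab' [del del0 diss] small.
set eps := hnorm b + hnorm b' + hnorm b'' in small.
have eps0 : 0 <= eps by rewrite !addr_ge0 ?hnorm_ge0.
have c0 := hnorm_ge0 c.
have q8 : K2 * eps * hnorm c <= 8^-1 by rewrite -mulrA mulrC -ler_pdivlMr.
have q0 : 0 <= K2 * eps * hnorm c by rewrite !mulr_ge0// ltW.
have [K K0 [sur0 bnd0]] := at0.
have dissA u v : A u v -> Re (hip v u) <= 0.
  move=> Auv; rewrite -oppr_ge0; apply: le_trans (diss _ _ Auv).
  by rewrite mulr_ge0 ?sqr_ge0// ltW.
have [J hJ] : exists J : R -> X -> X, forall h, 0 < h <= 1 -> resolvent A h (J h).
  have /choice[J hJ] : forall h : R, exists J, 0 < h <= 1 -> resolvent A h J.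
    move=> h; case: (boolP (0 < h <= 1)) => [/andP[h0 h1]|]; last by exists id.
    by have [J hJ] := resolvent_exists hX lA dissA sur0 bnd0 h0; exists J.
  by exists J.
have hgt (h : R) : 0 < h <= 1 -> 0 < h by case/andP.
have contr (h : R) x : 0 < h <= 1 -> hnorm (J h x) <= hnorm x.
  by move=> h01; have := @resolvent_contr _ _ A hX dissA h (J h) x (ltW (hgt _ h01)) (hJ _ h01).
have dec2 (h : R) n u v : 0 < h <= 1 -> A u v ->
    hnorm (iter n (J h) u) ^+ 2 * (1 + n%:R * (eta * h)) <= (D * hnorm v) ^+ 2.
  move=> h01 Auv; have hp := hgt _ h01.
  have := resolvent_decay hX hT hN g0 (ltW D0) dec n h01 (hJ _ h01) Auv.
  have B1 : 1 <= 1 + n%:R * (eta * h) by rewrite lerDl !mulr_ge0// ltW.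
  rewrite -/eta; set B := 1 + _ in B1 * => hd; have Bp : 0 < B by lra.
  apply: (@le_trans _ _ ((D * hnorm v * B `^ (- g)) ^+ 2 * B)).
    rewrite ler_pM2r// ler_pXn2r ?nnegrE ?hnorm_ge0//.
    by rewrite mulr_ge0 ?powR_ge0// mulr_ge0 ?hnorm_ge0// ltW.
  rewrite exprMn -mulrA; apply: ler_piMr; first exact: sqr_ge0.
  rewrite -powR_mulrn ?powR_ge0// -powRrM -ler_pdivlMr// mul1r.
  rewrite -[leRHS]powR_inv1 ?(ltW Bp)//; apply: ler_powR => //.
  by have := g12; lra.
have mult8 (h : R) (f : nat -> R[i]) L : 0 < h <= 1 ->
    \sum_(n < L) normc (hip (response h (J h) b f n.+1) c) ^+ 2 <=
    32^-1 * \sum_(n < L) normc (f n) ^+ 2.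
  move=> h01; apply: le_trans (multiplier hX lA h01 etap D0 (hJ _ h01)
    (fun x => contr h x h01) (fun n u v => dec2 h n u v h01) Ab Ab' c f L) _.
  apply: ler_wpM2r; first by apply: sumr_ge0 => i _; exact: sqr_ge0.
  rewrite -/K1 -/K2 -/eps.
  have : (K2 * eps * hnorm c) ^+ 2 <= 8^-1 ^+ 2 by rewrite ler_pXn2r ?nnegrE.
  by lra.
have mult (h : R) (f : nat -> R[i]) L : 0 < h <= 1 ->
    \sum_(n < L) normc (hip (response h (J h) b f n.+1) c) ^+ 2 <=
    8^-1 * \sum_(n < L) normc (f n) ^+ 2.
  move=> h01; apply: le_trans (mult8 h f L h01) _.
  apply: ler_wpM2r; first by apply: sumr_ge0 => i _; exact: sqr_ge0.
  by rewrite lef_pV2 ?posrE// ler_nat.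
(* The gain bound for a single unit impulse: the first response is [h J b], and
   [1/32 <= (1/4)^2]. *)
have smallk (h : R) : 0 < h <= 1 -> normc (hip (h%:C *: J h b) c) <= 4^-1.
  move=> h01; have := mult8 h (fun=> 1) 1%N h01.
  have -> : h%:C *: J h b = response h (J h) b (fun=> 1) 1.
    by rewrite /= add0r mulr1 (resolventZ lA _ _ (hJ _ h01)).
  rewrite !big_ord1 Normc.normc1 expr1n mulr1.
  set x := normc _ => hx; have x0 : 0 <= x by exact: normc_ge0.
  rewrite -(@ler_pXn2r _ 2)// ?nnegrE//; apply: le_trans hx _.
  by rewrite exprVn lef_pV2 ?posrE// -natrX ler_nat.
pose E (h : R) := perturbed_resolvent b c h (J h).
pose P := perturbed A b c.
have lP : linear_graph P := perturbed_linear b c hX lA.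
have hE (h : R) : 0 < h <= 1 -> resolvent P h (E h).
  by move=> h01; exact (perturbed_resolventP hX lA (hJ _ h01) (smallk _ h01)).
pose Cb : R := 2 * D ^+ 2 * hnorm b''; pose a : R := eta / 2.
have a0 : 0 < a by rewrite divr_gt0.
have Cb0 : 0 <= Cb.
  by apply: mulr_ge0; [apply: mulr_ge0 => //; exact: sqr_ge0|exact: hnorm_ge0].
have decb (h : R) n : 0 < h <= 1 -> hnorm (iter n (J h) b) <= Cb / (1 + n%:R * (a * h)).
  move=> h01; exact (resolvent_decay2 hX hT hN g0 (ltW D0) dec n g12 h01 (hJ _ h01) Ab Ab'
    (fun x => contr h x h01)).
pose N1 : R := 1 + Num.sqrt (Cb ^+ 2 / a * (2 / del)).
have N11 : 1 <= N1 by rewrite lerDl sqrtr_ge0.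
have bnd (h : R) x n : 0 < h <= 1 -> hnorm (iter n (E h) x) <= N1 * hnorm x.
  move=> h01; exact (perturbed_bounded hX lA (hgt _ h01) (hJ _ h01)
    (fun x => contr h x h01) (smallk _ h01) del0 diss (fun (f : nat -> R[i]) L => mult h f L h01)
    a0 Cb0 (fun n => decb h n h01) x n).
(* [P] and [A] have the same domain, in which [J h x] tends to [x]. *)
have dense x (e : R) : 0 < e -> exists u v, P u v /\ hnorm (x - u) <= e.
  move=> e0; have [d d0 hd] := resolvent_cvg hX hT hN x e0.
  pose h := Num.min 1 (d / 2).
  have h01 : 0 < h <= 1 by rewrite lt_min ltr01 divr_gt0//= ge_min lexx.
  have hlt : 0 < h < d.
    rewrite (hgt _ h01)/=; apply: (@le_lt_trans _ _ (d / 2)); last by lra.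
    by rewrite ge_min lexx orbT.
  have [v Av _] := (hJ _ h01).1 x.
  exists (J h x), (v + hip (J h x) c *: b); split; first by rewrite /P /perturbed/= addrK.
  by rewrite (hnormBC hX); exact: hd hlt (hJ _ h01).
have [TC0 TG] := generation hX lP hE N11 bnd dense.
have Tcvg := limit_semigroup_cvg hX lP hE N11 bnd dense.
have Tbnd := limit_semigroup_bounded hX lP hE N11 bnd dense.
set T := limit_semigroup E in TC0 TG Tcvg Tbnd.
(* Rank-one inversion at [l = i s]: with [w = (l - A)^-1 b] the denominator is [1 - <w,c>], and
   [|<w,c>| <= 2 K2 eps |c| <= 1/4] by [apriori_imaginary]. *)
have rhoP (s : R) : resolvent_set P (0 +i* s).
  have /resolvent_setP[Ks [surs bnds]] := rho s.
  have [w Aw] := surs b; set l := 0 +i* s in surs bnds Aw *.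
  have wc : normc (hip w c) <= 4^-1.
    have sn := normr_ge0 s; have s2 := sqr_ge0 s.
    (* The step [1 / m] meets both smallness conditions of [apriori_imaginary]. *)
    pose m : R := 1 + `|s| + 2 * K1 * (1 + 2 * `|s|) ^+ 2 * s ^+ 2.
    have z0 : 0 <= 2 * K1 * (1 + 2 * `|s|) ^+ 2 * s ^+ 2.
      apply: mulr_ge0 => //; apply: mulr_ge0; last exact: sqr_ge0.
      by rewrite mulr_ge0// ltW.
    have m1 : 1 <= m by rewrite /m; lra.
    have mp : 0 < m by lra.
    have h01 : 0 < m^-1 <= 1 by rewrite invr_gt0 mp/= invf_le1.
    have c1 : m^-1 * `|s| <= 1 by rewrite mulrC ler_pdivrMr// mul1r /m; lra.
    have c2 : K1 * (1 + 2 * `|s|) ^+ 2 * (m^-1 * s ^+ 2) <= 2^-1.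
      rewrite (_ : _ * _ = K1 * (1 + 2 * `|s|) ^+ 2 * s ^+ 2 / m); last by ring.
      by rewrite ler_pdivrMr// /m; lra.
    have ew : l *: w - (l *: w - b) = b by rewrite opprB addrCA subrr addr0.
    have hw := apriori_imaginary hX lA h01 etap D0 (hJ _ h01)
      (fun x => contr _ x h01) (fun n u v => dec2 _ n u v h01) Ab Ab' c1 c2 Aw ew.
    rewrite -/K1 -/K2 -/eps in hw.
    apply: le_trans (CS hX _ _) _; apply: le_trans (ler_wpM2r c0 hw) _.
    by move: q8; rewrite -!mulrA; lra.
  have wc1 : 4^-1 <= normc (1 - hip w c).
    have := le_normcD (1 - hip w c) (hip w c).
    by rewrite subrK Normc.normc1; lra.
  have wc0 : 1 - hip w c != 0.
    apply/eqP => e; move: wc1; rewrite e Normc.normc0; lra.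
  apply/resolvent_setP; exists ((1 + 4 * hnorm c * hnorm w) * Ks); split=> [f|u v Puv].
    have [u0 Au0] := surs f; pose phi := hip u0 c / (1 - hip w c).
    exists (u0 + phi *: w); rewrite /P /perturbed/= ipDl// ipZl//.
    have -> : hip u0 c + phi * hip w c = phi by rewrite /phi; field.
    have := lA.2 phi _ _ _ _ Aw Au0; rewrite addrC; congr (A _ _); lmod.
  set f := hip u c; have Auv : A u (v - f *: b) by [].
  have := bnds _ _ (lgB lA Auv (lgZ lA f Aw)).
  have -> : l *: (u - f *: w) - (v - f *: b - f *: (l *: w - b)) = l *: u - v by lmod.
  set y := hnorm (l *: u - v); set u' := u - f *: w => hu'.
  have fu' : hip u' c = f * (1 - hip w c) by rewrite ipBl// ipZl// -/f; ring.
  have nf : normc f <= 4 * hnorm c * hnorm u'.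
    have := CS hX u' c; rewrite fu' Normc.normcM => h1.
    have := ler_wpM2l (normc_ge0 f) wc1; lra.
  have -> : u = u' + f *: w by rewrite subrK.
  apply: le_trans (hnormD hX _ _) _; rewrite (hnormZ hX) -mulrA.
  have w0 := hnorm_ge0 w; have := ler_wpM2r w0 nf.
  have F0 : 0 <= 1 + 4 * hnorm c * hnorm w by rewrite addr_ge0// !mulr_ge0// hnorm_ge0.
  have := ler_wpM2l F0 hu'; lra.
exists T; split=> //; first by exists N1.
have /resolvent_setP[K0' [_ bndP0]] := rhoP 0.
have Kp u v : P u v -> hnorm u <= `|K0'| * hnorm v.
  move=> Puv; have := bndP0 _ _ Puv.
  rewrite (_ : (0 +i* 0) = 0)// scale0r sub0r (hnormN hX) => h; apply: le_trans h _.
  by rewrite ler_wpM2r ?hnorm_ge0// ler_norm.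
have N10 : 0 < N1 by lra.
(* It bounds, relative to [y = P x], the norm of [x] and [D] times the norm of [A] along the whole
   orbit, since [A (E^k x) = E^k y - <E^k x, c> b]. *)
pose Yc : R := D * (N1 + hnorm b * hnorm c * N1 * `|K0'|) + `|K0'|.
pose F : R := 2 / del; pose c3 : R := (3 `^ g) ^+ 2.
have F0 : 0 <= F by rewrite divr_ge0// ltW.
have c30 : 0 < c3 by rewrite exprn_gt0// powR_gt0.
pose G : R := 64 * N1 ^+ 6 * F * (Cb / a) ^+ 2 * c3.
pose t0 : R := 1 + G ^+ 2 * (1 + a).
have t00 : 0 <= t0.
  by rewrite addr_ge0// mulr_ge0 ?sqr_ge0// addr_ge0// ltW.
pose w0 : R := ((1 + eta * (3 * t0 + 2)) `^ (- g)) ^+ 2.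
have B0 : 0 < 1 + eta * (3 * t0 + 2).
  by rewrite ltr_wpDr// mulr_ge0 ?(ltW etap)//; lra.
have w00 : 0 < w0 by rewrite exprn_gt0// powR_gt0.
pose Q : R := 4 * N1 ^+ 4 * c3 + N1 ^+ 2 / w0.
have Q0 : 0 <= Q.
  apply: addr_ge0; last by apply: divr_ge0; [exact: sqr_ge0|exact: ltW].
  by apply: mulr_ge0; [apply: mulr_ge0 => //; apply: exprn_ge0; exact: ltW|exact: ltW].
have nbc : 0 <= hnorm b * hnorm c * N1 * `|K0'|.
  by rewrite mulr_ge0// mulr_ge0 ?(ltW N10)// mulr_ge0 ?hnorm_ge0.
have Yc0 : 0 <= Yc by rewrite addr_ge0// mulr_ge0 ?(ltW D0)// addr_ge0// ltW.
have eta1 : eta <= 1.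
  by rewrite /eta invf_le1 ?mulr_gt0 ?addr_gt0// mulrDr mulr1 -[leLHS]addr0 lerD ?ler1n ?mulr_ge0 ?(ltW gp).
have orbit (h : R) n x y : 0 < h <= 1 -> P x y ->
    hnorm (iter n (E h) x) <= Num.sqrt Q * Yc * hnorm y * (1 + n%:R * (eta * h)) `^ (- g).
  move=> h01 Pxy; have /andP[hp h1] := h01; have y0 := hnorm_ge0 y.
  have eh0 : 0 < eta * h by rewrite mulr_gt0.
  have eh1 : eta * h <= 1 by rewrite -[1]mulr1 ler_pM// ltW.
  pose W (k : nat) : R := ((1 + k%:R * (eta * h)) `^ (- g)) ^+ 2.
  have Bk (k : nat) : 0 < 1 + k%:R * (eta * h) by rewrite ltr_wpDr// mulr_ge0// ltW.
  have W0 k : 0 < W k by rewrite exprn_gt0// powR_gt0.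
  have W3 L k : (k <= 3 * L + 2)%N -> W L <= c3 * W k.
    (* Because [eta h <= 1], [k <= 3 L + 2] gives [1 + k eta h <= 3 (1 + L eta h)]; hence the
       constant [(3^g)^2]. *)
    move=> kL; rewrite /W /c3 -exprMn ler_pXn2r ?nnegrE ?mulr_ge0 ?powR_ge0//.
    rewrite !powRN ler_pdivlMr ?powR_gt0// mulrC ler_pdivrMr ?powR_gt0// -powRM ?(ltW (Bk _))//.
    apply: ge0_ler_powR; rewrite ?nnegrE ?(ltW g0) ?mulr_ge0 ?(ltW (Bk _))//.
    have : k%:R <= 3 * L%:R + 2 :> R by rewrite -natrM -natrD ler_nat.
    move=> /(ler_wpM2r (ltW eh0)); lra.
  have Ww0 k : k%:R * h <= 3 * t0 + 2 -> w0 <= W k.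
    move=> kh; rewrite /w0 /W ler_pXn2r ?nnegrE ?powR_ge0//.
    rewrite !powRN lef_pV2 ?posrE ?powR_gt0//.
    apply: ge0_ler_powR; rewrite ?nnegrE ?(ltW g0) ?(ltW (Bk _)) ?(ltW B0)//.
    by rewrite lerD2l mulrCA ler_pM2l.
  have feed z L : h * \sum_(k < L) normc (hip (iter k.+1 (E h) z) c) ^+ 2 <= F * hnorm z ^+ 2.
    exact (feed_sum hX lA (hgt _ h01) (hJ _ h01) (smallk _ h01) del0 diss
      (fun (f : nat -> R[i]) L => mult h f L h01) z L).
  have duhamel z k : hnorm (iter k (E h) z) <= hnorm (iter k (J h) z) +
      h * \sum_(m < k) normc (hip (iter m.+1 (E h) z) c) * hnorm (iter (k - m) (J h) b).
    rewrite {1}/E (perturbed_iterE hX lA (hJ _ h01) (smallk _ h01)).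
    apply: le_trans (hnormD hX _ _) _; rewrite lerD2l.
    exact (response_bound hX lA b hp (hJ _ h01) _ k).
  have xY : hnorm x <= Yc * hnorm y.
    apply: le_trans (Kp _ _ Pxy) _; apply: ler_wpM2r => //.
    by rewrite lerDr mulr_ge0 ?(ltW D0)// addr_ge0// ltW.
  have decx k m : hnorm (iter m (J h) (iter k (E h) x)) ^+ 2 <= (Yc * hnorm y) ^+ 2 * W m.
    have Pk := resolvent_iter_gen lP k (lt0r_neq0 hp) (hE _ h01) Pxy.
    have Ak : A (iter k (E h) x) (iter k (E h) y - hip (iter k (E h) x) c *: b) by [].
    have := resolvent_decay hX hT hN g0 (ltW D0) dec m h01 (hJ _ h01) Ak; rewrite -/eta => hd.
    rewrite /W -exprMn ler_pXn2r ?nnegrE ?hnorm_ge0//; last first.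
      by rewrite mulr_ge0 ?powR_ge0// mulr_ge0.
    apply: le_trans hd _; apply: ler_wpM2r; first exact: powR_ge0.
    apply: (@le_trans _ _ (D * (N1 * hnorm y + hnorm b * hnorm c * N1 * `|K0'| * hnorm y))).
      rewrite ler_pM2l//; apply: le_trans (hnormB hX _ _) _; apply: lerD; first exact: bnd.
      rewrite (hnormZ hX) mulrC -!mulrA; apply: ler_wpM2l; first exact: hnorm_ge0.
      apply: le_trans (CS hX _ _) _; rewrite mulrC; apply: ler_wpM2l => //.
      by apply: le_trans (bnd _ _ _ h01) _; rewrite ler_pM2l//; exact: Kp.
    rewrite -mulrDl mulrA; apply: ler_wpM2r => //; rewrite /Yc lerDl//.
  have := perturbed_decay h01 N11 F0 Cb0 a0 c30 w00 (fun z k => bnd h z k h01) feed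
    duhamel (fun k => decb h k h01) decx xY W0 W3 Ww0 n.
  rewrite -/Q => hd.
  rewrite -(@ler_pXn2r _ 2)// ?nnegrE ?hnorm_ge0//.
    by apply: le_trans hd _; rewrite /W !exprMn (sqr_sqrtr Q0) [Q * (_ * _)]mulrA.
  by rewrite !mulr_ge0 ?powR_ge0// ?sqrtr_ge0.
pose M' : R := Num.sqrt Q * Yc * (eta / 2) `^ (- g) + 1.
have M'0 : 0 < M' by rewrite ltr_wpDl// !mulr_ge0 ?powR_ge0// ?sqrtr_ge0.
exists M' => // t u v tp Puv; have v0 := hnorm_ge0 v.
apply: (hcvg_norm_le hX (Tcvg t u (ltW tp))).
have hjc : (fun j : nat => (2^-1 : R) ^+ j) @ \oo --> (0 : R).
  by apply: cvg_expr; rewrite gtr0_norm; lra.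
have t2 : 0 < t / 2 by lra.
have /cvgr0Pnorm_le/(_ _ t2)[n _ hn] := hjc; exists n => // j nj /=.
have hj2 : 0 < (2^-1 : R) ^+ j <= 1.
  by rewrite exprn_gt0 ?invr_gt0//= exprn_ile1// invf_le1// ler1n.
have := hn j nj; rewrite /= gtr0_norm ?(hgt _ hj2)// => hjt.
apply: le_trans (orbit _ _ _ _ hj2 Puv) _.
have p : 0 <= t * 2 ^+ j by rewrite mulr_ge0 ?(ltW tp)// exprn_ge0.
have /andP[_ nt] := truncn_itv p; set k := Num.truncn _ in nt *.
set h := 2^-1 ^+ j in hj2 hjt *.
have h2 : 2 ^+ j * h = 1 by rewrite /h exprVn mulfV// gt_eqF// exprn_gt0.
(* Rounding [t] down loses at most one step, and [h <= t / 2] for the steps considered. *)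
have kt : t / 2 <= k%:R * h.
  have : t <= k%:R * h + h; last by lra.
  rewrite (_ : k%:R * h + h = (k%:R + 1) * h); last by ring.
  have tE : t = t * 2 ^+ j * h by rewrite -mulrA h2 mulr1.
  by rewrite [leLHS]tE ler_pM2r ?(hgt _ hj2)// natr1 ltW.
have pw : (1 + k%:R * (eta * h)) `^ (- g) <= (eta / 2) `^ (- g) * t `^ (- g).
  have et0 : 0 < eta / 2 * t by rewrite mulr_gt0// divr_gt0.
  have kk : 0 <= k%:R * (eta * h) by rewrite mulr_ge0// mulr_ge0 ?(ltW etap)// ltW// (hgt _ hj2).
  rewrite -powRM ?(ltW tp)//; last by rewrite ltW// divr_gt0.
  rewrite !powRN lef_pV2 ?posrE ?powR_gt0//; last by lra.
  apply: ge0_ler_powR; rewrite ?nnegrE ?(ltW g0) ?(ltW et0)//; first by lra.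
  have := ler_wpM2l (ltW etap) kt; lra.
have SY : 0 <= Num.sqrt Q * Yc * hnorm v by rewrite !mulr_ge0 ?sqrtr_ge0.
apply: le_trans (ler_wpM2l SY pw) _.
rewrite /M' -subr_ge0 (_ : _ - _ = t `^ (- g) * hnorm v); last by ring.
by rewrite mulr_ge0// powR_ge0.
Qed.

End PerturbationTheorem.

(** * The Hilbert space of classes, realized on chosen representatives *)

Section Quotient.
Variables (R : realType) (H : hspace R).

(** The choice is made from the class itself, so equivalent vectors have equal canonical
    representatives ([canon_eq]). *)
Definition canon (u : H) : H := xget 0 [set v | hcar v /\ hsame u v].

Hypothesis pH : prehilbert H.

Lemma canonP u : hcar u -> hcar (canon u) /\ hsame u (canon u).
Proof.
move=> hu; have := @xgetPex _ (0 : H) [set v | hcar v /\ hsame u v].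
by apply; exists u; split=> //; exact: hsame_refl.
Qed.

Lemma canon_eq u v : hcar u -> hcar v -> hsame u v -> canon u = canon v.
Proof.
move=> hu hv uv; rewrite /canon; congr xget; apply/seteqP; split=> w /= [hw e]; split=> //.
- exact: (hsame_trans pH hv hu hw (hsame_sym pH hu hv uv) e).
- exact: (hsame_trans pH hu hv hw uv e).
Qed.

Lemma canonK u : hcar u -> canon (canon u) = canon u.
Proof.
by move=> hu; have [hc e] := canonP hu; apply/esym; exact: canon_eq.
Qed.

End Quotient.

(** The quotient of a pre-Hilbert space by its null vectors, realized on the
    canonical representatives. *)
Definition hq (R : realType) (H : hspace R) of prehilbert H : Type :=
  {u : H | `[< hcar u /\ canon u = u >]}.

Section QuotientOperations.
Variables (R : realType) (H : hspace R) (pH : prehilbert H).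
Local Notation Q := (hq pH).

HB.instance Definition _ := gen_eqMixin (hq pH).
HB.instance Definition _ := gen_choiceMixin (hq pH).

Definition hq_rep (x : Q) : H := sval x.

Lemma hq_rep_inj : injective hq_rep.
Proof.
move=> [u pu] [v pv]; rewrite /hq_rep/= => e; move: pu pv; rewrite e => pu pv.
by congr exist; exact: bool_irrelevance.
Qed.

Lemma hq_repP (x : Q) : hcar (hq_rep x) /\ canon (hq_rep x) = hq_rep x.
Proof. by apply/asboolP; exact: (svalP x). Qed.

Lemma hq_rep_car (x : Q) : hcar (hq_rep x). Proof. exact: (hq_repP x).1. Qed.

Lemma hq_pi_subproof (u : H) :
  `[< hcar (if `[< hcar u >] then canon u else canon 0) /\
      canon (if `[< hcar u >] then canon u else canon 0) =
      (if `[< hcar u >] then canon u else canon 0) >].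
Proof.
apply/asboolP; case: asboolP => hu.
  by split; [exact: (canonP pH hu).1|exact: canonK].
by have h0 := ph_car0 pH; split; [exact: (canonP pH h0).1|exact: canonK].
Qed.

(** Made total by sending vectors outside [hcar] to the class of 0. *)
Definition hq_pi (u : H) : Q :=
  @exist H (fun v => `[< hcar v /\ canon v = v >]) _ (hq_pi_subproof u).

Lemma hq_rep_pi u : hcar u -> hq_rep (hq_pi u) = canon u.
Proof. by move=> hu; rewrite /hq_rep/=; case: asboolP. Qed.

Lemma hq_rep_same u : hcar u -> hsame u (hq_rep (hq_pi u)).
Proof. by move=> hu; rewrite hq_rep_pi//; exact: (canonP pH hu).2. Qed.

Lemma hq_repK x : hq_pi (hq_rep x) = x.
Proof.
have [hx e] := hq_repP x; apply: hq_rep_inj.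
by rewrite hq_rep_pi.
Qed.

Lemma hq_pi_eq u v : hcar u -> hcar v -> hsame u v -> hq_pi u = hq_pi v.
Proof.
move=> hu hv e; apply: hq_rep_inj; 
by rewrite !hq_rep_pi//; exact: canon_eq.
Qed.

Definition hq_add (x y : Q) : Q := hq_pi (hq_rep x + hq_rep y).
Definition hq_opp (x : Q) : Q := hq_pi (- hq_rep x).
Definition hq_scale (k : R[i]) (x : Q) : Q := hq_pi (k *: hq_rep x).

Lemma hq_scaleE k u : hcar u -> hq_scale k (hq_pi u) = hq_pi (k *: u).
Proof.
move=> hu; have hr := hq_rep_car (hq_pi u).
apply: hq_pi_eq; [exact: ph_carZ|exact: ph_carZ|].
have e := hsame_sym pH hu hr (hq_rep_same hu).
have := hsame_comb pH k hr hu (ph_car0 pH) (ph_car0 pH) e (hsame_refl pH _).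
by rewrite !addr0.
Qed.

Lemma hq_addE u v : hcar u -> hcar v -> hq_add (hq_pi u) (hq_pi v) = hq_pi (u + v).
Proof.
move=> hu hv; have hr := hq_rep_car (hq_pi u); have hr' := hq_rep_car (hq_pi v).
apply: hq_pi_eq; [exact: ph_carD|exact: ph_carD|].
have e := hsame_sym pH hu hr (hq_rep_same hu).
have e' := hsame_sym pH hv hr' (hq_rep_same hv).
by have := hsame_comb pH 1 hr hu hr' hv e e'; rewrite !scale1r.
Qed.

Let surj (P : Q -> Prop) : (forall u, hcar u -> P (hq_pi u)) -> forall x, P x.
Proof. by move=> h x; rewrite -(hq_repK x); apply: h; exact: hq_rep_car. Qed.

Let cD := ph_carD pH.
Let cZ := ph_carZ pH.
Let cN := ph_carN pH.

Lemma hq_addA : associative hq_add.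
Proof.
elim/surj => u hu; elim/surj => v hv; elim/surj => w hw.
by rewrite !hq_addE ?addrA//; exact: cD.
Qed.

Lemma hq_addC : commutative hq_add.
Proof.
by elim/surj => u hu; elim/surj => v hv; rewrite !hq_addE// addrC.
Qed.

Lemma hq_add0 : left_id (hq_pi 0) hq_add.
Proof. by elim/surj => u hu; rewrite hq_addE ?add0r//; exact: ph_car0. Qed.

Lemma hq_addN : left_inverse (hq_pi 0) hq_opp hq_add.
Proof.
elim/surj => u hu; have -> : hq_opp (hq_pi u) = hq_pi (- u).
  by have := hq_scaleE (-1) hu; rewrite /hq_scale !scaleN1r.
by rewrite hq_addE ?addNr//; exact: cN.
Qed.

HB.instance Definition _ := GRing.isZmodule.Build (hq pH) hq_addA hq_addC hq_add0 hq_addN.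

Lemma hq_scaleA (a b : R[i]) (x : Q) : hq_scale a (hq_scale b x) = hq_scale (a * b) x.
Proof.
by elim/surj : x => u hu; rewrite !hq_scaleE ?scalerA//; exact: cZ.
Qed.

Lemma hq_scale1 : left_id 1 hq_scale.
Proof. by elim/surj => u hu; rewrite hq_scaleE// scale1r. Qed.

Lemma hq_scaleDr : right_distributive hq_scale +%R.
Proof.
move=> k; elim/surj => u hu; elim/surj => v hv.
by rewrite [hq_pi u + _]hq_addE// !hq_scaleE ?[RHS]hq_addE ?scalerDr//; auto.
Qed.

Lemma hq_scaleDl (x : Q) : {morph hq_scale^~ x : a b / a + b}.
Proof.
by move=> a b; elim/surj : x => u hu; rewrite !hq_scaleE// [RHS]hq_addE ?scalerDl//; auto.
Qed.

HB.instance Definition _ := GRing.Zmodule_isLmodule.Build R[i] (hq pH)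
  hq_scaleA hq_scale1 hq_scaleDr hq_scaleDl.

Definition quot : hspace R :=
  @HSpace R Q setT (fun x y => hip (hq_rep x) (hq_rep y)).

Definition qpi (u : H) : quot := hq_pi u.
Definition rep (x : quot) : H := hq_rep x.

Lemma rep_car x : hcar (rep x). Proof. exact: hq_rep_car. Qed.
Lemma repK x : qpi (rep x) = x. Proof. exact: hq_repK. Qed.
Lemma pi_same u v : hcar u -> hcar v -> hsame u v -> qpi u = qpi v.
Proof. exact: hq_pi_eq. Qed.

Lemma piP (k : R[i]) u v : hcar u -> hcar v -> qpi (k *: u + v) = k *: qpi u + qpi v.
Proof.
move=> hu hv; rewrite -[k *: qpi u]/(hq_scale _ _) -[RHS]/(hq_add _ _).
by rewrite hq_scaleE// hq_addE//; exact: cZ.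
Qed.

Lemma piD u v : hcar u -> hcar v -> qpi (u + v) = qpi u + qpi v.
Proof. by move=> hu hv; have := piP 1 hu hv; rewrite !scale1r. Qed.

Lemma pi0 : qpi 0 = 0. Proof. by []. Qed.

Lemma piZ (k : R[i]) u : hcar u -> qpi (k *: u) = k *: qpi u.
Proof.
by move=> hu; have := piP k hu (ph_car0 pH); rewrite pi0 !addr0.
Qed.

Lemma piB u v : hcar u -> hcar v -> qpi (u - v) = qpi u - qpi v.
Proof.
move=> hu hv; have := piZ (-1) hv; rewrite !scaleN1r => e.
by rewrite piD ?e//; exact: ph_carN.
Qed.

Lemma pi_sum (I : Type) (s : seq I) (P : pred I) (F : I -> H) :
  (forall i, hcar (F i)) ->
  qpi (\sum_(i <- s | P i) F i) = \sum_(i <- s | P i) qpi (F i).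
Proof.
move=> hF; suff [_ h] : hcar (\sum_(i <- s | P i) F i) /\
    qpi (\sum_(i <- s | P i) F i) = \sum_(i <- s | P i) qpi (F i) by [].
elim/big_ind2 : _ => [|u x v y [hu <-] [hv <-]|//].
- by split; [exact: ph_car0|exact: pi0].
- by split; [exact: ph_carD|rewrite piD].
Qed.

Lemma pi_ip u v : hcar u -> hcar v -> hip (qpi u) (qpi v) = hip u v.
Proof.
move=> hu hv; rewrite -[LHS]/(hip (rep _) (rep _)).
rewrite (hsame_ipl pH hu (rep_car (qpi u)) hv (hq_rep_same hu)).
by rewrite (hsame_ipr pH hv (rep_car (qpi v)) (rep_car _) (hq_rep_same hv)).
Qed.

Lemma pi_norm u : hcar u -> hnorm (qpi u) = hnorm u.
Proof. by move=> hu; rewrite /hnorm pi_ip. Qed.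

Lemma rep_norm x : hnorm (rep x) = hnorm x. Proof. by []. Qed.

Lemma pi_inj u v : hcar u -> hcar v -> qpi u = qpi v -> hsame u v.
Proof.
move=> hu hv e; have h0 := ph_car0 pH.
rewrite /hsame -(pi_norm (ph_carB pH hu hv)) (piB hu hv) e subrr.
by rewrite -pi0 (pi_norm h0) (ph_norm0 pH).
Qed.

Lemma quot_prehilbert : prehilbert quot.
Proof.
split=> //.
- move=> k u v w _ _ _; rewrite -(repK u) -(repK v) -(repK w).
  have cu := rep_car u; have cv := rep_car v; have cw := rep_car w.
  rewrite -(piP k cu cv) (pi_ip (ph_carP pH k cu cv) cw) (pi_ip cu cw) (pi_ip cv cw).
  exact: (ph_lin pH).
- by move=> u v _ _; apply: (ph_herm pH); exact: rep_car.
- by move=> u _; apply: (ph_ge0 pH); exact: rep_car.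
Qed.

Lemma quot_hilbert :
  (forall s : nat -> H, (forall n, hcar (s n)) ->
    (forall e : R, 0 < e -> exists n, forall m p, (n <= m)%N -> (n <= p)%N ->
      hnorm (s m - s p) <= e) ->
    exists2 l, hcar l & hnorm (s m - l) @[m --> \oo] --> (0 : R)) ->
  hilbert quot.
Proof.
move=> cplt; split=> //; first exact: quot_prehilbert.
- move=> u hu; rewrite -(repK u); rewrite -pi0; apply: pi_same.
  + exact: rep_car.
  + exact: ph_car0.
  + by rewrite /hsame subr0.
- move=> s hs; have rb m x : hnorm (rep (s m) - rep x) = hnorm (s m - x).
    have e := piB (rep_car (s m)) (rep_car x); rewrite !repK in e.
    by rewrite -e pi_norm//; apply: (ph_carB pH); exact: rep_car.
  have [e e0|l hl cl] := cplt (fun n => rep (s n)) (fun n => rep_car _).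
    by have [n hn] := hs e e0; exists n => m p nm np; rewrite rb; exact: hn.
  exists (qpi l); apply: cvg_trans cl; apply: near_eq_cvg; apply: nearW => m.
  have e := piB (rep_car (s m)) hl; rewrite repK in e.
  by rewrite -e pi_norm//; apply: (ph_carB pH) => //; exact: rep_car.
Qed.

End QuotientOperations.
Arguments piP {R H} pH k {u v}.
Arguments piD {R H} pH {u v}.
Arguments piB {R H} pH {u v}.
Arguments piZ {R H} pH k {u}.
Arguments pi_ip {R H} pH {u v}.
Arguments pi_norm {R H} pH {u}.
Arguments pi_same {R H} pH {u v}.
Arguments pi_inj {R H} pH {u v}.
Arguments rep_car {R H pH} x.
Arguments repK {R H pH} x.
Arguments rep_norm {R H pH} x.

(** * Uniqueness of classical solutions *)

Section SolutionSemigroup.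
Context {R : realType} {X : hspace R}.
Hypothesis hX : hilbert X.
Variables (T : R -> X -> X) (N : R).
Hypothesis hT : C0_semigroup T.
Hypothesis hN : forall (t : R) u, 0 <= t -> hnorm (T t u) <= N * hnorm u.
Variables U U' : R -> X.
Hypothesis hU : forall t, 0 <= t -> generator T (U t) (U' t).
Hypothesis dU : forall t e : R, 0 <= t -> 0 < e -> exists2 d : R, 0 < d &
  forall s : R, 0 <= s -> `|s - t| < d ->
    hnorm (U s - U t - (s - t)%:C *: U' t) <= e * `|s - t|.

(* [s |-> T (t - s) (U s)] has vanishing right derivative. *)
Lemma solution_semigroup t : 0 <= t -> U t = T t (U 0).
Proof.
move=> t0; pose g s := T (t - s) (U s).
have N1 : 0 < `|N| + 1 by have := normr_ge0 N; lra.
have hN1 (s : R) u : 0 <= s -> hnorm (T s u) <= (`|N| + 1) * hnorm u.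
  move=> s0; apply: le_trans (hN _ s0) _; apply: ler_wpM2r; first exact: hnorm_ge0.
  by apply: le_trans (ler_norm _) _; rewrite lerDl.
suff : hnorm (g t - g 0) <= 0 - 0.
  rewrite subrr => h; apply: (hnorm_subr_le0 hX); move: h.
  by rewrite /g subrr subr0 (sgt0 hX hT).
apply: (vector_mvt (hil_ph hX) (hil_car hX) (G := fun=> 0)) => // s /andP[s0 st] e e0.
- have e2 : 0 < e / (2 * (`|N| + 1)) by rewrite divr_gt0// mulr_gt0.
  have [d d0 hd] := dU s0 e2.
  have /(gen_eps hX)/(_ _ e2)[d' d'0 hd'] := hU s0.
  exists (Num.min (t - s) (Num.min d d')); first by rewrite !lt_min subr_gt0 st d0.
  move=> r /andP[r0]; rewrite !lt_min => /and3P[rt rd rd']; have r0' := ltW r0.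
  have ts0 : 0 <= t - (s + r) by lra.
  have -> : g (s + r) - g s = T (t - (s + r)) (U (s + r) - T r (U s)).
    rewrite (sgB hX hT hN _ _ ts0) -(sgA hX hT _ r0' ts0) /g; congr (_ - T _ _); ring.
  rewrite subrr add0r; apply: le_trans (hN1 _ _ ts0) _.
  have h1 := hd (s + r) (addr_ge0 s0 r0').
  have sr : s + r - s = r by rewrite addrAC subrr add0r.
  rewrite sr gtr0_norm// in h1; have {}h1 := h1 rd.
  have h2 := hd' r (introT andP (conj r0 rd')).
  have : hnorm (U (s + r) - T r (U s)) <= e / (2 * (`|N| + 1)) * r + e / (2 * (`|N| + 1)) * r.
    apply: le_trans (lerD h1 h2); apply: le_trans (hnormB hX _ _).
    by rewrite le_eqVlt; apply/orP; left; apply/eqP; congr hnorm; lmod.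
  rewrite -mulrDl => h3; apply: le_trans (ler_wpM2l (ltW N1) h3) _.
  rewrite mulrA ler_pM2r// le_eqVlt; apply/orP; left; apply/eqP.
  by field; rewrite gt_eqF.
- have s0' := ltW s0; pose K := `|N| + 1.
  have [d d0 hd] := dU s0' ltr01.
  have K0 : 0 < 2 * (K * K) by rewrite !mulr_gt0.
  have e3 : 0 < e / (2 * K) by rewrite divr_gt0// mulr_gt0.
  have [d' d'0 hd'] := sg_cont hX hT (U s) e3.
  have u0 := hnorm_ge0 (U' s).
  have d''0 : 0 < e / (2 * (K * K)) / (1 + hnorm (U' s)).
    by rewrite divr_gt0 ?divr_gt0//; lra.
  exists (Num.min s (Num.min d (Num.min d' (e / (2 * (K * K)) / (1 + hnorm (U' s)))))).
    by rewrite !lt_min s0 d0 d'0.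
  move=> r /andP[r0]; rewrite !lt_min => /and4P[rs rd rd' rd'']; have r0' := ltW r0.
  have ts0 : 0 <= t - s by lra.
  have sr0 : 0 <= s - r by lra.
  have -> : g s - g (s - r) = T (t - s) (U s - T r (U (s - r))).
    rewrite (sgB hX hT hN _ _ ts0) -(sgA hX hT _ r0' ts0) /g; congr (_ - T _ _); ring.
  rewrite subrr addr0; apply: le_trans (hN1 _ _ ts0) _.
  have h1 := hd (s - r) sr0.
  have sr : s - r - s = - r by rewrite addrAC subrr add0r.
  rewrite sr normrN gtr0_norm// mul1r in h1; have {}h1 := h1 rd.
  have h2 := hd' r (introT andP (conj r0 rd')).
  have h3 : hnorm (U (s - r) - U s) <= r * (1 + hnorm (U' s)).
    have := hnormD hX (U (s - r) - U s - (- r)%:C *: U' s) ((- r)%:C *: U' s).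
    rewrite subrK (hnormZR hX) normrN gtr0_norm//; lra.
  have h4 : hnorm (U (s - r) - U s) <= e / (2 * (K * K)).
    apply: le_trans h3 _; move: rd''; rewrite ltr_pdivlMr; last by lra.
    by move=> /ltW.
  have h5 : hnorm (U s - T r (U (s - r))) <= e / (2 * K) + K * (e / (2 * (K * K))).
    have -> : U s - T r (U (s - r)) = - (T r (U s) - U s) - T r (U (s - r) - U s).
      by rewrite (sgB hX hT hN _ _ r0'); lmod.
    apply: le_trans (hnormB hX _ _) _; rewrite (hnormN hX); apply: lerD => //.
    by apply: le_trans (hN1 _ _ r0') _; rewrite ler_pM2l.
  apply: le_trans (ler_wpM2l (ltW N1) h5) _; rewrite -/K le_eqVlt; apply/orP; left.
  by apply/eqP; field; rewrite gt_eqF.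
Qed.

End SolutionSemigroup.

(** * Transfer of stability between representatives and classes *)

Section GraphNorm.
Context {R : realType} {H : hspace R}.
Implicit Types B : H -> set H.

(** Scaling [u] by [1 / (|u| + e)] brings it into the unit ball, null vectors included, and [e]
    tends to 0. Homogeneity is required only for positive scalars and for the norm of the value. *)
Lemma le_opnorm B (N : R) :
  (forall (r : R) u v, 0 < r -> hcar u -> B u v ->
     [/\ hcar (r%:C *: u), hnorm (r%:C *: u) = r * hnorm u &
        exists2 v', B (r%:C *: u) v' & hnorm v' = r * hnorm v]) ->
  (opnorm B <= N%:E)%E ->
  forall u v, hcar u -> B u v -> hnorm v <= N * hnorm u.
Proof.
move=> hB hN u v hu buv.
have key (e : R) : 0 < e -> hnorm v <= N * (hnorm u + e).
  move=> e0; have d0 : 0 < hnorm u + e by have := hnorm_ge0 u; lra.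
  have r0 : 0 < (hnorm u + e)^-1 by rewrite invr_gt0.
  have [h1 h2 [v' h3 h4]] := hB _ _ _ r0 hu buv.
  have : ((hnorm v')%:E <= N%:E)%E.
    apply: le_trans hN; apply: ereal_sup_ubound; exists v' => //.
    exists ((hnorm u + e)^-1%:C *: u); split=> //; rewrite h2 mulrC ler_pdivrMr//.
    by rewrite mul1r lerDl ltW.
  by rewrite lee_fin h4 mulrC ler_pdivrMr.
have N0 : 0 <= N.
  have := le_trans (hnorm_ge0 v) (key 1 ltr01); rewrite pmulr_lge0//.
  by have := hnorm_ge0 u; lra.
apply/ler_addgt0Pl => e e0; have N1 : 0 < N + 1 by lra.
apply: le_trans (key (e / (N + 1)) (divr_gt0 e0 N1)) _.
rewrite mulrDr addrC lerD2r mulrA ler_pdivrMr//; have := e0; nra.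
Qed.

Lemma opnorm_le B (N : R) : 0 <= N ->
  (forall u v, hcar u -> B u v -> hnorm v <= N * hnorm u) ->
  (opnorm B <= N%:E)%E.
Proof.
move=> N0 hB; apply: ge_ereal_sup => _ [v [u [hu u1 buv] <-]].
rewrite lee_fin; apply: le_trans (hB _ _ hu buv) _; by rewrite ler_piMr.
Qed.

End GraphNorm.

Section Transfer.
Context {R : realType} {H : hspace R} (pH : prehilbert H).
Local Notation Q := (quot pH).
Local Notation qpi := (@qpi R H pH).
Hypothesis hQ : hilbert Q.

Lemma pi_eqP u v : hcar u -> hcar v -> qpi u = qpi v <-> hsame u v.
Proof. by move=> hu hv; split; [exact: pi_inj|exact: pi_same]. Qed.

Lemma bounded_linear_pi (T : H -> H) (S : Q -> Q) :
  (forall u, hcar u -> hcar (T u) /\ qpi (T u) = S (qpi u)) ->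
  bounded_linear T <-> bounded_linear S.
Proof.
move=> TS; have cT u : hcar u -> hcar (T u) by move=> /TS[].
have eT u : hcar u -> qpi (T u) = S (qpi u) by move=> /TS[].
split=> -[_ hl [K hK]]; split=> //.
- move=> k x y _ _; rewrite -(repK x) -(repK y).
  have c1 := rep_car x; have c2 := rep_car y; rewrite -(piP pH k c1 c2).
  rewrite -(eT _ (ph_carP pH k c1 c2)) -(eT _ c1) -(eT _ c2).
  rewrite -(piP pH k (cT _ c1) (cT _ c2)); rewrite (pi_same pH (cT _ (ph_carP pH k c1 c2)) (ph_carP pH k (cT _ c1) (cT _ c2)) (hl k _ _ c1 c2)).
  exact: (hsame_refl (quot_prehilbert pH)).
- exists K => x _; rewrite -(repK x); have c1 := rep_car x.
  by rewrite -(eT _ c1) (pi_norm pH c1) (pi_norm pH (cT _ c1)); exact: hK.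
- move=> k u v hu hv; apply/pi_eqP; [exact: cT (ph_carP pH k hu hv)|exact: (ph_carP pH k (cT _ hu) (cT _ hv))|].
  rewrite (piP pH k (cT _ hu) (cT _ hv)) (eT _ hu) (eT _ hv) (eT _ (ph_carP pH k hu hv)).
  by rewrite (piP pH k hu hv); apply: (hsame_eq hQ); exact: hl.
- by exists K => u hu; rewrite -(pi_norm pH (cT _ hu)) eT// -(pi_norm pH hu); exact: hK.
Qed.

Section TwoSemigroups.
Variables (T : R -> H -> H) (S : R -> Q -> Q).
Hypothesis TS : forall t u, 0 <= t -> hcar u -> hcar (T t u) /\ qpi (T t u) = S t (qpi u).

Lemma generator_pi u v :
  generator T u v <-> [/\ hcar u, hcar v & generator S (qpi u) (qpi v)].
Proof.
have key : hcar u -> hcar v -> \forall t \near (0 : R)^'+,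
    hnorm ((t^-1)%:C *: (T t u - u) - v) = hnorm ((t^-1)%:C *: (S t (qpi u) - qpi u) - qpi v).
  move=> hu hv; near=> t; have t0 : 0 < t by [].
  have [c e] := TS (ltW t0) hu.
  have c1 := ph_carB pH c hu; have c2 := ph_carZ pH (t^-1)%:C c1.
  by rewrite -e -(piB pH c hu) -(piZ pH _ c1) -(piB pH c2 hv) pi_norm//; exact: (ph_carB pH).
split=> [[hu hv h]|[hu hv [_ _ h]]]; split=> //.
  split=> //; apply: cvg_trans h; apply: near_eq_cvg.
  by apply: filterS (key hu hv) => t ->.
apply: cvg_trans h; apply: near_eq_cvg.
by apply: filterS (key hu hv) => t /esym.
Unshelve. all: by end_near. Qed.

Lemma C0_semigroup_pi : C0_semigroup T <-> C0_semigroup S.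
Proof.
have cT t u : 0 <= t -> hcar u -> hcar (T t u) by move=> t0 /(TS t0)[].
have eT t u : 0 <= t -> hcar u -> qpi (T t u) = S t (qpi u) by move=> t0 /(TS t0)[].
have near0 u : hcar u -> \forall t \near (0 : R)^'+,
    hnorm (T t u - u) = hnorm (S t (qpi u) - qpi u).
  move=> hu; near=> t; have t0 : 0 < t by [].
  have c := cT _ _ (ltW t0) hu; rewrite -eT// ?ltW// -(piB pH c hu) pi_norm//.
  exact: (ph_carB pH).
split=> -[h1 h2 h3 h4]; split.
- by move=> t t0; apply/(bounded_linear_pi (fun u => TS t0)); exact: h1.
- move=> x _; rewrite -(repK x); have c := rep_car x.
  rewrite -(eT _ _ (lexx 0) c) (pi_same pH (cT _ _ (lexx 0) c) c (h2 _ c)).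
  exact: (hsame_refl (quot_prehilbert pH)).
- move=> s t x s0 t0 _; rewrite -(repK x); have c := rep_car x.
  have c1 := cT _ _ s0 c; have ts0 := addr_ge0 t0 s0.
  rewrite -(eT _ _ s0 c) -(eT _ _ t0 c1) -(eT _ _ ts0 c).
  rewrite (pi_same pH (cT _ _ ts0 c) (cT _ _ t0 c1) (h3 _ _ _ s0 t0 c)).
  exact: (hsame_refl (quot_prehilbert pH)).
- move=> x _; rewrite -(repK x); have c := rep_car x.
  apply: cvg_trans (h4 _ c); apply: near_eq_cvg.
  by apply: filterS (near0 _ c) => t ->.
- by move=> t t0; apply/(bounded_linear_pi (fun u => TS t0)); exact: h1.
- move=> u hu; apply/(pi_eqP (cT _ _ (lexx 0) hu) hu).
  by rewrite (eT _ _ (lexx 0) hu); apply: (hsame_eq hQ); exact: h2.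
- move=> s t u s0 t0 hu; have c1 := cT _ _ s0 hu; have ts0 := addr_ge0 t0 s0.
  apply/(pi_eqP (cT _ _ ts0 hu) (cT _ _ t0 c1)).
  rewrite (eT _ _ t0 c1) (eT _ _ s0 hu) (eT _ _ ts0 hu).
  by apply: (hsame_eq hQ); exact: h3.
- move=> u hu; apply: cvg_trans (h4 (qpi u) I); apply: near_eq_cvg.
  by apply: filterS (near0 _ hu) => t /esym.
Unshelve. all: by end_near. Qed.

End TwoSemigroups.

Lemma resolvent_set_pi (A : H -> set H) (B : Q -> set Q) l :
  (forall u v, A u v <-> [/\ hcar u, hcar v & B (qpi u) (qpi v)]) ->
  resolvent_set A l <-> resolvent_set B l.
Proof.
move=> AB; split=> -[K [h1 h2]]; exists K; split.
- move=> f _; have c := rep_car f; have [u [v [/[dup] auv /AB[hu hv b] e]]] := h1 _ c.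
  have hlu := ph_carZ pH l hu; have cc := ph_carB pH hlu hv.
  exists (qpi u), (qpi v); split=> //; rewrite -(piZ pH l hu) -(piB pH hlu hv) -[f]repK (pi_same pH cc c e).
  exact: (hsame_refl (quot_prehilbert pH)).
- move=> x y; rewrite -(repK x) -(repK y) => b.
  have hx := rep_car x; have hy := rep_car y; have hlu := ph_carZ pH l hx.
  rewrite -(piZ pH)// -(piB pH)// !(pi_norm pH)//; last exact: (ph_carB pH).
  by apply: h2; apply/AB.
- move=> f hf; have [x [y [b e]]] := h1 (qpi f) I.
  have hx := rep_car x; have hy := rep_car y; have hlu := ph_carZ pH l hx.
  exists (rep x), (rep y); split; first by apply/AB; rewrite !repK.
  apply/pi_eqP => //; first exact: (ph_carB pH).
  by rewrite piB// piZ// !repK; apply: (hsame_eq hQ).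
- move=> u v /AB[hu hv b]; have hlu := ph_carZ pH l hu; have := h2 _ _ b.
  by rewrite -(piZ pH)// -(piB pH)// !(pi_norm pH)//; exact: (ph_carB pH).
Qed.

(** Each [T t] respects [hsame], because it is bounded and linear up to [hsame], so [S t] is well
    defined on classes. Operator norm bounds become pointwise ones by [le_opnorm]. *)
Lemma quot_stable_in (A : H -> set H) (alpha : R) : polynomially_stable A alpha ->
  exists (S : R -> Q -> Q) (N M0 : R),
  [/\ C0_semigroup S,
      forall t u, 0 <= t -> hnorm (S t u) <= N * hnorm u,
      forall t u v, 0 < t -> generator S u v ->
        hnorm (S t u) <= M0 * t `^ (- alpha^-1) * hnorm v,
      forall s, resolvent_set (generator S) (0 +i* s) &
      forall u v, A u v <-> [/\ hcar u, hcar v & generator S (qpi u) (qpi v)]].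
Proof.
move=> [T [[hT eA] supT hR [M0 M00 hM]]].
have cT t u : 0 <= t -> hcar u -> hcar (T t u).
  by move=> t0; case: hT => /(_ t t0)[h _ _] _ _ _; exact: h.
pose S t (x : Q) := qpi (T t (rep x)).
have TS t u : 0 <= t -> hcar u -> hcar (T t u) /\ qpi (T t u) = S t (qpi u).
  move=> t0 hu; split; first exact: cT.
  have hr := rep_car (qpi u).
  apply: pi_same; try exact: cT.
  have eur : hsame u (rep (qpi u)) by apply/(pi_eqP hu hr); rewrite repK.
  case: hT => /(_ t t0)[_ hl [K hK]] _ _ _.
  have e := hl (-1) _ _ hr hu.
  have c1 := cT t _ t0 (ph_carP pH (-1) hr hu).
  have c2 := ph_carP pH (-1) (cT t _ t0 hr) (cT t _ t0 hu).
  have e' := hsame_norm pH c1 c2 e.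
  rewrite /hsame; have -> : T t u - T t (rep (qpi u)) = -1 *: T t (rep (qpi u)) + T t u.
    by rewrite scaleN1r addrC.
  apply/eqP; rewrite eq_le hnorm_ge0 andbT -e'.
  apply: le_trans (hK _ (ph_carP pH _ hr hu)) _; rewrite scaleN1r addrC.
  by rewrite (_ : hnorm _ = 0) ?mulr0.
have hS : C0_semigroup S by apply/(C0_semigroup_pi TS).
have gA u v : A u v <-> [/\ hcar u, hcar v & generator S (qpi u) (qpi v)].
  by rewrite eA; exact: generator_pi.
have zT (r t : R) u : 0 < r -> 0 <= t -> hcar u ->
    hnorm (T t (r%:C *: u)) = r * hnorm (T t u).
  move=> r0 t0 hu; have hru := ph_carZ pH r%:C hu.
  rewrite -(pi_norm pH (cT _ _ t0 hru)) -(pi_norm pH (cT _ _ t0 hu)).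
  rewrite (TS _ _ t0 hru).2 (TS _ _ t0 hu).2 (piZ pH _ hu).
  have [/(_ t t0)[_ hl _] _ _ _] := hS.
  have := hl r%:C (qpi u) 0 I I; rewrite addr0 => /(hsame_eq hQ) ->.
  have := hl 1 0 0 I I; rewrite !scale1r addr0 => /(hsame_eq hQ)/eqP.
  rewrite -subr_eq0 opprD addNKr oppr_eq0 => /eqP ->.
  by rewrite addr0 (hnormZR hQ) gtr0_norm.
have nZ (r : R) (u : H) : 0 < r -> hcar u ->
    hcar (r%:C *: u) /\ hnorm (r%:C *: u) = r * hnorm u.
  move=> r0 hu; split; first exact (ph_carZ pH r%:C hu).
  by rewrite (ph_normZ pH)// normcR gtr0_norm.
have [N hN] : exists N : R, forall t, 0 <= t ->
    (opnorm (fun u => [set T t u]) <= N%:E)%E.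
  move: supT; set E := ereal_sup _ => supT.
  have [N hN] : exists N : R, (E <= N%:E)%E.
    case: E supT => [r _|//|_]; first by exists r.
    by exists 0; rewrite leNye.
  by exists N => t t0; apply: le_trans hN; apply: ereal_sup_ubound; exists t.
have hSN (t : R) (x : Q) : 0 <= t -> hnorm (S t x) <= N * hnorm x.
  move=> t0; have c := rep_car x.
  change (hnorm (qpi (T t (rep x))) <= N * hnorm (rep x)).
  rewrite (pi_norm pH (cT _ _ t0 c)); apply: (le_opnorm _ (hN t t0)) => //.
  move=> r u v r0 hu ->; have [? ?] := nZ r u r0 hu; split=> //.
  by exists (T t (r%:C *: u)) => //; exact: zT.
exists S, N, M0; split=> //.
- move=> t x y t0; rewrite -{1}(repK x) -{1}(repK y) => g.
  have hx := rep_car x; have hy := rep_car y; have t0' := ltW t0.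
  change (hnorm (qpi (T t (rep x))) <= M0 * t `^ (- alpha^-1) * hnorm (rep y)).
  rewrite (pi_norm pH (cT _ _ t0' hx)).
  apply: (le_opnorm _ (hM t t0)) => //; last by exists (rep x) => //; apply/gA.
  move=> r v w r0 hv [u /gA[hu _ guv] <-]; have [? ?] := nZ r v r0 hv; split=> //.
  have [c1 _] := nZ r u r0 hu.
  exists (T t (r%:C *: u)); last exact: zT.
  have g' := (gen_linear hQ hS hSN).2 r%:C _ _ _ _ guv (gen_linear hQ hS hSN).1.
  rewrite !addr0 -(piZ pH r%:C hu) -(piZ pH r%:C hv) in g'.
  by exists (r%:C *: u); [apply/gA; split|].
- by move=> s; exact: (proj1 (resolvent_set_pi (0 +i* s) gA) (hR s)).
Qed.

(** The semigroup on classes is lifted as [rep (S t (qpi u))], which picks one representative of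
    each value. *)
Lemma quot_stable_out (A : H -> set H) (S : R -> Q -> Q) (N M0 alpha : R) :
  C0_semigroup S ->
  (forall t u, 0 <= t -> hnorm (S t u) <= N * hnorm u) ->
  0 < M0 ->
  (forall t u v, 0 < t -> generator S u v ->
    hnorm (S t u) <= M0 * t `^ (- alpha^-1) * hnorm v) ->
  (forall s, resolvent_set (generator S) (0 +i* s)) ->
  (forall u v, A u v <-> [/\ hcar u, hcar v & generator S (qpi u) (qpi v)]) ->
  polynomially_stable A alpha.
Proof.
move=> hS hN M00 hM hR gA; pose T t (u : H) := rep (S t (qpi u)).
have TS t u : 0 <= t -> hcar u -> hcar (T t u) /\ qpi (T t u) = S t (qpi u).
  by move=> _ _; split; [exact: rep_car|exact: repK].
exists T; split.
- split; first by apply/(C0_semigroup_pi TS).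
  apply/funext => u; apply/seteqP; split=> v.
  + by move=> /gA h; apply/(generator_pi TS).
  + by move=> /(generator_pi TS) h; apply/gA.
- apply: (@le_lt_trans _ _ (`|N|)%:E); last exact: ltry.
  apply: ge_ereal_sup => _ [t /= t0 <-]; apply: opnorm_le => // u v hu ->.
  rewrite rep_norm; apply: le_trans (hN _ _ t0) _; rewrite pi_norm//.
  by apply: ler_wpM2r; [exact: hnorm_ge0|exact: ler_norm].
- by move=> s; exact: (proj2 (resolvent_set_pi (0 +i* s) gA) (hR s)).
- exists M0 => // t t0; apply: opnorm_le; first by rewrite mulr_ge0 ?powR_ge0 ?ltW.
  move=> v w hv [u /gA[hu _ g] <-]; rewrite rep_norm.
  by have := hM _ _ _ t0 g; rewrite (pi_norm pH hv).
Qed.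

Lemma classical_solution_quot (A : H -> set H) (S : R -> Q -> Q) (N : R) (u : R -> H) :
  C0_semigroup S ->
  (forall t u, 0 <= t -> hnorm (S t u) <= N * hnorm u) ->
  (forall u v, A u v <-> [/\ hcar u, hcar v & generator S (qpi u) (qpi v)]) ->
  classical_solution A u ->
  forall t, 0 <= t -> qpi (u t) = S t (qpi (u 0)).
Proof.
move=> hS hN gA [u' hu'].
have cu t : 0 <= t -> hcar (u t) by move=> /hu'[/gA[]].
have cu' t : 0 <= t -> hcar (u' t) by move=> /hu'[/gA[]].
apply: (solution_semigroup hQ hS hN (U' := fun t => qpi (u' t))).
  by move=> t /hu'[/gA[]].
move=> t e t0 e0; have [_ /cvgr0Pnorm_le/(_ e e0) + _] := hu' t t0.
rewrite 2!near_withinE => /nbhs_ballP[d /= d0 hd]; exists d => // s s0 sd.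
have cs := cu _ s0; have ct := cu _ t0; have ct' := cu' _ t0.
have c1 := ph_carB pH cs ct; have c2 := ph_carZ pH (s - t)%:C ct'.
rewrite -(piB pH cs ct) -(piZ pH _ ct') -(piB pH c1 c2) pi_norm; last exact: (ph_carB pH).
have [->|st] := eqVneq s t.
  by rewrite !subrr normr0 mulr0 scale0r subr0 (ph_norm0 pH).
have := hd s; rewrite /ball/= distrC => /(_ sd st s0).
rewrite ger0_norm ?hnorm_ge0// => h.
have st0 : s - t != 0 by rewrite subr_eq0.
have -> : u s - u t - (s - t)%:C *: u' t =
    (s - t)%:C *: (((s - t)^-1)%:C *: (u s - u t) - u' t).
  by rewrite scalerBr scalerA -rmorphM divff// scale1r.
rewrite (ph_normZ pH); last by apply: (ph_carB pH) => //; exact: (ph_carZ pH).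
by rewrite normcR mulrC ler_wpM2r.
Qed.

End Transfer.

(** * Orthonormal systems and independence of the eigenbasis *)

Section Orthonormal.
Context {R : realType} {H : hspace R}.
Hypothesis pH : prehilbert H.
Implicit Types (u v w : H).

Section System.
Variable e : nat -> H.
Hypothesis ce : forall n, hcar (e n).
Hypothesis oe : forall m n, hip (e m) (e n) = (m == n)%:R.

Definition fourier (c : nat -> R[i]) N : H := \sum_(n < N) c n *: e n.

Lemma fourier_car c N : hcar (fourier c N).
Proof.
rewrite /fourier; elim: N => [|N IH]; first by rewrite big_ord0; exact: ph_car0.
by rewrite big_ord_recr/= addrC; exact: (ph_carP pH).
Qed.

Lemma fourier_ip c N v : hcar v -> hip (fourier c N) v = \sum_(n < N) c n * hip (e n) v.
Proof.
move=> hv; elim: N => [|N IH]; first by rewrite /fourier !big_ord0 (ph_ip0l pH).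
rewrite /fourier !big_ord_recr/= addrC (ph_lin pH)//; last exact: fourier_car.
by rewrite addrC -IH.
Qed.

Lemma fourier_coef c N k : hip (fourier c N) (e k) = if (k < N)%N then c k else 0.
Proof.
rewrite fourier_ip//; elim: N => [|N IH]; first by rewrite big_ord0.
rewrite big_ord_recr/= IH oe ltnS; case: (ltngtP k N) => [h|h|->].
- by rewrite ?(gtn_eqF h) mulr0n mulr0 addr0.
- by rewrite ?(ltn_eqF h) mulr0n mulr0 addr0.
- by rewrite ?eqxx mulr1n mulr1 add0r.
Qed.

Lemma fourier_norm c N : hnorm (fourier c N) ^+ 2 = \sum_(n < N) normc (c n) ^+ 2.
Proof.
rewrite (ph_norm2 pH); last exact: fourier_car.
rewrite (fourier_ip c N (fourier_car c N)) Re_sum; apply: eq_bigr => n _.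
rewrite (ph_herm pH (fourier_car c N) (ce n)) fourier_coef ltn_ord.
by rewrite normc_sqr.
Qed.

Lemma fourier_normB c m p : (p <= m)%N ->
  hnorm (fourier c m - fourier c p) ^+ 2 =
  \sum_(n < m) normc (c n) ^+ 2 - \sum_(n < p) normc (c n) ^+ 2.
Proof.
move=> pm; pose c' n := if (n < p)%N then 0 else c n.
have -> : fourier c m - fourier c p = fourier c' m.
  have -> : fourier c p = \sum_(n < m) (if (n < p)%N then c n *: e n else 0).
    by rewrite /fourier -big_mkcond /= (big_ord_widen m (fun n => c n *: e n) pm).
  rewrite /fourier -sumrB; apply: eq_bigr => n _; rewrite /c'.
  by case: ifP; rewrite ?subrr ?scale0r ?subr0.
rewrite fourier_norm (big_ord_widen m (fun n => normc (c n) ^+ 2) pm) [X in _ = _ - X]big_mkcond -sumrB.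
apply: eq_bigr => n _; rewrite /c'; case: ifP => _; rewrite ?subrr ?subr0//.
by rewrite Normc.normc0 expr0n.
Qed.

Lemma bessel u N : hcar u -> \sum_(n < N) normc (hip u (e n)) ^+ 2 <= hnorm u ^+ 2.
Proof.
move=> hu; pose c n := hip u (e n); have cs := fourier_car c N.
have e1 : hip (fourier c N) u = (hnorm (fourier c N) ^+ 2)%:C.
  rewrite fourier_ip// fourier_norm rmorph_sum; apply: eq_bigr => n _ /=.
  by rewrite (ph_herm pH hu (ce n)) normc_sqrC.
have := ph_CS pH cs hu; rewrite e1 normcR ger0_norm ?sqr_ge0//.
rewrite -(fourier_norm c N); have := hnorm_ge0 (fourier c N).
rewrite le_eqVlt => /orP[/eqP <-|h]; first by rewrite expr0n sqr_ge0.
by rewrite [X in X <= _ -> _]expr2 ler_pM2l// => h'; apply: lerXn2r => //; rewrite nnegrE hnorm_ge0.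
Qed.

Hypothesis cpl : forall s : nat -> H, (forall n, hcar (s n)) ->
  (forall e : R, 0 < e -> exists n, forall m p, (n <= m)%N -> (n <= p)%N ->
    hnorm (s m - s p) <= e) ->
  exists2 l, hcar l & hnorm (s m - l) @[m --> \oo] --> (0 : R).

(** The squared distance of two partial sums is a difference of partial sums of a bounded increasing
    real series, so they form a Cauchy sequence; coefficients and norm bound pass to the limit. *)
Lemma riesz_fischer (c : nat -> R[i]) (B : R) : 0 <= B -> (forall N, \sum_(n < N) normc (c n) ^+ 2 <= B ^+ 2) ->
  exists v, [/\ hcar v, forall n, hip v (e n) = c n, hnorm v <= B &
    hnorm (fourier c m - v) @[m --> \oo] --> (0 : R)].
Proof.
move=> B0 hB; pose a_ N := \sum_(n < N) normc (c n) ^+ 2.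
have am m p : (p <= m)%N -> a_ p <= a_ m.
  by move=> pm; rewrite -subr_ge0 -fourier_normB// sqr_ge0.
have ca : cvgn a_.
  apply: nondecreasing_is_cvgn; first by move=> m n; exact: am.
  by exists (B ^+ 2) => _ [n _ <-]; exact: hB.
have [l hl cl] : exists2 l, hcar l & hnorm (fourier c m - l) @[m --> \oo] --> (0 : R).
  apply: cpl => [n|x x0]; first exact: fourier_car.
  have x2 : 0 < x ^+ 2 / 2 by rewrite divr_gt0// exprn_gt0.
  have /cvgrPdist_le/(_ _ x2)[n _ hn] := ca; exists n => m p nm np.
  wlog pm : m p nm np / (p <= m)%N.
    move=> W; case/orP: (leq_total p m) => h; first exact: W.
    by rewrite (ph_normBC pH (fourier_car c m) (fourier_car c p)); exact: W.
  rewrite -ler_sqr ?nnegrE ?hnorm_ge0 ?(ltW x0)// fourier_normB// -/(a_ m) -/(a_ p).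
  have := hn m nm; have := hn p np; rewrite /= !ler_norml => /andP[h1 h2] /andP[h3 h4].
  by lra.
have cl' := (proj1 (hcvg_eps _ _)) cl.
exists l; split=> //.
- move=> n; apply/eqP; rewrite -subr_eq0; apply/eqP; apply: Normc.eq0_normc.
  apply/eqP; rewrite eq_le normc_ge0 andbT; apply/ler_addgt0Pl => x x0.
  have [m hm] := cl' x x0; rewrite addr0.
  have := hm (maxn m n.+1) (leq_maxl _ _); apply: le_trans.
  have -> : hip l (e n) - c n = - hip (fourier c (maxn m n.+1) - l) (e n).
    by rewrite (ph_ipBl pH (fourier_car c _) hl (ce n)) fourier_coef leq_maxr opprB.
  have -> : normc (- hip (fourier c (maxn m n.+1) - l) (e n)) =
      normc (hip (fourier c (maxn m n.+1) - l) (e n)).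
    by case: (hip _ _) => x1 y1 /=; rewrite !sqrrN.
  have cd := ph_carB pH (fourier_car c (maxn m n.+1)) hl.
  have n1 : hnorm (e n) = 1 by rewrite /hnorm oe eqxx sqrtr1.
  by apply: le_trans (ph_CS pH cd (ce n)) _; rewrite n1 mulr1.
- apply/ler_addgt0Pl => x x0; have [m hm] := cl' x x0.
  have h1 : hnorm (fourier c m) <= B.
    by rewrite -ler_sqr ?nnegrE ?hnorm_ge0// fourier_norm; exact: hB.
  have cd := ph_carB pH (fourier_car c m) hl.
  have := ph_normD pH (ph_carN pH cd) (fourier_car c m).
  rewrite (ph_normN pH cd) opprB subrK; have := hm m (leqnn m); move: h1.
  by move: (hnorm _) (hnorm _) (hnorm _) => p q r; lra.
Qed.

Hypothesis total : forall u, hcar u -> (forall n, hip u (e n) = 0) -> hnorm u = 0.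

Lemma hsame_coef u v : hcar u -> hcar v -> (forall n, hip u (e n) = hip v (e n)) -> hsame u v.
Proof.
move=> hu hv h; apply: total; first exact: (ph_carB pH).
by move=> n; rewrite (ph_ipBl pH)// h subrr.
Qed.

Lemma fourier_cvg u : hcar u ->
  hnorm (fourier (fun n => hip u (e n)) m - u) @[m --> \oo] --> (0 : R).
Proof.
move=> hu; pose c n := hip u (e n).
have [v [hv hc _ cv]] := @riesz_fischer c _ (hnorm_ge0 u) (fun N => bessel N hu).
have uv := hsame_coef hv hu hc.
have e1 m : hnorm (fourier c m - u) = hnorm (fourier c m - v).
  have cf := fourier_car c m; apply: (hsame_norm pH); [exact: (ph_carB pH)|exact: (ph_carB pH)|].
  rewrite /hsame; have -> : fourier c m - u - (fourier c m - v) = v - u by rewrite opprB addrC subrKA.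
  exact: uv.
by under eq_cvg do rewrite e1.
Qed.

(* Both inner products are the limits of the same partial sums. *)
Lemma parseval_eq u v u' v' : hcar u -> hcar v -> hcar u' -> hcar v' ->
  (forall n, hip u (e n) * conjc (hip v (e n)) = hip u' (e n) * conjc (hip v' (e n))) ->
  hip u v = hip u' v'.
Proof.
move=> hu hv hu' hv' h.
have lim x y : hcar x -> hcar y -> forall eps : R, 0 < eps -> exists n, forall m, (n <= m)%N ->
    normc (hip x y - \sum_(n < m) hip x (e n) * conjc (hip y (e n))) <= eps.
  move=> hx hy eps eps0; have y1 : 0 < hnorm y + 1 by have := hnorm_ge0 y; lra.
  have [n hn] := (proj1 (hcvg_eps _ _)) (fourier_cvg hx) _ (divr_gt0 eps0 y1).
  exists n => m nm; have := hn m nm; set s := fourier _ m => hs.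
  have cs : hcar s by exact: fourier_car.
  have -> : \sum_(n < m) hip x (e n) * conjc (hip y (e n)) = hip s y.
    by rewrite fourier_ip//; apply: eq_bigr => k _; rewrite (ph_herm pH hy (ce k)).
  rewrite -(ph_ipBl pH hx cs hy); apply: le_trans (ph_CS pH (ph_carB pH hx cs) hy) _.
  rewrite (ph_normBC pH hx cs); apply: le_trans (ler_wpM2r (hnorm_ge0 y) hs) _.
  by rewrite mulrAC ler_pdivrMr// ler_pM2l// lerDl.
apply/eqP; rewrite -subr_eq0; apply/eqP; apply: Normc.eq0_normc.
apply/eqP; rewrite eq_le normc_ge0 andbT; apply/ler_addgt0Pl => x x0; rewrite addr0.
have x2 : 0 < x / 2 by rewrite divr_gt0.
have [n hn] := lim _ _ hu hv _ x2; have [n' hn'] := lim _ _ hu' hv' _ x2.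
have := hn' _ (leq_maxr n n'); have := hn _ (leq_maxl n n').
rewrite (eq_bigr (fun k : 'I__ => hip u' (e k) * conjc (hip v' (e k)))) => [|k _]; last exact: h.
set S := \sum_(_ < _) _ => h1 h2.
have -> : hip u v - hip u' v' = (hip u v - S) - (hip u' v' - S) by rewrite opprB subrKA.
apply: le_trans (le_normcD _ _) _.
have -> : normc (- (hip u' v' - S)) = normc (hip u' v' - S).
  by case: (hip u' v' - S) => x1 y1 /=; rewrite !sqrrN.
by move: h1 h2; move: (normc _) (normc _) => p q; lra.
Qed.

End System.

Section TwoEigenbases.
Variables (A : H -> set H) (e f : nat -> H) (lam mu : nat -> R).
Hypothesis cpl : forall s : nat -> H, (forall n, hcar (s n)) ->
  (forall e : R, 0 < e -> exists n, forall m p, (n <= m)%N -> (n <= p)%N ->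
    hnorm (s m - s p) <= e) ->
  exists2 l, hcar l & hnorm (s m - l) @[m --> \oo] --> (0 : R).
Hypothesis cA : forall u v, A u v -> hcar u.
Hypothesis symA : forall u v u' v', A u v -> A u' v' -> hip v u' = hip u v'.
Hypothesis be : eigenbasis A e lam.
Hypothesis bf : eigenbasis A f mu.

(** By symmetry, [hip (e m) (f n)] vanishes unless [lam m = mu n]. Hence expanding [f n] in the
    basis [e] meets a single value of [F], and Parseval's identity moves the relation to [f]. This
    is why [frac_pow] may quantify over eigenbases. *)
Lemma eigenbasis_change (F : R -> R) u v : hcar u -> hcar v ->
  (forall n, hip v (e n) = (F (lam n))%:C * hip u (e n)) ->
  forall n, hip v (f n) = (F (mu n))%:C * hip u (f n).
Proof.
move: be bf => [Ae oe te] [Af of_ tf] hu hv h n.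
have ce m : hcar (e m) by exact: cA (Ae m).
have cf m : hcar (f m) by exact: cA (Af m).
rewrite -(ph_ipZl pH _ hu (cf n)); apply: (parseval_eq ce oe cpl te) => //; first exact: (ph_carZ pH).
move=> m; rewrite h (ph_ipZl pH _ hu (ce m)).
have := symA (Ae m) (Af n); rewrite (ph_ipZl pH _ (ce m) (cf n)) (ph_ipZr pH _ (cf n) (ce m)) conjc_real.
move/eqP; rewrite -subr_eq0 -mulrBl mulf_eq0 => /orP[|].
  by rewrite subr_eq0 => /eqP[->].
by move=> /eqP z; rewrite (ph_herm pH (ce m) (cf n)) z conjc0 conjc0 !mulr0.
Qed.

End TwoEigenbases.

End Orthonormal.

(** * Direct sums of pre-Hilbert spaces *)

Section DirectSum.
Context {R : realType} (H1 H2 : hspace R).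
Hypotheses (p1 : prehilbert H1) (p2 : prehilbert H2).

Definition dsum : hspace R := @HSpace R (H1 * H2)%type
  [set u : H1 * H2 | hcar u.1 /\ hcar u.2]
  (fun u v : H1 * H2 => hip u.1 v.1 + hip u.2 v.2).

Lemma dsum_prehilbert : prehilbert dsum.
Proof.
split.
- by split; exact: ph_car0.
- by move=> k u v [h1 h2] [h3 h4]; split; exact: ph_carP.
- move=> k u v w [h1 h2] [h3 h4] [h5 h6]; rewrite /hip/= !ph_lin// mulrDr.
  by rewrite addrACA.
- by move=> u v [h1 h2] [h3 h4]; rewrite /hip/= (ph_herm p1 h1 h3) (ph_herm p2 h2 h4) -conjcD.
- by move=> u [h1 h2]; rewrite /hip/= ReD addr_ge0// ph_ge0.
Qed.

End DirectSum.

(** * Square integrable functions *)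

Section SquareIntegrable.
Context {d : measure_display} {T : measurableType d} {R : realType}.
Variables (mu : {measure set T -> \bar R}) (D : set T).
Hypothesis mD : measurable D.
Hypothesis finD : (mu D < +oo)%E.
Implicit Types f g h : T -> R.

Definition sqint f :=
  measurable_fun D f /\ mu.-integrable D (EFin \o (fun x => f x ^+ 2)).

Definition square_ip f g : R := \int[mu]_(x in D) (f x * g x).

Lemma sqint_mul f g : sqint f -> sqint g ->
  mu.-integrable D (EFin \o (fun x => f x * g x)).
Proof.
move=> [mf hf] [mg hg]; apply: le_integrable (integrableD mD hf hg) => //.
  by apply/measurable_EFinP; exact: measurable_funM.
move=> x _ /=; rewrite lee_fin [leRHS]ger0_norm ?addr_ge0 ?sqr_ge0// normrM.
rewrite -[f x ^+ 2]real_normK ?num_real// -[g x ^+ 2]real_normK ?num_real//.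
have := normr_ge0 (f x); have := normr_ge0 (g x); nra.
Qed.

Lemma sqintD f g : sqint f -> sqint g -> sqint (f \+ g).
Proof.
move=> hf hg; split; first by apply: measurable_funD; [case: hf|case: hg].
have h := integrableD mD hf.2 (integrableD mD hg.2 (integrableZl mD 2 (sqint_mul hf hg))).
apply: eq_integrable h => // x _ /=; congr EFin; ring.
Qed.

Lemma sqintZ (k : R) f : sqint f -> sqint (fun x => k * f x).
Proof.
move=> [mf hf]; split; first exact: measurable_funM.
apply: eq_integrable (integrableZl mD (k ^+ 2) hf) => // x _ /=; congr EFin; ring.
Qed.

Lemma sqintN f : sqint f -> sqint (fun x => - f x).
Proof. by move=> /(sqintZ (-1)); under eq_fun do rewrite mulN1r. Qed.

Lemma sqintB f g : sqint f -> sqint g -> sqint (fun x => f x - g x).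
Proof. by move=> hf /sqintN; exact: sqintD. Qed.

Lemma sqint_bounded f (c : R) : measurable_fun D f ->
  (forall x, D x -> `|f x| <= c) -> sqint f.
Proof.
move=> mf hc; split => //; apply: (@le_integrable _ _ _ _ _ mD _ (cst (c ^+ 2)%:E)).
- by apply/measurable_EFinP; exact: measurable_funX.
- move=> x Dx /=; rewrite lee_fin ger0_norm ?sqr_ge0// ger0_norm ?sqr_ge0//.
  by rewrite -[f x ^+ 2]real_normK ?num_real// lerXn2r ?nnegrE// ?hc//; apply: le_trans (hc _ Dx).
- by apply/integrableP; split=> //; under eq_integral do rewrite /=; rewrite integral_cst// lte_mul_pinfty.
Qed.

Lemma eq_sqint f g : (forall x, D x -> f x = g x) -> sqint f -> sqint g.
Proof.
move=> e [mf hf]; split.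
  by apply: eq_measurable_fun mf => x /set_mem; exact: e.
by apply: eq_integrable hf => // x /set_mem Dx /=; rewrite e.
Qed.

Lemma sqint_integrable f : sqint f -> mu.-integrable D (EFin \o f).
Proof.
move=> hf; have h1 : sqint (cst 1) by apply: (@sqint_bounded _ 1) => // x _; rewrite normr1.
by apply: eq_integrable (sqint_mul hf h1) => // x _ /=; rewrite mulr1.
Qed.

Lemma square_ipC f g : square_ip f g = square_ip g f.
Proof. by apply: eq_Rintegral => x _; rewrite mulrC. Qed.

Lemma eq_square_ip f f' g g' : (forall x, D x -> f x = f' x) -> (forall x, D x -> g x = g' x) ->
  square_ip f g = square_ip f' g'.
Proof. by move=> e e'; apply: eq_Rintegral => x /set_mem Dx; rewrite e ?e'. Qed.

Lemma square_ip_lin (k : R) f f' g : sqint f -> sqint f' -> sqint g ->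
  square_ip (fun x => k * f x + f' x) g = k * square_ip f g + square_ip f' g.
Proof.
move=> hf hf' hg; have i1 := sqint_mul hf hg; have i2 := sqint_mul hf' hg.
rewrite /square_ip -RintegralZl// -RintegralD//; last exact: (integrableZl mD k i1).
by apply: eq_Rintegral => x _ /=; ring.
Qed.

Lemma square_ip_ge0 f : 0 <= square_ip f f.
Proof. by apply: Rintegral_ge0 => x _; rewrite -expr2 sqr_ge0. Qed.

Lemma square_ip_EFin f : sqint f -> ((square_ip f f)%:E = \int[mu]_(x in D) (f x ^+ 2)%:E)%E.
Proof.
move=> hf; rewrite /square_ip /Rintegral fineK; last exact: (integrable_fin_num mD (sqint_mul hf hf)).
by apply: eq_integral => x _; rewrite expr2.
Qed.

Lemma sqint_Lfun f : f \_ D \in Lfun mu 2%:E <-> sqint f.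
Proof.
split=> [h|[mf hf]].
- have mf : measurable_fun D f.
    by apply/(measurable_restrictT _ mD); move: h; rewrite inE => /andP[/[!inE]].
  split=> //; have := Lfun2_integrable_sqr h.
  move=> /(integrableS measurableT mD (@subsetT _ _)); apply: eq_integrable => // x xD /=.
  by rewrite patchE xD.
- have mfD : measurable_fun setT (f \_ D) by apply/(measurable_restrictT _ mD).
  rewrite inE; apply/andP; split; first by rewrite inE.
  rewrite inE/= /finite_norm; apply: (@lty_poweRy _ _ 2) => //.
  rewrite powR_Lnorm//.
  have /integrableP[_] := hf; rewrite integral_mkcond.
  apply: le_lt_trans; rewrite le_eqVlt; apply/orP; left; apply/eqP.
  apply: eq_integral => x _ /=; rewrite !patchE; case: ifP => _ /=.
    by rewrite powR_mulrn// normrX.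
  by rewrite normr0 powR0.
Qed.

(* The L^1 norm is dominated by the L^2 norm with [mu D] finite. *)
Lemma integral_abs_le f (e : R) : sqint f -> 0 < e -> square_ip f f <= e ^+ 2 ->
  (\int[mu]_(x in D) `|f x|%:E <= (e * (1 + fine (mu D)))%:E)%E.
Proof.
move=> hf e0 he.
have i1 : mu.-integrable D (EFin \o (fun x => e^-1 * f x ^+ 2)).
  exact: (integrableZl mD e^-1 hf.2).
have i2 : mu.-integrable D (EFin \o cst e).
  have h : sqint (cst e) by apply: (@sqint_bounded _ e) => // x _; rewrite gtr0_norm.
  exact: sqint_integrable.
have mabs : measurable_fun D (fun x => `|f x|%:E).
  by apply/measurable_EFinP; apply: measurableT_comp => //; exact: hf.1.
apply: (@le_trans _ _ (\int[mu]_(x in D) (e^-1 * f x ^+ 2 + e)%:E)%E).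
  apply: ge0_le_integral => //.
  - by have := measurable_int _ (integrableD mD i1 i2).
  - move=> x _; rewrite lee_fin -[f x ^+ 2]real_normK ?num_real//.
    have := normr_ge0 (f x); set y := `|f x| => y0.
    rewrite -(ler_pM2l e0) mulrDr mulrA divff ?gt_eqF// mul1r; nra.
under eq_integral do rewrite EFinD.
rewrite integralD//.
have -> : (\int[mu]_(x in D) (e^-1 * f x ^+ 2)%:E = (e^-1 * square_ip f f)%:E)%E.
  rewrite EFinM (square_ip_EFin hf) -(integralZl mD hf.2).
  by apply: eq_integral.
rewrite integral_cst// mulrDr EFinD mulr1.
have fD : mu D \is a fin_num by rewrite ge0_fin_numE.
rewrite [(e * _)%:E]EFinM fineK// leeD2r// lee_fin mulrC ler_pdivrMr//.
Qed.

(** Riesz-Fischer: a subsequence with rapidly decreasing increments converges almost everywhere,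
    since the sum of the absolute increments is integrable; Fatou's lemma then gives convergence in
    mean square of the full sequence. *)
Lemma sqint_complete (f : nat -> T -> R) :
  (forall n, sqint (f n)) ->
  (forall e : R, 0 < e -> exists n, forall m p, (n <= m)%N -> (n <= p)%N ->
    square_ip (fun x => f m x - f p x) (fun x => f m x - f p x) <= e ^+ 2) ->
  exists2 g, sqint g & forall e : R, 0 < e -> exists n, forall m, (n <= m)%N ->
    square_ip (fun x => f m x - g x) (fun x => f m x - g x) <= e ^+ 2.
Proof.
move=> hf cau.
have /choice[k0 hk0] : forall n, exists k, forall m p, (k <= m)%N -> (k <= p)%N ->
    square_ip (fun x => f m x - f p x) (fun x => f m x - f p x) <= ((2^-1 : R) ^+ n) ^+ 2.
  by move=> n; apply: cau; rewrite exprn_gt0.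
(* Strictly increasing indices along which consecutive terms are within [2^-n]. *)
pose k := fix F n := if n is n'.+1 then maxn (k0 n) (F n').+1 else k0 0%N.
have kS n : (k n <= k n.+1)%N by rewrite /= leq_max leqnSn orbT.
have kk0 n : (k0 n <= k n)%N by case: n => [//|n] /=; exact: leq_maxl.
have kid n : (n <= k n)%N.
  by elim: n => [//|n IH] /=; rewrite leq_max ltnS IH orbT.
have hk n m : (n <= m)%N -> (k0 n <= k m)%N.
  move=> nm; apply: leq_trans (kk0 n) _; elim: m nm => [|m IH]; first by rewrite leqn0 => /eqP ->.
  by rewrite leq_eqVlt => /orP[/eqP->//|/IH h]; exact: leq_trans h (kS m).
pose D_ n x := f (k n.+1) x - f (k n) x.
have sD n : sqint (D_ n) by exact: sqintB.
have mabs n : measurable_fun D (fun x => `|D_ n x|%:E).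
  by apply/measurable_EFinP; apply: measurableT_comp => //; exact: (sD n).1.
pose G x : \bar R := (\sum_(0 <= n <oo) `|D_ n x|%:E)%E.
have p2 n : 0 < (2^-1 : R) ^+ n by rewrite exprn_gt0.
have iG : (\int[mu]_(x in D) G x < +oo)%E.
  rewrite integral_nneseries//.
  apply: (@le_lt_trans _ _ (\sum_(0 <= n <oo) ((2^-1) ^+ n * (1 + fine (mu D)))%:E)%E).
    apply: lee_nneseries => n _; first by move=> _; apply: integral_ge0.
    by apply: integral_abs_le (sD n) (p2 n) _; apply: hk0; exact: hk.
  have c0 : 0 <= 1 + fine (mu D) by rewrite addr_ge0// fine_ge0.
  apply: (@le_lt_trans _ _ ((1 + fine (mu D)) * 2)%:E); last exact: ltry.
  apply: lime_le; first by apply: is_cvg_nneseries => n _ _; rewrite lee_fin mulr_ge0// ltW.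
  apply: nearW => n; rewrite sumEFin lee_fin -mulr_suml mulrC ler_wpM2l//.
  have -> : \sum_(0 <= i < n) (2^-1 : R) ^+ i = 2 - 2 * (2^-1) ^+ n.
    elim: n => [|n IH]; first by rewrite big_nil expr0; ring.
    by rewrite big_nat_recr//= IH exprS; field.
  by rewrite gerBl mulr_ge0// exprn_ge0.
have mG : measurable_fun D G by exact: ge0_emeasurable_sum.
have G0 x : (0 <= G x)%E by exact: nneseries_ge0.
have : {ae mu, forall x, D x -> G x \is a fin_num}.
  apply: integrable_ae => //; apply/integrableP; split=> //.
  by under eq_integral do rewrite gee0_abs//.
move=> [N [mN muN hN]].
(* Replacing the terms by 0 on the null set makes the convergence hold everywhere on [D], so that
   the limit is measurable. *)
pose h n x := if x \in N then 0 else f (k n) x.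
have mh n : measurable_fun D (h n).
  have [mf _] := hf (k n).
  apply: (@eq_measurable_fun _ _ _ _ D (fun x => \1_(~` N) x * f (k n) x)).
    move=> x _; rewrite /h indicE in_setC; case: ifP => /= _; by rewrite ?mul0r ?mul1r.
  by apply: measurable_funM => //; apply: measurable_indic; exact: measurableC.
have cvh x : D x -> cvgn (h ^~ x).
  move=> Dx; have [xN|xN] := boolP (x \in N).
    have -> : h ^~ x = cst 0 by apply/funext => n; rewrite /h xN.
    exact: is_cvg_cst.
  have -> : h ^~ x = (fun n => f (k n) x) by apply/funext => n; rewrite /h (negbTE xN).
  have Gfin : G x \is a fin_num.
    apply: contrapT => Gx; move/negP: xN; apply; rewrite inE; apply: hN => /= h'.
    by apply: Gx; exact: h'.
  have cs : cvgn (series (fun n => `|D_ n x|)).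
    apply: nondecreasing_is_cvgn.
      by apply/nondecreasing_seqP => n; rewrite /series/= big_nat_recr//= lerDl.
    exists (fine (G x)) => _ [n _ <-]; rewrite -lee_fin fineK// /series/= -sumEFin.
    by apply: nneseries_lim_ge.
  have /cvg_ex[l hl] := normed_cvg cs.
  have e n : f (k n) x = series (D_ ^~ x) n + f (k 0%N) x.
    rewrite /series/= /D_ telescope_sumr//; by rewrite subrK.
  have -> : (fun n => f (k n) x) = (fun n => series (D_ ^~ x) n + f (k 0%N) x).
    by apply/funext => n; exact: e.
  by apply: is_cvgD; [apply/cvg_ex; exists l|exact: is_cvg_cst].
pose g x := if x \in D then limn (h ^~ x) else 0.
have hg x : D x -> h ^~ x @ \oo --> g x.
  by move=> Dx; rewrite /g mem_set//; exact: cvh.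
have mg : measurable_fun D g by apply: measurable_fun_cvg hg.
have key (e : R) : 0 < e -> exists n, forall m, (n <= m)%N ->
    (\int[mu]_(x in D) ((f m x - g x) ^+ 2)%:E <= (e ^+ 2)%:E)%E.
  move=> e0; have [n hn] := cau e e0; exists n => m nm.
  have aeq : (\int[mu]_(x in D) ((f m x - g x) ^+ 2)%:E =
      \int[mu]_(x in D) limn_einf (fun j => ((f m x - h j x) ^+ 2)%:E))%E.
    apply: eq_integral => x /set_mem Dx; apply/esym; apply: (cvg_limn_einf_sup _).1.
    apply: cvg_EFin; first by apply: nearW.
    have c : (f m x - h j x) @[j --> \oo] --> f m x - g x.
      by apply: cvgB; [exact: cvg_cst|exact: hg].
    exact: (cvgM c c).
  rewrite aeq; apply: le_trans (fatou _ _ _ _) _ => //.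
  - move=> j; apply/measurable_EFinP; apply: measurable_funX; apply: measurable_funB => //.
    by exact: (hf m).1.
  - by move=> j x _; rewrite lee_fin sqr_ge0.
  have hle j : (n <= k j)%N ->
      (\int[mu]_(x in D) ((f m x - h j x) ^+ 2)%:E <= (e ^+ 2)%:E)%E.
    move=> nk; have -> : (\int[mu]_(x in D) ((f m x - h j x) ^+ 2)%:E =
        \int[mu]_(x in D) ((f m x - f (k j) x) ^+ 2)%:E)%E.
      apply: ge0_ae_eq_integral => //.
      - apply/measurable_EFinP; apply: measurable_funX; apply: measurable_funB => //.
        by exact: (hf m).1.
      - apply/measurable_EFinP; apply: measurable_funX; apply: measurable_funB => //.
          by exact: (hf m).1.
        by exact: (hf (k j)).1.
      - by move=> x _; rewrite lee_fin sqr_ge0.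
      - by move=> x _; rewrite lee_fin sqr_ge0.
      - exists N; split=> // x /= /not_implyP[_ hx]; apply: contrapT => xN; apply: hx.
        by rewrite /h memNset.
    rewrite -square_ip_EFin ?lee_fin; first exact: hn.
    exact: sqintB.
  rewrite limn_einf_lim; apply: lime_le; first exact: is_cvg_einfs.
  exists n => // j /= nj; apply: le_trans (hle j (leq_trans nj (kid j))).
  by apply: ereal_inf_lbound; exists j => /=.
have sg : sqint g.
  have [n hn] := key 1 ltr01.
  have mfg : measurable_fun D (fun x => f n x - g x) by apply: measurable_funB => //; exact: (hf n).1.
  have s1 : sqint (fun x => f n x - g x).
    split=> //; apply/integrableP; split.
      by apply/measurable_EFinP; exact: measurable_funX.
    apply: le_lt_trans (ltry (1 ^+ 2)); apply: le_trans (hn n (leqnn n)).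
    rewrite le_eqVlt; apply/orP; left; apply/eqP; apply: eq_integral => x _ /=.
    by rewrite ger0_norm ?sqr_ge0.
  by apply: eq_sqint (sqintB (hf n) s1) => x _; rewrite subKr.
exists g => // e e0; have [n hn] := key e e0; exists n => m nm.
by rewrite -lee_fin square_ip_EFin; [exact: hn|exact: sqintB].
Qed.

End SquareIntegrable.

(** * Open sets and continuous functions in the plane are measurable *)

Section PlaneMeasurability.
Context {R : realType}.
Local Notation point := (R * R)%type.
Local Notation mpoint := (measurableTypeR R * measurableTypeR R)%type.

(** The measurable structure is the product one, so an open set is written as a countable union of
    squares with rational centre and radius contained in it. *)
Lemma open_measurable2 (U : set point) : open U -> measurable (U : set mpoint).
Proof.
move=> oU; pose B (q1 q2 r : rat) : set mpoint :=
  (ball (ratr q1 : R) (ratr r : R)) `*` (ball (ratr q2 : R) (ratr r : R)).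
have mB q1 q2 r : measurable (B q1 q2 r).
  by apply: measurableX; apply: open_measurable; exact: ball_open.
have -> : (U : set mpoint) = \bigcup_q1 \bigcup_q2 \bigcup_r
    (if `[< B q1 q2 r `<=` U >] then B q1 q2 r else set0).
  apply/seteqP; split=> [p Up|p [q1 _ [q2 _ [r _]]]]; last by case: asboolP => [h /h|_ []].
  have /nbhs_ballP[e /= e0 he] := open_nbhs_nbhs (conj oU Up).
  have e2 : 0 < e / 2 by rewrite divr_gt0.
  have [r] := rat_in_itvoo e2; rewrite in_itv/= => /andP[r0 re].
  have rat_near (x : R) : exists q : rat, `|x - ratr q| < ratr r.
    have [q] := @rat_in_itvoo R (x - ratr r) x (ltac:(by rewrite gtrBl)).
    rewrite in_itv/= => /andP[h1 h2]; exists q; rewrite gtr0_norm ?subr_gt0//; lra.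
  have [q1 h1] := rat_near p.1; have [q2 h2] := rat_near p.2.
  exists q1 => //; exists q2 => //; exists r => //; case: asboolP => [_|[]].
    by split; rewrite /ball/= distrC.
  move=> p' [/= h1' h2']; apply: he; split; rewrite /ball/=.
    have -> : p.1 - p'.1 = (p.1 - ratr q1) + (ratr q1 - p'.1) by ring.
    by apply: le_lt_trans (ler_normD _ _) _; move: h1'; rewrite /ball/= => h1'; lra.
  have -> : p.2 - p'.2 = (p.2 - ratr q2) + (ratr q2 - p'.2) by ring.
  by apply: le_lt_trans (ler_normD _ _) _; move: h2'; rewrite /ball/= => h2'; lra.
apply: bigcupT_measurable_rat => q1; apply: bigcupT_measurable_rat => q2.
by apply: bigcupT_measurable_rat => r; case: ifP.
Qed.

Lemma continuous_measurable2 (D : set point) (f : point -> R) : open D ->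
  (forall p, D p -> {for p, continuous f}) ->
  measurable_fun (D : set mpoint) (f : mpoint -> R).
Proof.
move=> oD cf mD; apply: (measurability _ (RGenOInfty.measurableE R)) => //.
move=> _ [_ [x ->] <-].
apply: open_measurable2; rewrite openE => p [Dp /= fp].
rewrite in_itv/= andbT in fp.
have h1 : nbhs p D by exact: open_nbhs_nbhs.
have h2 : \forall q \near p, x < f q by exact: (cvgr_gt _ (cf p Dp)).
apply: filterS (filterI h1 h2) => q [Dq fq]; split=> //=; by rewrite in_itv/= fq.
Qed.

End PlaneMeasurability.

(** * The complex space [L2] through real and imaginary parts *)

Section L2Space.
Context {R : realType}.
Local Notation point := (R * R)%type.
Local Notation fn := (R * R -> R[i])%type.
Variable Om : set point.
Hypothesis mOm : measurable (Om : set (measurableTypeR R * measurableTypeR R)).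
Hypothesis finOm : (leb2 Om < +oo)%E.
Implicit Types u v w : fn.
Local Notation sqint := (@sqint _ _ R leb2 Om).
Local Notation rip := (@square_ip _ (measurableTypeR R * measurableTypeR R)%type R leb2 Om).

Lemma L2_carP u : L2_car Om u <->
  sqint (fun p => Re (u p)) /\ sqint (fun p => Im (u p)).
Proof.
have h := @sqint_Lfun _ _ R leb2 Om mOm.
by split=> -[h1 h2]; split; [apply/h|apply/h|apply/h|apply/h].
Qed.

Lemma L2_ipE u v : L2_car Om u -> L2_car Om v ->
  hip (u : L2 Om) v =
  (rip (fun p => Re (u p)) (fun p => Re (v p)) + rip (fun p => Im (u p)) (fun p => Im (v p))) +i*
  (rip (fun p => Im (u p)) (fun p => Re (v p)) - rip (fun p => Re (u p)) (fun p => Im (v p))).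
Proof.
move=> /L2_carP[h1 h2] /L2_carP[h3 h4]; rewrite /hip/= /cintegral; congr (_ +i* _).
  rewrite /square_ip -RintegralD//; [|exact: sqint_mul|exact: sqint_mul].
  by apply: eq_Rintegral => p _ /=; case: (u p) => x y; case: (v p) => x' y' /=; ring.
rewrite /square_ip -RintegralB//; [|exact: sqint_mul|exact: sqint_mul].
by apply: eq_Rintegral => p _ /=; case: (u p) => x y; case: (v p) => x' y' /=; ring.
Qed.

Let linE (k : R[i]) u v p :
  (Re ((k *: u + v) p) = Re k * Re (u p) + ((- Im k) * Im (u p) + Re (v p))) *
  (Im ((k *: u + v) p) = Re k * Im (u p) + (Im k * Re (u p) + Im (v p))).
Proof.
have -> : (k *: u + v) p = k * u p + v p by [].
case: k => x y; case: (u p) => x1 y1; case: (v p) => x2 y2; simpc; split=> /=; ring.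
Qed.

Lemma L2_car_lin (k : R[i]) u v : L2_car Om u -> L2_car Om v -> L2_car Om (k *: u + v).
Proof.
move=> /L2_carP[h1 h2] /L2_carP[h3 h4]; apply/L2_carP; split.
- have h : sqint (fun p => Re k * Re (u p) + ((- Im k) * Im (u p) + Re (v p))).
    by apply: sqintD; [|exact: sqintZ|apply: sqintD; [|exact: sqintZ|]].
  by apply: eq_sqint h => // p _; rewrite linE.
- have h : sqint (fun p => Re k * Im (u p) + (Im k * Re (u p) + Im (v p))).
    by apply: sqintD; [|exact: sqintZ|apply: sqintD; [|exact: sqintZ|]].
  by apply: eq_sqint h => // p _; rewrite linE.
Qed.

Lemma L2_prehilbert : prehilbert (L2 Om).
Proof.
have lin2 (x y : R) (f g h q : point -> R) : sqint f -> sqint g -> sqint h -> sqint q ->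
    rip (fun p => x * f p + (y * g p + h p)) q = x * rip f q + (y * rip g q + rip h q).
  move=> hf hg hh hw; rewrite -square_ip_lin// square_ip_lin//.
  by apply: sqintD => //; exact: sqintZ.
split.
- apply/L2_carP; split; apply: (@sqint_bounded _ _ _ _ _ _ _ _ 0) => // p _; by rewrite normr0.
- exact: L2_car_lin.
- move=> k u v w hu hv hw; have hl := L2_car_lin k hu hv; rewrite (L2_ipE hl hw) (L2_ipE hu hw) (L2_ipE hv hw).
  move: hu hv hw => /L2_carP[h1 h2] /L2_carP[h3 h4] /L2_carP[h5 h6].
  have e1 f : rip (fun p => Re ((k *: u + v) p)) f =
      rip (fun p => Re k * Re (u p) + ((- Im k) * Im (u p) + Re (v p))) f.
    by apply: eq_square_ip => // p _; rewrite linE.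
  have e2 f : rip (fun p => Im ((k *: u + v) p)) f =
      rip (fun p => Re k * Im (u p) + (Im k * Re (u p) + Im (v p))) f.
    by apply: eq_square_ip => // p _; rewrite linE.
  rewrite !e1 !e2 !lin2//; case: (k) => x y; simpc; congr (_ +i* _) => /=; ring.
- move=> u v hu hv; rewrite (L2_ipE hu hv) (L2_ipE hv hu); simpc.
  have C (f g : point -> R) : rip f g = rip g f by exact: square_ipC.
  rewrite (C (fun p => Re (v p)) (fun p => Re (u p))) (C (fun p => Im (v p)) (fun p => Im (u p))).
  rewrite (C (fun p => Im (v p)) (fun p => Re (u p))) (C (fun p => Re (v p)) (fun p => Im (u p))).
  congr (_ +i* _); ring.
- by move=> u hu; rewrite L2_ipE//= addr_ge0// square_ip_ge0.
Qed.

Lemma L2_normE u : L2_car Om u -> hnorm (u : L2 Om) ^+ 2 =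
  rip (fun p => Re (u p)) (fun p => Re (u p)) + rip (fun p => Im (u p)) (fun p => Im (u p)).
Proof.
by move=> hu; rewrite (ph_norm2 L2_prehilbert)// L2_ipE.
Qed.

Lemma L2_complete (s : nat -> L2 Om) : (forall n, hcar (s n)) ->
  (forall e : R, 0 < e -> exists n, forall m p, (n <= m)%N -> (n <= p)%N ->
    hnorm (s m - s p) <= e) ->
  exists2 l : L2 Om, hcar l & hnorm (s m - l) @[m --> \oo] --> (0 : R).
Proof.
move=> hs cau.
have ImB (x y : R[i]) : Im (x - y) = Im x - Im y by case: x; case: y.
have cB m p : L2_car Om (s m - s p) by exact: (ph_carB L2_prehilbert).
have nB m p : hnorm (s m - s p) ^+ 2 =
    rip (fun x => Re (s m x) - Re (s p x)) (fun x => Re (s m x) - Re (s p x)) +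
    rip (fun x => Im (s m x) - Im (s p x)) (fun x => Im (s m x) - Im (s p x)).
  by rewrite L2_normE//; congr (_ + _); apply: eq_square_ip => x _; [exact: ReB|exact: ReB|exact: ImB|exact: ImB].
have cau2 (e : R) : 0 < e -> exists n, forall m p, (n <= m)%N -> (n <= p)%N ->
    rip (fun x => Re (s m x) - Re (s p x)) (fun x => Re (s m x) - Re (s p x)) <= e ^+ 2 /\
    rip (fun x => Im (s m x) - Im (s p x)) (fun x => Im (s m x) - Im (s p x)) <= e ^+ 2.
  move=> e0; have [n hn] := cau e e0; exists n => m p nm np.
  have : hnorm (s m - s p) ^+ 2 <= e ^+ 2.
    by apply: lerXn2r; rewrite ?nnegrE ?hnorm_ge0 ?(ltW e0)//; exact: hn.
  rewrite nB; set A := rip _ _; set B := rip _ _.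
  have A0 : 0 <= A by exact: square_ip_ge0.
  have B0 : 0 <= B by exact: square_ip_ge0.
  by move=> h; split; lra.
have [f hf cf] := @sqint_complete _ _ R leb2 Om mOm finOm (fun n x => Re (s n x))
  (fun n => (proj1 (L2_carP _) (hs n)).1) (fun e e0 => let: ex_intro n hn := cau2 e e0 in
   ex_intro _ n (fun m p a b => (hn m p a b).1)).
have [g hg cg] := @sqint_complete _ _ R leb2 Om mOm finOm (fun n x => Im (s n x))
  (fun n => (proj1 (L2_carP _) (hs n)).2) (fun e e0 => let: ex_intro n hn := cau2 e e0 in
   ex_intro _ n (fun m p a b => (hn m p a b).2)).
have hl : L2_car Om (fun p => f p +i* g p) by apply/L2_carP; split.
exists (fun p => f p +i* g p) => //; apply/hcvg_eps => e e0.
have e2 : 0 < e / 2 by rewrite divr_gt0.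
have [n1 h1] := cf _ e2; have [n2 h2] := cg _ e2; exists (maxn n1 n2) => m.
rewrite geq_max => /andP[m1 m2].
rewrite -ler_sqr ?nnegrE ?hnorm_ge0 ?(ltW e0)// L2_normE; last exact: (ph_carB L2_prehilbert).
have eE : e ^+ 2 = (e / 2) ^+ 2 *+ 2 + (e / 2) ^+ 2 *+ 2 by field.
apply: le_trans (_ : (e / 2) ^+ 2 + (e / 2) ^+ 2 <= _); last first.
  by have := sqr_ge0 (e / 2); rewrite eE; lra.
apply: lerD; [apply: le_trans (h1 m m1)|apply: le_trans (h2 m m2)];
  rewrite le_eqVlt; apply/orP; left; apply/eqP; apply: eq_square_ip => x _;
  by [exact: ReB (f x +i* g x)|exact: ImB (f x +i* g x)].
Qed.

End L2Space.

(** * The rectangle, and integrals of derivatives of compactly supported functions *)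

Section Rectangle.
Context {R : realType} (a b : R).
Hypotheses (a0 : 0 < a) (b0 : 0 < b).
Local Notation point := (R * R)%type.
Local Notation mpoint := (measurableTypeR R * measurableTypeR R)%type.
Local Notation Om := (rect a b).

Lemma rect_open : open Om.
Proof.
have -> : Om = fst @^-1` `]0, a[ `&` snd @^-1` `]0, b[ by [].
by apply: openI; apply: open_comp => // p _; [exact: cvg_fst|exact: cvg_snd].
Qed.

Lemma rect_measurable : measurable (Om : set mpoint).
Proof. by apply: open_measurable2; exact: rect_open. Qed.

Lemma rect_finite : (@leb2 R Om < +oo)%E.
Proof.
have -> : @leb2 R Om = (lebesgue_measure (`]0%R, a[%classic : set R) * lebesgue_measure (`]0%R, b[%classic : set R))%E.
  by apply: product_measure1E; exact: measurable_itv.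
by rewrite !lebesgue_measure_itv/= !lte_fin a0 b0 !oppr0 !adde0 ltry.
Qed.

Definition axis (k : bool) : point := if k then (0, 1) else (1, 0).

Lemma partial_slice (k : bool) (f : point -> R) (p : point) :
  derivable f p (axis k) ->
  is_derive (if k then p.2 else p.1) 1
    (fun x : R => f (if k then (p.1, x) else (x, p.2))) (partial k f p).
Proof.
case: p => x y; rewrite /partial /axis; case: k => /= h.
- have e : (fun t : R => t^-1 *: ((f \o shift (x, y)) (t *: ((0, 1) : point)) - f (x, y))) =
           (fun t : R => t^-1 *: (((fun z => f (x, z)) \o shift y) (t *: 1) - f (x, y))).
    by apply/funext => t /=; congr (_ *: (f _ - _)); apply: injective_projections; rewrite /= ?scaler0 ?add0r.
  by split; [move: h; rewrite /derivable e|rewrite /derive -e].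
- have e : (fun t : R => t^-1 *: ((f \o shift (x, y)) (t *: ((1, 0) : point)) - f (x, y))) =
           (fun t : R => t^-1 *: (((fun z => f (z, y)) \o shift x) (t *: 1) - f (x, y))).
    by apply/funext => t /=; congr (_ *: (f _ - _)); apply: injective_projections; rewrite /= ?scaler0 ?add0r.
  by split; [move: h; rewrite /derivable e|rewrite /derive -e].
Qed.

Section Supported.
Variables (K : set point) (cK : compact K) (KOm : K `<=` Om).

Lemma support_bounded (f : point -> R) : (forall p, {for p, continuous f}) ->
  (forall p, ~ K p -> f p = 0) -> exists c : R, forall p, `|f p| <= c.
Proof.
move=> cf f0.
have cf' : {within K, continuous f} by apply: continuous_subspaceT => p; exact: cf.
have := compact_bounded (continuous_compact cf' cK).
rewrite /bounded_set /globally /= => -[M [_ hM]].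
exists (`|M| + 1) => p; have [Kp|/f0 ->] := pselect (K p); last by rewrite normr0; have := normr_ge0 M; lra.
by apply: (hM (`|M| + 1)); [have := ler_norm M; lra|exists p].
Qed.

Lemma support_open : open (~` K).
Proof. by apply: closed_openC; apply: compact_closed => //; exact: norm_hausdorff. Qed.

Lemma partial_support (k : bool) (f : point -> R) :
  (forall p, ~ K p -> f p = 0) -> forall p, ~ K p -> partial k f p = 0.
Proof.
move=> f0 p Kp; rewrite /partial.
have e : {near p, f =1 cst 0}.
  have : \forall q \near p, (~` K) q by apply: open_nbhs_nbhs; split=> //; exact: support_open.
  by apply: filterS => q; exact: f0.
by rewrite (near_eq_derive _ e) derive_cst.
Qed.

(** By Fubini, integrate first in the variable of differentiation; on each slice the fundamental
    theorem of calculus gives a difference of boundary values, and these vanish because the support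
    lies in the open rectangle. *)
Lemma integral_partial (k : bool) (f : point -> R) :
  (forall p, derivable f p (axis k)) ->
  (forall p, {for p, continuous (partial k f)}) ->
  (forall p, ~ K p -> f p = 0) ->
  \int[leb2]_(p in Om) partial k f p = 0.
Proof.
move=> df cf f0; have pf0 := @partial_support k _ f0.
have OmC p : ~ Om p -> f p = 0 by move=> h; apply: f0 => /KOm.
have [c hc] := support_bounded cf pf0.
have mf : measurable_fun [set: mpoint] (partial k f : mpoint -> R).
  by apply: continuous_measurable2; [exact: openT|move=> p _; exact: cf].
have e0 : partial k f \_ Om = partial k f.
  apply/funext => p; rewrite patchE; case: ifPn => // h; apply/esym; apply: pf0 => /KOm.
  by move=> hp; move/negP: h; apply; rewrite inE.
have [_ sq] : True /\ (@leb2 R).-integrable Om (EFin \o partial k f).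
  split=> //; apply: (sqint_integrable rect_measurable rect_finite).
  apply: (sqint_bounded rect_measurable rect_finite (c := c)) => //.
  by apply: measurable_funS mf.
have int : (@leb2 R).-integrable setT (EFin \o partial k f).
  move: sq; rewrite (integrable_mkcond _ rect_measurable) => h.
  apply: eq_integrable h => // p _ /=; rewrite -[in RHS]e0 !patchE; by case: ifP.
rewrite Rintegral_mkcond e0 /Rintegral.
have slice (l : R) (F f' : R -> R) : 0 < l -> (forall x, is_derive x (1 : R) F (f' x)) ->
    (forall x, {for x, continuous f'}) -> (forall x, ~ (0 < x < l) -> f' x = 0) ->
    F 0 = 0 -> F l = 0 -> (\int[lebesgue_measure]_x (f' x)%:E = 0)%E.
  move=> l0 hF cf' f'0 F0 Fl.
  have -> : (\int[lebesgue_measure]_x (f' x)%:E = \int[lebesgue_measure]_(x in `[0%R, l]) (f' x)%:E)%E.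
    rewrite [RHS]integral_mkcond; apply: eq_integral => x _; rewrite patchE; case: ifPn => // h.
    rewrite f'0// => /andP[h1 h2]; move/negP: h; apply; rewrite inE/= in_itv/=.
    by rewrite !ltW.
  have cF x : {for x, continuous F}.
    by apply: differentiable_continuous; apply/derivable1_diffP; case: (hF x).
  rewrite (@continuous_FTC2 _ f' F) ?F0 ?Fl ?subee//.
  - by apply: continuous_subspaceT => x; exact: cf'.
  - split.
    + by move=> x _; case: (hF x).
    + by apply: cvg_at_right_filter; exact: cF.
    + by apply: cvg_at_left_filter; exact: cF.
  - by move=> x _; rewrite derive1E; case: (hF x).
have nOm x y : ~ (0 < x < a) \/ ~ (0 < y < b) -> ~ Om (x, y).
  by move=> h [/= h1 h2]; case: h; apply; [move: h1|move: h2]; rewrite in_itv.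
have kOm p : ~ Om p -> partial k f p = 0 by move=> h; apply: pf0 => /KOm.
have nlt (l : R) : ~ (l < l)%R by rewrite ltxx.
have fst_cont y x : {for x, continuous (fun z : R => (z, y) : point)}.
  exact (cvg_pair (@cvg_id _ (nbhs x)) (@cvg_cst _ y _ (nbhs x) _)).
have snd_cont x y : {for y, continuous (fun z : R => (x, z) : point)}.
  exact (cvg_pair (@cvg_cst _ x _ (nbhs y) _) (@cvg_id _ (nbhs y))).
case: k df cf pf0 hc mf e0 sq int kOm => df cf pf0 hc mf e0 sq int kOm.
- rewrite -(integral12_prod_meas1 int) (eq_integral (cst 0%E)) ?integral0// => x _.
  apply: (@slice b (fun y => f (x, y)) (fun y => partial true f (x, y))) => //.
  + by move=> y; exact: (@partial_slice true f (x, y) (df _)).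
  + by move=> y; apply: (continuous_comp (snd_cont x y)); exact: cf.
  + by move=> y h; apply: kOm; apply: nOm; right.
  + by apply: OmC; apply: nOm; right => /andP[/nlt].
  + by apply: OmC; apply: nOm; right => /andP[_ /nlt].
- rewrite -(integral21_prod_meas1 int) (eq_integral (cst 0%E)) ?integral0// => y _.
  apply: (@slice a (fun x => f (x, y)) (fun x => partial false f (x, y))) => //.
  + by move=> x; exact: (@partial_slice false f (x, y) (df _)).
  + by move=> x; apply: (continuous_comp (fst_cont y x)); exact: cf.
  + by move=> x h; apply: kOm; apply: nOm; left.
  + by apply: OmC; apply: nOm; left => /andP[/nlt].
  + by apply: OmC; apply: nOm; left => /andP[_ /nlt].
Qed.

End Supported.

End Rectangle.

Lemma sum_order1 (V : nmodType) (F : nat -> nat -> V) :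
  \sum_(i < 2) \sum_(j < 2 | (i + j <= 1)%N) F i j = F 0%N 0%N + (F 1%N 0%N + F 0%N 1%N).
Proof.
under eq_bigr do rewrite big_mkcond.
rewrite !big_ord_recl !big_ord0 /= !addr0. 
by rewrite -addrA (addrC (F 0%N 1%N)).
Qed.
Lemma sum_order2 (V : nmodType) (F : nat -> nat -> V) :
  \sum_(i < 3) \sum_(j < 3 | (i + j <= 2)%N) F i j =
  F 0%N 0%N + F 0%N 1%N + F 0%N 2%N + (F 1%N 0%N + F 1%N 1%N) + F 2%N 0%N.
Proof.
under eq_bigr do rewrite big_mkcond.
by rewrite !big_ord_recl !big_ord0 /= !addr0 !addrA.
Qed.

Lemma sum_sqr3_le (R : realType) (x y z e : R) : 0 <= x -> 0 <= y -> 0 <= z -> 0 <= e ->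
  x ^+ 2 + (y ^+ 2 + z ^+ 2) <= e ^+ 2 -> [/\ x <= e, y <= e & z <= e].
Proof.
move=> x0 y0 z0 e0 h; have := sqr_ge0 x; have := sqr_ge0 y; have := sqr_ge0 z => z2 y2 x2.
by split; rewrite -ler_sqr ?nnegrE//; lra.
Qed.

Lemma le_eps_norm (R : realType) (x y c : R) : (forall e : R, 0 < e -> x <= y + c * e) -> x <= y.
Proof.
move=> h; apply/ler_addgt0Pl => e e0; have c1 : 0 < `|c| + 1 by have := normr_ge0 c; lra.
apply: le_trans (h (e / (`|c| + 1)) (divr_gt0 e0 c1)) _; rewrite addrC lerD2r.
rewrite mulrA ler_pdivrMr// mulrC ler_wpM2l ?(ltW e0)//.
by have := ler_norm c; lra.
Qed.

Lemma poincare_integrand (R : realType) (x a A B : R) : 0 <= x -> x <= a ->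
  0 <= 2^-1 * (A * A) + (2 * a ^+ 2 * (B * B) + 2 * (x * A * B)).
Proof.
move=> x0 xa; have x2 : x ^+ 2 <= a ^+ 2 by rewrite ler_sqr ?nnegrE// (le_trans x0).
have h1 : 0 <= (A + 2 * x * B) ^+ 2 * 2^-1 by apply: mulr_ge0; [exact: sqr_ge0|rewrite invr_ge0].
have h2 : 0 <= 2 * (a ^+ 2 - x ^+ 2) by apply: mulr_ge0 => //; rewrite subr_ge0.
have -> : 2^-1 * (A * A) + (2 * a ^+ 2 * (B * B) + 2 * (x * A * B)) =
  (A + 2 * x * B) ^+ 2 * 2^-1 + 2 * (a ^+ 2 - x ^+ 2) * B ^+ 2 by field.
exact: addr_ge0 h1 (mulr_ge0 h2 (sqr_ge0 B)).
Qed.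

(** * Weak derivatives, Green's formula and Poincare's inequality *)

Section TestFunctions.
Context {R : realType} (a b : R).
Hypotheses (a0 : 0 < a) (b0 : 0 < b).
Local Notation point := (R * R)%type.
Local Notation fn := (R * R -> R[i])%type.
Local Notation Om := (rect a b).
Local Notation sqint := (@sqint _ _ R leb2 Om).
Local Notation rip := (@square_ip _ (measurableTypeR R * measurableTypeR R)%type R leb2 Om).
Implicit Types (phi psi : point -> R) (u v f g h : fn).
Let mOm := @rect_measurable R a b.
Let fOm := rect_finite a0 b0.
Let pL : prehilbert (L2 Om) := L2_prehilbert mOm fOm.

Lemma C_on_partial k n (D : set point) phi :
  C_on n.+1 D phi -> C_on n D (partial k phi).
Proof.
move=> h s p sn Dp; have e : partials s (partial k phi) = partials (rcons s k) phi.
  by rewrite /partials foldr_rcons.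
have [|h1 h2] := h (rcons s k) p _ Dp; first by rewrite size_rcons.
by rewrite e; split=> // sn'; apply: h2; rewrite size_rcons.
Qed.

Lemma test_continuous phi : test_function Om phi -> forall p, {for p, continuous phi}.
Proof. by move=> [h _] p; have [] := h 0%N [::] p (leqnn _) I. Qed.

Lemma test_derivable k phi : test_function Om phi -> forall p, derivable phi p (axis k).
Proof.
move=> [h _] p; have [_ /(_ isT)[h1 h2]] := h 1%N [::] p isT I.
by case: k; [exact: h2|exact: h1].
Qed.

Lemma test_partial k phi : test_function Om phi -> test_function Om (partial k phi).
Proof.
move=> [h [K [cK KO K0]]]; split; first by move=> n; exact: C_on_partial (h n.+1).
by exists K; split=> //; exact: partial_support.
Qed.

Lemma test_bounded phi : test_function Om phi -> exists c : R, forall p, `|phi p| <= c.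
Proof.
by move=> h; have cf := test_continuous h; case: h => _ [K [cK _ K0]]; exact: support_bounded cK _ cf K0.
Qed.

Lemma continuous_sqint phi (c : R) : (forall p, {for p, continuous phi}) ->
  (forall p, Om p -> `|phi p| <= c) -> sqint phi.
Proof.
move=> cf hc; apply: (sqint_bounded mOm fOm _ hc).
by apply: continuous_measurable2; [exact: rect_open|move=> p _; exact: cf].
Qed.

Lemma test_sqint phi : test_function Om phi -> sqint phi.
Proof.
move=> h; have [c hc] := test_bounded h.
by apply: (@continuous_sqint _ c) => // p; exact: test_continuous.
Qed.

Lemma test_byparts k phi psi : test_function Om phi -> test_function Om psi ->
  rip phi (partial k psi) = - rip (partial k phi) psi.
Proof.
move=> t1 t2; have t3 := test_partial k t1; have t4 := test_partial k t2.
have c1 := test_continuous t1; have c2 := test_continuous t2.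
have c3 := test_continuous t3; have c4 := test_continuous t4.
have d1 := @test_derivable k _ t1; have d2 := @test_derivable k _ t2.
have e : partial k (phi * psi) = (fun p => phi p * partial k psi p + partial k phi p * psi p).
  have pE (f : point -> R) p : partial k f p = 'D_(axis k) f p by [].
  apply/funext => p; rewrite !pE deriveM//.
  by rewrite /GRing.scale/= (mulrC (psi p)).
have : \int[leb2]_(p in Om) partial k (phi * psi) p = 0.
  case: (t1) => _ [K [cK KO K0]]; apply: (integral_partial a0 b0 cK KO).
  - by move=> p; exact: derivableM.
  - by move=> p; rewrite e; apply: cvgD; apply: cvgM; [exact: c1|exact: c4|exact: c3|exact: c2].
  - by move=> p /K0 h; rewrite fctE h mul0r.
rewrite e RintegralD//; first by move/eqP; rewrite addr_eq0 => /eqP.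
- by apply: sqint_mul => //; exact: test_sqint.
- by apply: sqint_mul => //; exact: test_sqint.
Qed.

(** The integral of the x-derivative of [x phi^2] is zero, so the integral of [phi^2] equals that of
    [- 2 x phi phi_x]. The latter is absorbed by the pointwise inequality [poincare_integrand], as
    [0 < x < a]. *)
Lemma test_poincare phi : test_function Om phi ->
  rip phi phi <= 4 * a ^+ 2 * rip (partial false phi) (partial false phi).
Proof.
move=> t1; have t3 := test_partial false t1.
have c1 := test_continuous t1; have c3 := test_continuous t3.
have d1 := @test_derivable false _ t1.
have s1 := test_sqint t1; have s3 := test_sqint t3.
pose X : point -> R := fst.
have cX p : {for p, continuous X} by exact: cvg_fst.
have dX (p : point) : is_derive p (axis false) X 1.
  have e : (fun t : R => t^-1 *: ((X \o shift p) (t *: axis false) - X p)) =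
           (fun t : R => t^-1 *: ((id \o shift p.1) (t *: 1) - p.1)).
    by apply/funext => t /=; congr (_ *: (_ - _)).
  have [h1 h2] := @is_derive_id R R p.1 1.
  by split; [rewrite /derivable e|rewrite /derive e].
pose xphi := (fun p => X p * phi p : R).
have e : partial false (X * (phi * phi)) =
    (fun p => phi p * phi p + 2 * (xphi p * partial false phi p)).
  have pE (f : point -> R) p : partial false f p = 'D_(axis false) f p by [].
  apply/funext => p; rewrite !pE.
  case: (dX p) => dX1 dX2.
  rewrite (deriveM dX1 (derivableM (d1 p) (d1 p))) (deriveM (d1 p) (d1 p)) dX2.
  rewrite /GRing.scale/= /xphi fctE; ring.
have [c hc] := test_bounded t1.
have sx : sqint xphi.
  apply: (@continuous_sqint _ (a * c)); first by move=> p; apply: cvgM; [exact: cX|exact: c1].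
  move=> [x y] [/= + _]; rewrite in_itv/= => /andP[x0 xa]; rewrite /xphi normrM.
  by apply: ler_pM => //; rewrite gtr0_norm// ltW.
have i1 := sqint_mul mOm s1 s1; have i3 := sqint_mul mOm s3 s3.
have i2 := sqint_mul mOm sx s3.
have i2' := integrableZl mOm 2 i2; have i1' := integrableZl mOm (2^-1) i1.
have i3' := integrableZl mOm (2 * a ^+ 2) i3.
have e1 : rip phi phi + 2 * rip xphi (partial false phi) = 0.
  rewrite /square_ip -RintegralZl// -RintegralD//.
  have <- : \int[leb2]_(p in Om) partial false (X * (phi * phi)) p = 0.
    case: (t1) => _ [K [cK KO K0]]; apply: (integral_partial a0 b0 cK KO).
    - by move=> p; have [dX1 _] := dX p; exact: (derivableM dX1 (derivableM (d1 p) (d1 p))).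
    - move=> p; rewrite e; apply: cvgD; first by apply: cvgM; exact: c1.
      apply: cvgM; first exact: cvg_cst.
      by apply: cvgM; [apply: cvgM; [exact: cX|exact: c1]|exact: c3].
    - by move=> p /K0 h; rewrite !fctE h !mulr0.
  by rewrite e.
have : 0 <= 2^-1 * rip phi phi + (2 * a ^+ 2 * rip (partial false phi) (partial false phi) +
    2 * rip xphi (partial false phi)).
  rewrite /square_ip -!RintegralZl// -RintegralD// -RintegralD//.
    apply: Rintegral_ge0 => -[x y] [/= + _]; rewrite in_itv/= => /andP[x0 xa].
    by rewrite /xphi /=; apply: poincare_integrand; exact: ltW.
  exact: (integrableD mOm i3' i2').
move: e1; set P := rip phi phi; set Q := rip (partial _ _) _; set S := rip xphi _.
by move=> e1 h; lra.
Qed.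

Definition ofr phi : fn := fun p => (phi p)%:C.

Lemma ofr_L2 phi : sqint phi -> L2_car Om (ofr phi).
Proof.
move=> h; apply/(L2_carP mOm); split=> //.
by apply: (@continuous_sqint _ 0) => [p|p _]; [exact: cvg_cst|rewrite normr0].
Qed.

Lemma ip_ofr u phi : L2_car Om u -> sqint phi ->
  hip (u : L2 Om) (ofr phi) = rip (fun p => Re (u p)) phi +i* rip (fun p => Im (u p)) phi.
Proof.
move=> hu hp; rewrite (L2_ipE mOm hu (ofr_L2 hp)).
have z w : rip w (fun p => Im (ofr phi p)) = 0.
  transitivity (\int[leb2]_(p in Om) (cst 0 p : R)); last by rewrite Rintegral_cst// mul0r.
  by apply: eq_Rintegral => p _; rewrite /ofr/= mulr0.
by rewrite !z addr0 subr0.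
Qed.

Definition cpartial k u : fn := fun p =>
  (partial k (@complex.Re R \o u) p) +i* (partial k (@complex.Im R \o u) p).

Lemma ctest_L2 u : ctest_function Om u -> L2_car Om u.
Proof. by move=> [h1 h2]; apply/(L2_carP mOm); split; exact: test_sqint. Qed.

Lemma ctest_partial k u : ctest_function Om u -> ctest_function Om (cpartial k u).
Proof. by move=> [h1 h2]; split; exact: test_partial. Qed.

Definition weak1 k u g := [/\ L2_car Om u, L2_car Om g & forall phi, test_function Om phi ->
  hip (u : L2 Om) (ofr (partial k phi)) = - hip (g : L2 Om) (ofr phi)].

Let ipofr u phi : cintegral Om (fun p => u p * (phi p)%:C) = hip (u : L2 Om) (ofr phi).
Proof.
rewrite /hip/=; congr cintegral; apply/funext => p; congr (_ * _).
by rewrite /ofr; apply/eqP; rewrite eq_complex /= oppr0 !eqxx.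
Qed.

Lemma weak_derivativeP i j u g : weak_derivative Om i j u g <->
  [/\ L2_car Om u, L2_car Om g & forall phi, test_function Om phi ->
    hip (u : L2 Om) (ofr (partials (nseq i false ++ nseq j true) phi)) =
    (-1) ^+ (i + j) * hip (g : L2 Om) (ofr phi)].
Proof.
by split=> -[h1 h2 h3]; split=> // phi /h3; rewrite !ipofr.
Qed.

Lemma weak_derivative1P k u g :
  weak_derivative Om (~~ k) k u g <-> weak1 k u g.
Proof.
have e phi : partials (nseq (~~ k) false ++ nseq k true) phi = partial k phi by case: (k).
have s : (-1) ^+ (~~ k + k) = -1 :> R[i] by case: (k).
by split=> [/weak_derivativeP|] -[h1 h2 h3]; [|apply/weak_derivativeP]; split=> // phi /h3; rewrite e s mulN1r.
Qed.

Lemma ctest_weak k u : ctest_function Om u -> weak1 k u (cpartial k u).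
Proof.
move=> hu; split; [exact: ctest_L2|exact/ctest_L2/ctest_partial|move=> phi hp].
have hp' := test_partial k hp; case: (hu) => h1 h2.
rewrite !ip_ofr; try exact: test_sqint; try exact: ctest_L2; last exact/ctest_L2/ctest_partial.
rewrite [rip (fun p => Re (u p)) _](test_byparts k h1 hp).
by rewrite [rip (fun p => Im (u p)) _](test_byparts k h2 hp).
Qed.

Let ctestE u : u = 'i *: ofr (fun p => Im (u p)) + ofr (fun p => Re (u p)).
Proof.
apply/funext => p; have -> : ('i *: ofr (fun p => Im (u p)) + ofr (fun p => Re (u p))) p =
  'i * (Im (u p))%:C + (Re (u p))%:C by [].
by case: (u p) => x y; simpc.
Qed.

(** A complex test function is a combination of two real ones, and both sides are conjugate linear
    in it. *)
Lemma ctest_ip (L1 L2' : fn) k (s : R[i]) : L2_car Om L1 -> L2_car Om L2' ->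
  (forall phi, test_function Om phi ->
    hip (L1 : L2 Om) (ofr (partial k phi)) = s * hip (L2' : L2 Om) (ofr phi)) ->
  forall u, ctest_function Om u ->
    hip (L1 : L2 Om) (cpartial k u) = s * hip (L2' : L2 Om) u.
Proof.
move=> h1 h2 h u [t1 t2].
have s1 := ofr_L2 (test_sqint t1); have s2 := ofr_L2 (test_sqint t2).
have s3 := ofr_L2 (test_sqint (test_partial k t1)).
have s4 := ofr_L2 (test_sqint (test_partial k t2)).
have lin (L x y : L2 Om) : hcar L -> hcar x -> hcar y ->
    hip L ('i *: x + y) = conjc 'i * hip L x + hip L y.
  by move=> hL hx hy; rewrite (ph_ipDr pL)// ?(ph_ipZr pL)//; exact: (ph_carZ pL).
rewrite (ctestE (cpartial k u)) [in RHS](ctestE u).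
rewrite (lin _ _ _ h1 s4 s3) (lin _ _ _ h2 s2 s1).
by rewrite (h _ t1) (h _ t2); ring.
Qed.

Section UniqueDerivatives.
(** The fundamental lemma of the calculus of variations, supplied later by
    [unique_weak_derivatives]. *)
Hypothesis uniq : forall f, L2_car Om f ->
  (forall phi, test_function Om phi -> hip (f : L2 Om) (ofr phi) = 0) ->
  hnorm (f : L2 Om) = 0.

Lemma weak_derivative_unique i j u g h : weak_derivative Om i j u g ->
  weak_derivative Om i j u h -> hsame (g : L2 Om) h.
Proof.
move=> /weak_derivativeP[hu hg h1] /weak_derivativeP[_ hh h2].
apply: uniq; first exact: (ph_carB pL).
move=> phi tp; have sp := ofr_L2 (test_sqint tp).
rewrite (ph_ipBl pL)//; have := h1 _ tp; rewrite h2// => /eqP.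
rewrite -subr_eq0 -mulrBr mulf_eq0 signr_eq0/= subr_eq0 => /eqP ->.
by rewrite subrr.
Qed.

Lemma wderivP i j u : (exists g, weak_derivative Om i j u g) ->
  weak_derivative Om i j u (wderiv Om i j u).
Proof. by move=> h; exact: (@xgetPex _ 0 [set v | weak_derivative Om i j u v]). Qed.

Lemma weak_derivative00 u : L2_car Om u -> weak_derivative Om 0 0 u u.
Proof. by move=> hu; apply/weak_derivativeP; split=> // phi _; rewrite mul1r. Qed.

Lemma weak1B k u g v h : weak1 k u g -> weak1 k v h -> weak1 k (u - v) (g - h).
Proof.
move=> [h1 h2 h3] [h4 h5 h6]; split; [exact: (ph_carB pL)|exact: (ph_carB pL)|move=> phi tp].
have s1 := ofr_L2 (test_sqint tp); have s2 := ofr_L2 (test_sqint (test_partial k tp)).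
by rewrite !(ph_ipBl pL)// h3// h6//; ring.
Qed.

Lemma wderiv_norm i j u g : weak_derivative Om i j u g ->
  hnorm (wderiv Om i j u : L2 Om) = hnorm (g : L2 Om).
Proof.
move=> h; have h' := wderivP (ex_intro _ _ h).
case: (h) => _ hg _; case: (h') => _ hg' _.
exact: (hsame_norm pL hg' hg (weak_derivative_unique h' h)).
Qed.

Lemma sobolev_norm1E u gx gy : weak1 false u gx -> weak1 true u gy ->
  sobolev_norm Om 1 u ^+ 2 =
  hnorm (u : L2 Om) ^+ 2 + (hnorm (gx : L2 Om) ^+ 2 + hnorm (gy : L2 Om) ^+ 2).
Proof.
move=> wx wy; have hu : L2_car Om u by case: wx.
have w00 := weak_derivative00 hu.
have wx' : weak_derivative Om 1 0 u gx := proj2 (weak_derivative1P false u gx) wx.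
have wy' : weak_derivative Om 0 1 u gy := proj2 (weak_derivative1P true u gy) wy.
rewrite sqr_sqrtr; last by apply: sumr_ge0 => i _; apply: sumr_ge0 => j _; exact: sqr_ge0.
rewrite (sum_order1 (fun i j => hnorm (wderiv Om i j u : L2 Om) ^+ 2)).
have sq (x y : R) : x = y -> x ^+ 2 = y ^+ 2 by move=> ->.
exact (f_equal2 +%R (sq _ _ (wderiv_norm w00))
  (f_equal2 +%R (sq _ _ (wderiv_norm wx')) (sq _ _ (wderiv_norm wy')))).
Qed.

Lemma sobolev1_grad u : sobolev Om 1 u ->
  exists gx gy, weak1 false u gx /\ weak1 true u gy.
Proof.
move=> h; have [gx hx] := h 1%N 0%N isT; have [gy hy] := h 0%N 1%N isT.
exists gx, gy; split.
  exact: (proj1 (weak_derivative1P false u gx) hx).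
exact: (proj1 (weak_derivative1P true u gy) hy).
Qed.

Lemma H10_approx v vx vy (e : R) : H10 Om v -> weak1 false v vx -> weak1 true v vy -> 0 < e ->
  exists2 phi, ctest_function Om phi &
    [/\ hnorm (v - phi : L2 Om) <= e, hnorm (vx - cpartial false phi : L2 Om) <= e &
        hnorm (vy - cpartial true phi : L2 Om) <= e].
Proof.
move=> [_ /(_ e) h] wx wy e0; have [phi tp hp] := h e0; exists phi => //.
have := sobolev_norm1E (weak1B wx (ctest_weak false tp)) (weak1B wy (ctest_weak true tp)).
have : sobolev_norm Om 1 (v - phi) ^+ 2 <= e ^+ 2.
  by rewrite lerXn2r ?nnegrE ?sqrtr_ge0 ?ltW.
move=> h1 h2; have := h1; rewrite h2 => h3.
by apply: sum_sqr3_le (ltW e0) h3; exact: hnorm_ge0.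
Qed.

Lemma H10_poincare v vx vy : H10 Om v -> weak1 false v vx -> weak1 true v vy ->
  hnorm (v : L2 Om) <= 2 * a * hnorm (vx : L2 Om).
Proof.
move=> hv wx wy; apply: (@le_eps_norm R _ _ (1 + 2 * a)) => e e0.
have [phi tp [h1 h2 _]] := H10_approx hv wx wy e0.
have cp := ctest_L2 tp; have cp' := ctest_L2 (ctest_partial false tp).
have cv : L2_car Om v by case: wx.
have cvx : L2_car Om vx by case: wx.
have h3 : hnorm (phi : L2 Om) <= 2 * a * hnorm (cpartial false phi : L2 Om).
  rewrite -ler_sqr ?nnegrE ?hnorm_ge0//; last by rewrite mulr_ge0 ?hnorm_ge0// mulr_ge0// ltW.
  rewrite exprMn !(L2_normE mOm fOm)//; case: (tp) => t1 t2.
  have -> : (2 * a) ^+ 2 = 4 * a ^+ 2 by ring.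
  by rewrite mulrDr; apply: lerD; exact: test_poincare.
have h4 : hnorm (v : L2 Om) <= e + hnorm (phi : L2 Om).
  have := ph_normD pL (ph_carB pL cv cp) cp; rewrite subrK; lra.
have h5 : hnorm (cpartial false phi : L2 Om) <= e + hnorm (vx : L2 Om).
  have c := ph_carB pL cvx cp'; have := ph_normD pL (ph_carN pL c) cvx.
  by rewrite (ph_normN pL c) opprB subrK; lra.
have : 2 * a * hnorm (cpartial false phi : L2 Om) <= 2 * a * (e + hnorm (vx : L2 Om)).
  by apply: ler_wpM2l h5; rewrite mulr_ge0// ltW.
by move: h3 h4; set A := 2 * a * _; lra.
Qed.

(** For a test function in place of [v] the identity is the definition of the weak derivatives,
    [partial k phi] being itself a test function; both sides are continuous in [v] for the H^1 norm,
    in which test functions are dense in [H10]. *)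
Lemma H10_green k u g h v vx vy : weak1 k u g -> L2_car Om h ->
  (forall phi, test_function Om phi ->
    hip (u : L2 Om) (ofr (partial k (partial k phi))) = hip (h : L2 Om) (ofr phi)) ->
  H10 Om v -> weak1 false v vx -> weak1 true v vy ->
  hip (h : L2 Om) v = - hip (g : L2 Om) (if k then vy else vx).
Proof.
move=> [cu cg wg] ch hh hv wx wy; pose vk := if k then vy else vx.
have cvk : L2_car Om vk by rewrite /vk; case: (k); [case: wy|case: wx].
have cv : L2_car Om v by case: wx.
have key (phi : fn) : ctest_function Om phi -> hip (h : L2 Om) phi = - hip (g : L2 Om) (cpartial k phi).
  move=> tp; rewrite (@ctest_ip g h k (-1) cg ch)//; first by rewrite mulN1r opprK.
  by move=> psi ts; rewrite -hh// (wg _ (test_partial k ts)) mulN1r opprK.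
suff : normc (hip (h : L2 Om) v + hip (g : L2 Om) vk) <= 0.
  move=> h0; have : normc (hip (h : L2 Om) v + hip (g : L2 Om) vk) = 0.
    by apply/eqP; rewrite eq_le h0 normc_ge0.
  by move/Normc.eq0_normc/eqP; rewrite addr_eq0 => /eqP.
apply: (@le_eps_norm R _ _ (hnorm (h : L2 Om) + hnorm (g : L2 Om))) => e e0.
have [phi tp [h1 h2 h3]] := H10_approx hv wx wy e0.
have cp := ctest_L2 tp; have cp' := ctest_L2 (ctest_partial k tp).
have h4 : hnorm (vk - cpartial k phi : L2 Om) <= e by rewrite /vk; case: (k).
have -> : hip (h : L2 Om) v + hip (g : L2 Om) vk =
    hip (h : L2 Om) (v - phi) + hip (g : L2 Om) (vk - cpartial k phi).
  rewrite (ph_ipBr pL cv cp ch) (ph_ipBr pL cvk cp' cg) (key _ tp).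
  by rewrite opprK addrACA subrr addr0.
rewrite add0r mulrDl; apply: le_trans (le_normcD _ _) _; apply: lerD.
- apply: le_trans (ph_CS pL ch (ph_carB pL cv cp)) _; apply: ler_wpM2l => //; exact: hnorm_ge0.
- apply: le_trans (ph_CS pL cg (ph_carB pL cvk cp')) _; apply: ler_wpM2l => //; exact: hnorm_ge0.
Qed.

Lemma laplacian_green u l ux uy v vx vy : laplacian Om u l ->
  weak1 false u ux -> weak1 true u uy ->
  H10 Om v -> weak1 false v vx -> weak1 true v vy ->
  hip (l : L2 Om) v = - (hip (ux : L2 Om) vx + hip (uy : L2 Om) vy).
Proof.
move=> [_ _ cl [uxx [uyy [/weak_derivativeP[_ cxx hxx] /weak_derivativeP[_ cyy hyy] e]]]].
move=> wux wuy hv wx wy; have cv : L2_car Om v by case: wx.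
rewrite (hsame_ipl pL cl (ph_carD pL cxx cyy) cv e) (ph_ipDl pL)//.
rewrite (@H10_green false u ux uxx v vx vy)//; last first.
  by move=> phi tp; have := hxx _ tp; rewrite /= expr2 mulrNN !mul1r.
rewrite (@H10_green true u uy uyy v vx vy)//; last first.
  by move=> phi tp; have := hyy _ tp; rewrite /= expr2 mulrNN !mul1r.
by rewrite opprD.
Qed.

End UniqueDerivatives.

End TestFunctions.

(** * Numerical inequalities for the final decay estimate *)

Lemma sqr_sum3_le (R : realType) (x y z : R) :
  (x + (y + z)) ^+ 2 <= 3 * (x ^+ 2 + (y ^+ 2 + z ^+ 2)).
Proof.
rewrite -subr_ge0.
have -> : 3 * (x ^+ 2 + (y ^+ 2 + z ^+ 2)) - (x + (y + z)) ^+ 2 =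
  (x - y) ^+ 2 + (y - z) ^+ 2 + (x - z) ^+ 2 by ring.
by rewrite !addr_ge0// sqr_ge0.
Qed.

(** Bounds the norm [n] of the generator at the initial state by the data: [x], [y], [z] stand for
    the norms of the Laplacian of [w0], of [w1] and of its gradient, and [q] for the size of the
    feedback. *)
Lemma decay_data_bound (R : realType) (Dd q x y z n f : R) :
  0 <= Dd -> 0 <= q -> 0 <= x -> 0 <= y -> 0 <= z -> 0 <= n ->
  n <= f + (x + Dd * y + y * q) -> f <= z ->
  n ^+ 2 <= (1 + (Dd + q)) ^+ 2 * 3 * (x ^+ 2 + (y ^+ 2 + z ^+ 2)).
Proof.
move=> D0 q0 x0 y0 z0 n0 h fz; set P := 1 + (Dd + q).
have h1 : n <= P * (x + (y + z)).
  have m1 : 0 <= (Dd + q) * x by rewrite mulr_ge0// addr_ge0.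
  have m2 : 0 <= (Dd + q) * z by rewrite mulr_ge0// addr_ge0.
  have -> : P * (x + (y + z)) = z + (x + Dd * y + y * q) + y + (Dd + q) * x + (Dd + q) * z.
    by rewrite /P; ring.
  lra.
apply: le_trans (_ : (P * (x + (y + z))) ^+ 2 <= _).
  by rewrite lerXn2r ?nnegrE//; apply: le_trans h1.
rewrite exprMn -[leRHS]mulrA; apply: ler_wpM2l; first exact: sqr_ge0.
exact: sqr_sum3_le.
Qed.

(** Here [n] is the energy norm at time [t]; the missing norm [u1] of the displacement is recovered
    from the gradient norm [g] by Poincare's inequality. *)
Lemma decay_final_bound (R : realType) (C M p n nv W X tt u1 g u2 : R) :
  0 <= C -> 0 <= n -> 0 <= u1 -> 0 <= g -> u1 <= C * g -> n ^+ 2 = g ^+ 2 + u2 ^+ 2 ->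
  n <= M * p * nv -> p ^+ 2 = tt^-1 -> nv ^+ 2 <= W * X ->
  u1 ^+ 2 + g ^+ 2 + u2 ^+ 2 <= (C ^+ 2 + 1) * (M ^+ 2 * W) / tt * X.
Proof.
move=> C0 n0 u0 g0 ug nE nM pE nW.
have h1 : u1 ^+ 2 <= C ^+ 2 * g ^+ 2 by rewrite -exprMn lerXn2r// nnegrE// mulr_ge0.
have h2 : u1 ^+ 2 + g ^+ 2 + u2 ^+ 2 <= (C ^+ 2 + 1) * n ^+ 2.
  have : 0 <= C ^+ 2 * u2 ^+ 2 by rewrite mulr_ge0 ?sqr_ge0.
  by rewrite nE !mulrDl !mulrDr !mul1r; lra.
apply: le_trans h2 _.
have h3 : n ^+ 2 <= M ^+ 2 * tt^-1 * nv ^+ 2.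
  by rewrite -pE -!exprMn lerXn2r// nnegrE// (le_trans n0).
have -> : (C ^+ 2 + 1) * (M ^+ 2 * W) / tt * X = (C ^+ 2 + 1) * (M ^+ 2 * tt^-1 * (W * X)) by ring.
apply: ler_wpM2l; first by rewrite addr_ge0// sqr_ge0.
apply: le_trans h3 _; apply: ler_wpM2l => //.
by rewrite -pE mulr_ge0// sqr_ge0.
Qed.

Lemma powR_decay_sqr (R : realType) (t alpha : R) : 0 < t -> alpha != 0 ->
  (t `^ (- alpha^-1)) ^+ 2 = (t `^ (2 / alpha))^-1.
Proof.
move=> t0 a0; rewrite expr2 -powRD; last by rewrite (gt_eqF t0) implybT.
by rewrite -powRN; congr (_ `^ _); field.
Qed.

Section DirectSumNorm.
Context {R : realType} (H1 H2 : hspace R).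
Hypotheses (p1 : prehilbert H1) (p2 : prehilbert H2).
Local Notation K := (dsum H1 H2).
Let pK : prehilbert K := dsum_prehilbert p1 p2.

Lemma dsum_norm (x : H1) (y : H2) : hcar x -> hcar y ->
  hnorm ((x, y) : K) ^+ 2 = hnorm x ^+ 2 + hnorm y ^+ 2.
Proof.
move=> hx hy; have hxy : hcar ((x, y) : K) by split.
by rewrite (ph_norm2 pK hxy) (ph_norm2 p1 hx) (ph_norm2 p2 hy) -ReD.
Qed.

Lemma dsum_norm1 (x : H1) (y : H2) : hcar x -> hcar y -> hnorm x <= hnorm ((x, y) : K).
Proof.
move=> hx hy; rewrite -ler_sqr ?nnegrE ?hnorm_ge0// dsum_norm//.
by rewrite lerDl sqr_ge0.
Qed.

Lemma dsum_norm2 (x : H1) (y : H2) : hcar x -> hcar y -> hnorm y <= hnorm ((x, y) : K).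
Proof.
move=> hx hy; rewrite -ler_sqr ?nnegrE ?hnorm_ge0// dsum_norm//.
by rewrite lerDr sqr_ge0.
Qed.

Lemma dsum_norm_le (x : H1) (y : H2) : hcar x -> hcar y ->
  hnorm ((x, y) : K) <= hnorm x + hnorm y.
Proof.
move=> hx hy; have x0 := hnorm_ge0 x; have y0 := hnorm_ge0 y.
rewrite -ler_sqr ?nnegrE ?hnorm_ge0 ?addr_ge0// dsum_norm// sqrrD.
by rewrite lerD2r lerDl mulrn_wge0// mulr_ge0.
Qed.

End DirectSumNorm.

Section EnergySpace.
Context {R : realType} {H K : hspace R}.
Hypothesis pH : prehilbert H.
Hypothesis cpl : forall s : nat -> H, (forall n, hcar (s n)) ->
  (forall e : R, 0 < e -> exists n, forall m p, (n <= m)%N -> (n <= p)%N ->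
    hnorm (s m - s p) <= e) ->
  exists2 l, hcar l & hnorm (s m - l) @[m --> \oo] --> (0 : R).
Hypothesis pK : prehilbert K.
Variables (L : H -> set H) (D : set H) (grad : H -> K) (C : R).
Local Notation A := (fun u => [set v | L u (- v)]).
Hypothesis C0 : 0 < C.
Hypothesis LD : forall u l, L u l -> D u /\ hcar l.
Hypothesis cD : forall u, D u -> hcar u.
Hypothesis cG : forall u, D u -> hcar (grad u).
Hypothesis green : forall u l v, L u l -> D v -> hip l v = - hip (grad u) (grad v).
Hypothesis poin : forall v, D v -> hnorm v <= C * hnorm (grad v).
Variables (e : nat -> H) (lam : nat -> R).
Hypothesis be : eigenbasis A e lam.

Local Notation fp := (frac_pow_val A 2^-1).
Local Notation half u := (opdom (frac_pow A 2^-1) u).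

Definition energy : hspace R :=
  @HSpace R (H * H)%type [set u : H * H | half u.1 /\ hcar u.2]
    (fun u v : H * H => hip (fp u.1) (fp v.1) + hip u.2 v.2).

Let oe : forall m n, hip (e m) (e n) = (m == n)%:R. Proof. by case: be. Qed.
Let te : forall u, hcar u -> (forall n, hip u (e n) = 0) -> hnorm u = 0.
Proof. by case: be. Qed.
Let De n : D (e n). Proof. by case: be => /(_ n)/LD[]. Qed.
Let ce n : hcar (e n). Proof. exact: cD. Qed.

Lemma carA u v : A u v -> hcar u.
Proof. by move=> /LD[/cD]. Qed.

Lemma carA2 u v : A u v -> hcar v.
Proof. by move=> /LD[_ /(ph_carN pH)]; rewrite opprK. Qed.

Lemma greenA u w v : A u w -> D v -> hip w v = hip (grad u) (grad v).
Proof.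
move=> auw dv; have := green auw dv; rewrite (ph_ipNl pH (carA2 auw) (cD dv)).
by move=> /eqP; rewrite eqr_opp => /eqP.
Qed.

Lemma symA u v u' v' : A u v -> A u' v' -> hip v u' = hip u v'.
Proof.
move=> a1 a2; have [d1 _] := LD a1; have [d2 _] := LD a2.
rewrite (greenA a1 d2) (ph_herm pH (carA2 a2) (cD d1)) (greenA a2 d1).
exact: (ph_herm pK (cG d2) (cG d1)).
Qed.

Lemma lam_grad m n : hip (grad (e m)) (grad (e n)) = (lam m)%:C * (m == n)%:R.
Proof.
case: be => Ae _ _; rewrite -(greenA (Ae m) (De n)) (ph_ipZl pH _ (ce m) (ce n)).
by rewrite oe.
Qed.

Lemma lam_gt0 n : 0 < lam n.
Proof.
have h1 : hnorm (grad (e n)) ^+ 2 = lam n.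
  by rewrite (ph_norm2 pK (cG (De n))) lam_grad eqxx mulr1.
have h2 := poin (De n); rewrite /hnorm oe eqxx /= sqrtr1 in h2.
rewrite -h1 exprn_gt0// lt_neqAle hnorm_ge0 andbT eq_sym; apply/eqP => z.
by move: h2; rewrite -/(hnorm _) z mulr0 ler10.
Qed.

Let r n := lam n `^ 2^-1.
Let r0 n : 0 < r n. Proof. exact/powR_gt0/lam_gt0. Qed.
Let r2 n : r n * r n = lam n.
Proof. by rewrite /r powR12_sqrt ?ltW ?lam_gt0// -expr2 sqr_sqrtr// ltW// lam_gt0. Qed.

Definition coefs (th : R) u v :=
  [/\ hcar u, hcar v & forall n, hip v (e n) = (lam n `^ th)%:C * hip u (e n)].

(** The eigenbasis hidden in [frac_pow] may be exchanged for the fixed one by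
    [eigenbasis_change]. *)
Lemma frac_powP th u v : frac_pow A th u v <-> coefs th u v.
Proof.
split=> [[hu hv [f [mu [bf h]]]]|[hu hv h]]; split=> //; last by exists e, lam.
exact: (eigenbasis_change pH cpl carA symA bf be (F := fun x => x `^ th) hu hv h).
Qed.

Lemma coefs_val th u : opdom (frac_pow A th) u -> coefs th u (frac_pow_val A th u).
Proof.
by move=> h; apply/frac_powP; exact: (@xgetPex _ 0 (frac_pow A th u)).
Qed.

Lemma coefs_same th u v : coefs th u v -> hsame (frac_pow_val A th u) v.
Proof.
move=> h; have [_ h1 h2] : coefs th u (frac_pow_val A th u).
  by apply: coefs_val; exists v; apply/frac_powP.
case: h => _ h3 h4; apply: (hsame_coef pH ce te) => // n; by rewrite h2 h4.
Qed.

Lemma coefs_norm th u v : coefs th u v -> hnorm (frac_pow_val A th u) = hnorm v.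
Proof.
move=> h; have [_ h1 _] : coefs th u (frac_pow_val A th u).
  by apply: coefs_val; exists v; apply/frac_powP.
by case: (h) => _ h2 _; apply: (hsame_norm pH h1 h2 (coefs_same h)).
Qed.

Lemma coefs_lin th k u v u' v' : coefs th u v -> coefs th u' v' ->
  coefs th (k *: u + u') (k *: v + v').
Proof.
move=> [h1 h2 h3] [h4 h5 h6]; split; [exact: (ph_carP pH)|exact: (ph_carP pH)|move=> n].
by rewrite (ph_lin pH)// (ph_lin pH)// h3 h6 mulrDr mulrCA.
Qed.

Lemma coefs0 th : coefs th 0 0.
Proof.
have h0 := ph_car0 pH; split=> // n; by rewrite (ph_ip0l pH (ce n)) mulr0.
Qed.

Lemma coefs_dom u w : A u w -> coefs 1 u w.
Proof.
move=> h; split; [exact: carA h|exact: carA2 h|move=> n].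
case: be => Ae _ _; have hu := carA h.
rewrite (symA h (Ae n)) (ph_ipZr pH _ (ce n) hu) conjc_real powRr1//.
by rewrite ltW// lam_gt0.
Qed.

(** By Green's formula the vectors [grad (e n) / sqrt(lam n)] are orthonormal in [K], and [grad v]
    has coefficients [sqrt(lam n) hip v (e n)] against them. Bessel's inequality in [K] and
    Riesz-Fischer in [H] produce [g]. *)
Lemma half_D v : D v -> exists2 g, coefs 2^-1 v g & hnorm g <= hnorm (grad v).
Proof.
move=> dv; pose f n : K := (r n)^-1%:C *: grad (e n).
have cf n : hcar (f n) by apply: (ph_carZ pK); exact: cG.
have of_ m n : hip (f m) (f n) = (m == n)%:R.
  rewrite (ph_ipZl pK _ (cG (De m)) (cf n)) (ph_ipZr pK _ (cG (De n)) (cG (De m))).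
  rewrite lam_grad conjc_real; case: eqVneq => [->|_]; last by rewrite !mulr0.
  rewrite mulr1 -r2 -!rmorphM/=; congr (_%:C).
  by have := r0 n; move: (r n) => x x0; field; rewrite gt_eqF.
have hv n : hip (grad v) (f n) = (r n)%:C * hip v (e n).
  case: be => Ae _ _.
  rewrite (ph_ipZr pK _ (cG (De n)) (cG dv)) conjc_real.
  rewrite (ph_herm pK (cG (De n)) (cG dv)) -(greenA (Ae n) dv).
  rewrite (ph_ipZl pH _ (ce n) (cD dv)) conjcM conjc_real -(ph_herm pH (ce n) (cD dv)).
  rewrite mulrA -rmorphM/= -r2; congr (_%:C * _).
  by have := r0 n; move: (r n) => x x0; field; rewrite gt_eqF.
have [g [cg hg ng _]] := riesz_fischer pH ce oe cpl (c := fun n => (r n)%:C * hip v (e n))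
  (hnorm_ge0 (grad v)) (fun N => ltac:(by under eq_bigr do rewrite -hv; exact: (bessel pK cf of_ N (cG dv)))).
by exists g => //; split=> //; exact: cD.
Qed.

Lemma halfP u : half u -> coefs 2^-1 u (fp u).
Proof. exact: coefs_val. Qed.

Lemma half_of u g : coefs 2^-1 u g -> half u.
Proof. by move=> h; exists g; apply/frac_powP. Qed.

Lemma D_half u : D u -> half u.
Proof. by move=> /half_D[g /half_of]. Qed.

Lemma fp_D u : D u -> hnorm (fp u) <= hnorm (grad u).
Proof. by move=> /half_D[g h]; rewrite -(coefs_norm h). Qed.

Lemma half_lin k u v : half u -> half v ->
  half (k *: u + v) /\ hsame (fp (k *: u + v)) (k *: fp u + fp v).
Proof.
move=> /halfP hu /halfP hv; have h := coefs_lin k hu hv.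
by split; [exact: half_of h|exact: coefs_same].
Qed.

Lemma fp_ip u w v : A u w -> half v -> hip (fp u) (fp v) = hip w v.
Proof.
move=> h /halfP[hv cv ev]; have [hu cu eu] := halfP (D_half (LD h).1).
have [_ cw ew] := coefs_dom h.
apply: (parseval_eq pH ce oe cpl te cu cv cw hv) => n.
rewrite eu ev ew conjcM conjc_real powRr1 ?(ltW (lam_gt0 n))//.
by rewrite mulrACA -rmorphM/= r2 mulrA.
Qed.

Lemma dom_grad u w : A u w -> hnorm (grad u) = hnorm (fp u).
Proof.
move=> h; have [d _] := LD h; have hd := D_half d.
have [_ cu _] := halfP hd.
apply/eqP; rewrite -(eqrXn2 (ltn0Sn 1)) ?hnorm_ge0//; apply/eqP.
by rewrite (ph_norm2 pK (cG d)) (ph_norm2 pH cu) (fp_ip h hd) (greenA h d).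
Qed.

(** Green, Cauchy-Schwarz and Poincare: [|grad u|^2 = <w,u> <= |w| |u| <= C |w| |grad u|]; the
    gradient norm is that of [fp u] on the domain. *)
Lemma dom_bound u w : A u w -> hnorm u <= C ^+ 2 * hnorm w /\ hnorm (fp u) <= C * hnorm w.
Proof.
move=> h; have [d _] := LD h; have cw := carA2 h; have hp := poin d; have cu := cD d.
have e1 : hnorm (grad u) ^+ 2 = Re (hip w u).
  by rewrite (ph_norm2 pK (cG d)) (greenA h d).
have h1 : hnorm (grad u) ^+ 2 <= hnorm w * hnorm u.
  rewrite e1; apply: le_trans (Re_le_normc _) _; exact: (ph_CS pH).
have g0 := hnorm_ge0 (grad u); have w0 := hnorm_ge0 w; have u0 := hnorm_ge0 u.
have h2 : hnorm (grad u) <= C * hnorm w.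
  move: h1 hp g0 w0 u0; move: (hnorm (grad u)) (hnorm w) (hnorm u) C0 => x y z.
  move=> C1 h1 hp g0 w0 u0; rewrite leNgt; apply/negP => xy.
  have x0 : 0 < x by apply: le_lt_trans xy; rewrite mulr_ge0// ltW.
  have : x ^+ 2 <= y * (C * x) by apply: le_trans h1 _; exact: ler_wpM2l.
  by rewrite expr2 mulrA ler_pM2r// mulrC leNgt xy.
rewrite -(dom_grad h); split=> //; apply: le_trans hp _.
by rewrite expr2 -mulrA ler_pM2l.
Qed.

Lemma energy_car (u : energy) : hcar u -> hcar ((fp u.1, u.2) : dsum H H).
Proof. by case: u => x y [/= /halfP[_ h _] hy]; split. Qed.

Let pE := dsum_prehilbert pH pH.

Lemma energy_lin k (u v : energy) : hcar u -> hcar v ->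
  hsame ((fp (k *: u + v).1, (k *: u + v).2) : dsum H H)
    (k *: ((fp u.1, u.2) : dsum H H) + ((fp v.1, v.2) : dsum H H)).
Proof.
case: u => x y; case: v => x' y' [/= h1 h2] [/= h3 h4].
have [h5 h6] := half_lin k h1 h3; have [_ c1 _] := halfP h1; have [_ c3 _] := halfP h3.
have [_ c5 _] := halfP h5.
have cd : hcar (fp (k *: x + x') - (k *: fp x + fp x')).
  by apply: (ph_carB pH) => //; exact: (ph_carP pH).
have cd2 : hcar ((k *: y + y') - (k *: y + y')) by rewrite subrr; exact: (ph_car0 pH).
have n0 : hnorm ((k *: y + y') - (k *: y + y')) = 0 by rewrite subrr (ph_norm0 pH).
have := dsum_norm pH pH cd cd2; rewrite h6 n0 expr0n addr0 => /eqP.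
by rewrite expf_eq0/= => /eqP.
Qed.

Lemma energy_prehilbert : prehilbert energy.
Proof.
split.
- by split; [exact: half_of (coefs0 _)|exact: (ph_car0 pH)].
- move=> k u v [h1 h2] [h3 h4]; split; first by have [] := half_lin k h1 h3.
  exact: (ph_carP pH).
- move=> k u v w hu hv hw.
  have huv : hcar (k *: u + v : energy).
    case: hu hv => h1 h2 [h3 h4]; split; first by have [] := half_lin k h1 h3.
    exact: (ph_carP pH).
  have cu := energy_car hu; have cv := energy_car hv; have cw := energy_car hw.
  have cuv := ph_carP pE k cu cv.
  have := hsame_ipl pE (energy_car huv) cuv cw (energy_lin k hu hv).
  by rewrite (ph_lin pE k cu cv cw).
- by move=> u v hu hv; exact: (ph_herm pE (energy_car hu) (energy_car hv)).
- by move=> u hu; exact: (ph_ge0 pE (energy_car hu)).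
Qed.

Lemma energy_normE (u : energy) : hnorm u = hnorm ((fp u.1, u.2) : dsum H H).
Proof. by []. Qed.

Lemma energy_normB (u v : energy) : hcar u -> hcar v ->
  hnorm (u - v) = hnorm ((fp u.1 - fp v.1, u.2 - v.2) : dsum H H).
Proof.
move=> hu hv; have hl := energy_lin (-1) hv hu.
rewrite !scaleN1r ![- _ + _]addrC in hl.
have huv := ph_carB energy_prehilbert hu hv.
exact: (hsame_norm pE (energy_car huv) (ph_carB pE (energy_car hu) (energy_car hv)) hl).
Qed.

(** The images under the square root converge to some [g]. A preimage of [g] has coefficients
    [hip g (e n) / r n], square summable because Poincare's inequality at [e n] gives
    [C r n >= 1]. *)
Lemma energy_complete (s : nat -> energy) : (forall n, hcar (s n)) ->
  (forall e : R, 0 < e -> exists n, forall m p, (n <= m)%N -> (n <= p)%N ->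
    hnorm (s m - s p) <= e) ->
  exists2 l : energy, hcar l & hnorm (s m - l) @[m --> \oo] --> (0 : R).
Proof.
move=> hs cau; have h1 n : coefs 2^-1 (s n).1 (fp (s n).1) by apply: halfP; case: (hs n).
have c1 n : hcar (fp (s n).1) by case: (h1 n).
have c2 n : hcar (s n).2 by case: (hs n).
have cB1 m p := ph_carB pH (c1 m) (c1 p); have cB2 m p := ph_carB pH (c2 m) (c2 p).
have [g cg hg] : exists2 g, hcar g & hnorm (fp (s m).1 - g) @[m --> \oo] --> (0 : R).
  apply: cpl => // x x0; have [n hn] := cau x x0; exists n => m p nm np.
  apply: le_trans (hn m p nm np); rewrite energy_normB//.
  exact: (dsum_norm1 pH pH (cB1 m p) (cB2 m p)).
have [l cl hl] : exists2 l, hcar l & hnorm ((s m).2 - l) @[m --> \oo] --> (0 : R).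
  apply: cpl => // x x0; have [n hn] := cau x x0; exists n => m p nm np.
  apply: le_trans (hn m p nm np); rewrite energy_normB//.
  exact: (dsum_norm2 pH pH (cB1 m p) (cB2 m p)).
pose c n := (r n)^-1%:C * hip g (e n).
have rC n : 1 <= C * r n.
  have h2 := poin (De n); rewrite {1}/hnorm oe eqxx /= sqrtr1 in h2.
  apply: le_trans h2 _; rewrite ler_pM2l// -ler_sqr ?nnegrE ?hnorm_ge0 ?(ltW (r0 n))//.
  by rewrite (ph_norm2 pK (cG (De n))) lam_grad eqxx mulr1 expr2 r2.
have hc N : \sum_(n < N) normc (c n) ^+ 2 <= (C * hnorm g) ^+ 2.
  rewrite exprMn; apply: le_trans (ler_wpM2l (sqr_ge0 C) (bessel pH ce oe N cg)).
  rewrite mulr_sumr; apply: ler_sum => n _.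
  rewrite /c Normc.normcM normcR ger0_norm ?invr_ge0 ?(ltW (r0 n))// exprMn.
  apply: ler_wpM2r; first exact: sqr_ge0.
  by rewrite lerXn2r ?nnegrE ?invr_ge0 ?(ltW (r0 n)) ?(ltW C0)// -div1r ler_pdivrMr.
have B0 : 0 <= C * hnorm g by apply: mulr_ge0; [exact: ltW|exact: hnorm_ge0].
have [u [cu hu _ _]] := riesz_fischer pH ce oe cpl B0 hc.
have cug : coefs 2^-1 u g.
  split=> // n; rewrite hu /c mulrA -rmorphM/= divff ?mul1r//.
  by rewrite gt_eqF//; exact: (r0 n).
have hul : hcar ((u, l) : energy) by split=> //; exact: half_of cug.
exists (u, l) => //; apply/hcvg_eps => x x0.
have x2 : 0 < x / 2 by rewrite divr_gt0.
have [n hn] := proj1 (hcvg_eps _ _) hg _ x2; have [n' hn'] := proj1 (hcvg_eps _ _) hl _ x2.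
exists (maxn n n') => m; rewrite geq_max => /andP[nm nm'].
have [_ cfu _] := halfP (half_of cug).
rewrite energy_normB//; apply: le_trans (dsum_norm_le pH pH (ph_carB pH (c1 m) cfu) (ph_carB pH (c2 m) cl)) _.
have e1 : hnorm (fp (s m).1 - fp u) = hnorm (fp (s m).1 - g).
  apply: (hsame_norm pH (ph_carB pH (c1 m) cfu) (ph_carB pH (c1 m) cg)).
  have := hsame_comb pH (-1) cfu cg (c1 m) (c1 m) (coefs_same cug) (hsame_refl pH _).
  by rewrite !scaleN1r ![- _ + _]addrC.
by rewrite /= e1 [leRHS]splitr; apply: lerD; [exact: hn|exact: hn'].
Qed.

Section Wave.
Variables (dm sm : H -> H) (Dd alpha : R).
Hypothesis Dd0 : 0 <= Dd.
Hypothesis c_dm : forall u, hcar u -> hcar (dm u).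
Hypothesis n_dm : forall u, hcar u -> hnorm (dm u) <= Dd * hnorm u.
Hypothesis c_sm : forall u, hcar u -> hcar (sm u).
Hypothesis sm_sym : forall u v, hcar u -> hcar v -> hip (sm u) v = hip u (sm v).
Hypothesis dm_sm : forall u, hcar u -> Re (hip (dm u) u) = hnorm (sm u) ^+ 2.
Hypothesis L00 : L 0 0.
Hypothesis alpha02 : 0 < alpha <= 2.

(** [dm] and [sm] stand for multiplication by [d] and by its square root. For the Dirichlet
    Laplacian, [energy] unfolds to [state] and [wave] to [wave_op] with the conjugate of [c]. *)
Definition wave (b c : H) : energy -> set energy := fun u => [set v : energy |
  [/\ opdom L u.1, half u.2, hcar v, hsame v.1 u.2 &
      exists2 l, L u.1 l & hsame v.2 (l - dm u.2 + hip (sm u.2) c *: b)]].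

Let pE' : prehilbert energy := energy_prehilbert.
Let hX : hilbert (quot pE') := quot_hilbert pE' energy_complete.
Let h0 := ph_car0 pH.

Let half0 : half 0. Proof. exact: half_of (coefs0 _). Qed.
Let fp0 : hnorm (fp 0) = 0.
Proof. by rewrite (coefs_norm (coefs0 _)) (ph_norm0 pH). Qed.

Lemma wave_car b c u v : wave b c u v -> hcar u /\ hcar v.
Proof.
case=> -[l hl] hu2 hv _ _; split=> //; split; last by case: (halfP hu2).
by apply: D_half; case: (LD hl).
Qed.

Lemma energy_ip0 (u : energy) y : hcar u -> hcar y ->
  hip u ((0, y) : energy) = hip u.2 y.
Proof.
move=> [/halfP[_ h1 _] h2] hy; have [_ h3 _] := halfP half0.
rewrite /hip/= (hsame_ipr pH h3 h0 h1 (coefs_same (coefs0 _))) (ph_ip0r pH h1).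
by rewrite add0r.
Qed.

(** The integral term is the rank-one map with vectors [(0, b)] and [(0, sm c)], [sm] being
    symmetric; on vectors with zero first component the energy product is that of [H]. *)
Lemma wave_perturbed b c u v : hcar b -> hcar c -> hcar u ->
  wave b c u v <-> wave 0 0 u (v - hip u ((0, sm c) : energy) *: ((0, b) : energy)).
Proof.
move=> cb cc cu; have cu2 : hcar u.2 by case: cu.
rewrite (energy_ip0 cu (c_sm cc)) -(sm_sym cu2 cc); set k := hip _ c.
have cbt : hcar ((0, b) : energy) by split.
have ckb := ph_carZ pE' k cbt.
have e1 : (v - k *: ((0, b) : energy)).1 = v.1 by rewrite /= scaler0 subr0.
have e2 l : (v - k *: ((0, b) : energy)).2 - (l - dm u.2 + hip (sm u.2) 0 *: 0) =
    v.2 - (l - dm u.2 + k *: b).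
  by rewrite /= scaler0 addr0 -addrA -opprD [k *: b + _]addrC.
split=> -[h1 h2 h3 h4 [l h5 h6]]; split=> //.
- exact: (ph_carB pE').
- by rewrite e1.
- by exists l => //; rewrite /hsame e2.
- by rewrite -(subrK (k *: ((0, b) : energy)) v); exact: (ph_carD pE').
- by rewrite -e1.
- by exists l => //; rewrite /hsame -e2.
Qed.

(** The Laplacian term cancels the first component of the product in real part, by [fp_ip]; what
    remains is [- Re <dm u_2, u_2>]. *)
Lemma wave_dissipative u v : wave 0 0 u v -> Re (hip v u) = - hnorm (sm u.2) ^+ 2.
Proof.
move=> h; have [[cu1 cu2] [cv1 cv2]] := wave_car h.
case: h => _ hu2 _ hs [l Ll hl]; have cl := (LD Ll).2.
have [_ c1 _] := halfP cu1; have [_ c2 e2] := halfP hu2; have [c3 c4 _] := halfP cv1.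
have s1 : hsame (fp v.1) (fp u.2).
  apply: coefs_same; split=> // n; rewrite e2; congr (_ * _).
  by rewrite (hsame_ipl pH c3 cu2 (ce n) hs).
have Au : A u.1 (- l) by rewrite /= opprK.
rewrite /hip/= ReD (hsame_ipl pH c4 c2 c1 s1) (ph_herm pH c1 c2) ReJ (fp_ip Au hu2).
have cd := c_dm cu2; have cld := ph_carB pH cl cd.
rewrite scaler0 addr0 in hl.
rewrite (hsame_ipl pH cv2 cld cu2 hl) (ph_ipBl pH cl cd cu2) (ph_ipNl pH cl cu2).
by rewrite ReN ReB dm_sm// addrA addNr sub0r.
Qed.

Lemma energy_norm_le (x y : H) : half x -> hcar y ->
  hnorm ((x, y) : energy) <= hnorm (fp x) + hnorm y.
Proof. by move=> /halfP[_ hx _] hy; exact: (dsum_norm_le pH pH hx hy). Qed.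

(** A classical solution is the semigroup orbit of its initial state, which lies in the domain; the
    decay then involves the generator at that state, bounded by the data. On the domain the energy
    norm is the gradient norm together with the norm of the velocity. *)
Lemma wave_decay b c (T : R -> quot pE' -> quot pE') (N' M' : R) :
  hcar b -> hcar c -> C0_semigroup T ->
  (forall (t : R) u, 0 <= t -> hnorm (T t u) <= N' * hnorm u) -> 0 < M' ->
  (forall (t : R) u v, 0 < t -> generator T u v ->
    hnorm (T t u) <= M' * t `^ (- alpha^-1) * hnorm v) ->
  (forall u v, wave b c u v <->
    [/\ hcar u, hcar v & generator T (qpi pE' u) (qpi pE' v)]) ->
  exists2 MT : R, 0 < MT & forall w0 l0 w1 (u : R -> energy),
    L w0 l0 -> D w1 -> classical_solution (wave b c) u ->
    hsame (u 0) ((w0, w1) : energy) -> forall t : R, 0 < t ->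
    opdom L (u t).1 /\
    hnorm (u t).1 ^+ 2 + hnorm (grad (u t).1) ^+ 2 + hnorm (u t).2 ^+ 2 <=
      MT / t `^ (2 / alpha) * (hnorm l0 ^+ 2 + (hnorm w1 ^+ 2 + hnorm (grad w1) ^+ 2)).
Proof.
move=> cb cc hT hN' M'0 dec gA.
have q0 : 0 <= hnorm (sm c) * hnorm b := mulr_ge0 (hnorm_ge0 _) (hnorm_ge0 _).
pose W := (1 + (Dd + hnorm (sm c) * hnorm b)) ^+ 2 * 3.
exists ((C ^+ 2 + 1) * (M' ^+ 2 * W)).
  have w0 : 0 < W by apply: mulr_gt0; [apply: exprn_gt0; apply: ltr_wpDr; [exact: addr_ge0|exact: ltr01]|exact: ltr0Sn].
  exact: mulr_gt0 (ltr_wpDl (sqr_ge0 C) ltr01) (mulr_gt0 (exprn_gt0 2 M'0) w0).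
move=> w0 l0 w1 u Lw0 Dw1 sol ini t t0.
have hw0 := D_half (LD Lw0).1; have hw1 := D_half Dw1; have cw1 := cD Dw1.
have cl0 := (LD Lw0).2; have cdw1 := c_dm cw1.
pose k := hip (sm w1) c; have ckb := ph_carZ pH k cb.
have cld := ph_carB pH cl0 cdw1; have cv2 := ph_carD pH cld ckb.
pose v : energy := (w1, l0 - dm w1 + k *: b).
have Wi : wave b c ((w0, w1) : energy) v.
  have sv : hsame v.2 (l0 - dm w1 + k *: b) := hsame_refl pH _.
  exact (And5 (ex_intro _ l0 Lw0) hw1 (conj hw1 cv2) (hsame_refl pH _) (ex_intro2 _ _ l0 Lw0 sv)).
have [cw cwv] := wave_car Wi; have [u' hu'] := sol.
have [W0 _ _] := hu' 0 (lexx 0); have [Wt _ _] := hu' t (ltW t0).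
have [cu0 _] := wave_car W0; have [cut _] := wave_car Wt.
have ci : qpi pE' (u 0) = qpi pE' ((w0, w1) : energy) := pi_same pE' cu0 cw ini.
have dt : opdom L (u t).1 by case: Wt.
split; first exact: dt.
have et := classical_solution_quot hX hT hN' gA sol (ltW t0).
have [_ _ gi] := (gA _ _).1 Wi.
have ub := dec t _ _ t0 gi.
rewrite -ci -et (pi_norm pE' cut) (pi_norm pE' cwv) in ub.
have nv : hnorm v <= hnorm (fp w1) + (hnorm l0 + Dd * hnorm w1 + hnorm w1 * (hnorm (sm c) * hnorm b)).
  apply: le_trans (energy_norm_le hw1 cv2) _; apply: (lerD (lexx _)).
  apply: le_trans (ph_normD pH cld ckb) _; apply: lerD.
    apply: le_trans (ph_normD pH cl0 (ph_carN pH cdw1)) _; rewrite (ph_normN pH cdw1).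
    exact: (lerD (lexx _) (n_dm cw1)).
  rewrite (ph_normZ pH _ cb) mulrA; apply: ler_wpM2r; first exact: hnorm_ge0.
  by rewrite /k (sm_sym cw1 cc); exact: (ph_CS pH cw1 (c_sm cc)).
have [cu1 cu2] := cut; have [l1 Ll1] := dt.
have A1 : A (u t).1 (- l1) by rewrite /= opprK.
have [_ cf1 _] := halfP cu1.
have n1 : hnorm (u t) ^+ 2 = hnorm (grad (u t).1) ^+ 2 + hnorm (u t).2 ^+ 2.
  by rewrite energy_normE (dsum_norm pH pH cf1 cu2) (dom_grad A1).
have al0 : alpha != 0 by case/andP: alpha02 => al0 _; rewrite gt_eqF.
exact (decay_final_bound (ltW C0) (hnorm_ge0 _) (hnorm_ge0 _) (hnorm_ge0 _)
  (poin (LD Ll1).1) n1 ub (powR_decay_sqr t0 al0)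
  (decay_data_bound Dd0 q0 (hnorm_ge0 _) (hnorm_ge0 _) (hnorm_ge0 _) (hnorm_ge0 _) nv (fp_D Dw1))).
Qed.

Hypothesis stab0 : polynomially_stable (wave 0 0) alpha.

(** The vector [(0, b)] is in the domain of the square of the wave operator: its images are
    [(b, - dm b)] and [(- dm b, l + dm (dm b))], the second requiring [half (dm b)]. Their norms are
    controlled by [kappa], so [perturbation_theorem] applies. *)
Theorem wave_stability : exists2 kappa : R, 0 < kappa & forall b l c,
  L b l -> hcar c -> half (dm b) -> hnorm (sm c) < kappa ->
  hnorm (fp (dm b)) ^+ 2 + hnorm l ^+ 2 < kappa ^+ 2 ->
  polynomially_stable (wave b c) alpha /\
  exists2 MT : R, 0 < MT & forall w0 l0 w1 (u : R -> energy),
    L w0 l0 -> D w1 -> classical_solution (wave b c) u ->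
    hsame (u 0) ((w0, w1) : energy) -> forall t : R, 0 < t ->
    opdom L (u t).1 /\
    hnorm (u t).1 ^+ 2 + hnorm (grad (u t).1) ^+ 2 + hnorm (u t).2 ^+ 2 <=
      MT / t `^ (2 / alpha) * (hnorm l0 ^+ 2 + (hnorm w1 ^+ 2 + hnorm (grad w1) ^+ 2)).
Proof.
have [S [N [M0 [hS hN dec res gA]]]] := quot_stable_in hX stab0.
have [al0 al2] := andP alpha02.
have g12 : 1 <= 2 * alpha^-1 by rewrite ler_pdivlMr// mul1r.
have [k0 k00 hk] := perturbation_theorem hX hS hN g12 dec res.
(* [Q kappa] bounds the sum of the norms of [(0, b)] and of its first two images; the minimum with 1
   in [kappa] bounds the norm of [(0, sm c)]. *)
pose Q := C ^+ 2 + C + Dd * C ^+ 2 + 2 + Dd * (Dd * C ^+ 2).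
have C2 : 0 <= C ^+ 2 by exact: sqr_ge0.
have DC : 0 <= Dd * C ^+ 2 by exact: mulr_ge0.
have DDC : 0 <= Dd * (Dd * C ^+ 2) by exact: mulr_ge0.
have Q0 : 0 < Q by have := C0; rewrite /Q; lra.
exists (Num.min 1 (k0 / Q)); first by rewrite lt_min ltr01 divr_gt0.
set kap := Num.min _ _ => b l c Lb cc hdb hsc hkap.
have kap0 : 0 < kap by rewrite lt_min ltr01 divr_gt0.
have kap1 : kap <= 1 by rewrite ge_min lexx.
have kapk : Q * kap <= k0 by rewrite mulrC -ler_pdivlMr// ge_min lexx orbT.
have [Db cl] := LD Lb; have cb := cD Db; have hb := D_half Db.
have Ab : A b (- l) by rewrite /= opprK.
have [nl nfd] : hnorm l <= kap /\ hnorm (fp (dm b)) <= kap.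
  have := sqr_ge0 (hnorm l); have := sqr_ge0 (hnorm (fp (dm b))) => s1 s2.
  by split; rewrite -ler_sqr ?nnegrE ?hnorm_ge0 ?(ltW kap0)//; lra.
have [nb nfb] := dom_bound Ab; rewrite (ph_normN pH cl) in nb nfb.
have cdb := c_dm cb; have cNdb := ph_carN pH cdb.
have cf := coefs_lin (-1) (halfP hdb) (coefs0 _); rewrite !addr0 !scaleN1r in cf.
have hNdb : half (- dm b) := half_of cf.
have cddb := c_dm cNdb; have cldd := ph_carB pH cl cddb.
pose bt : energy := (0, b); pose bt1 : energy := (b, - dm b).
pose bt2 : energy := (- dm b, l - dm (- dm b)); pose ct : energy := (0, sm c).
have cbt : hcar bt by split. have cbt1 : hcar bt1 by split.
have cbt2 : hcar bt2 by split. have cct : hcar ct by split=> //; exact: c_sm.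
have W1 : wave 0 0 bt bt1.
  split=> //; [by exists 0|exact: hsame_refl|exists 0 => //].
  by rewrite /= scaler0 addr0 sub0r; exact: hsame_refl.
have W2 : wave 0 0 bt1 bt2.
  split=> //; [by exists l|exact: hsame_refl|exists l => //].
  by rewrite /= scaler0 addr0; exact: hsame_refl.
have Kc : (hnorm (qpi pE' bt) + hnorm (qpi pE' bt1) + hnorm (qpi pE' bt2)) * hnorm (qpi pE' ct) <= k0.
  rewrite (pi_norm pE' cbt) (pi_norm pE' cbt1) (pi_norm pE' cbt2) (pi_norm pE' cct).
  have i0 := energy_norm_le half0 cb; have i1 := energy_norm_le hb cNdb.
  have i2 := energy_norm_le hNdb cldd; have i3 := energy_norm_le half0 (c_sm cc).
  rewrite (coefs_norm cf) (ph_normN pH) in i2; last by case: (halfP hdb).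
  rewrite fp0 in i0 i3; rewrite (ph_normN pH cdb) in i1.
  have j1 := n_dm cb; have j2 := n_dm cNdb; rewrite (ph_normN pH cdb) in j2.
  have j3 := ph_normBC pH cl cddb; have j4 := ph_normD pH cl (ph_carN pH cddb).
  rewrite (ph_normN pH cddb) in j4.
  have m1 : C ^+ 2 * hnorm l <= C ^+ 2 * kap by exact: ler_wpM2l.
  have m2 : C * hnorm l <= C * kap by apply: ler_wpM2l => //; exact: ltW.
  have m3 : Dd * hnorm b <= Dd * (C ^+ 2 * kap).
    by apply: ler_wpM2l => //; exact: le_trans nb m1.
  have m4 : Dd * hnorm (dm b) <= Dd * (Dd * (C ^+ 2 * kap)).
    by apply: ler_wpM2l => //; exact: le_trans j1 m3.
  have sum : hnorm bt + hnorm bt1 + hnorm bt2 <= Q * kap.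
    have -> : Q * kap = C ^+ 2 * kap + (C * kap + Dd * (C ^+ 2 * kap)) +
       (kap + (kap + Dd * (Dd * (C ^+ 2 * kap)))) by rewrite /Q; ring.
    apply: lerD; first apply: lerD.
    - by apply: le_trans i0 _; rewrite add0r; exact: le_trans nb m1.
    - apply: le_trans i1 _; apply: lerD; [exact: le_trans nfb m2|exact: le_trans j1 m3].
    - apply: le_trans i2 _; apply: lerD => //; apply: le_trans j4 _; apply: lerD => //.
      exact: le_trans j2 m4.
  have c1 : hnorm ct <= 1.
    by apply: le_trans i3 _; rewrite add0r; exact: le_trans (ltW hsc) kap1.
  apply: le_trans (_ : Q * kap * 1 <= _); last by rewrite mulr1.
  by apply: ler_pM => //; rewrite ?addr_ge0 ?hnorm_ge0.
(* The observation is [<sm u_2, c>], at most [|c|] times the square root of the dissipation;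
   [del = 1 / (1 + |c|^2)] is also defined for [c = 0]. *)
have diss : exists2 del : R, 0 < del & forall x y, generator S x y ->
    del * normc (hip x (qpi pE' ct)) ^+ 2 <= - Re (hip y x).
  have d0 : 0 < 1 + hnorm c ^+ 2 by have := sqr_ge0 (hnorm c); lra.
  exists (1 + hnorm c ^+ 2)^-1; first by rewrite invr_gt0.
  move=> x y gxy; have cx := rep_car x; have cy := rep_car y.
  have gxy' : generator S (qpi pE' (rep x)) (qpi pE' (rep y)) by rewrite !repK.
  have w : wave 0 0 (rep x) (rep y) := (gA (rep x) (rep y)).2 (And3 cx cy gxy').
  rewrite -(repK x) -(repK y) (pi_ip pE' cx cct) (pi_ip pE' cy cx) (wave_dissipative w) opprK.
  have c2 : hcar (rep x).2 by case: cx.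
  rewrite (energy_ip0 cx (c_sm cc)) -(sm_sym c2 cc) mulrC ler_pdivrMr//.
  have := ph_CS pH (c_sm c2) cc; have n0 := normc_ge0 (hip (sm (rep x).2) c).
  move: (normc _) (hnorm (sm _)) n0 (hnorm_ge0 (sm (rep x).2)) (hnorm_ge0 c) (hnorm c).
  move=> p q p0 q0 _ r_ pq; have : p ^+ 2 <= (q * r_) ^+ 2 by rewrite lerXn2r ?nnegrE// (le_trans p0).
  by rewrite exprMn mulrDr mulr1; have := sqr_ge0 q; lra.
have [_ _ G1] := (gA _ _).1 W1.
have [_ _ G2] := (gA _ _).1 W2.
have [T [hT eT [N' hN'] hres' [M' M'0 dec']]] := hk _ _ _ _ G1 G2 diss Kc.
have gA' u v : wave b c u v <-> [/\ hcar u, hcar v & generator T (qpi pE' u) (qpi pE' v)].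
  have key : hcar u -> hcar v -> generator T (qpi pE' u) (qpi pE' v) =
      generator S (qpi pE' u) (qpi pE' (v - hip u ct *: bt)).
    move=> cu cv; rewrite -eT (piB pE' cv (ph_carZ pE' _ cbt)) (piZ pE' _ cbt).
    by rewrite -(pi_ip pE' cu cct).
  split=> [h|[cu cv gt]].
    have [cu cv] := wave_car h; have [_ _ gs] := (gA _ _).1 ((wave_perturbed v cb cc cu).1 h).
    by split; [exact: cu|exact: cv|rewrite (key cu cv); exact: gs].
  rewrite (key cu cv) in gt; have cvk := ph_carB pE' cv (ph_carZ pE' (hip u ct) cbt).
  exact: ((wave_perturbed v cb cc cu).2 ((gA _ _).2 (And3 cu cvk gt))).
have hres'' s : resolvent_set (generator T) (0 +i* s) by rewrite -eT; exact: hres'.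
have dec'' (t : R) u v : 0 < t -> generator T u v ->
    hnorm (T t u) <= M' * t `^ (- alpha^-1) * hnorm v by rewrite -eT; exact: dec'.
split; first exact: (quot_stable_out hX hT hN' M'0 dec'' hres'' gA').
exact: (wave_decay cb cc hT hN' M'0 dec'' gA').
Qed.

End Wave.

End EnergySpace.

(** * Single-valuedness of generators on the state space *)

Lemma frac_pow_val_car (R : realType) (H : hspace R) (A : H -> set H) (th : R) u :
  prehilbert H -> hcar (frac_pow_val A th u).
Proof.
move=> pH; rewrite /frac_pow_val; case: xgetP => [y _ [_ h _]|_]; first exact: h.
exact: ph_car0.
Qed.

(** Both values are limits of the same difference quotients. The norm of a second component is at
    most the energy norm for every pair with second component in [hcar], since [frac_pow_val] always
    lands there, its default being 0. *)
Lemma generator_snd (R : realType) (H : hspace R) (L : H -> set H)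
    (T : R -> energy L -> energy L) (u v v' : energy L) :
  prehilbert H -> C0_semigroup T -> generator T u v -> generator T u v' ->
  hnorm (v.2 - v'.2) = 0.
Proof.
move=> pH hT [hu [_ cv] g] [_ [_ cv'] g']; have cu : hcar u.2 by case: hu.
have snd (x : energy L) : hcar x.2 -> hnorm x.2 <= hnorm x.
  by move=> hx; exact: (dsum_norm2 pH pH (frac_pow_val_car _ _ _ pH) hx).
have key (e : R) : 0 < e -> hnorm (v.2 - v'.2) <= e + e.
  move=> e0; have /cvgr0Pnorm_le/(_ e e0) h := g; have /cvgr0Pnorm_le/(_ e e0) h' := g'.
  have [t [[h1 h2] t0]] := filter_ex (filterI (filterI h h') (nbhs_right_gt (0 : R))).
  have [/(_ t (ltW t0))[cT _ _] _ _ _] := hT.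
  have [_ cTu] := cT u hu; have cd := ph_carZ pH (t^-1)%:C (ph_carB pH cTu cu).
  have c1 := ph_carB pH cd cv; have c2 := ph_carB pH cd cv'.
  have n1 := snd ((t^-1)%:C *: (T t u - u) - v) c1.
  have n2 := snd ((t^-1)%:C *: (T t u - u) - v') c2.
  rewrite ger0_norm ?hnorm_ge0// in h1; rewrite ger0_norm ?hnorm_ge0// in h2.
  set x := (t^-1)%:C *: ((T t u).2 - u.2) in cd c1 c2.
  have -> : v.2 - v'.2 = (x - v'.2) - (x - v.2) by rewrite opprB [RHS]addrC subrKA.
  have := ph_normD pH c2 (ph_carN pH c1); rewrite (ph_normN pH c1) => h3.
  apply: le_trans h3 _; apply: lerD.
    exact: le_trans n2 h2.
  exact: le_trans n1 h1.
apply/eqP; rewrite eq_le hnorm_ge0 andbT; apply/ler_addgt0Pl => e e0; rewrite addr0.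
by apply: le_trans (key _ (divr_gt0 e0 (ltr0Sn _ 1))) _; rewrite -splitr.
Qed.

(** * Multiplication by the damping and by its square root *)

Section Multiplication.
Context {R : realType} (a b : R).
Hypotheses (a0 : 0 < a) (b0 : 0 < b).
Local Notation point := (R * R)%type.
Local Notation mpoint := (measurableTypeR R * measurableTypeR R)%type.
Local Notation fn := (R * R -> R[i])%type.
Local Notation Om := (rect a b).
Local Notation sqint := (@sqint _ _ R leb2 Om).
Local Notation rip := (@square_ip _ mpoint R leb2 Om).
Let mOm := @rect_measurable R a b.
Let fOm := rect_finite a0 b0.
Let pL : prehilbert (L2 Om) := L2_prehilbert mOm fOm.

Lemma sqint_mul_ae (g f : point -> R) (c : R) :
  measurable_fun (Om : set mpoint) (g : mpoint -> R) ->
  {ae (@leb2 R), forall p, Om p -> `|g p| <= c} -> 0 <= c -> sqint f ->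
  sqint (fun p => g p * f p) /\
  rip (fun p => g p * f p) (fun p => g p * f p) <= c ^+ 2 * rip f f.
Proof.
move=> mg hg c0 hf; have [mf fi] := hf.
have mgf : measurable_fun (Om : set mpoint) (fun p : mpoint => g p * f p) by exact: measurable_funM.
have le : (\int[leb2]_(p in Om) ((g p * f p) ^+ 2)%:E <=
           \int[leb2]_(p in Om) (c ^+ 2 * f p ^+ 2)%:E)%E.
  apply: ae_ge0_le_integral => //.
  - by move=> p _; rewrite lee_fin sqr_ge0.
  - by apply/measurable_EFinP; exact: measurable_funX.
  - by move=> p _; rewrite lee_fin; apply: mulr_ge0; exact: sqr_ge0.
  - by apply/measurable_EFinP; apply: measurable_funM => //; exact: measurable_funX.
  - case: hg => N [mN N0 hN]; exists N; split=> // p hp; apply: hN => /= h; apply: hp => Op.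
    rewrite lee_fin exprMn; apply: ler_wpM2r; first exact: sqr_ge0.
    by rewrite -(real_normK (num_real (g p))) lerXn2r ?nnegrE//; exact: h.
have eR : (\int[leb2]_(p in Om) (c ^+ 2 * f p ^+ 2)%:E = (c ^+ 2 * rip f f)%:E)%E.
  by rewrite EFinM (square_ip_EFin mOm hf) -(integralZl mOm fi); apply: eq_integral.
have hgf : sqint (fun p => g p * f p).
  split=> //; apply/integrableP; split; first by apply/measurable_EFinP; exact: measurable_funX.
  apply: le_lt_trans (ltry (c ^+ 2 * rip f f)); rewrite -eR; apply: le_trans le.
  rewrite le_eqVlt; apply/orP; left; apply/eqP; apply: eq_integral => p _ /=.
  by rewrite ger0_norm ?sqr_ge0.
by split=> //; rewrite -lee_fin (square_ip_EFin mOm hgf) -eR.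
Qed.

Let ReM (k : R) (z : R[i]) : Re (k%:C * z) = k * Re z. Proof. exact: ReZ. Qed.
Let ImM (k : R) (z : R[i]) : Im (k%:C * z) = k * Im z.
Proof. by case: z => x y; simpc. Qed.

Lemma rmul_bound (g : point -> R) (c : R) :
  measurable_fun (Om : set mpoint) (g : mpoint -> R) ->
  {ae (@leb2 R), forall p, Om p -> `|g p| <= c} -> 0 <= c ->
  forall u, L2_car Om u -> L2_car Om (rmul g u) /\
    hnorm (rmul g u : L2 Om) <= c * hnorm (u : L2 Om).
Proof.
move=> mg hg c0 u /[dup] hu /(L2_carP mOm)[h1 h2].
have [s1 n1] := sqint_mul_ae mg hg c0 h1; have [s2 n2] := sqint_mul_ae mg hg c0 h2.
have e1 p : g p * Re (u p) = Re (rmul g u p) by rewrite /rmul ReM.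
have e2 p : g p * Im (u p) = Im (rmul g u p) by rewrite /rmul ImM.
have hgu : L2_car Om (rmul g u).
  apply/(L2_carP mOm); split.
    by apply: eq_sqint s1 => // p _; exact: e1.
  by apply: eq_sqint s2 => // p _; exact: e2.
split; first exact: hgu.
rewrite -ler_sqr ?nnegrE ?hnorm_ge0//; last exact: mulr_ge0 c0 (hnorm_ge0 _).
rewrite exprMn (L2_normE mOm fOm hgu) (L2_normE mOm fOm hu) mulrDr; apply: lerD.
  apply: le_trans n1; rewrite le_eqVlt; apply/orP; left; apply/eqP.
  by apply: eq_square_ip => p _; rewrite e1.
apply: le_trans n2; rewrite le_eqVlt; apply/orP; left; apply/eqP.
by apply: eq_square_ip => p _; rewrite e2.
Qed.

Lemma rmul_sym (g : point -> R) (u v : fn) :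
  hip (rmul g u : L2 Om) v = hip (u : L2 Om) (rmul g v).
Proof.
rewrite /hip/=; congr cintegral; apply/funext => p; rewrite /rmul.
by case: (u p) => x y; case: (v p) => x' y'; apply/eqP; rewrite eq_complex /=;
  apply/andP; split; apply/eqP; ring.
Qed.

Lemma rmul_sqrtf (d : point -> R) (u : fn) : (forall p, Om p -> 0 <= d p) ->
  L2_car Om u -> L2_car Om (rmul d u) -> L2_car Om (rmul (sqrtf d) u) ->
  Re (hip (rmul d u : L2 Om) u) = hnorm (rmul (sqrtf d) u : L2 Om) ^+ 2.
Proof.
move=> d0 hu hdu hsu; rewrite (L2_normE mOm fOm hsu) (L2_ipE mOm hdu hu) /=.
congr (_ + _); apply: eq_Rintegral => p /set_mem Op; rewrite /rmul.
  by rewrite !ReM mulrACA -expr2 sqr_sqrtr ?d0// mulrA.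
by rewrite !ImM mulrACA -expr2 sqr_sqrtr ?d0// mulrA.
Qed.

Lemma Linfty_ae (d : point -> R) : (Linfty_norm Om d < +oo)%E ->
  0 <= fine (Linfty_norm Om d) /\
  {ae (@leb2 R), forall p, Om p -> `|d p| <= fine (Linfty_norm Om d)}.
Proof.
move=> h; have l0 : (0 <= Linfty_norm Om d)%E by exact: Lnorm_ge0.
split; first exact: fine_ge0.
have e : Linfty_norm Om d = (fine (Linfty_norm Om d))%:E by rewrite fineK// ge0_fin_numE.
(* [Lnorm] at infinity is the essential supremum only when the total measure is positive. *)
have muT : (0 < @leb2 R setT)%E.
  have mO : (@leb2 R Om = a%:E * b%:E)%E.
    have -> : @leb2 R Om = (lebesgue_measure (`]0%R, a[%classic : set R) * lebesgue_measure (`]0%R, b[%classic : set R))%E.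
      by apply: product_measure1E; exact: measurable_itv.
    by rewrite !lebesgue_measure_itv/= !lte_fin a0 b0 !oppr0 !adde0.
  apply: (@lt_le_trans _ _ (@leb2 R Om)); first by rewrite mO mule_gt0 ?lte_fin.
  by apply: le_measure => //; rewrite inE.
have := ess_sup_ge (@leb2 R) (abse \o (EFin \o (d \_ Om))).
have -> : ess_sup (@leb2 R) (abse \o (EFin \o (d \_ Om))) = (fine (Linfty_norm Om d))%:E.
  by rewrite -e /Linfty_norm unlock /Lnorm muT.
move=> [N [mN N0 hN]]; exists N; split=> // p hp; apply: hN => /= hq; apply: hp => Op.
by move: hq; rewrite patchE mem_set// lee_fin.
Qed.

Lemma continuous_sqrtf_measurable (d : point -> R) : (forall p, Om p -> {for p, continuous d}) ->
  measurable_fun (Om : set mpoint) (d : mpoint -> R) /\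
  measurable_fun (Om : set mpoint) (sqrtf d : mpoint -> R).
Proof.
move=> cd; split; first by apply: continuous_measurable2 => //; exact: rect_open.
apply: continuous_measurable2; first exact: rect_open.
by move=> p Op; apply: (@continuous_comp _ _ _ d (@Num.sqrt R)); [exact: cd|exact: sqrt_continuous].
Qed.

End Multiplication.

Lemma sum_order2_ge (R : realType) (x00 x01 x02 x10 x11 x20 : R) :
  x20 ^+ 2 + x02 ^+ 2 <=
  x00 ^+ 2 + x01 ^+ 2 + x02 ^+ 2 + (x10 ^+ 2 + x11 ^+ 2) + x20 ^+ 2.
Proof.
have := sqr_ge0 x00; have := sqr_ge0 x01; have := sqr_ge0 x10; have := sqr_ge0 x11; lra.
Qed.

(** * The Dirichlet Laplacian of the rectangle *)

Section DirichletLaplacian.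
Context {R : realType} (a b : R).
Hypotheses (a0 : 0 < a) (b0 : 0 < b).
Local Notation point := (R * R)%type.
Local Notation fn := (R * R -> R[i])%type.
Local Notation Om := (rect a b).
Let mOm := @rect_measurable R a b.
Let fOm := rect_finite a0 b0.
Let pL : prehilbert (L2 Om) := L2_prehilbert mOm fOm.
Let pK : prehilbert (dsum (L2 Om) (L2 Om)) := dsum_prehilbert pL pL.

Lemma H10_car (u : fn) : H10 Om u -> L2_car Om u.
Proof. by move=> [h _]; have [v []] := h 0%N 0%N isT. Qed.

Lemma laplacian_car (u l : L2 Om) : laplacian Om u l -> H10 Om u /\ hcar l.
Proof. by move=> [_ h1 h2 _]. Qed.

Definition dgrad (u : L2 Om) : dsum (L2 Om) (L2 Om) := (wderiv Om 1 0 u, wderiv Om 0 1 u).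

Lemma H10_weak (u : fn) : H10 Om u ->
  weak1 a b false u (wderiv Om 1 0 u) /\ weak1 a b true u (wderiv Om 0 1 u).
Proof.
move=> [h _]; have hx := wderivP (h 1%N 0%N isT); have hy := wderivP (h 0%N 1%N isT).
split; first exact: (proj1 (weak_derivative1P a b false u _) hx).
exact: (proj1 (weak_derivative1P a b true u _) hy).
Qed.

Lemma dgrad_car (u : L2 Om) : H10 Om u -> hcar (dgrad u).
Proof. by move=> hu; have [[_ h1 _] [_ h2 _]] := H10_weak hu; exact (conj h1 h2). Qed.

(* Two candidate weak Laplacians of an eigenfunction give two values of the
   generator at the same state. *)
Lemma unique_weak_derivatives (d : point -> R) (alpha : R) (e : nat -> L2 Om) (lam : nat -> R) :
  eigenbasis (neg_laplacian Om) e lam -> polynomially_stable (wave_op Om d 0 0) alpha ->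
  forall f, L2_car Om f ->
  (forall phi, test_function Om phi -> hip (f : L2 Om) (ofr phi) = 0) ->
  hnorm (f : L2 Om) = 0.
Proof.
move=> be [T [[hT eT] _ _ _]] f hf perp; have [Ae _ _] := be.
have h0 := ph_car0 pL.
have ce n : hcar (e n) by have [_ /H10_car] := Ae n.
have [s2 h10 cl [uxx [uyy [w20 w02 hs]]]] := Ae 0%N.
set l : L2 Om := - ((lam 0%N)%:C *: e 0%N) in cl hs.
(* Adding to a weak derivative a function orthogonal to all test functions gives a weak derivative
   again. *)
have w20f : weak_derivative Om 2 0 (e 0%N) (uxx + f).
  have [c1 c2 w] := proj1 (weak_derivativeP a b 2 0 (e 0%N) uxx) w20.
  apply/weak_derivativeP; split; [exact: c1|exact: (ph_carD pL c2 hf)|move=> phi tp].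
  have sp := ofr_L2 a0 b0 (test_sqint a0 b0 tp).
  by rewrite (w phi tp) (ph_ipDl pL c2 hf sp) (perp phi tp) addr0.
have lap1 : laplacian Om (e 0%N) l.
  exact: (And4 s2 h10 cl (ex_intro _ uxx (ex_intro _ uyy (And3 w20 w02 hs)))).
have lap2 : laplacian Om (e 0%N) (l + f).
  have hs' : hsame (l + f) (uxx + f + uyy : L2 Om).
    rewrite /hsame; have -> : l + f - (uxx + f + uyy) = l - (uxx + uyy).
      by rewrite [uxx + f + uyy]addrAC opprD addrACA subrr addr0.
    exact: hs.
  exact: (And4 s2 h10 (ph_carD pL cl hf) (ex_intro _ (uxx + f) (ex_intro _ uyy (And3 w20f w02 hs')))).
have half0 : Hdom Om 2^-1 0.
  exists 0; split; [exact: h0|exact: h0|exists e, lam; split; first exact: be].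
  by move=> n; rewrite (ph_ip0l pL (ce n)) mulr0.
(* At the state with displacement [e 0] and zero velocity the operator takes the value [(0, g)] for
   each weak Laplacian [g]; comparing [l] and [l + f] forces [f] to be null. *)
have wave_at (g : L2 Om) : hcar g -> laplacian Om (e 0%N) g ->
    wave_op Om d 0 0 ((e 0%N, 0) : state Om) ((0, g) : state Om).
  move=> cg lg; have s : hsame g (g - rmul d 0 + cintegral Om (fun p => rmul (sqrtf d) 0 p * 0) *: 0).
    have z : rmul d 0 = 0 by apply/funext => p; rewrite /rmul mulr0.
    by rewrite scaler0 addr0 z subr0; exact: (hsame_refl pL).
  exact: (And5 (ex_intro _ g lg) half0 (conj half0 cg) (hsame_refl pL _) (ex_intro2 _ _ g lg s)).
have g1 := wave_at _ cl lap1; have g2 := wave_at _ (ph_carD pL cl hf) lap2.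
rewrite eT in g1 g2.
have := @generator_snd R (L2 Om) (laplacian Om) T _ _ _ pL hT g2 g1.
by rewrite /= addrAC subrr add0r.
Qed.

Section UniqueDerivatives.
Hypothesis uniq : forall f, L2_car Om f ->
  (forall phi, test_function Om phi -> hip (f : L2 Om) (ofr phi) = 0) ->
  hnorm (f : L2 Om) = 0.

Lemma dgrad_green (u l v : L2 Om) : laplacian Om u l -> H10 Om v ->
  hip l v = - hip (dgrad u) (dgrad v).
Proof.
move=> hl hv; have [_ hu _ _] := hl.
have [wux wuy] := H10_weak hu; have [wvx wvy] := H10_weak hv.
exact: (laplacian_green a0 b0 uniq hl wux wuy hv wvx wvy).
Qed.

Lemma dgrad_poincare (v : L2 Om) : H10 Om v -> hnorm v <= 2 * a * hnorm (dgrad v).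
Proof.
move=> hv; have [wvx wvy] := H10_weak hv; have [_ c1 _] := wvx; have [_ c2 _] := wvy.
apply: le_trans (H10_poincare a0 b0 uniq hv wvx wvy) _.
apply: ler_wpM2l; first exact: mulr_ge0 (ler0n R 2) (ltW a0).
exact: (dsum_norm1 pL pL c1 c2).
Qed.

Lemma dgrad_norm (u gx gy : L2 Om) : weak1 a b false u gx -> weak1 a b true u gy ->
  hnorm (dgrad u) ^+ 2 = hnorm gx ^+ 2 + hnorm gy ^+ 2.
Proof.
move=> wx wy; have w1 : weak_derivative Om 1 0 u gx := proj2 (weak_derivative1P a b false u gx) wx.
have w2 : weak_derivative Om 0 1 u gy := proj2 (weak_derivative1P a b true u gy) wy.
have [_ c1 _] := wderivP (ex_intro _ _ w1); have [_ c2 _] := wderivP (ex_intro _ _ w2).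
rewrite (dsum_norm pL pL c1 c2).
have sq (x y : R) : x = y -> x ^+ 2 = y ^+ 2 by move=> ->.
exact (f_equal2 +%R (sq _ _ (wderiv_norm a0 b0 uniq w1)) (sq _ _ (wderiv_norm a0 b0 uniq w2))).
Qed.

Lemma sobolev_norm1_dgrad (u : L2 Om) : sobolev Om 1 u ->
  sobolev_norm Om 1 u ^+ 2 = hnorm u ^+ 2 + hnorm (dgrad u) ^+ 2.
Proof.
move=> /sobolev1_grad[gx [gy [wx wy]]].
by rewrite (sobolev_norm1E a0 b0 uniq wx wy) (dgrad_norm wx wy).
Qed.

Lemma sobolev_norm2_ge (u uxx uyy : fn) : weak_derivative Om 2 0 u uxx ->
  weak_derivative Om 0 2 u uyy ->
  hnorm (uxx : L2 Om) ^+ 2 + hnorm (uyy : L2 Om) ^+ 2 <= sobolev_norm Om 2 u ^+ 2.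
Proof.
move=> w20 w02; have sq (x y : R) : x = y -> x ^+ 2 = y ^+ 2 by move=> ->.
have E := f_equal2 +%R (sq _ _ (wderiv_norm a0 b0 uniq w20)) (sq _ _ (wderiv_norm a0 b0 uniq w02)).
rewrite -E [leRHS]sqr_sqrtr; last by apply: sumr_ge0 => i _; apply: sumr_ge0 => j _; exact: sqr_ge0.
rewrite (sum_order2 (fun i j => hnorm (wderiv Om i j u : L2 Om) ^+ 2)).
exact (sum_order2_ge _ _ _ _ _ _).
Qed.

Lemma weak_derivative0 i j : weak_derivative Om i j 0 0.
Proof.
have h0 := ph_car0 pL; apply/weak_derivativeP; split; [exact: h0|exact: h0|move=> phi tp].
have tps s : test_function Om (partials s phi) by elim: s => [//|k s IH]; exact: test_partial.
have z psi : test_function Om psi -> hip (0 : L2 Om) (ofr psi) = 0.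
  by move=> ts; exact: (ph_ip0l pL (ofr_L2 a0 b0 (test_sqint a0 b0 ts))).
by rewrite (z _ (tps _)) (z _ tp) mulr0.
Qed.

Lemma test_function0 : test_function Om (cst 0).
Proof.
have z s : partials s (cst 0 : point -> R) = cst 0.
  elim: s => [//|k s IH]; rewrite /= -/(partials s _) IH.
  by apply/funext => p; rewrite /partial derive_cst.
split; last by exists set0; split=> //; exact: compact0.
move=> k s p _ _; rewrite z; split; first exact: cst_continuous.
by move=> _; split; exact: derivable_cst.
Qed.

Lemma laplacian0 : laplacian Om 0 0.
Proof.
have sob k : sobolev Om k 0 by move=> i j _; exists 0; exact: weak_derivative0.
have h0 := ph_car0 pL.
split; [exact: sob| |exact: h0|].
  split; [exact: sob|move=> eps eps0; exists 0].
    by split; exact: test_function0.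
  have w k : weak1 a b k 0 0 by apply/weak_derivative1P; exact: weak_derivative0.
  have := sobolev_norm1E a0 b0 uniq (w false) (w true).
  rewrite (ph_norm0 pL) expr0n /= !addr0 subrr => /eqP.
  by rewrite sqrf_eq0 => /eqP ->.
exists 0, 0; split; [exact: weak_derivative0|exact: weak_derivative0|].
by rewrite /hsame addr0 subrr; exact: (ph_norm0 pL).
Qed.

End UniqueDerivatives.

(** The functional is compared only after multiplication by [b2], so that the case [b2 = 0] is
    covered directly. *)
Lemma wave_opE (d : point -> R) (b2 c : fn) (c' : L2 Om) :
  (forall x : L2 Om, cintegral Om (fun p => rmul (sqrtf d) x p * c p) *: (b2 : L2 Om) =
    hip (rmul (sqrtf d) x : L2 Om) c' *: (b2 : L2 Om)) ->
  wave_op Om d b2 c = wave (L := laplacian Om) (rmul d) (rmul (sqrtf d)) b2 c'.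
Proof.
move=> e; apply/funext => u; apply/seteqP; split=> v [h1 h2 h3 h4 [l h5 h6]];
  apply: (And5 h1 h2 h3 h4); exists l; try exact: h5.
  by rewrite -e.
by rewrite e.
Qed.

(** The equation integrates against [c] itself, whereas [hip] conjugates its second argument. *)
Definition fconj (c : fn) : fn := fun p => conjc (c p).

Lemma cintegral_fconj (s c : fn) : cintegral Om (fun p => s p * c p) = hip (s : L2 Om) (fconj c).
Proof.
rewrite /hip/=; congr cintegral; apply/funext => p; congr (_ * _); rewrite /fconj.
by case: (c p) => x y; apply/eqP; rewrite eq_complex /= opprK !eqxx.
Qed.

Lemma fconj_car (c : fn) : L2_car Om c -> L2_car Om (fconj c).
Proof.
move=> /(L2_carP mOm)[h1 h2]; apply/(L2_carP mOm); split.
  by apply: eq_sqint h1 => // p _; rewrite /fconj; case: (c p).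
by apply: eq_sqint (sqintN mOm h2) => // p _; rewrite /fconj; case: (c p).
Qed.

Lemma rmul_fconj_norm (g : point -> R) (c : fn) :
  hnorm (rmul g (fconj c) : L2 Om) = hnorm (rmul g c : L2 Om).
Proof.
rewrite /hnorm; congr (Num.sqrt (Re _)); rewrite /hip/=; congr cintegral.
apply/funext => p; rewrite /rmul /fconj; case: (c p) => x y.
by apply/eqP; rewrite eq_complex /=; apply/andP; split; apply/eqP; ring.
Qed.

End DirichletLaplacian.

Lemma eq_sum_le (R : realType) (x x' y y' z s K : R) : x = x' -> y = y' ->
  x' + z <= K * (s + y') -> x + z <= K * (s + y).
Proof. by move=> -> ->. Qed.

(** Replaces the norm of the Laplacian of [w0] by its H^2 norm; the factor 2 comes from squaring the
    sum of the two second derivatives. *)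
Lemma final_sum_le (R : realType) (U X t : R) (p q l w g s : R) : 0 <= X -> 0 < t ->
  U <= X / t * (l ^+ 2 + (w ^+ 2 + g ^+ 2)) ->
  l <= p + q -> 0 <= l -> p ^+ 2 + q ^+ 2 <= s ^+ 2 ->
  U <= 2 * X / t * (s ^+ 2 + (w ^+ 2 + g ^+ 2)).
Proof.
move=> X0 t0 h1 h2 l0 h3; apply: le_trans h1 _.
have -> : 2 * X / t = X / t * 2 by ring.
rewrite -[leRHS]mulrA; apply: ler_wpM2l; first by rewrite divr_ge0// ltW.
have l2 : l ^+ 2 <= (p + q) ^+ 2 by rewrite lerXn2r// nnegrE// (le_trans l0).
have pq : (p + q) ^+ 2 <= 2 * (p ^+ 2 + q ^+ 2).
  rewrite -subr_ge0; have -> : 2 * (p ^+ 2 + q ^+ 2) - (p + q) ^+ 2 = (p - q) ^+ 2 by ring.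
  exact: sqr_ge0.
by have := sqr_ge0 w; have := sqr_ge0 g; lra.
Qed.

(** * The damped wave equation on the rectangle *)

Section MainTheorem.
Context {R : realType} (a b : R) (d : R * R -> R) (alpha : R).
Hypotheses (a0 : 0 < a) (b0 : 0 < b).
Local Notation fn := (R * R -> R[i])%type.
Local Notation Om := (rect a b).
Hypothesis d_bounded : (Linfty_norm Om d < +oo)%E.
Hypothesis d_C2 : C_on 2 Om d.
Hypothesis d_ge0 : forall p, Om p -> 0 <= d p.
Hypothesis alpha02 : 0 < alpha <= 2.
Hypothesis stab : polynomially_stable (wave_op Om d 0 0) alpha.
Let pL : prehilbert (L2 Om) := L2_prehilbert (@rect_measurable R a b) (rect_finite a0 b0).

Definition perturbation_conclusion (M kappa : R) : Prop :=
  forall b2 c : fn,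
    opdom (laplacian Om) b2 ->
    L2_car Om c ->
    hnorm (rmul (sqrtf d) c : L2 Om) < kappa ->
    Hdom Om 2^-1 (rmul d b2) ->
    Hnorm Om 2^-1 (rmul d b2) ^+ 2 + Hnorm Om 1 b2 ^+ 2
      < kappa ^+ 2 / M ^+ 2 ->
    polynomially_stable (wave_op Om d b2 c) alpha /\
    exists2 MT : R, 0 < MT &
    forall (w0 w1 : fn) (u : R -> state Om),
      sobolev Om 2 w0 -> H10 Om w0 -> H10 Om w1 ->
      classical_solution (wave_op Om d b2 c) u ->
      hsame (u 0) ((w0, w1) : state Om) ->
      forall t : R, 0 < t ->
        sobolev Om 1 (u t).1 /\
        sobolev_norm Om 1 (u t).1 ^+ 2 + hnorm ((u t).2 : L2 Om) ^+ 2
          <= MT / t `^ (2 / alpha) *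
             (sobolev_norm Om 2 w0 ^+ 2 + sobolev_norm Om 1 w1 ^+ 2).

(** The eigenbasis and the stability for [b2 = 0] give uniqueness of weak derivatives, hence Green's
    formula and Poincare's inequality, and [wave_stability] applies with constant [C = 2 a]. *)
Lemma stability_of_eigenbasis (M : R) (e : nat -> L2 Om) (lam : nat -> R) : 1 <= M ->
  eigenbasis (neg_laplacian Om) e lam ->
  exists2 kappa : R, 0 < kappa & perturbation_conclusion M kappa.
Proof.
move=> M1 be; have uniq := unique_weak_derivatives a0 b0 be stab.
have pK := dsum_prehilbert pL pL.
have [D0 hD] := Linfty_ae a0 b0 d_bounded; set Dd := fine (Linfty_norm Om d) in D0 hD.
have cd p : Om p -> {for p, continuous d} by move=> Op; have [] := d_C2 (s := [::]) isT Op.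
have [md ms] := continuous_sqrtf_measurable cd.
have hS : {ae (@leb2 R), forall p, Om p -> `|sqrtf d p| <= Num.sqrt Dd}.
  case: hD => N [mN N0 hN]; exists N; split; [exact: mN|exact: N0|move=> p hp; apply: hN => /= h].
  apply: hp => Op; rewrite /sqrtf ger0_norm ?sqrtr_ge0// ler_sqrt//.
  exact: le_trans (ler_norm _) (h Op).
have bd := rmul_bound a0 b0 md hD D0; have bs := rmul_bound a0 b0 ms hS (sqrtr_ge0 _).
have a20 : 0 < 2 * a by exact: mulr_gt0.
have C_dm (u : L2 Om) (hu : hcar u) : hcar (rmul d u : L2 Om) := (bd u hu).1.
have N_dm (u : L2 Om) (hu : hcar u) : hnorm (rmul d u : L2 Om) <= Dd * hnorm u := (bd u hu).2.
have C_sm (u : L2 Om) (hu : hcar u) : hcar (rmul (sqrtf d) u : L2 Om) := (bs u hu).1.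
have S_sm (u v : L2 Om) (hu : hcar u) (hv : hcar v) :
  hip (rmul (sqrtf d) u : L2 Om) v = hip u (rmul (sqrtf d) v : L2 Om) := rmul_sym a b (sqrtf d) u v.
have DS (u : L2 Om) (hu : hcar u) :
  Re (hip (rmul d u : L2 Om) u) = hnorm (rmul (sqrtf d) u : L2 Om) ^+ 2 :=
  rmul_sqrtf a0 b0 d_ge0 hu (C_dm u hu) (C_sm u hu).
have stab' : polynomially_stable (wave (L := laplacian Om) (rmul d) (rmul (sqrtf d)) 0 0) alpha.
  rewrite -(@wave_opE R a b d 0 0 0); first exact: stab.
  by move=> x; rewrite !scaler0.
have cpl := L2_complete (@rect_measurable R a b) (rect_finite a0 b0).
have gr (u l v : L2 Om) := @dgrad_green R a b a0 b0 uniq u l v.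
have po := dgrad_poincare a0 b0 uniq.
have [kap kap0 hk] := wave_stability pL cpl pK a20 (@laplacian_car R a b)
  (@H10_car R a b) (@dgrad_car R a b) gr po be D0 C_dm N_dm C_sm S_sm DS
  (laplacian0 a0 b0 uniq) alpha02 stab'.
exists kap; first exact: kap0.
move=> b2 c [l hl] cc hc hdb hH.
have Ab : neg_laplacian Om b2 (- l) by rewrite /neg_laplacian /= opprK.
have cl : hcar (l : L2 Om) := (laplacian_car hl).2.
have n1 : Hnorm Om 1 b2 = hnorm (l : L2 Om).
  rewrite -(ph_normN pL cl); apply: (coefs_norm pL cpl pK (@laplacian_car R a b)
    (@H10_car R a b) (@dgrad_car R a b) gr be).
  exact: (coefs_dom pL pK (@laplacian_car R a b) (@H10_car R a b) (@dgrad_car R a b) gr po be Ab).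
(* As [M >= 1], the bound [kappa^2 / M^2] is at most [kappa^2]. *)
have small : hnorm (frac_pow_val (neg_laplacian Om) 2^-1 (rmul d b2) : L2 Om) ^+ 2 +
    hnorm (l : L2 Om) ^+ 2 < kap ^+ 2.
  rewrite -n1; apply: lt_le_trans hH _.
  rewrite ler_pdivrMr; last by apply: exprn_gt0; exact: lt_le_trans M1.
  by apply: ler_peMr; [exact: sqr_ge0|exact: exprn_ege1].
have hc' : hnorm (rmul (sqrtf d) (fconj c) : L2 Om) < kap by rewrite rmul_fconj_norm.
have [st [MT MT0 hMT]] := hk b2 l (fconj c) hl (fconj_car cc) hdb hc' small.
have eW : wave_op Om d b2 c = wave (L := laplacian Om) (rmul d) (rmul (sqrtf d)) b2 (fconj c).
  by apply: wave_opE => x; rewrite (cintegral_fconj a b (rmul (sqrtf d) x) c).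
rewrite eW; split; first exact: st.
exists (2 * MT); first exact: mulr_gt0.
move=> w0 w1 u s2 h0 h1 sol ini t t0.
have [uxx wxx] := s2 2%N 0%N isT; have [uyy wyy] := s2 0%N 2%N isT.
have [_ cxx _] := wxx; have [_ cyy _] := wyy.
have Lw0 : laplacian Om w0 (uxx + uyy : L2 Om).
  exact: (And4 s2 h0 (ph_carD pL cxx cyy) (ex_intro _ uxx (ex_intro _ uyy
    (And3 wxx wyy (hsame_refl pL _))))).
have [[lt Llt] est] := hMT w0 _ w1 u Lw0 h1 sol ini t t0.
have sob1 : sobolev Om 1 (u t).1.
  have [s _ _ _] := Llt; move=> i j ij; apply: s; exact: leq_trans ij _.
split; first exact: sob1.
have sw1 : sobolev Om 1 w1 by case: h1.
have E1 := sobolev_norm1_dgrad a0 b0 uniq sob1.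
have E2 := sobolev_norm1_dgrad a0 b0 uniq sw1.
have nl : hnorm (uxx + uyy : L2 Om) <= hnorm (uxx : L2 Om) + hnorm (uyy : L2 Om) :=
  ph_normD pL cxx cyy.
have n2 := sobolev_norm2_ge a0 b0 uniq wxx wyy.
have F := final_sum_le (ltW MT0) (powR_gt0 (2 / alpha) t0) est nl (hnorm_ge0 _) n2.
exact (eq_sum_le E1 E2 F).
Qed.

(* Without an eigenbasis [Hdom] is empty, and the assumption on [d b2] fails. *)
Lemma stability_of_damped_wave (M : R) : 1 <= M ->
  exists2 kappa : R, 0 < kappa & perturbation_conclusion M kappa.
Proof.
move=> M1; have [[e [lam be]]|none] :=
  pselect (exists (e : nat -> L2 Om) (lam : nat -> R), eigenbasis (neg_laplacian Om) e lam).
  exact: stability_of_eigenbasis be.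
exists 1; first exact: ltr01.
by move=> b2 c _ _ _ [v [_ _ [e [lam [be _]]]]]; case: none; exists e, lam.
Qed.

End MainTheorem.

Unset Implicit Arguments.

Theorem theorem3p7 (R : realType) (a b : R) (d : R * R -> R) (alpha : R) :
  0 < a -> 0 < b ->
  let Om := rect a b in
  let omega := [set p | Om p /\ 0 < d p] in
  (Linfty_norm Om d < +oo)%E ->
  C_on 2 Om d ->
  (forall p, Om p -> 0 <= d p) ->
  (exists U : set (R * R), [/\ open U, U !=set0 & U `<=` omega]) ->
  ~ geometric_control a b omega ->
  0 < alpha <= 2 ->
  polynomially_stable (wave_op Om d 0 0) alpha ->
  let M := 1 + a * b * fine (Linfty_norm Om d) /
               (pi * Num.sqrt (a ^+ 2 + b ^+ 2)) in
  exists2 kappa : R, 0 < kappa &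
  forall b2 c : R * R -> R[i],
    opdom (laplacian Om) b2 ->
    L2_car Om c ->
    hnorm (rmul (sqrtf d) c : L2 Om) < kappa ->
    Hdom Om 2^-1 (rmul d b2) ->
    Hnorm Om 2^-1 (rmul d b2) ^+ 2 + Hnorm Om 1 b2 ^+ 2
      < kappa ^+ 2 / M ^+ 2 ->
    polynomially_stable (wave_op Om d b2 c) alpha /\
    exists2 MT : R, 0 < MT &
    forall (w0 w1 : R * R -> R[i]) (u : R -> state Om),
      sobolev Om 2 w0 -> H10 Om w0 -> H10 Om w1 ->
      classical_solution (wave_op Om d b2 c) u ->
      hsame (u 0) ((w0, w1) : state Om) ->
      forall t : R, 0 < t ->
        sobolev Om 1 (u t).1 /\
        sobolev_norm Om 1 (u t).1 ^+ 2 + hnorm ((u t).2 : L2 Om) ^+ 2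
          <= MT / t `^ (2 / alpha) *
             (sobolev_norm Om 2 w0 ^+ 2 + sobolev_norm Om 1 w1 ^+ 2).
Proof.
move=> a0 b0 Om omega d_bounded d_C2 d_ge0 _ _ alpha02 stab M.
apply: (stability_of_damped_wave a0 b0 d_bounded d_C2 d_ge0 alpha02 stab).
have [D0 _] := Linfty_ae a0 b0 d_bounded.
rewrite /M lerDl; apply: divr_ge0; first exact: mulr_ge0 (mulr_ge0 (ltW a0) (ltW b0)) D0.
exact: mulr_ge0 (pi_ge0 R) (sqrtr_ge0 _).
Qed.
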